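(* Let $n\ge 1$. Let $\sigma$ be a compactly supported Borel measure on $\mathbb{R}^n$, let $m=\widehat{\sigma}$ be its Fourier transform, and let $0\le\beta\le n$ and $\alpha>1/2$ be real numbers such that: 1) $\sigma$ is locally uniformly $\beta$-dimensional; 2) there is a constant $C$ such that $\left\{\int_{1}^{2}|m(t\xi)|^{2}\,dt\right\}^{1/2}\leq C(1+|\xi|)^{-\alpha}$ for all $\xi\in\mathbb{R}^n$; 3) there is a constant $C$ such that $\left\{\int_{1}^{2}|\nabla m(t\xi)|^{2}\,dt\right\}^{1/2}\leq C(1+|\xi|)^{-\alpha}$ for all $\xi\in\mathbb{R}^n$. If $p(\cdot)\in\mathcal{P}_{\log}$ and $$\frac{2n+2\alpha-2\beta-1}{n+2\alpha-\beta-1}<p_{-}\leq p_{+}<\frac{2n+2\alpha-2\beta-1}{n-\beta}$$ (the right-hand side being $+\infty$ when $\beta=n$), then the maximal operator $\mathcal{M}_m$ maps $L^{p(\cdot)}(\mathbb{R}^n)$ to itself, i.e. there is a constant $C'$ such that $\|\mathcal{M}_m f\|_{p(\cdot)}\le C'\|f\|_{p(\cdot)}$ for all Schwartz functions $f$ on $\mathbb{R}^n$.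
   Context: Maximal multiplier operator: Borel measures are nonnegative and finite. For $m=\widehat\sigma$ with $\sigma$ a compactly supported Borel measure, and for $t>0$, define $M_t$ by $(M_tf)^{\wedge}(\xi)=\widehat f(\xi)m(t\xi)$; equivalently $M_tf(x)=\int f(x-ty)\,d\sigma(y)$. The maximal operator is $\mathcal{M}_mf(x)=\sup_{t>0}|M_tf(x)|$, defined a priori for Schwartz functions $f$. Here $\nabla m(t\xi)$ denotes the gradient of $m$ evaluated at the point $t\xi$. Locally uniformly $\beta$-dimensional: there is a constant $C_\beta$ such that $\sigma(B(x,R))\le C_\beta R^\beta$ for every $x\in\mathbb{R}^n$ and $0<R\le 1$, where $B(x,R)$ is the ball of radius $R$ centered at $x$. Variable Lebesgue spaces: for a measurable $p:\mathbb{R}^n\to[1,\infty]$ put $p_-=\operatorname{ess\,inf}_{x}p(x)$ and $p_+=\operatorname{ess\,sup}_{x}p(x)$. $L^{p(\cdot)}(\mathbb{R}^n)$ is the set of measurable $f$ with $\int_{\mathbb{R}^n}(|f(x)|/\lambda)^{p(x)}dx<\infty$ for some $\lambda>0$, with norm $\|f\|_{p(\cdot)}=\inf\{\lambda>0:\int_{\mathbb{R}^n}(|f(x)|/\lambda)^{p(x)}dx\le 1\}$. The class $\mathcal{P}_{\log}$ (globally log-Hölder continuous functions): the functions $p:\mathbb{R}^n\to(0,\infty)$ such that there exist $c_1,c_2>0$ and $p_\infty\in(0,\infty)$ with $|p(x)-p(y)|\le \frac{c_1}{\log(e+1/|x-y|)}$ for all $x,y\in\mathbb{R}^n$ with $0<|x-y|<1/2$,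 and $|p(x)-p_\infty|\le\frac{c_2}{\log(e+|x|)}$ for all $x\in\mathbb{R}^n$. *)

(* Defs.v *)
From HB Require Import structures.
From mathcomp Require Import all_boot all_order all_algebra.
From mathcomp Require Import all_classical all_reals all_analysis.
From mathcomp Require Import measurable_realfun ess_sup_inf.
From mathcomp Require Import complex.

Set Implicit Arguments.
Unset Strict Implicit.
Unset Printing Implicit Defensive.

Import Order.TTheory GRing.Theory Num.Theory.
Import numFieldNormedType.Exports.

Local Open Scope classical_set_scope.
Local Open Scope ring_scope.
Local Open Scope complex_scope.

Section borel.
Context {R : realType} {n : nat}.

(* R^n carries its Borel sigma-algebra, generated by the open sets *)
HB.instance Definition _ := Measurable.copy 'rV[R]_n
  (g_sigma_algebraType (@open 'rV[R]_n)).

Lemma measurable_coord (i : 'I_n) :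
  measurable_fun setT (fun x : 'rV[R]_n => x 0 i).
Proof.
apply: (measurability _ (RGenOpens.measurableE R)) => _ [_ [a [b ->] <-]].
rewrite setTI; apply: sub_sigma_algebra.
have /continuousP := @coord_continuous R 1 n 0 i.
by apply; exact: interval_open.
Qed.

Lemma measurable_fun_rV d (T : measurableType d) (f : T -> 'rV[R]_n) :
  (forall i, measurable_fun setT (fun x => f x 0 i)) -> measurable_fun setT f.
Proof.
move=> mf; apply: (@measurability _ _ _ _ _ _ (@open 'rV[R]_n)) => // _ [U oU <-].
rewrite setTI.
pose box (qk : 'rV[rat]_n * nat) : set 'rV[R]_n :=
  [set y | forall i, `|y 0 i - ratr (qk.1 0 i)| < qk.2.+1%:R^-1].
have -> : f @^-1` U = \bigcup_(qk in [set: 'rV[rat]_n * nat])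
    (if `[< box qk `<=` U >] then f @^-1` box qk else set0).
  apply/seteqP; split=> [x Ux|x [qk _]]; last first.
    by case: asboolP => // h /h.
  have /nbhs_ballP[e /= e0 eU] : nbhs (f x) U by exact: open_nbhs_nbhs.
  have [k] : exists k : nat, 0 + k.+1%:R^-1 < e / 2.
    by apply: ltr_add_invr; rewrite divr_gt0.
  rewrite add0r => ke.
  have k0 : 0 < k.+1%:R^-1 :> R by rewrite invr_gt0.
  have ex i : exists q : rat, `|f x 0 i - ratr q| < k.+1%:R^-1.
    have [q] : exists q : rat,
      ratr q \in `](f x 0 i - k.+1%:R^-1), (f x 0 i + k.+1%:R^-1)[.
      by apply: rat_in_itvoo; rewrite ltrD2l (lt_trans _ k0)// oppr_lt0.
    by rewrite in_itv/= => qi; exists q; rewrite distrC ltr_distl.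
  have [q qP] := choice ex.
  exists (\row_i q i, k) => //.
  rewrite asboolT; first by move=> i /=; rewrite mxE.
  move=> y /= yq; apply: eU; split => //= i j; rewrite !ord1.
  rewrite -ball_normE/= -(subrKA (ratr (q j))) (le_lt_trans (ler_normD _ _))//.
  rewrite [ltRHS]splitr ltrD// (lt_trans _ ke)//.
  by rewrite distrC; have := yq j; rewrite mxE.
apply: countable_bigcupT_measurable => // -[q k].
case: asboolP => // _.
have -> : f @^-1` box (q, k) = \bigcap_(i in [set: 'I_n])
    ((fun x => f x 0 i) @^-1`
       `](ratr (q 0 i) - k.+1%:R^-1), (ratr (q 0 i) + k.+1%:R^-1)[%classic).
  apply/seteqP; split=> x /= h i.
    by move=> _ /=; rewrite in_itv/= -ltr_distl; exact: h.
  by have := h i Logic.I; rewrite /= in_itv/= -ltr_distl.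
apply: fin_bigcap_measurable; first exact: finite_finset.
by move=> i _; rewrite -[X in measurable X]setTI; exact: mf.
Qed.

End borel.

Section lebesgue.
Context {R : realType}.

Definition rV_cons n (z : measurableTypeR R * 'rV[R]_n) : 'rV[R]_n.+1 :=
  \row_i oapp (fun j => z.2 0 j) z.1 (unlift ord0 i).

Lemma measurable_rV_cons n : measurable_fun setT (@rV_cons n).
Proof.
apply: measurable_fun_rV => i.
under eq_fun do rewrite mxE.
case: (unlift ord0 i) => [j|] /=; last exact: measurable_fst.
by apply: (measurableT_comp (measurable_coord j)); exact: measurable_snd.
Qed.

Definition rV_uncons n (x : 'rV[R]_n.+1) : measurableTypeR R * 'rV[R]_n :=
  (x 0 ord0, \row_i x 0 (lift ord0 i)).

Lemma measurable_rV_uncons n : measurable_fun setT (@rV_uncons n).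
Proof.
apply/measurable_fun_pairP; split; first exact: (measurable_coord ord0).
apply: measurable_fun_rV => i; rewrite /rV_uncons /=.
by under eq_fun do rewrite /= mxE; exact: measurable_coord.
Qed.

Lemma rV_consK n : cancel (@rV_cons n) (@rV_uncons n).
Proof.
move=> [x y]; rewrite /rV_cons /rV_uncons mxE unlift_none; congr pair.
by apply/rowP => i; rewrite !mxE liftK.
Qed.

Section step.
Context {n : nat} (mu : {sigma_finite_measure set 'rV[R]_n -> \bar R}).

Definition lebesgue_step : set 'rV[R]_n.+1 -> \bar R :=
  pushforward (lebesgue_measure \x mu)%E (@rV_cons n).

Let step_measurable (A : set 'rV[R]_n.+1) :
  measurable A -> measurable (@rV_cons n @^-1` A).
Proof.
by move=> mA; rewrite -[X in measurable X]setTI; exact: measurable_rV_cons.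
Qed.

Let step0 : lebesgue_step set0 = 0%E.
Proof. by rewrite /lebesgue_step /pushforward preimage_set0 measure0. Qed.

Let step_ge0 A : (0 <= lebesgue_step A)%E.
Proof. exact: (measure_ge0 (lebesgue_measure \x mu)%E). Qed.

Let step_sigma_additive : semi_sigma_additive lebesgue_step.
Proof.
move=> F mF tF mUF; rewrite /lebesgue_step /pushforward preimage_bigcup.
apply: measure_semi_sigma_additive.
- by move=> k; exact: step_measurable.
- apply/trivIsetP => /= i j _ _ ij; rewrite -preimage_setI.
  by move/trivIsetP : tF => /(_ _ _ _ _ ij) ->//; rewrite preimage_set0.
- by rewrite -preimage_bigcup; exact: step_measurable.
Qed.

HB.instance Definition _ := isMeasure.Build _ _ _ lebesgue_step
  step0 step_ge0 step_sigma_additive.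

Let step_sigma_finite : sigma_finite setT lebesgue_step.
Proof.
have /sigma_finiteP[F [FT ndF Foo]] := sigma_finiteT (@lebesgue_measure R).
have /sigma_finiteP[G [GT ndG Goo]] := sigma_finiteT mu.
exists (fun k => @rV_uncons n @^-1` (F k `*` G k)).
  rewrite -preimage_bigcup; apply/seteqP; split => // x _.
  have [k _ Fk] : (\bigcup_i F i) (x 0 ord0) by rewrite -FT.
  have [l _ Gl] : (\bigcup_i G i) (\row_i x 0 (lift ord0 i)) by rewrite -GT.
  exists (maxn k l) => //; split => /=.
    by move: Fk; exact/subsetPset/ndF/leq_maxl.
  by move: Gl; exact/subsetPset/ndG/leq_maxr.
move=> k; have [mF Fk] := Foo k; have [mG Gk] := Goo k.
have mFG : measurable (F k `*` G k) by exact: measurableX.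
split; first by rewrite -[X in measurable X]setTI; exact: measurable_rV_uncons.
rewrite /lebesgue_step /pushforward -comp_preimage.
rewrite (_ : _ \o _ = id); last by apply/funext => z; exact: rV_consK.
by rewrite preimage_id product_measure1E// lte_mul_pinfty// ge0_fin_numE.
Qed.

HB.instance Definition _ := Measure_isSigmaFinite.Build _ _ _ lebesgue_step
  step_sigma_finite.

End step.

(* n-dimensional Lebesgue measure, as an iterated product *)
Fixpoint lebesgue_rV (n : nat) : {sigma_finite_measure set 'rV[R]_n -> \bar R} :=
  match n with
  | 0 => dirac (0 : 'rV[R]_0)
  | k.+1 => lebesgue_step (lebesgue_rV k)
  end.

Lemma lebesgue_rV_box (n : nat) (a b : 'rV[R]_n) :
  (forall i, a 0 i <= b 0 i) ->
  lebesgue_rV n [set x : 'rV[R]_n | forall i, a 0 i <= x 0 i <= b 0 i]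
  = (\prod_(i < n) (b 0 i - a 0 i))%:E.
Proof.
elim: n a b => [|n IH] a b ab /=.
  by rewrite big_ord0 diracE mem_set//= => -[].
pose tl (x : 'rV[R]_n.+1) : 'rV[R]_n := \row_i x 0 (lift ord0 i).
rewrite big_ord_recl EFinM /lebesgue_step /pushforward.
transitivity ((lebesgue_measure \x lebesgue_rV n)%E
  (`[a 0 ord0, b 0 ord0]%classic `*`
   [set x : 'rV[R]_n | forall i, tl a 0 i <= x 0 i <= tl b 0 i])).
  congr product_measure1; apply/seteqP; split=> -[x y] /=.
    move=> h; split.
      by have := h ord0; rewrite /rV_cons mxE unlift_none/= in_itv.
    by move=> i; have := h (lift ord0 i); rewrite /rV_cons !mxE liftK.
  move=> [hx hy] i; rewrite /rV_cons mxE; case: unliftP => [j ->|->] /=.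
    by have := hy j; rewrite !mxE.
  by move: hx; rewrite in_itv.
rewrite product_measure1E//; last first.
  rewrite (_ : mkset _ = \bigcap_(i in [set: 'I_n])
      ((fun x : 'rV[R]_n => x 0 i) @^-1` `[tl a 0 i, tl b 0 i]%classic)).
    apply: fin_bigcap_measurable; first exact: finite_finset.
    by move=> i _; rewrite -[X in measurable X]setTI; exact: measurable_coord.
  by apply/seteqP; split=> x /= h i; have := h i; rewrite /= in_itv//; apply.
rewrite IH; last by move=> i; rewrite !mxE.
congr (_ * _)%E.
  transitivity (lebesgue_measure `[a 0 ord0, b 0 ord0]%classic) => //.
  rewrite lebesgue_measure_itv/= lte_fin.
  by case: ltgtP (ab ord0) => // -> _; rewrite subrr.
by congr EFin; apply: eq_bigr => i _; rewrite !mxE.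
Qed.

End lebesgue.

Section euclidean.
Context {R : realType} {n : nat}.
Implicit Types x y : 'rV[R]_n.

Definition dot x y : R := \sum_(i < n) x 0 i * y 0 i.

(* the norm `|x| that MathComp-Analysis puts on matrices is the sup norm *)
Definition enorm x : R := Num.sqrt (dot x x).

Definition eball x (r : R) : set 'rV[R]_n := [set y | enorm (y - x) < r].

End euclidean.

Section fourier.
Context {R : realType}.

Definition cis (theta : R) : R[i] := cos theta +i* sin theta.

Definition cintegral d (T : measurableType d) (mu : {measure set T -> \bar R})
    (f : T -> R[i]) : R[i] :=
  (\int[mu]_x complex.Re (f x)) +i* (\int[mu]_x complex.Im (f x)).

Context {n : nat}.

(* normalisation: the kernel is exp(-2 pi i x.xi), so that the inverse
   transform carries no constant *)
Definition fourier_measure (sigma : {measure set 'rV[R]_n -> \bar R})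
    (xi : 'rV[R]_n) : R[i] :=
  cintegral sigma (fun x => cis (- (2 * pi * dot x xi))).

Definition fourier (f : 'rV[R]_n -> R[i]) (xi : 'rV[R]_n) : R[i] :=
  cintegral (lebesgue_rV n) (fun x => f x * cis (- (2 * pi * dot x xi))).

Definition inverse_fourier (g : 'rV[R]_n -> R[i]) (x : 'rV[R]_n) : R[i] :=
  cintegral (lebesgue_rV n) (fun xi => g xi * cis (2 * pi * dot x xi)).

(* M_t, i.e. (M_t f)^ (xi) = f^ (xi) m(t xi) *)
Definition multiplier_op (m : 'rV[R]_n -> R[i]) (t : R)
    (f : 'rV[R]_n -> R[i]) : 'rV[R]_n -> R[i] :=
  inverse_fourier (fun xi => fourier f xi * m (t *: xi)).

Definition maximal_multiplier (m : 'rV[R]_n -> R[i]) (f : 'rV[R]_n -> R[i])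
    (x : 'rV[R]_n) : \bar R :=
  ereal_sup [set (Normc.normc (multiplier_op m t f x))%:E | t in [set t | 0 < t]].

End fourier.

Section derivatives.
Context {R : realType} {n : nat}.

Definition partial (j : 'I_n) (f : 'rV[R]_n -> R) : 'rV[R]_n -> R :=
  fun x => 'D_(delta_mx 0 j) f x.

Definition cpartial (j : 'I_n) (f : 'rV[R]_n -> R[i]) : 'rV[R]_n -> R[i] :=
  fun x => partial j (fun y => complex.Re (f y)) x
    +i* partial j (fun y => complex.Im (f y)) x.

Definition gradient (f : 'rV[R]_n -> R[i]) (x : 'rV[R]_n) : 'rV[R[i]]_n :=
  \row_j cpartial j f x.

Definition cvnorm (v : 'rV[R[i]]_n) : R :=
  Num.sqrt (\sum_(j < n) Normc.normc (v 0 j) ^+ 2).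

Definition partials (s : seq 'I_n) (f : 'rV[R]_n -> R) : 'rV[R]_n -> R :=
  foldr partial f s.

Definition real_schwartz (f : 'rV[R]_n -> R) : Prop :=
  forall s : seq 'I_n,
    (forall x, differentiable (partials s f) x) /\
    (forall N : nat, exists C : R, forall x,
        (1 + enorm x) ^+ N * `|partials s f x| <= C).

Definition schwartz (f : 'rV[R]_n -> R[i]) : Prop :=
  real_schwartz (fun y => complex.Re (f y)) /\
  real_schwartz (fun y => complex.Im (f y)).

End derivatives.

Section measures.
Context {R : realType} {n : nat}.
Implicit Type sigma : {measure set 'rV[R]_n -> \bar R}.

Definition measure_support sigma : set 'rV[R]_n :=
  [set x | forall U : set 'rV[R]_n, open U -> U x -> (0 < sigma U)%E].

Definition compactly_supported sigma : Prop := compact (measure_support sigma).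

Definition locally_uniformly_dimensional (beta : R) sigma : Prop :=
  exists C : R, forall (x : 'rV[R]_n) (r : R), 0 < r -> r <= 1 ->
    (sigma (eball x r) <= (C * r `^ beta)%:E)%E.

End measures.

Section variable_lebesgue.
Context {R : realType} {n : nat}.
Implicit Types (p : 'rV[R]_n -> R) (f : 'rV[R]_n -> \bar R).

Definition p_minus p : \bar R := ess_inf (lebesgue_rV n) (EFin \o p).

Definition p_plus p : \bar R := ess_sup (lebesgue_rV n) (EFin \o p).

Definition modular p f : \bar R :=
  \int[lebesgue_rV n]_x poweR (`|f x|)%E (p x).

(* the value is +oo when no lambda is admissible *)
Definition vl_norm p f : \bar R :=
  ereal_inf [set lambda%:E | lambda in
    [set l : R | 0 < l /\ (modular p (fun x => `|f x| * (l^-1)%:E) <= 1)%E]].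

Definition log_holder p : Prop :=
  (forall x, 0 < p x) /\
  exists c1 c2 pinfty : R,
    [/\ 0 < c1, 0 < c2, 0 < pinfty,
      forall x y, 0 < enorm (x - y) -> enorm (x - y) < 2^-1 ->
        `|p x - p y| <= c1 / ln (expR 1 + 1 / enorm (x - y)) &
      forall x, `|p x - pinfty| <= c2 / ln (expR 1 + enorm x)].

End variable_lebesgue.

(* Main.v *)
(** Smoothing [sigma] by Gaussians at the scales [2^-j a] splits the averages
    [M_t], [a <= t <= 2a], into pieces [T_j]. Write [kap = n - beta] and
    [s = 2 alpha - 1]. Since [sigma] is [beta]-dimensional, [sup_t |T_j f|] is at
    most [C 2^(j kap)] times the Hardy-Littlewood maximal function of [f], while
    the mean decay of [m] and of its gradient bounds [sup_t |T_j f|] on [L^2] by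
    [C 2^(- j s / 2)]: on each interval of length [2^-j a] the square of a
    function is controlled by the integrals of its square and of the square of
    its derivative in [t], and Bessel's inequality evaluates these in [x].
    The two bounds are interpolated by hand: [f] of modular at most 1 is cut along
    the level sets of [|f|^(p/2 - p/q)], where [1/p = (1 - theta)/2 + theta/q], so
    that each slice obeys both an [L^2] bound and a bound by the maximal function
    on [L^q(.)], which is finite as [q] is again log-Hoelder. The estimates sum
    geometrically over the slices, and over [j] exactly when
    [theta (2 kap + s) < s]; together with [1 < q < oo] this is the stated range
    of [p]. For Schwartz [f] the partial sums of the [T_j f] converge to [M_t f]. *)

Require Import Defs.
From HB Require Import structures.
From mathcomp Require Import all_boot all_order all_algebra.
From mathcomp Require Import all_classical all_reals all_analysis.
From mathcomp Require Import measurable_realfun ess_sup_inf.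
From mathcomp Require Import complex.
From mathcomp Require Import ring lra.

Set Implicit Arguments.
Unset Strict Implicit.
Unset Printing Implicit Defensive.

Import Order.TTheory GRing.Theory Num.Theory.
Import numFieldNormedType.Exports.

Local Open Scope classical_set_scope.
Local Open Scope ring_scope.

(** * Integration on R^n *)

(** The maximal operator is not linear and the exponent varies, so interpolation is done pointwise.
    At a point [x] the k-th slice of [f] obeys two bounds, one through a square function [V x], one
    through the maximal function of [h] at [x], with opposite powers of the level. Summing over k
    leaves [V ^ ((1 - theta) / 2)] times the [theta]-th power of the maximal function, and the power
    [p x] of this product is at most [V] plus the [q x]-th power of the maximal function. Suprema
    over the uncountable range of [t] are never integrated: each bound comes with a measurable
    majorant valid for every [t]. The smoothing uses not one Gaussian but a combination with symbol
    [1 - (1 - exp (- v)) ^ N], flat to order N at the origin: the pieces must vanish at low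
    frequencies fast enough for the L^2 bounds to sum over all dyadic blocks of [t] at once. The
    zeroth piece has no such vanishing and takes its L^2 bound from the maximal function. Complex
    numbers are replaced by separate cosine and sine transforms of real functions until the very
    end. *)

Section fubini_real.
Context d1 d2 (T1 : measurableType d1) (T2 : measurableType d2) (R : realType).
Variable m1 : {sigma_finite_measure set T1 -> \bar R}.
Variable m2 : {sigma_finite_measure set T2 -> \bar R}.
Implicit Types (F : T1 -> R) (G : T2 -> R) (K : T1 * T2 -> R) (c : R).

Lemma integrable_mulrl d (T : measurableType d) (m : {measure set T -> \bar R})
    (D : set T) (c : R) (F : T -> R) : measurable D ->
  m.-integrable D (EFin \o F) -> m.-integrable D (fun z => (c * F z)%:E).
Proof. by move=> mD iF; exact: (integrableZl mD c iF). Qed.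

Lemma integrable_mulrr d (T : measurableType d) (m : {measure set T -> \bar R})
    (D : set T) (c : R) (F : T -> R) : measurable D ->
  m.-integrable D (EFin \o F) -> m.-integrable D (fun z => (F z * c)%:E).
Proof. by move=> mD iF; exact: (integrableZr mD c iF). Qed.

Lemma integrable_bounded_mul d (T : measurableType d)
    (m : {measure set T -> \bar R}) (F K : T -> R) (c : R) :
  m.-integrable setT (EFin \o F) -> measurable_fun setT K ->
  (forall z, `|K z| <= c) -> m.-integrable setT (fun z => (F z * K z)%:E).
Proof.
move=> iF mK Kc.
have mF : measurable_fun setT F by exact/measurable_EFinP/(measurable_int m).
have iG : m.-integrable setT (fun z => (c%:E * (F z)%:E)%E).
  exact: integrableZl.
apply: (le_integrable measurableT _ _ iG).
  by apply/measurable_EFinP; exact: measurable_funM.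
move=> z _ /=; rewrite lee_fin !normrM mulrC ler_wpM2r//.
by rewrite (le_trans (Kc z))// ler_norm.
Qed.

Lemma integrable_tensor F G K c :
  m1.-integrable setT (EFin \o F) -> m2.-integrable setT (EFin \o G) ->
  measurable_fun setT K -> (forall z, `|K z| <= c) ->
  (m1 \x m2)%E.-integrable setT (fun z => (F z.1 * G z.2 * K z)%:E).
Proof.
move=> iF iG mK Kc.
have mF : measurable_fun setT F by exact/measurable_EFinP/(measurable_int m1).
have mG : measurable_fun setT G by exact/measurable_EFinP/(measurable_int m2).
apply: (integrable_bounded_mul _ mK Kc) => /=.
have mFG : measurable_fun setT (fun z : T1 * T2 => F z.1 * G z.2).
  by apply: measurable_funM; apply: measurableT_comp.
apply/integrable12ltyP; first exact/measurable_EFinP.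
rewrite (_ : (fun x => _) = (fun x => `|(F x)%:E| * \int[m2]_y `|(G y)%:E|)%E).
  have [_ Foo] := integrableP _ _ _ iF.
  have [_ Goo] := integrableP _ _ _ iG.
  rewrite ge0_integralZr//; last exact: integral_ge0.
    by rewrite lte_mul_pinfty// ?integral_ge0// ge0_fin_numE ?integral_ge0.
  by apply: measurableT_comp => //; exact/measurable_EFinP.
apply/funext => x; rewrite -ge0_integralZl//.
  by apply: eq_integral => y _; rewrite -abseM.
by apply: measurableT_comp => //; exact/measurable_EFinP.
Qed.

Lemma measurable_tensor_inner F K c :
  m1.-integrable setT (EFin \o F) -> measurable_fun setT K ->
  (forall z, `|K z| <= c) ->
  measurable_fun setT (fun y => \int[m1]_x (F x * K (x, y))).
Proof.
move=> iF mK Kc.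
have mF : measurable_fun setT F by exact/measurable_EFinP/(measurable_int m1).
have mFK : measurable_fun setT (fun z => (F z.1 * K z)%:E).
  by apply/measurable_EFinP; apply: measurable_funM => //; exact: measurableT_comp.
(* Tonelli gives measurability for nonnegative integrands only, hence the split into positive and
   negative parts. *)
rewrite (_ : (fun y => _) = (fun y => fine
  (\int[m1]_x ((fun z => (F z.1 * K z)%:E)^\+ (x, y))
   - \int[m1]_x ((fun z => (F z.1 * K z)%:E)^\- (x, y)))%E)); last first.
  apply/funext => y; congr fine; rewrite integralE; congr (_ - _)%E;
    by apply: eq_integral => x _; rewrite ?funeposE ?funenegE.
apply: (measurableT_comp (fine_measurable measurableT)); apply: emeasurable_funB.
  apply: (measurable_fun_fubini_tonelli_G (m1 := m1)) => //.
  exact: measurable_funepos.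
apply: (measurable_fun_fubini_tonelli_G (m1 := m1)) => //.
exact: measurable_funeneg.
Qed.

Lemma tensor_inner_le F K c y :
  m1.-integrable setT (EFin \o F) -> measurable_fun setT K ->
  (forall z, `|K z| <= c) ->
  `|\int[m1]_x (F x * K (x, y))| <= c * \int[m1]_x `|F x|.
Proof.
move=> iF mK Kc.
have iFK : m1.-integrable setT (fun x => (F x * K (x, y))%:E).
  by apply: (integrable_bounded_mul (c := c) iF) => //; exact: measurableT_comp.
apply: (le_trans (le_normr_Rintegral measurableT iFK)).
have iFa : m1.-integrable setT (EFin \o (fun x => `|F x|)).
  exact: (integrable_norm iF).
rewrite -RintegralZl//.
apply: le_Rintegral => //; first exact: (integrable_norm iFK).
  rewrite (_ : _ \o _ = fun x => (c%:E * (`|F x|)%:E)%E)//.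
  exact: integrableZl.
by move=> x _; rewrite normrM mulrC ler_wpM2r.
Qed.

(** The form in which integrals are exchanged below: one integrable factor per variable and a
    bounded kernel, typically a cosine, make the product absolutely integrable. *)
Lemma Rfubini_tensor F G K c :
  m1.-integrable setT (EFin \o F) -> m2.-integrable setT (EFin \o G) ->
  measurable_fun setT K -> (forall z, `|K z| <= c) ->
  \int[m1]_x (F x * \int[m2]_y (G y * K (x, y)))
  = \int[m2]_y (G y * \int[m1]_x (F x * K (x, y))).
Proof.
move=> iF iG mK Kc.
have iP := integrable_tensor iF iG mK Kc.
have iK2 x : m2.-integrable setT (fun y => (G y * K (x, y))%:E).
  by apply: (integrable_bounded_mul (c := c) iG) => //; exact: measurableT_comp.
have iK1 y : m1.-integrable setT (fun x => (F x * K (x, y))%:E).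
  by apply: (integrable_bounded_mul (c := c) iF) => //; exact: measurableT_comp.
rewrite /Rintegral; congr fine.
transitivity (\int[m1]_x \int[m2]_y (F x * G y * K (x, y))%:E)%E.
  apply: eq_integral => x _; rewrite EFinM fineK; last exact: integrable_fin_num.
  rewrite -integralZl//.
  by apply: eq_integral => y _; rewrite -EFinM mulrA.
rewrite (Fubini iP)/=.
apply: eq_integral => y _; rewrite EFinM fineK; last exact: integrable_fin_num.
rewrite -integralZl//.
by apply: eq_integral => x _; rewrite -EFinM mulrCA mulrA.
Qed.

End fubini_real.

Section rV_measure.
Context {R : realType}.
Implicit Types n : nat.

Lemma continuous_measurable_rV n (f : 'rV[R]_n -> R) :
  continuous f -> measurable_fun setT f.
Proof.
move=> cf.
apply: (measurability _ (RGenOpens.measurableE R)) => _ [_ [a [b ->] <-]].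
rewrite setTI; apply: sub_sigma_algebra.
by have /continuousP := cf; apply; exact: interval_open.
Qed.

Lemma measurable_rVD n d (T : measurableType d) (f g : T -> 'rV[R]_n) :
  measurable_fun setT f -> measurable_fun setT g ->
  measurable_fun setT (fun x => f x + g x).
Proof.
move=> mf mg; apply: measurable_fun_rV => i.
under eq_fun do rewrite mxE.
by apply: measurable_funD; exact: (measurableT_comp (measurable_coord i)).
Qed.

Lemma measurable_rVN n d (T : measurableType d) (f : T -> 'rV[R]_n) :
  measurable_fun setT f -> measurable_fun setT (fun x => - f x).
Proof.
move=> mf; apply: measurable_fun_rV => i.
under eq_fun do rewrite mxE.
by apply: measurableT_comp => //; exact: (measurableT_comp (measurable_coord i)).
Qed.

Lemma measurable_rVZ n d (T : measurableType d) (f : T -> R) (g : T -> 'rV[R]_n) :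
  measurable_fun setT f -> measurable_fun setT g ->
  measurable_fun setT (fun x => f x *: g x).
Proof.
move=> mf mg; apply: measurable_fun_rV => i.
under eq_fun do rewrite mxE.
by apply: measurable_funM => //; exact: (measurableT_comp (measurable_coord i)).
Qed.

Lemma measurable_dot n d (T : measurableType d) (f g : T -> 'rV[R]_n) :
  measurable_fun setT f -> measurable_fun setT g ->
  measurable_fun setT (fun x => dot (f x) (g x)).
Proof.
move=> mf mg; rewrite /dot; apply: measurable_sum => i.
by apply: measurable_funM; exact: (measurableT_comp (measurable_coord i)).
Qed.

Lemma measurable_cosf d (T : measurableType d) (f : T -> R) :
  measurable_fun setT f -> measurable_fun setT (fun x => cos (f x)).
Proof.
by move=> mf; apply: (measurableT_comp _ mf); apply: continuous_measurable_fun;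
  exact: continuous_cos.
Qed.

Lemma measurable_sinf d (T : measurableType d) (f : T -> R) :
  measurable_fun setT f -> measurable_fun setT (fun x => sin (f x)).
Proof.
by move=> mf; apply: (measurableT_comp _ mf); apply: continuous_measurable_fun;
  exact: continuous_sin.
Qed.

Lemma measurable_expf d (T : measurableType d) (f : T -> R) :
  measurable_fun setT f -> measurable_fun setT (fun x => expR (f x)).
Proof. by move=> mf; exact: (measurableT_comp (@measurable_expR R) mf). Qed.

End rV_measure.

Ltac meas := repeat first
  [ assumption | exact: measurable_cst | exact: measurable_id
  | exact: measurable_fst | exact: measurable_snd
  | apply: measurable_cosf | apply: measurable_sinf | apply: measurable_expf
  | apply: measurable_dot | apply: measurable_rVD | apply: measurable_rVN
  | apply: measurable_rVZ
  | apply: measurable_funD | apply: measurable_funB | apply: measurable_funM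
  | apply: measurable_funX | apply: measurable_funN
  | progress (apply/measurable_EFinP)
  | apply: (measurableT_comp measurable_fst)
  | apply: (measurableT_comp measurable_snd) ].

Section rV_lebesgue.
Context {R : realType}.
Implicit Types n : nat.

Lemma lebesgue_rVS_integral n (f : 'rV[R]_n.+1 -> \bar R) :
  measurable_fun setT f -> (forall x, (0 <= f x)%E) ->
  (\int[lebesgue_rV n.+1]_x f x =
   \int[lebesgue_measure]_t \int[lebesgue_rV n]_y f (rV_cons (t, y)))%E.
Proof.
move=> mf f0.
have mc := @measurable_rV_cons R n.
transitivity (\int[pushforward (lebesgue_measure \x lebesgue_rV n)
   (@rV_cons R n)]_x f x)%E; first by [].
rewrite ge0_integral_pushforward//.
rewrite preimage_setT fubini_tonelli1//.
  exact: measurableT_comp.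
by move=> z; exact: f0.
Qed.

(** Uniqueness of Lebesgue measure: [c] times the image measure gives each half-open interval its
    length. *)
Lemma ge0_integral_affine (c b : R) (f : R -> \bar R) : 0 < c ->
  measurable_fun setT f -> (forall x, (0 <= f x)%E) ->
  (\int[lebesgue_measure]_x f (c * x + b)%R = c^-1%:E * \int[lebesgue_measure]_x f x)%E.
Proof.
move=> c0 mf f0.
pose phi : measurableTypeR R -> measurableTypeR R := fun x => c * x + b.
have mphi : measurable_fun setT phi by rewrite /phi; meas.
transitivity (\int[pushforward lebesgue_measure phi]_x f x)%E.
  by rewrite ge0_integral_pushforward.
pose k : {nonneg R} := NngNum (ltW c0).
transitivity (c^-1%:E * (k%:num%:E * \int[pushforward lebesgue_measure phi]_x f x))%E.
  by rewrite muleA -EFinM mulVf ?gt_eqF// mul1e.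
rewrite -ge0_integral_mscale//; congr (_ * _)%E.
apply: eq_measure_integral => /= A mA _.
apply/esym/lebesgue_measure_unique => //= _ [[u v]] _ <-.
rewrite /mscale/= /pushforward.
have -> : phi @^-1` [set` `]u, v]] = [set` `](u - b) / c, (v - b) / c]].
  apply/seteqP; split => x /=; rewrite /phi !in_itv/=.
    by rewrite ltr_pdivrMr// ler_pdivlMr// mulrC ltrBlDr lerBrDr.
  by rewrite ltr_pdivrMr// ler_pdivlMr// mulrC ltrBlDr lerBrDr.
rewrite !lebesgue_measure_itv/= !lte_fin ltr_pM2r ?invr_gt0// ltrD2r.
case: ifPn => _; last by rewrite mule0.
by rewrite -EFinB -EFinM -mulrBl mulrC mulfVK ?gt_eqF// opprB addrA subrK.
Qed.

Lemma integral_prod_rV n (g : 'I_n -> R -> R) (c : 'I_n -> R) :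
  (forall i, measurable_fun setT (g i)) -> (forall i x, 0 <= g i x) ->
  (forall i, \int[lebesgue_measure]_x (g i x)%:E = (c i)%:E)%E ->
  (\int[lebesgue_rV n]_x (\prod_(i < n) g i (x 0 i))%:E = (\prod_(i < n) c i)%:E)%E.
Proof.
elim: n g c => [|n IH] g c mg g0 gc.
  rewrite integral_dirac//; first by rewrite diracT mul1e !big_ord0.
  by under eq_fun do rewrite big_ord0; exact: measurable_cst.
rewrite lebesgue_rVS_integral; last 2 first.
- apply/measurable_EFinP; apply: measurable_prod => i _.
  exact: (measurableT_comp (mg i) (measurable_coord i)).
- by move=> x; rewrite lee_fin prodr_ge0.
rewrite [in RHS]big_ord_recl [in RHS]EFinM.
rewrite -(IH (fun i => g (lift ord0 i))) ?gc//.
rewrite -gc -ge0_integralZr//; last 3 first.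
- by apply/measurable_EFinP; exact: mg.
- by move=> x _; rewrite lee_fin.
- by apply: integral_ge0 => x _; rewrite lee_fin prodr_ge0.
apply: eq_integral => t _; rewrite -ge0_integralZl//; last 3 first.
- apply/measurable_EFinP; apply: measurable_prod => i _.
  exact: (measurableT_comp (mg _) (measurable_coord i)).
- by move=> x _; rewrite lee_fin prodr_ge0.
- by rewrite lee_fin.
apply: eq_integral => y _; rewrite -EFinM big_ord_recl /rV_cons mxE unlift_none/=.
by congr (_ * _)%:E; apply: eq_bigr => i _; rewrite mxE liftK.
Qed.

Lemma rV_consD n t s (y v : 'rV[R]_n) :
  rV_cons (t, y) + rV_cons (s, v) = rV_cons (t + s, y + v).
Proof.
by apply/rowP => i; rewrite !mxE; case: (unlift _ _) => [j|]//=; rewrite mxE.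
Qed.

Lemma rV_unconsK n : cancel (@rV_uncons R n) (@rV_cons R n).
Proof.
move=> x; apply/rowP => i; rewrite mxE.
by case: unliftP => [j ->|->]//=; rewrite mxE.
Qed.

Lemma ge0_integral_rV_shift n (v : 'rV[R]_n) (f : 'rV[R]_n -> \bar R) :
  measurable_fun setT f -> (forall x, (0 <= f x)%E) ->
  (\int[lebesgue_rV n]_x f (x + v)%R = \int[lebesgue_rV n]_x f x)%E.
Proof.
elim: n v f => [|n IH] v f mf f0.
  by apply: eq_integral => x _; congr f; apply/rowP => -[].
have mfv : measurable_fun setT (fun x : 'rV[R]_n.+1 => f (x + v)%R).
  by apply: (measurableT_comp mf); apply: measurable_rVD.
rewrite (lebesgue_rVS_integral mfv (fun x => f0 _)) (lebesgue_rVS_integral mf f0).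
rewrite -(rV_unconsK v).
case: (rV_uncons v) => s w.
have mft t : measurable_fun setT (fun y => f (rV_cons (t, y))).
  by apply: (measurableT_comp mf); apply: (measurableT_comp (@measurable_rV_cons R n)).
under eq_integral => t _.
  under eq_integral do rewrite rV_consD.
  rewrite (IH w (fun y => f (rV_cons (t + s, y))))//.
  over.
have mF : measurable_fun setT (fun t : R => \int[lebesgue_rV n]_y f (rV_cons (t, y)))%E.
  apply: (measurable_fun_fubini_tonelli_F (m2 := lebesgue_rV n)
     (fun z => f (rV_cons z))) => //.
  by apply: (measurableT_comp mf); exact: measurable_rV_cons.
have F0 t : (0 <= \int[lebesgue_rV n]_y f (rV_cons (t, y)))%E by exact: integral_ge0.
have := @ge0_integral_affine 1 s _ ltr01 mF F0.
rewrite invr1 mul1e => <-.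
by apply: eq_integral => t _; rewrite mul1r.
Qed.

Lemma Rintegral_rV_shift n (v : 'rV[R]_n) (f : 'rV[R]_n -> R) :
  measurable_fun setT f ->
  \int[lebesgue_rV n]_x f (x + v) = \int[lebesgue_rV n]_x f x.
Proof.
move=> mf; rewrite /Rintegral; congr fine; rewrite integralE [RHS]integralE.
have mEf : measurable_fun setT (EFin \o f) by exact/measurable_EFinP.
rewrite -(@ge0_integral_rV_shift _ v (fun x => (EFin \o f)^\+ x))%E//; last first.
  exact: measurable_funepos.
rewrite -(@ge0_integral_rV_shift _ v (fun x => (EFin \o f)^\- x))%E//; last first.
  exact: measurable_funeneg.
by congr (_ - _)%E; apply: eq_integral => x _; rewrite ?funeposE ?funenegE.
Qed.

(** [ball] is taken in the sup norm, so it is a cube: its volume is explicit and scales exactly,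
    which is why the maximal function is built on these balls and not on [eball]. *)
Lemma lebesgue_rV_ball n (x : 'rV[R]_n) (r : R) : 0 < r ->
  lebesgue_rV n (ball x r) = ((2 * r) ^+ n)%:E.
Proof.
move=> r0.
pose I i : set R := `]x 0 i - r, x 0 i + r[%classic.
have -> : ball x r = [set y : 'rV[R]_n | forall i, I i (y 0 i)].
  apply/seteqP; split => y /=.
    move=> [_ h] i; have := h 0 i.
    by rewrite /I /= in_itv/= -ball_normE/= distrC ltr_distl.
  move=> h; split => // i j; rewrite !ord1 -ball_normE/= distrC ltr_distl.
  by have := h j; rewrite /I/= in_itv/=.
have mI i : measurable (I i) by exact: measurable_itv.
have mB : measurable [set y : 'rV[R]_n | forall i, I i (y 0 i)].
  rewrite (_ : mkset _ = \bigcap_(i in [set: 'I_n])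
      ((fun x : 'rV[R]_n => x 0 i) @^-1` I i)).
    apply: fin_bigcap_measurable; first exact: finite_finset.
    by move=> i _; rewrite -[X in measurable X]setTI; exact: measurable_coord.
  by apply/seteqP; split=> y /= h i; [move=> _|]; exact: (h i).
rewrite -[LHS]mul1e -integral_cst// integral_mkcond.
transitivity (\int[lebesgue_rV n]_y (\prod_(i < n) \1_(I i) (y 0 i))%:E)%E.
  apply: eq_integral => y _; rewrite patchE; case: ifPn.
    move=> /set_mem h; rewrite big1// => i _.
    by rewrite indicE mem_set//; exact: h.
  move=> /negP h; apply/eqP; rewrite eq_sym eqe prodf_seq_eq0.
  apply/hasP; apply: contrapT => /= nh; apply: h; apply/mem_set => /= i.
  apply: contrapT => Ii; apply: nh; exists i; first by rewrite mem_index_enum.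
  by rewrite indicE memNset.
rewrite (@integral_prod_rV _ (fun i => \1_(I i)) (fun=> 2 * r))//.
- by rewrite prodr_const card_ord.
move=> i; rewrite (integral_indic lebesgue_measure measurableT (mI i)) setIT.
transitivity (lebesgue_measure `]x 0 i - r, x 0 i + r[%classic) => //.
rewrite lebesgue_measure_itv/= lte_fin.
by rewrite ifT; [rewrite -EFinB; congr EFin; ring|lra].
Qed.

(** A product weight, so that its integral [pi ^ n] is computed one coordinate at a time; it serves
    as dominating function for everything that decays fast on R^n. *)
Definition weight n (x : 'rV[R]_n) : R := \prod_(i < n) (oneDsqr (x 0 i))^-1.

Lemma measurable_oneDsqrV : measurable_fun setT (fun x : R => (oneDsqr x)^-1).
Proof. by apply: continuous_measurable_fun => x; exact: continuous_oneDsqrV. Qed.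

Lemma measurable_weight n : measurable_fun setT (@weight n).
Proof.
apply: measurable_prod => i _.
exact: (measurableT_comp measurable_oneDsqrV (measurable_coord i)).
Qed.

Lemma weight_ge0 n (x : 'rV[R]_n) : 0 <= weight x.
Proof. by apply: prodr_ge0 => i _; rewrite invr_ge0. Qed.

Lemma integral_oneDsqrV : (\int[lebesgue_measure]_x (oneDsqr (x : R))^-1%:E = pi%:E)%E.
Proof.
have m : measurable_fun setT (fun x : R => ((oneDsqr x)^-1)%:E).
  by apply/measurable_EFinP; exact: measurable_oneDsqrV.
have mI : measurable (`[0%R, +oo[%classic : set R) by exact: measurable_itv.
rewrite -(setUv `[0%R, +oo[%classic) ge0_integral_setU//=; last 3 first.
- by apply: measurableC.
- by rewrite setUv.
- exact/disj_setPCl.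
rewrite setCitvr integral0y_oneDsqr.
suff -> : (\int[lebesgue_measure]_(x in `]-oo, (0%R:R)[) (oneDsqr x)^-1%:E = (pi / 2)%:E)%E.
  by rewrite -EFinD -splitr.
rewrite -integral0y_oneDsqr ge0_integration_by_substitution0//.
rewrite integral_itv_bndo_bndc//; last first.
  by apply: measurable_funTS; exact: m.
by apply: eq_integral => x _; rewrite /oneDsqr sqrrN.
Qed.

Lemma integral_weight n : (\int[lebesgue_rV n]_x (weight x)%:E = (pi ^+ n)%:E)%E.
Proof.
rewrite (integral_prod_rV (g := fun _ x => (oneDsqr x)^-1) (c := fun=> pi))//.
- by rewrite prodr_const card_ord.
- by move=> i; exact: measurable_oneDsqrV.
- by move=> i; exact: integral_oneDsqrV.
Qed.

Lemma integrable_weight n : (lebesgue_rV n).-integrable setT (EFin \o @weight n).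
Proof.
apply/integrableP; split; first by apply/measurable_EFinP; exact: measurable_weight.
under eq_integral do rewrite /= ger0_norm ?weight_ge0//.
by rewrite integral_weight ltry.
Qed.

End rV_lebesgue.

(** * Limits and derivatives under the integral sign *)

Lemma Rdominated_cvg d (T : measurableType d) (R : realType)
    (mu : {measure set T -> \bar R}) (f_ : nat -> T -> R) (f g : T -> R) :
  (forall k, measurable_fun setT (f_ k)) ->
  (forall x, f_ k x @[k --> \oo] --> f x) ->
  (forall k x, `|f_ k x| <= g x) -> mu.-integrable setT (EFin \o g) ->
  \int[mu]_x f_ k x @[k --> \oo] --> \int[mu]_x f x.
Proof.
move=> mf ff fg ig.
have mlim : measurable_fun setT f.
  by apply: (measurable_fun_cvg mf) => x _; exact: ff.
have [] := @dominated_convergence _ _ _ mu setT measurableT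
  (fun k => EFin \o f_ k) (EFin \o f) (EFin \o g).
- by move=> k; exact/measurable_EFinP.
- exact/measurable_EFinP.
- by apply/aeW => x _ /=; apply: cvg_EFin; [exact: nearW|exact: ff].
- by [].
- by apply/aeW => x k _ /=; rewrite lee_fin.
move=> fi _ h; apply: fine_cvg; rewrite fineK//.
exact: integrable_fin_num.
Qed.

Lemma scaleRE (R : realType) (a b : R) : a *: b = a * b :> R.
Proof. by []. Qed.

Lemma derivable_cts (R : realType) (f : R -> R) (x : R) :
  derivable f x 1 -> {for x, continuous f}.
Proof. by move=> ?; apply/differentiable_continuous/derivable1_diffP. Qed.

Section under.
Context {R : realType} d (T : measurableType d) (m : {measure set T -> \bar R}).

Lemma is_derive_under (B : set T) (f df : R -> T -> R) (G : T -> R) (w : R) :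
  measurable B ->
  (forall w, m.-integrable B (EFin \o f w)) ->
  (forall (w : R) x, B x -> is_derive w 1 (f ^~ x) (df w x)) ->
  m.-integrable B (EFin \o G) -> (forall w x, B x -> `|df w x| <= G x) ->
  is_derive w 1 (fun w => \int[m]_(x in B) f w x) (\int[m]_(x in B) df w x).
Proof.
move=> mB fi fd Gi fG.
have E (w0 : R) x : B x -> partial1of2 f w0 x = df w0 x.
  by move=> Bx; rewrite partial1of2E; have := fd w0 x Bx => ?; exact: derive_val.
have wI : `]w - 1, w + 1[%classic w by rewrite /= in_itv/=; lra.
have H := @derivable_under_integral R d T m f B mB w (w - 1) (w + 1) wI
  (fun x _ => fi x) (fun x y _ By => @ex_derive _ _ _ _ _ _ _ (fd x y By))
  (fun y => `|G y|) (fun y => normr_ge0 _).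
have H' := @differentiation_under_integral R d T m f B mB w (w - 1) (w + 1) wI
  (fun x _ => fi x) (fun x y _ By => @ex_derive _ _ _ _ _ _ _ (fd x y By))
  (fun y => `|G y|) (fun y => normr_ge0 _).
have Gi' : m.-integrable B (EFin \o (fun y => `|G y|)) by exact: (integrable_norm Gi).
have b x y : `]w - 1, w + 1[%classic x -> B y -> `|partial1of2 f x y| <= `|G y|.
  by move=> _ By; rewrite E// (le_trans (fG _ _ By))// ler_norm.
split; first exact: H Gi' b.
rewrite -derive1E (H' Gi' b); apply: eq_Rintegral => x; rewrite inE => Bx.
exact: E.
Qed.

End under.

(** * The Fourier transform of the Gaussian in one variable *)

Section gauss1.
Context {R : realType}.
Let mu := @lebesgue_measure R.

Lemma Rintegral_derive (F f : R -> R) (a b : R) : a <= b ->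
  (forall x : R, is_derive x 1 F (f x)) -> continuous f ->
  \int[mu]_(x in `[a, b]) f x = F b - F a.
Proof.
rewrite le_eqVlt => /predU1P[->|ab] dF cf.
  by rewrite set_itv1 Rintegral_set1 subrr.
rewrite /Rintegral (@continuous_FTC2 _ _ F)//.
- by apply: continuous_subspaceT.
- have cF x : {for x, continuous F}.
    by apply/differentiable_continuous/derivable1_diffP; exact: ex_derive.
  split; [by move=> x _; exact: ex_derive|exact/cvg_at_right_filter/cF|].
  exact/cvg_at_left_filter/cF.
- by move=> x _; rewrite derive1E; exact: derive_val.
Qed.

Lemma Rintegral_affine (c b : R) (f : R -> R) : 0 < c ->
  mu.-integrable setT (EFin \o f) ->
  \int[mu]_x f (c * x + b) = c^-1 * \int[mu]_x f x.
Proof.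
move=> c0 fi.
have mE : measurable_fun setT (EFin \o f) by exact: (measurable_int mu).
have iP := integrable_funepos measurableT fi.
have iN := integrable_funeneg measurableT fi.
rewrite /Rintegral integralE.
have := @ge0_integral_affine R c b _ c0 (measurable_funepos mE) (funepos_ge0 _).
have := @ge0_integral_affine R c b _ c0 (measurable_funeneg mE) (funeneg_ge0 _).
have -> : (fun x => (EFin \o f)^\- (c * x + b)%R)%E = (fun x => (f (c * x + b))%:E)^\-%E.
  by apply/funext => x; rewrite !funenegE.
have -> : (fun x => (EFin \o f)^\+ (c * x + b)%R)%E = (fun x => (f (c * x + b))%:E)^\+%E.
  by apply/funext => x; rewrite !funeposE.
move=> -> ->; rewrite -muleBr//; last by apply: fin_num_adde_defr; exact: integrable_fin_num.
by rewrite -integralE fineM//; exact: integrable_fin_num.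
Qed.

(** Since |x| <= 1 + x^2 / 2 <= exp (x^2 / 2), half of the exponent absorbs the factor x. The right
    side dominates the derivative in the frequency in [gauss_cos]. *)
Lemma expR_sqr_bound (x : R) : `|2 * x * expR (- x ^+ 2)| <= 2 * expR (- (x ^+ 2 / 2)).
Proof.
rewrite !normrM (ger0_norm (expR_ge0 _)) ger0_norm// -mulrA ler_pM2l//.
rewrite (_ : - x ^+ 2 = - (x ^+ 2 / 2) + - (x ^+ 2 / 2)); last by field.
rewrite expRD mulrA ler_piMl ?expR_ge0// expRN ler_pdivrMr ?expR_gt0// mul1r.
apply: (le_trans _ (expR_ge1Dx _)).
have := sqr_ge0 (`|x| - 1); rewrite -[x ^+ 2]real_normK ?num_real//.
by nra.
Qed.

Lemma integrable_gauss_half : mu.-integrable setT (fun x => (expR (- (x ^+ 2 / 2)))%:E).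
Proof.
have s0 : 0 < (Num.sqrt 2)^-1 :> R by rewrite invr_gt0 sqrtr_gt0.
have mg : measurable_fun setT (EFin \o @gauss_fun R).
  by apply/measurable_EFinP; exact: measurable_gauss_fun.
have E : (fun x : R => (expR (- (x ^+ 2 / 2)))%:E) =
    (fun x => (EFin \o gauss_fun) ((Num.sqrt 2)^-1 * x + 0)).
  apply/funext => x /=; rewrite addr0 /gauss_fun exprMn exprVn sqr_sqrtr//.
  by rewrite [x ^+ 2 / 2]mulrC.
rewrite E; apply/integrableP; split.
  rewrite -E; apply/measurable_EFinP; apply: measurable_expf.
  by apply: measurableT_comp => //; apply: measurable_funM => //; meas.
under eq_integral do rewrite gee0_abs ?lee_fin ?gauss_fun_ge0//.
rewrite (@ge0_integral_affine R _ _ (EFin \o gauss_fun) s0)//.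
  by rewrite invrK integralT_gauss -EFinM ltry.
by move=> x; rewrite lee_fin gauss_fun_ge0.
Qed.

Let ga (x : R) := expR (- x ^+ 2).

Let mga : measurable_fun setT ga.
Proof. exact: measurable_gauss_fun. Qed.

Let iga : mu.-integrable setT (EFin \o ga).
Proof. exact: integrableT_gauss. Qed.

Let igx : mu.-integrable setT (fun x => (2 * x * ga x)%:E).
Proof.
have i2 : mu.-integrable setT (fun x => (2%:E * (expR (- (x ^+ 2 / 2)))%:E)%E).
  by apply: integrableZl => //; exact: integrable_gauss_half.
apply: (le_integrable measurableT _ _ i2).
  by apply/measurable_EFinP; meas; exact: mga.
move=> x _ /=; rewrite lee_fin (le_trans (expR_sqr_bound x))//.
by rewrite ler_norm.
Qed.

Lemma Rintegral_derive_eq0 (H h : R -> R) :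
  (forall x : R, is_derive x 1 H (h x)) -> continuous h ->
  mu.-integrable setT (EFin \o h) -> (forall x, `|H x| <= ga x) ->
  \int[mu]_x h x = 0.
Proof.
move=> dH ch ih Hg.
pose I k : set R := `[- k%:R, k%:R]%classic.
have mI k : measurable (I k) by exact: measurable_itv.
have mh : measurable_fun setT h by exact: continuous_measurable_fun.
have c1 : \int[mu]_x (h \_ (I k)) x @[k --> \oo] --> \int[mu]_x h x.
  apply: (@Rdominated_cvg _ _ _ mu _ _ (fun x => `|h x|)).
  - by move=> k; apply/(measurable_restrictT h (mI k)); exact: measurable_funTS.
  - move=> x; apply: cvg_near_cst.
    near=> k; rewrite patchE mem_set// /I /= in_itv/= -ler_norml.
    by near: k; exact: nbhs_infty_ger.
  - by move=> k x; rewrite patchE; case: ifP => // _; rewrite normr0.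
  - exact: (integrable_norm ih).
have c2 : \int[mu]_x (h \_ (I k)) x @[k --> \oo] --> (0 : R).
  have E k : \int[mu]_x (h \_ (I k)) x = H k%:R - H (- k%:R).
    by rewrite -Rintegral_mkcond (Rintegral_derive _ dH ch)// ge0_cp.
  under eq_fun do rewrite E.
  apply: (@squeeze_cvgr _ _ _ _ (fun k => - (2 * k.+1%:R^-1)) (fun k => 2 * k.+1%:R^-1)).
  - near=> k; rewrite -ler_norml.
    (* exp (- k^2) <= 1 / (1 + k^2) <= 1 / (1 + k), since [k] is a natural number. *)
    have b x : x ^+ 2 = k%:R ^+ 2 -> `|H x| <= k.+1%:R^-1.
      move=> xk; rewrite (le_trans (Hg x))// /ga xk expRN lef_pV2 ?posrE ?expR_gt0//.
      rewrite (le_trans _ (expR_ge1Dx _))// -natr1 addrC lerD2l -natrX ler_nat.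
      by case: (k) => // k'; rewrite expnS leq_pmulr.
    rewrite (le_trans (ler_normB _ _))// mulr_natl mulr2n lerD// b//.
    by rewrite sqrrN.
  - rewrite -[X in _ --> X]oppr0; apply: cvgN; rewrite -(mulr0 2).
    by apply: cvgMl_tmp; exact: cvg_harmonic.
  - by rewrite -(mulr0 2); apply: cvgMl_tmp; exact: cvg_harmonic.
exact: (cvg_unique _ c1 c2).
Unshelve. all: by end_near. Qed.

(** The difference of the two sides is the integral of the derivative of
    [exp (- x^2) * sin (2 * x * w + phi)], which vanishes at both ends. *)
Lemma gauss_ibp (w phi : R) :
  \int[mu]_x (2 * x * ga x * sin (2 * x * w + phi))
  = 2 * w * \int[mu]_x (ga x * cos (2 * x * w + phi)).
Proof.
pose H x : R := ga x * sin (2 * x * w + phi).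
pose h x : R := ga x * cos (2 * x * w + phi) * (2 * w)
   - 2 * x * ga x * sin (2 * x * w + phi).
have dH (x : R) : is_derive x 1 H (h x).
  rewrite /H /ga /h; apply: is_derive_eq.
  by rewrite !scaleRE /ga; ring.
have mga' := mga.
have ic (c : R -> R) : measurable_fun setT c -> (forall x, `|c x| <= 1) ->
    mu.-integrable setT (fun x => (ga x * c x)%:E).
  by move=> mc c1; exact: (integrable_bounded_mul (c := 1) iga).
have i1 : mu.-integrable setT (fun x => (ga x * cos (2 * x * w + phi))%:E).
  apply: ic => [|x]; first by apply: measurable_cosf; meas.
  by rewrite ler_norml cos_geN1 cos_le1.
have i1' : mu.-integrable setT (EFin \o (fun x => ga x * cos (2 * x * w + phi) * (2 * w))).
  exact: integrable_mulrr.
have i2 : mu.-integrable setT (fun x => (2 * x * ga x * sin (2 * x * w + phi))%:E).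
  apply: (integrable_bounded_mul (c := 1) igx) => [|x].
    by apply: measurable_sinf; meas.
  by rewrite ler_norml sin_geN1 sin_le1.
have h0 : \int[mu]_x h x = 0.
  apply: (@Rintegral_derive_eq0 H) => //.
  - by move=> x; apply: derivable_cts; rewrite /h /ga; exact: ex_derive.
  - exact: (integrableB measurableT i1' i2).
  - move=> x; rewrite /H normrM (ger0_norm (expR_ge0 _)) ler_piMr ?expR_ge0//.
    by rewrite ler_norml sin_geN1 sin_le1.
move: h0; rewrite /h RintegralB// RintegralZr// => /eqP; rewrite subr_eq0 => /eqP <-.
by rewrite mulrC.
Qed.

(** By [gauss_ibp] the integral I solves I' = - 2 w I, so exp (w^2) I is constant. The phase [phi]
    carries the other coordinates in the induction on the dimension in [gauss_fourier]. *)
Lemma gauss_cos (w phi : R) :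
  \int[mu]_x (ga x * cos (2 * x * w + phi)) = cos phi * Num.sqrt pi * expR (- w ^+ 2).
Proof.
pose I (w : R) := \int[mu]_x (ga x * cos (2 * x * w + phi)).
have mga' := mga.
have dI (v : R) : is_derive v 1 I (- 2 * v * I v).
  have := @is_derive_under R _ _ mu setT (fun w x => ga x * cos (2 * x * w + phi))
    (fun w x => - (2 * x * ga x * sin (2 * x * w + phi)))
    (fun x => 2 * expR (- (x ^+ 2 / 2))) v measurableT.
  have i2 u : mu.-integrable setT (fun x => (2 * x * ga x * sin (2 * x * u + phi))%:E).
    apply: (integrable_bounded_mul (c := 1) igx) => [|x].
      by apply: measurable_sinf; meas.
    by rewrite ler_norml sin_geN1 sin_le1.
  have -> : \int[mu]_x (- (2 * x * ga x * sin (2 * x * v + phi))) = - 2 * v * I v.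
    under eq_Rintegral do rewrite -mulN1r.
    by rewrite RintegralZl; [rewrite gauss_ibp /I; ring|by []|exact: i2].
  apply.
  - move=> u; apply: (integrable_bounded_mul (c := 1) iga) => [|x].
      by apply: measurable_cosf; meas.
    by rewrite ler_norml cos_geN1 cos_le1.
  - move=> u x _; apply: is_derive_eq.
    by rewrite !scaleRE; ring.
  - by apply: integrable_mulrl => //; exact: integrable_gauss_half.
  - move=> u x _; rewrite normrN (le_trans _ (expR_sqr_bound x))// normrM.
    by rewrite ler_piMr// ler_norml sin_geN1 sin_le1.
have J0 (v : R) : is_derive v 1 (fun v => expR (v ^+ 2) * I v) 0.
  have := dI v => ?; apply: is_derive_eq.
  by rewrite !scaleRE; ring.
have := is_derive_0_is_cst w 0 J0.
rewrite expr0n/= expR0 mul1r -/(I w) => JE.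
have -> : I w = expR (- w ^+ 2) * I 0.
  by rewrite -JE mulrA -expRD addNr expR0 mul1r.
rewrite mulrC; congr (_ * _); rewrite /I.
under eq_Rintegral do rewrite mulr0 add0r.
by rewrite RintegralZr// mulrC /Rintegral integralT_gauss.
Qed.

Lemma gauss_cos_scaled (s w phi : R) : 0 < s ->
  \int[mu]_x (expR (- (pi * s ^+ 2 * x ^+ 2)) * cos (2 * pi * (x * w) + phi))
  = cos phi * (s^-1 * expR (- (pi * s ^- 2 * w ^+ 2))).
Proof.
move=> s0; have p0 := @pi_gt0 R.
have c0 : 0 < Num.sqrt pi * s by rewrite mulr_gt0// sqrtr_gt0.
pose f x := ga x * cos (2 * x * (Num.sqrt pi * w / s) + phi).
have fi : mu.-integrable setT (EFin \o f).
  have mga' := mga.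
  apply: (integrable_bounded_mul (c := 1) iga) => [|x].
    by apply: measurable_cosf; meas.
  by rewrite ler_norml cos_geN1 cos_le1.
have := Rintegral_affine 0 c0 fi; rewrite {2}/f gauss_cos.
have q2 : Num.sqrt pi ^+ 2 = pi :> R by rewrite sqr_sqrtr// ltW.
have q0 : Num.sqrt (pi : R) != 0 by rewrite sqrtr_eq0 -ltNge.
have s1 : s != 0 by rewrite gt_eqF.
have -> : (Num.sqrt pi * w / s) ^+ 2 = pi * s ^- 2 * w ^+ 2.
  by rewrite !exprMn q2 exprVn; ring.
have -> : (Num.sqrt pi * s)^-1 * (cos phi * Num.sqrt pi * expR (- (pi / s ^+ 2 * w ^+ 2)))
   = cos phi * (s^-1 * expR (- (pi / s ^+ 2 * w ^+ 2))) by field; apply/andP.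
move=> <-; apply: eq_Rintegral => x _; rewrite /f /ga addr0 !exprMn q2.
congr (expR _ * cos (_ + _)).
by rewrite -{1}q2; field.
Qed.

End gauss1.

(** * Gaussians and Bessel's inequality *)

Section gaussn.
Context {R : realType}.
Let mu := @lebesgue_measure R.

Definition gauss n (s : R) (w : 'rV[R]_n) : R := expR (- (pi * s ^+ 2 * dot w w)).

Lemma gauss_gt0 n s (w : 'rV[R]_n) : 0 < gauss s w. Proof. exact: expR_gt0. Qed.

Lemma gauss_ge0 n s (w : 'rV[R]_n) : 0 <= gauss s w. Proof. exact: expR_ge0. Qed.

Lemma dot_ge0 n (w : 'rV[R]_n) : 0 <= dot w w.
Proof. by apply: sumr_ge0 => i _; rewrite -expr2 sqr_ge0. Qed.

Lemma gauss_le1 n s (w : 'rV[R]_n) : gauss s w <= 1.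
Proof.
rewrite /gauss -[leRHS]expR0 ler_expR oppr_le0 mulr_ge0 ?dot_ge0//.
by rewrite mulr_ge0 ?sqr_ge0// pi_ge0.
Qed.

Lemma measurable_gauss n s d (T : measurableType d) (f : T -> 'rV[R]_n) :
  measurable_fun setT f -> measurable_fun setT (fun x => gauss s (f x)).
Proof. by move=> mf; rewrite /gauss; meas; apply: measurableT_comp => //; meas. Qed.

Lemma dotC n (x y : 'rV[R]_n) : dot x y = dot y x.
Proof. by apply: eq_bigr => i _; rewrite mulrC. Qed.

Lemma dotDl n (x y z : 'rV[R]_n) : dot (x + y) z = dot x z + dot y z.
Proof. by rewrite /dot -big_split; apply: eq_bigr => i _; rewrite mxE mulrDl. Qed.

Lemma dotNl n (x z : 'rV[R]_n) : dot (- x) z = - dot x z.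
Proof. by rewrite /dot -sumrN; apply: eq_bigr => i _; rewrite mxE mulNr. Qed.

Lemma dotZl n a (x z : 'rV[R]_n) : dot (a *: x) z = a * dot x z.
Proof. by rewrite /dot mulr_sumr; apply: eq_bigr => i _; rewrite mxE mulrA. Qed.

Lemma dotBl n (x y z : 'rV[R]_n) : dot (x - y) z = dot x z - dot y z.
Proof. by rewrite dotDl dotNl. Qed.

Lemma dotDr n (x y z : 'rV[R]_n) : dot z (x + y) = dot z x + dot z y.
Proof. by rewrite dotC dotDl !(dotC z). Qed.

Lemma dotNr n (x z : 'rV[R]_n) : dot z (- x) = - dot z x.
Proof. by rewrite dotC dotNl dotC. Qed.

Lemma dotZr n a (x z : 'rV[R]_n) : dot z (a *: x) = a * dot z x.
Proof. by rewrite dotC dotZl dotC. Qed.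

Lemma dotBr n (x y z : 'rV[R]_n) : dot z (x - y) = dot z x - dot z y.
Proof. by rewrite dotDr dotNr. Qed.

Lemma dot0r n (z : 'rV[R]_n) : dot z 0 = 0.
Proof. by rewrite /dot big1// => i _; rewrite mxE mulr0. Qed.

Lemma dot_cons n (t s : R) (y w : 'rV[R]_n) :
  dot (rV_cons (t, y)) (rV_cons (s, w)) = t * s + dot y w.
Proof.
rewrite /dot big_ord_recl !mxE unlift_none/=; congr (_ + _).
by apply: eq_bigr => i _; rewrite !mxE liftK.
Qed.

Lemma gaussN n s (w : 'rV[R]_n) : gauss s (- w) = gauss s w.
Proof. by rewrite /gauss dotNl dotNr opprK. Qed.

Lemma integral_gauss1 (s : R) : 0 < s ->
  (\int[mu]_x (expR (- (pi * s ^+ 2 * x ^+ 2)))%:E = (s^-1)%:E)%E.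
Proof.
move=> s0; have p0 := @pi_gt0 R.
have c0 : 0 < Num.sqrt pi * s by rewrite mulr_gt0// sqrtr_gt0.
have mg : measurable_fun setT (EFin \o @gauss_fun R).
  by apply/measurable_EFinP; exact: measurable_gauss_fun.
have := @ge0_integral_affine R _ 0 (EFin \o gauss_fun) c0 mg.
rewrite integralT_gauss -EFinM invfM mulrAC mulVf ?mul1r; last first.
  by rewrite sqrtr_eq0 -ltNge.
move=> <-; last by move=> x; rewrite lee_fin gauss_fun_ge0.
by apply: eq_integral => x _ /=; rewrite /gauss_fun addr0 !exprMn sqr_sqrtr// ltW.
Qed.

Lemma integrable_gauss1 (s : R) : 0 < s ->
  mu.-integrable setT (fun t => (expR (- (pi * s ^+ 2 * t ^+ 2)))%:E).
Proof.
move=> s0; apply/integrableP; split.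
  by apply/measurable_EFinP; apply: measurable_expf; meas; apply: measurableT_comp => //; meas.
under eq_integral do rewrite /= ger0_norm ?expR_ge0//.
by rewrite integral_gauss1// ltry.
Qed.

Lemma gauss_prod n s (w : 'rV[R]_n) :
  gauss s w = \prod_(i < n) expR (- (pi * s ^+ 2 * w 0 i ^+ 2)).
Proof.
rewrite /gauss -expR_sum; congr expR; rewrite /dot mulr_sumr -sumrN.
by apply: eq_bigr => i _; rewrite expr2.
Qed.

Lemma integral_gauss n (s : R) : 0 < s ->
  (\int[lebesgue_rV n]_x (gauss s x)%:E = (s ^- n)%:E)%E.
Proof.
move=> s0; under eq_integral do rewrite gauss_prod.
rewrite (@integral_prod_rV _ _ (fun _ x => expR (- (pi * s ^+ 2 * x ^+ 2))) (fun=> s^-1)).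
- by rewrite prodr_const card_ord exprVn.
- by move=> i; apply: measurable_expf; meas; apply: measurableT_comp => //; meas.
- by move=> *; exact: expR_ge0.
- by move=> i; exact: integral_gauss1.
Qed.

Lemma integrable_gauss n (s : R) : 0 < s ->
  (lebesgue_rV n).-integrable setT (EFin \o @gauss n s).
Proof.
move=> s0; apply/integrableP; split.
  by apply/measurable_EFinP; apply: measurable_gauss; exact: measurable_id.
under eq_integral do rewrite /= ger0_norm ?gauss_ge0//.
by rewrite integral_gauss// ltry.
Qed.

Lemma Rintegral_rVS_tensor n (f : 'rV[R]_n.+1 -> R) (F : R -> R)
    (G : 'rV[R]_n -> R) (K : R * 'rV[R]_n -> R) (c : R) :
  (forall t y, f (rV_cons (t, y)) = F t * G y * K (t, y)) ->
  measurable_fun setT f ->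
  mu.-integrable setT (EFin \o F) ->
  (lebesgue_rV n).-integrable setT (EFin \o G) ->
  measurable_fun setT (K : measurableTypeR R * 'rV[R]_n -> R) ->
  (forall z, `|K z| <= c) ->
  \int[lebesgue_rV n.+1]_x f x
  = \int[mu]_t (F t * \int[lebesgue_rV n]_y (G y * K (t, y))).
Proof.
move=> fE mf iF iG mK Kc.
have iP := @integrable_tensor _ _ _ _ R mu (lebesgue_rV n) F G K c iF iG mK Kc.
have mc := @measurable_rV_cons R n.
rewrite /Rintegral; congr fine.
transitivity (\int[pushforward (mu \x lebesgue_rV n)%E
   (@rV_cons R n)]_x (EFin \o f) x)%E; first by [].
rewrite integral_pushforward//; last 2 first.
- exact/measurable_EFinP.
- rewrite preimage_setT (_ : _ \o _ = fun z => (F z.1 * G z.2 * K z)%:E)//.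
  by apply/funext => -[t y] /=; rewrite fE.
rewrite preimage_setT.
transitivity (\int[mu \x lebesgue_rV n]_z (F z.1 * G z.2 * K z)%:E)%E.
  by apply: eq_integral => -[t y] _ /=; rewrite fE.
rewrite -integral12_prod_meas1//; apply: eq_integral => t _.
have iK2 : (lebesgue_rV n).-integrable setT (fun y => (G y * K (t, y))%:E).
  by apply: (integrable_bounded_mul (c := c) iG) => //; exact: measurableT_comp.
rewrite EFinM fineK; last exact: integrable_fin_num.
rewrite -integralZl//.
by apply: eq_integral => y _; rewrite -EFinM mulrA.
Qed.

Lemma cos_le1_norm (x : R) : `|cos x| <= 1.
Proof. by rewrite ler_norml cos_geN1 cos_le1. Qed.

Lemma sin_le1_norm (x : R) : `|sin x| <= 1.
Proof. by rewrite ler_norml sin_geN1 sin_le1. Qed.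

Lemma gauss_fourier n (s : R) (w : 'rV[R]_n) (phi : R) : 0 < s ->
  \int[lebesgue_rV n]_x (gauss s x * cos (2 * pi * dot x w + phi))
  = cos phi * (s ^- n * gauss s^-1 w).
Proof.
move=> s0; elim: n w phi => [|n IH] w phi.
  rewrite /Rintegral integral_dirac//; last first.
    by apply/measurable_EFinP; meas; exact: measurable_gauss.
  rewrite diracT mul1e /= /gauss /dot !big_ord0 !mulr0 oppr0 expR0 add0r expr0.
  by rewrite invr1 !mulr1 mul1r.
rewrite -(rV_unconsK w); case: (rV_uncons w) => w0 w' {w}.
pose F (t : R) := expR (- (pi * s ^+ 2 * t ^+ 2)).
rewrite (@Rintegral_rVS_tensor n _ F (@gauss n s)
  (fun z => cos (2 * pi * (z.1 * w0) + 2 * pi * dot z.2 w' + phi)) 1); last 6 first.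
- move=> t y; rewrite dot_cons mulrDr; congr (_ * _).
  by rewrite /gauss dot_cons mulrDr opprD expRD -expr2.
- by meas; exact: measurable_gauss.
- exact: integrable_gauss1.
- exact: integrable_gauss.
- by meas.
- by move=> z; exact: cos_le1_norm.
transitivity (\int[mu]_t (F t * cos (2 * pi * (t * w0) + phi) * (s ^- n * gauss s^-1 w'))).
  apply: eq_Rintegral => t _; rewrite -mulrA; congr (_ * _).
  rewrite -IH; apply: eq_Rintegral => y _ /=; congr (_ * cos _).
  by rewrite addrA [in RHS]addrAC addrC addrA.
rewrite RintegralZr//; last first.
  apply: (integrable_bounded_mul (c := 1)) => [||x]; last exact: cos_le1_norm.
    exact: integrable_gauss1.
  by meas.
rewrite gauss_cos_scaled// -(mulrA (cos phi)); congr (_ * _).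
rewrite /gauss dot_cons mulrDr opprD expRD -expr2 exprVn.
set A := expR (- (_ * w0 ^+ 2)); set B := expR _.
by rewrite exprS invfM; ring.
Qed.

End gaussn.

Section schur.
Context d (T : measurableType d) (R : realType).
Variable m : {sigma_finite_measure set T -> \bar R}.

(** Integrability of [f] follows from domination when the right side is finite; when it is infinite
    there is nothing to prove. *)
Lemma le_EFin_Rintegral (f : T -> R) (g : T -> \bar R) :
  measurable_fun setT f -> measurable_fun setT g ->
  (forall x, (`|f x|%:E <= g x)%E) ->
  (`|\int[m]_x f x|%:E <= \int[m]_x g x)%E.
Proof.
move=> mf mg fg.
have mf' : measurable_fun setT (EFin \o f) by exact/measurable_EFinP.
have le1 : (\int[m]_x `|(f x)%:E| <= \int[m]_x g x)%E.
  apply: ge0_le_integral => //; last by move=> x _; exact: fg.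
  by apply: measurableT_comp => //; exact: mf'.
have [goo|] := ltP (\int[m]_x g x)%E +oo%E; last by rewrite leye_eq => /eqP ->; rewrite leey.
have fi : m.-integrable setT (EFin \o f).
  by apply/integrableP; split => //; exact: le_lt_trans goo.
rewrite EFin_normr_Rintegral//.
by apply: (le_trans _ le1); exact: (le_abse_integral m measurableT mf').
Qed.

(** The product |f y| |f z| is at most half the sum of the squares, and each square only sees one
    marginal of [G], of mass 1. *)
Lemma schur_sqr (f : T -> R) (G : T * T -> R) :
  measurable_fun setT f -> measurable_fun setT G -> (forall z, 0 <= G z) ->
  (forall y, \int[m]_z (G (y, z))%:E = 1)%E ->
  (forall z, \int[m]_y (G (y, z))%:E = 1)%E ->
  (\int[m]_y \int[m]_z (`|f y| * `|f z| * G (y, z))%:E <= \int[m]_y (f y ^+ 2)%:E)%E.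
Proof.
move=> mf mG G0 G1 G2.
have sq0 y : 0 <= f y ^+ 2 / 2 by rewrite divr_ge0// sqr_ge0.
pose h1 yz : \bar R := ((f yz.1 ^+ 2 / 2) * G yz)%:E.
pose h2 yz : \bar R := ((f yz.2 ^+ 2 / 2) * G yz)%:E.
have mh1 : measurable_fun setT h1.
  apply/measurable_EFinP; apply: measurable_funM => //; apply: measurable_funM => //.
  by apply: measurable_funX; apply: (measurableT_comp mf).
have mh2 : measurable_fun setT h2.
  apply/measurable_EFinP; apply: measurable_funM => //; apply: measurable_funM => //.
  by apply: measurable_funX; apply: (measurableT_comp mf).
have h10 yz : (0 <= h1 yz)%E by rewrite lee_fin mulr_ge0.
have h20 yz : (0 <= h2 yz)%E by rewrite lee_fin mulr_ge0.
have mG1 y : measurable_fun setT (fun z => G (y, z)).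
  by apply: (measurableT_comp mG).
have mG2 z : measurable_fun setT (fun y => G (y, z)).
  by apply: (measurableT_comp mG).
have mF1 := measurable_fun_fubini_tonelli_F (m2 := m) h1 mh1 h10.
have mF2 := measurable_fun_fubini_tonelli_F (m2 := m) h2 mh2 h20.
apply: (@le_trans _ _ (\int[m]_y \int[m]_z (h1 (y, z) + h2 (y, z)))%E).
  apply: ge0_le_integral => //.
  - by move=> y _; apply: integral_ge0 => z _; rewrite lee_fin !mulr_ge0.
  - have mh : measurable_fun setT (fun yz => (`|f yz.1| * `|f yz.2| * G yz)%:E).
      apply/measurable_EFinP; apply: measurable_funM => //.
      by apply: measurable_funM; apply: measurableT_comp => //; apply: (measurableT_comp mf).
    apply: (measurable_fun_fubini_tonelli_F (m2 := m) _ mh).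
    by move=> z; rewrite lee_fin !mulr_ge0.
  - apply: (measurable_fun_fubini_tonelli_F (m2 := m) (fun z => h1 z + h2 z)%E).
      exact: emeasurable_funD.
    by move=> z; rewrite adde_ge0.
  move=> y _; apply: ge0_le_integral => //.
  - by move=> z _; rewrite lee_fin !mulr_ge0.
  - apply/measurable_EFinP; apply: measurable_funM => //; apply: measurable_funM => //.
    exact: measurableT_comp.
  - by apply: emeasurable_funD; [apply: (measurableT_comp mh1)|apply: (measurableT_comp mh2)].
  move=> z _; rewrite lee_fin/= -mulrDl ler_wpM2r//.
  have := sqr_ge0 (`|f y| - `|f z|).
  rewrite -[f y ^+ 2]real_normK ?num_real// -[f z ^+ 2]real_normK ?num_real//.
  by nra.
have -> : (\int[m]_y \int[m]_z (h1 (y, z) + h2 (y, z))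
   = \int[m]_y \int[m]_z h1 (y, z) + \int[m]_y \int[m]_z h2 (y, z))%E.
  rewrite -ge0_integralD//; last 2 first.
  - by move=> y _; exact: integral_ge0.
  - by move=> y _; exact: integral_ge0.
  apply: eq_integral => y _; rewrite -ge0_integralD//.
    by apply: (measurableT_comp mh1).
  by apply: (measurableT_comp mh2).
have -> : (\int[m]_y (f y ^+ 2)%:E = \int[m]_y (f y ^+ 2 / 2)%:E + \int[m]_y (f y ^+ 2 / 2)%:E)%E.
  have mf2 : measurable_fun setT (fun y => (f y ^+ 2 / 2)%:E).
    by apply/measurable_EFinP; apply: measurable_funM => //; exact: measurable_funX.
  rewrite -ge0_integralD//; try by move=> y _; rewrite lee_fin.
  by apply: eq_integral => y _; rewrite -EFinD -splitr.
rewrite (fubini_tonelli h2)//.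
apply: leeD; rewrite le_eqVlt; apply/orP; left; apply/eqP; apply: eq_integral => y _.
  under eq_integral do rewrite /h1/= EFinM.
  rewrite ge0_integralZl//; first by rewrite G1 mule1.
  - exact/measurable_EFinP.
  - by move=> z _; rewrite lee_fin.
  - by rewrite lee_fin.
under eq_integral do rewrite /h2/= EFinM.
rewrite ge0_integralZl//; first by rewrite G2 mule1.
- exact/measurable_EFinP.
- by move=> z _; rewrite lee_fin.
- by rewrite lee_fin.
Qed.

End schur.

Section bessel.
Context {R : realType} {n : nat}.
Implicit Types (nu : {sigma_finite_measure set 'rV[R]_n -> \bar R}).
Let mu := @lebesgue_rV R n.

Definition fcos nu (f : 'rV[R]_n -> R) (xi : 'rV[R]_n) : R :=
  \int[nu]_y (f y * cos (2 * pi * dot y xi)).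

Definition fsin nu (f : 'rV[R]_n -> R) (xi : 'rV[R]_n) : R :=
  \int[nu]_y (f y * sin (2 * pi * dot y xi)).

Lemma measurable_fcos nu f : nu.-integrable setT (EFin \o f) ->
  measurable_fun setT (fcos nu f).
Proof.
move=> fi; apply: (@measurable_tensor_inner _ _ _ _ R nu f
  (fun z => cos (2 * pi * dot z.1 z.2)) 1) => // [|z]; first by meas.
exact: cos_le1_norm.
Qed.

Lemma measurable_fsin nu f : nu.-integrable setT (EFin \o f) ->
  measurable_fun setT (fsin nu f).
Proof.
move=> fi; apply: (@measurable_tensor_inner _ _ _ _ R nu f
  (fun z => sin (2 * pi * dot z.1 z.2)) 1) => // [|z]; first by meas.
exact: sin_le1_norm.
Qed.

Lemma integrable_cos nu f (a : 'rV[R]_n -> R) : nu.-integrable setT (EFin \o f) ->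
  measurable_fun setT a -> nu.-integrable setT (fun y => (f y * cos (a y))%:E).
Proof.
move=> fi ma; apply: (integrable_bounded_mul (c := 1) fi) => [|z]; first by meas.
exact: cos_le1_norm.
Qed.

Lemma integrable_sin nu f (a : 'rV[R]_n -> R) : nu.-integrable setT (EFin \o f) ->
  measurable_fun setT a -> nu.-integrable setT (fun y => (f y * sin (a y))%:E).
Proof.
move=> fi ma; apply: (integrable_bounded_mul (c := 1) fi) => [|z]; first by meas.
exact: sin_le1_norm.
Qed.

Lemma fcos_le nu f x : nu.-integrable setT (EFin \o f) ->
  `|fcos nu f x| <= \int[nu]_x `|f x|.
Proof.
move=> fi.
have := @tensor_inner_le _ _ _ _ R nu f (fun z => cos (2 * pi * dot z.1 z.2)) 1 x fi.
by rewrite mul1r; apply => [|z]; [meas|exact: cos_le1_norm].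
Qed.

Lemma fsin_le nu f x : nu.-integrable setT (EFin \o f) ->
  `|fsin nu f x| <= \int[nu]_x `|f x|.
Proof.
move=> fi.
have := @tensor_inner_le _ _ _ _ R nu f (fun z => sin (2 * pi * dot z.1 z.2)) 1 x fi.
by rewrite mul1r; apply => [|z]; [meas|exact: sin_le1_norm].
Qed.

Lemma fcos_fsin_sqr nu f x : nu.-integrable setT (EFin \o f) ->
  fcos nu f x ^+ 2 + fsin nu f x ^+ 2
  = \int[nu]_y (f y * \int[nu]_z (f z * cos (2 * pi * dot (y - z) x))).
Proof.
move=> fi.
have ic := @integrable_cos nu f (fun y => 2 * pi * dot y x) fi.
have isn := @integrable_sin nu f (fun y => 2 * pi * dot y x) fi.
have ma : measurable_fun setT (fun y : 'rV[R]_n => 2 * pi * dot y x) by meas.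
rewrite !expr2 {1}/fcos {1}/fsin -!RintegralZr//; try by [apply: ic|apply: isn].
rewrite -RintegralD//; last 2 first.
- by apply: integrable_mulrr => //; exact: ic.
- by apply: integrable_mulrr => //; exact: isn.
apply: eq_Rintegral => y _; rewrite -(mulrA (f y)) -(mulrA (f y)) -mulrDr; congr (_ * _).
rewrite /fcos /fsin -!RintegralZl//; try by [apply: ic|apply: isn].
rewrite -RintegralD//; last 2 first.
- by apply: integrable_mulrl => //; exact: ic.
- by apply: integrable_mulrl => //; exact: isn.
apply: eq_Rintegral => z _; rewrite dotBl mulrBr cosB; ring.
Qed.

Lemma ge0_integral_gauss_shift (s : R) (y : 'rV[R]_n) : 0 < s ->
  (\int[mu]_z (s ^- n * gauss s^-1 (y - z))%:E = 1)%E.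
Proof.
move=> s0.
transitivity (\int[mu]_z ((s ^- n)%:E * (gauss s^-1 (z + - y)%R)%:E))%E.
  by apply: eq_integral => z _; rewrite -EFinM -(gaussN _ (y - z)) opprB.
rewrite ge0_integralZl//; last 3 first.
- by apply/measurable_EFinP; apply: measurable_gauss; meas.
- by move=> z _; rewrite lee_fin gauss_ge0.
- by rewrite lee_fin invr_ge0 exprn_ge0// ltW.
rewrite (@ge0_integral_rV_shift _ _ (- y) (fun z => (gauss s^-1 z)%:E)); last 2 first.
- by apply/measurable_EFinP; apply: measurable_gauss; meas.
- by move=> z; rewrite lee_fin gauss_ge0.
rewrite integral_gauss ?invr_gt0// -EFinM exprVn invrK mulVf//.
by rewrite expf_neq0// gt_eqF.
Qed.

Let bessel_gauss (f : 'rV[R]_n -> R) (s : R) : 0 < s -> mu.-integrable setT (EFin \o f) ->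
  (\int[mu]_x (gauss s x * (fcos mu f x ^+ 2 + fsin mu f x ^+ 2))%:E
   <= \int[mu]_x (f x ^+ 2)%:E)%E.
Proof.
move=> s0 fi.
have mf : measurable_fun setT f by apply/measurable_EFinP; exact: (measurable_int mu fi).
have gi := integrable_gauss n s0.
pose G (y z : 'rV[R]_n) := s ^- n * gauss s^-1 (y - z).
have G0 y z : 0 <= G y z by rewrite mulr_ge0 ?gauss_ge0// invr_ge0 exprn_ge0// ltW.
have sq0 x : 0 <= gauss s x * (fcos mu f x ^+ 2 + fsin mu f x ^+ 2).
  by rewrite mulr_ge0 ?gauss_ge0// addr_ge0 ?sqr_ge0.
have c2 (x : R) : `|cos x| <= 1 by exact: cos_le1_norm.
have mG : measurable_fun setT (fun yz : 'rV[R]_n * 'rV[R]_n => G yz.1 yz.2).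
  by rewrite /G; meas; apply: measurable_gauss; meas.
have mGy y : measurable_fun setT (G y) by rewrite /G; meas; apply: measurable_gauss; meas.
have Gb y z : `|G y z| <= s ^- n.
  rewrite ger0_norm// ler_piMr ?gauss_le1// invr_ge0 exprn_ge0// ltW//.
have E : \int[mu]_x (gauss s x * (fcos mu f x ^+ 2 + fsin mu f x ^+ 2))
    = \int[mu]_y (f y * \int[mu]_z (f z * G y z)).
  under eq_Rintegral do rewrite fcos_fsin_sqr//.
  pose K' (zyx : 'rV[R]_n * ('rV[R]_n * 'rV[R]_n)) : R :=
    cos (2 * pi * dot (zyx.2.2 - zyx.1) zyx.2.1).
  have mK' : measurable_fun setT K' by rewrite /K'; meas.
  pose K (xy : 'rV[R]_n * 'rV[R]_n) := \int[mu]_z (f z * K' (z, xy)).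
  have mK : measurable_fun setT K.
    by apply: (measurable_tensor_inner (m1 := mu) (c := 1) fi mK') => z; exact: c2.
  have Kc z : `|K z| <= 1 * \int[mu]_x `|f x|.
    by apply: (tensor_inner_le (m1 := mu) z fi mK') => ?; exact: c2.
  (* The integral in [x] is moved past [y], then past [z]; what remains innermost is the Fourier
     transform of the Gaussian at [y - z]. *)
  rewrite (Rfubini_tensor (m1 := mu) (m2 := mu) gi fi mK Kc).
  apply: eq_Rintegral => y _; congr (_ * _); rewrite /K /K'/=.
  rewrite (Rfubini_tensor (m1 := mu) (m2 := mu) (c := 1)
     (K := fun xz => cos (2 * pi * dot (y - xz.2) xz.1)) gi fi)//; last by meas.
  apply: eq_Rintegral => z _; congr (_ * _) => /=.
  rewrite /G; have := gauss_fourier (y - z) 0 s0.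
  rewrite cos0 mul1r => <-; apply: eq_Rintegral => x _.
  by rewrite addr0 dotC.
have mfG : measurable_fun setT (fun y => \int[mu]_z (f z * G y z)).
  have mG' : measurable_fun setT (fun zy : 'rV[R]_n * 'rV[R]_n => G zy.2 zy.1).
    by rewrite /G; meas; apply: measurable_gauss; meas.
  exact: (measurable_tensor_inner (m1 := mu) fi mG' (fun z => Gb _ _)).
have bound : (`|\int[mu]_y (f y * \int[mu]_z (f z * G y z))|%:E <= \int[mu]_x (f x ^+ 2)%:E)%E.
  apply: (le_trans _ (schur_sqr (m := mu) mf mG _ _ _)).
  - have mh : measurable_fun setT (fun yz : 'rV[R]_n * 'rV[R]_n =>
        (`|f yz.1| * `|f yz.2| * G yz.1 yz.2)%:E).
      apply/measurable_EFinP; apply: measurable_funM => //.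
      by apply: measurable_funM; apply: measurableT_comp => //; apply: (measurableT_comp mf).
    apply: le_EFin_Rintegral; first exact: measurable_funM.
      apply: (measurable_fun_fubini_tonelli_F (m2 := mu) _ mh).
      by move=> z; rewrite lee_fin; apply: mulr_ge0; [apply: mulr_ge0|exact: G0].
    move=> y; rewrite -RintegralZl//; last first.
      exact: (integrable_bounded_mul fi (mGy y) (Gb y)).
    apply: le_EFin_Rintegral.
    - by apply: measurable_funM => //; apply: measurable_funM.
    - apply/measurable_EFinP; apply: measurable_funM; last exact: mGy.
      by apply: measurable_funM => //; apply: measurableT_comp.
    by move=> z; rewrite lee_fin mulrA normrM (normrM (f y)) (ger0_norm (G0 y z)).
  - by move=> z; exact: G0.
  - by move=> y; exact: ge0_integral_gauss_shift.
  - move=> z; rewrite -(ge0_integral_gauss_shift z s0).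
    by apply: eq_integral => y _; rewrite /G /= -gaussN opprB.
move: bound; rewrite -E; apply: le_trans; rewrite ger0_norm; last first.
  by apply: Rintegral_ge0 => x _.
rewrite /Rintegral fineK//.
apply: integrable_fin_num => //.
apply: (integrable_bounded_mul (c := (\int[mu]_x `|f x|) ^+ 2 + (\int[mu]_x `|f x|) ^+ 2) gi).
  by apply: measurable_funD; apply: measurable_funX; [exact: measurable_fcos|exact: measurable_fsin].
move=> x; rewrite ger0_norm ?addr_ge0 ?sqr_ge0//.
have I0 : 0 <= \int[mu]_x `|f x| by apply: Rintegral_ge0.
by rewrite lerD// -[leLHS]real_normK ?num_real// lerXn2r ?nnegrE ?fcos_le ?fsin_le.
Qed.

(* Gaussian regularization turns the left side into a quadratic form with the
   positive kernel [s ^- n * gauss s^-1 (y - z)] of total mass 1. *)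
Lemma bessel (f : 'rV[R]_n -> R) : mu.-integrable setT (EFin \o f) ->
  (\int[mu]_x (fcos mu f x ^+ 2 + fsin mu f x ^+ 2)%:E
   <= \int[mu]_x (f x ^+ 2)%:E)%E.
Proof.
move=> fi.
pose S x := fcos mu f x ^+ 2 + fsin mu f x ^+ 2.
have S0 x : 0 <= S x by rewrite addr_ge0 ?sqr_ge0.
have mS : measurable_fun setT S.
  by apply: measurable_funD; apply: measurable_funX; [exact: measurable_fcos|exact: measurable_fsin].
(* These Gaussian weights increase to 1 with [k], so monotone convergence removes them. *)
pose g (k : nat) (x : 'rV[R]_n) : \bar R := (gauss k.+1%:R^-1 x * S x)%:E.
have mg k : measurable_fun setT (g k).
  by apply/measurable_EFinP; apply: measurable_funM => //; apply: measurable_gauss; meas.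
have g0 k x : (0 <= g k x)%E by rewrite lee_fin mulr_ge0// gauss_ge0.
have nd x : {homo g ^~ x : a b / (a <= b)%N >-> (a <= b)%E}.
  move=> a b ab; rewrite lee_fin ler_wpM2r// ler_expR lerN2.
  rewrite ler_wpM2r ?dot_ge0// ler_wpM2l ?pi_ge0// !exprVn lef_pV2 ?posrE ?exprn_gt0//.
  by rewrite lerXn2r ?nnegrE// ler_nat.
have gl x : limn (g ^~ x) = (S x)%:E.
  apply/cvg_lim => //; rewrite -[X in _ --> X%:E]mul1r.
  apply: cvg_EFin; first exact: nearW.
  apply: cvgMr_tmp.
  rewrite -[X in _ --> X]expR0.
  apply: continuous_cvg; first exact: continuous_expR.
  rewrite -[X in _ --> X]oppr0; apply: cvgN.
  rewrite -(mul0r (dot x x)); apply: cvgMr_tmp; rewrite -(mulr0 pi); apply: cvgMl_tmp.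
  rewrite (_ : (fun x0 : nat => _) = (fun k => harmonic k * harmonic k)); last first.
    by apply/funext => k; rewrite expr2.
  by rewrite -[X in _ --> X](mulr0 0); apply: cvgM; exact: cvg_harmonic.
rewrite (_ : (\int[mu]_x _ = \int[mu]_x limn (g ^~ x))%E); last first.
  by apply: eq_integral => x _; rewrite gl.
rewrite monotone_convergence//.
apply: lime_le; last by apply: nearW => k; apply: bessel_gauss; rewrite ?invr_gt0.
apply: ereal_nondecreasing_is_cvgn => a b ab.
by apply: ge0_le_integral => // x _; exact: nd.
Qed.

End bessel.

(** * The dyadic maximal function *)

Section dyad.
Context {R : realType}.

(* an enumeration of the dyadic scales [2 ^ k], [k] in Z *)
Definition dyad (i : nat) : R :=
  if odd i then (2 ^+ (i./2).+1)^-1 else 2 ^+ i./2.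

Lemma dyad_gt0 i : 0 < dyad i.
Proof. by rewrite /dyad; case: ifP => _; rewrite ?invr_gt0 exprn_gt0. Qed.

Lemma dyad_double k : dyad k.*2 = 2 ^+ k.
Proof. by rewrite /dyad odd_double doubleK. Qed.

Lemma dyad_doubleS k : dyad k.*2.+1 = (2 ^+ k.+1)^-1.
Proof. by rewrite /dyad /= odd_double /= uphalf_double. Qed.

Lemma ge1_pow2 (x : R) : 1 <= x -> exists k : nat, 2 ^+ k <= x < 2 ^+ k.+1.
Proof.
move=> x1.
have [m xm] : exists m : nat, x < 2 ^+ m.
  exists (Num.truncn x).+1; rewrite (lt_le_trans (truncnS_gt _))//.
  by rewrite -natrX ler_nat ltnW// ltn_expl.
elim: m xm => [|m IH] xm; first by move: xm; rewrite expr0 ltNge x1.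
by have [/IH//|mx] := ltP x (2 ^+ m); exists m; rewrite mx.
Qed.

Lemma dyad_ex (x : R) : 0 < x -> exists i, dyad i <= x < 2 * dyad i.
Proof.
move=> x0; have [x1|x1] := leP 1 x.
  have [k /andP[k1 k2]] := ge1_pow2 x1; exists k.*2.
  by rewrite dyad_double k1/= -exprS.
have x1' : 1 <= x^-1 by rewrite invf_ge1// ltW.
have [k /andP[k1 k2]] := ge1_pow2 x1'.
(* Inversion turns the half-open interval around, so the case where [x^-1] is exactly a power of 2
   is handled apart. *)
have [E|E] := eqVneq x^-1 (2 ^+ k).
  have -> : x = (2 ^+ k)^-1 by rewrite -E invrK.
  case: k E {k1 k2} => [|k] E.
    by exists 0%N; rewrite /dyad/= expr0 invr1 lexx mulr1 ltr1n.
  by exists k.*2.+1; rewrite dyad_doubleS lexx/= ltr_pMl ?ltr1n.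
have {}k1 : 2 ^+ k < x^-1 by rewrite lt_neqAle eq_sym E.
exists k.*2.+1; rewrite dyad_doubleS; apply/andP; split.
  by rewrite -[leRHS]invrK lef_pV2 ?posrE ?invr_gt0 ?exprn_gt0// ltW.
rewrite exprS invfM mulVKf// -[ltLHS]invrK ltf_pV2 ?posrE ?invr_gt0 ?exprn_gt0//.
Qed.

(* [g y = y / (1 + y)] telescopes along a geometric progression of ratio [l]. *)
Let g (y : R) := y / (1 + y).

Let gP (l y : R) : 1 < l -> 0 < y ->
  Num.min y y^-1 <= (4 * l / (l - 1)) * (g (l * y) - g y).
Proof.
move=> l1 y0; have l0 : 0 < l by lra.
have ly : 0 < 1 + l * y by rewrite addr_gt0// mulr_gt0.
have y1 : 0 < 1 + y by lra.
have E : (4 * l / (l - 1)) * (g (l * y) - g y) = 4 * l * y / ((1 + l * y) * (1 + y)).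
  rewrite /g; field; apply/and3P; split; rewrite gt_eqF//; lra.
rewrite E; apply: (@le_trans _ _ (4 * y / ((1 + y) * (1 + y)))).
  rewrite ler_pdivlMr ?mulr_gt0//.
  have [h|h] := leP y 1.
    rewrite (le_trans (y := y * ((1 + y) * (1 + y))))//.
      by rewrite ler_wpM2r ?ge_min ?lexx// mulr_ge0 ?ltW.
    rewrite mulrC ler_wpM2r ?(ltW y0)//; nra.
  rewrite (le_trans (y := y^-1 * ((1 + y) * (1 + y))))//.
    by rewrite ler_wpM2r ?ge_min ?lexx ?orbT// mulr_ge0 ?ltW.
  by rewrite mulrC ler_pdivrMr//; nra.
rewrite ler_pdivrMr ?mulr_gt0// mulrAC ler_pdivlMr ?mulr_gt0//.
have : 1 + l * y <= l * (1 + y) by nra.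
nra.
Qed.

(** The terms decay geometrically on both sides of the scale [rho^-1], wherever it lies: this
    uniformity in [rho] is what later allows sums over all dyadic levels, blocks or slices. *)
Lemma dyad_sum (w : R) : 0 < w -> exists2 C : R, 0 < C & forall rho, 0 < rho ->
  (\sum_(0 <= i <oo) (Num.min ((dyad i * rho) `^ w) (((dyad i * rho) `^ w)^-1))%:E
   <= C%:E)%E.
Proof.
move=> w0; pose l := 2 `^ w : R.
have l1 : 1 < l.
  by have := @gt0_ltr_powR R w w0 1 2; rewrite !nnegrE ler01 ler0n ltr1n powR1; apply.
have l0 : 0 < l by lra.
exists (4 * l / (l - 1)); first by rewrite divr_gt0// ?mulr_gt0//; lra.
move=> rho rho0; set C := _ / _.
pose a i : R := Num.min ((dyad i * rho) `^ w) (((dyad i * rho) `^ w)^-1).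
have a0 i : 0 <= a i by rewrite le_min powR_ge0 invr_ge0 powR_ge0.
pose z := rho `^ w; have z0 : 0 < z by rewrite powR_gt0.
have E i : (dyad i * rho) `^ w = dyad i `^ w * z.
  by rewrite powRM ?ltW// dyad_gt0.
have E1 k : dyad k.*2 `^ w = l ^+ k.
  by rewrite dyad_double /l -powR_mulrn// -!powRrM mulrC powRrM powR_mulrn ?powR_ge0.
have E2 k : dyad k.*2.+1 `^ w = (l ^+ k.+1)^-1.
  rewrite dyad_doubleS -powR_inv1 ?exprn_ge0// -powRrM mulN1r powRN.
  by rewrite /l -powR_mulrn// -!powRrM mulrC powRrM powR_mulrn ?powR_ge0.
have C0 : 0 < C by rewrite /C divr_gt0// ?mulr_gt0//; lra.
have gb y : 0 < y -> 0 <= g y <= 1.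
  move=> y0; have y1 : 0 < 1 + y by lra.
  by rewrite /g divr_ge0 ?(ltW y0) ?(ltW y1)//= ler_pdivrMr//; lra.
(* Indices [k.*2] and [k.*2.+1] extend the range of scales by one at each end, so the differences of
   [g] telescope in both directions. *)
have part k : \sum_(0 <= i < k.*2) a i <= C * (g (l ^+ k * z) - g (z / l ^+ k)).
  elim: k => [|k IH]; first by rewrite big_geq// expr0 divr1 mul1r subrr mulr0.
  rewrite doubleS !big_nat_recr//= {2 3}/a !E E1 E2.
  have p1 := @gP l (l ^+ k * z) l1 (mulr_gt0 (exprn_gt0 _ l0) z0).
  have zl : 0 < z / l ^+ k.+1 by rewrite divr_gt0// exprn_gt0.
  have p2 := @gP l (z / l ^+ k.+1) l1 zl.
  rewrite mulrA -exprS in p1.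
  have e3 : l * (z / l ^+ k.+1) = z / l ^+ k.
    by rewrite exprS invfM mulrCA (mulrA l) mulfV ?gt_eqF// mul1r.
  rewrite e3 in p2; rewrite [_^-1 * z]mulrC.
  by move: IH p1 p2; rewrite -/C; lra.
apply: lime_le.
  by apply: is_cvg_nneseries => i _ _; rewrite lee_fin; exact: a0.
apply: nearW => k /=.
rewrite sumEFin lee_fin.
apply: (@le_trans _ _ (\sum_(0 <= i < k.*2) a i)).
  rewrite [leRHS](@big_cat_nat _ _ _ k)//=; last by rewrite -addnn leq_addr.
  by rewrite lerDl sumr_ge0.
apply: (le_trans (part k)); rewrite ler_piMr ?(ltW C0)//.
have /andP[_ h1] := gb (l ^+ k * z) (mulr_gt0 (exprn_gt0 _ l0) z0).
have /andP[h2 _] := gb (z / l ^+ k) (divr_gt0 z0 (exprn_gt0 _ l0)).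
lra.
Qed.

End dyad.

Section vitali.
Context {R : realType} {n : nat}.
Variables (c : nat -> 'rV[R]_n) (r : nat -> R).
Hypothesis r0 : forall i, 0 < r i.
Local Notation B i := (ball (c i) (r i)).

(** Greedy choice of a ball of largest radius: a ball meeting it is no larger, hence lies in its
    triple; the others are treated by induction. *)
Lemma vitali_seq (s : seq nat) : exists t : seq nat,
  [/\ {subset t <= s}, uniq t, trivIset [set` t] (fun i => B i) &
      forall i, i \in s -> exists2 j, j \in t & B i `<=` ball (c j) (3 * r j)].
Proof.
have [m sm] := ubnP (size s); elim: m s sm => // m IH s sm.
have [->|sn0] := eqVneq s [::].
  by exists [::]; split.
have [i0 i0s imax] : exists2 i0, i0 \in s & forall i, i \in s -> r i <= r i0.
  elim: s sn0 {sm IH} => // a s IH _; have [->|/IH[b bs bmax]] := eqVneq s [::].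
    by exists a; rewrite ?mem_head// => i; rewrite inE => /eqP ->.
  have [ab|ab] := leP (r a) (r b).
    by exists b; [rewrite inE bs orbT|move=> i; rewrite inE => /orP[/eqP ->//|/bmax]].
  exists a; first by rewrite mem_head.
  move=> i; rewrite inE => /orP[/eqP ->//|/bmax h].
  exact: (le_trans h (ltW ab)).
pose s' := [seq i <- s | `[< B i `&` B i0 = set0 >]].
have [|t [ts ut tt tcov]] := IH s'.
  rewrite -ltnS (leq_trans _ sm)// ltnS size_filter -(count_predC (fun i => `[< B i `&` B i0 = set0 >]) s).
  rewrite -addn1 leq_add2l -has_count; apply/hasP; exists i0 => //=.
  apply/negP => /asboolP; rewrite setIid => /seteqP[h _].
  by have := h (c i0) (ballxx _ (r0 i0)).
have i0t : i0 \notin t.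
  apply/negP => /ts; rewrite mem_filter => /andP[/asboolP + _].
  rewrite setIid => /seteqP[h _].
  by have := h (c i0) (ballxx _ (r0 i0)).
exists (i0 :: t); split.
- by move=> i; rewrite inE => /orP[/eqP ->//|/ts]; rewrite mem_filter => /andP[].
- by rewrite /= i0t.
- apply/trivIsetP => i j /=; rewrite !inE.
  have dis k : k \in t -> B k `&` B i0 = set0.
    by move=> /ts; rewrite mem_filter => /andP[/asboolP].
  move=> /orP[/eqP ->|it] /orP[/eqP ->|jt]; rewrite ?eqxx//.
  + by rewrite setIC dis.
  + by rewrite dis.
  + by move/trivIsetP : tt => /(_ i j it jt).
- move=> i is_; have [|nd] := boolP (`[< B i `&` B i0 = set0 >]).
    move=> d; have : i \in s' by rewrite mem_filter d.
    by move=> /tcov[j jt h]; exists j => //; rewrite inE jt orbT.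
  exists i0; first by rewrite mem_head.
  move: nd => /asboolP/eqP/set0P[z [iz i0z]] y iy.
  have := imax i is_ => ri.
  have h : ball (c i0) (r i0 + (r i + r i)) y.
    by apply: ball_triangle i0z _; apply: ball_triangle _ iy; exact: ball_sym.
  by apply: (le_ball _ h); lra.
Qed.

End vitali.

Section maximal.
Context {R : realType} {n : nat}.
Let mu := @lebesgue_rV R n.
Implicit Types (f : 'rV[R]_n -> R) (x : 'rV[R]_n).

(* an enumeration of the balls of rational center and dyadic radius *)
Definition qball_index (i : nat) : 'rV[rat]_n * nat := odflt (0, 0%N) (unpickle i).

Definition qcenter i : 'rV[R]_n := \row_j ratr ((qball_index i).1 0 j).

Definition qradius i : R := dyad (qball_index i).2.

Definition qball i : set 'rV[R]_n := ball (qcenter i) (qradius i).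

Lemma qradius_gt0 i : 0 < qradius i. Proof. exact: dyad_gt0. Qed.

Lemma measurable_ball_rV x (r : R) : measurable (ball x r : set 'rV[R]_n).
Proof. by apply: sub_sigma_algebra; exact: ball_open. Qed.

Lemma qball_cover x (r : R) : 0 < r -> exists i,
  [/\ ball x r `<=` qball i, qball i x & qradius i <= 4 * r].
Proof.
(* A dyadic radius in ]2 r, 4 r] contains [ball x r] as soon as the rational center is within [r] of
   [x]. *)
move=> r0; have r4 : 0 < 4 * r by rewrite mulr_gt0.
have [k /andP[k1 k2]] := dyad_ex r4.
have ex j : exists q : rat, `|x 0 j - ratr q| < r.
  have [q] : exists q : rat, ratr q \in `](x 0 j - r), (x 0 j + r)[.
    by apply: rat_in_itvoo; lra.
  by rewrite in_itv/= => qi; exists q; rewrite distrC ltr_distl.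
have [q qP] := choice ex.
exists (pickle (\row_j q j, k)); rewrite /qball /qcenter /qradius /qball_index pickleK/=.
set c := (X in ball X (dyad k) x).
have xc : ball c r x.
  by split => // a j; rewrite !ord1 -ball_normE/= !mxE distrC.
split => //.
- move=> y xy; have h : ball c (r + r) y.
    exact: (ball_triangle xc).
  by apply: (le_ball _ h); lra.
- by apply: (le_ball _ xc); lra.
Qed.

Definition avg f i : \bar R :=
  (((2 * qradius i) ^+ n)^-1%:E * \int[mu]_(y in qball i) `|f y|%:E)%E.

(** The uncentered Hardy-Littlewood maximal function, restricted to countably many balls so as to be
    measurable; [integral_ball_le] recovers arbitrary centered balls up to a constant. *)
Definition maximal f x : \bar R :=
  esups (fun i => avg f i * (\1_(qball i) x)%:E)%E 0%N.

Lemma avg_ge0 f i : (0 <= avg f i)%E.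
Proof.
rewrite mule_ge0//; last by apply: integral_ge0 => y _; rewrite lee_fin.
by rewrite lee_fin invr_ge0 exprn_ge0// mulr_ge0// ltW// qradius_gt0.
Qed.

Lemma avg_le_maximal f x i : qball i x -> (avg f i <= maximal f x)%E.
Proof.
move=> ix; apply: ereal_sup_ubound; exists i => //=.
by rewrite indicE mem_set// mule1.
Qed.

Lemma maximal_le f x (a : \bar R) : (0 <= a)%E ->
  (forall i, qball i x -> (avg f i <= a)%E) -> (maximal f x <= a)%E.
Proof.
move=> a0 h; apply: ge_ereal_sup => _ [i _ <-].
rewrite indicE; have [/set_mem/h ?|_] := boolP (x \in qball i); first by rewrite mule1.
by rewrite mule0.
Qed.

Lemma maximal_ge0 f x : (0 <= maximal f x)%E.
Proof.
have [i [_ ix _]] := @qball_cover x 1 ltr01.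
exact: (le_trans (avg_ge0 f i) (avg_le_maximal _ _)).
Qed.

Lemma measurable_maximal f : measurable_fun setT (maximal f).
Proof.
apply: (measurable_fun_esups (f := fun i x => avg f i * (\1_(qball i) x)%:E)%E) => i.
apply: measurable_funeM; apply/measurable_EFinP; apply: measurable_indic.
exact: measurable_ball_rV.
Qed.

(** The ball lies in an enumerated one of radius at most [4 * r], whose side is at most [8 * r]. *)
Lemma integral_ball_le f x (r : R) : 0 < r -> measurable_fun setT f ->
  (\int[mu]_(y in ball x r) `|f y|%:E <= ((8 * r) ^+ n)%:E * maximal f x)%E.
Proof.
move=> r0 mf; have [i [xi ix ri]] := qball_cover x r0.
have q0 := qradius_gt0 i.
apply: (@le_trans _ _ (\int[mu]_(y in qball i) `|f y|%:E)%E).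
  apply: ge0_subset_integral => //; try exact: measurable_ball_rV.
  by apply/measurable_EFinP; apply: measurableT_comp => //; exact: measurable_funTS.
apply: (@le_trans _ _ (((2 * qradius i) ^+ n)%:E * avg f i)%E).
  by rewrite muleA -EFinM mulfV ?mul1e// expf_neq0// gt_eqF// mulr_gt0.
apply: lee_pmul; rewrite ?avg_ge0 ?avg_le_maximal//.
  by rewrite lee_fin exprn_ge0// mulr_ge0// ltW.
by rewrite lee_fin lerXn2r ?nnegrE ?mulr_ge0 ?(ltW q0) ?(ltW r0)//; lra.
Qed.

Lemma le_maximal (f g : 'rV[R]_n -> R) x : measurable_fun setT f -> measurable_fun setT g ->
  (forall y, `|f y| <= `|g y|) -> (maximal f x <= maximal g x)%E.
Proof.
move=> mf mg fg; apply: maximal_le; first exact: maximal_ge0.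
move=> i ix; apply: le_trans (avg_le_maximal g ix).
rewrite /avg lee_pmul2l ?lte_fin ?invr_gt0 ?exprn_gt0 ?mulr_gt0 ?qradius_gt0//.
apply: ge0_le_integral => //; try exact: measurable_ball_rV.
- by apply/measurable_EFinP; apply: measurableT_comp => //; exact: measurable_funTS.
- by apply/measurable_EFinP; apply: measurableT_comp => //; exact: measurable_funTS.
- by move=> y _; rewrite lee_fin.
Qed.

Lemma maximalZ f x (a : R) : 0 <= a -> measurable_fun setT f ->
  maximal (fun y => a * f y) x = (a%:E * maximal f x)%E.
Proof.
move=> a0 mf.
have avgZ i : avg (fun y => a * f y) i = (a%:E * avg f i)%E.
  rewrite /avg [RHS]muleCA; congr (_ * _)%E.
  under eq_integral do rewrite normrM (ger0_norm a0) EFinM.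
  rewrite ge0_integralZl//; first exact: measurable_ball_rV.
  by apply/measurable_EFinP; apply: measurableT_comp => //; exact: measurable_funTS.
move: a0 avgZ; rewrite le_eqVlt => /predU1P[<-|a0] avgZ.
  rewrite mul0e; apply/eqP; rewrite eq_le maximal_ge0 andbT.
  by apply: maximal_le => // i _; rewrite avgZ mul0e.
apply/eqP; rewrite eq_le; apply/andP; split.
  apply: maximal_le; first by rewrite mule_ge0 ?maximal_ge0// lee_fin ltW.
  by move=> i ix; rewrite avgZ lee_pmul2l// avg_le_maximal.
rewrite -lee_pdivlMl//; apply: maximal_le.
  by rewrite mule_ge0 ?maximal_ge0// lee_fin invr_ge0 ltW.
by move=> i ix; rewrite lee_pdivlMl// -avgZ avg_le_maximal.
Qed.

(** The level set is the union of the balls of large average. For finitely many of them, the Vitali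
    selection is disjoint and its triples cover, at the cost [3 ^ n]; continuity of the measure
    gives the whole union. *)
Lemma maximal_weak f (lam : R) : 0 < lam -> measurable_fun setT f ->
  (lam%:E * mu [set x | lam%:E < maximal f x] <= (3 ^+ n)%:E * \int[mu]_y `|f y|%:E)%E.
Proof.
move=> lam0 mf.
pose good : set nat := [set i | lam%:E < avg f i]%E.
pose F i : set 'rV[R]_n := if `[< good i >] then qball i else set0.
have mF i : measurable (F i).
  by rewrite /F; case: ifP => _; [exact: measurable_ball_rV|exact: measurable0].
have -> : [set x | lam%:E < maximal f x]%E = \bigcup_i F i.
  apply/seteqP; split => x /=.
    move=> /ereal_sup_gt[_ [i _ <-]]; rewrite indicE.
    have [/set_mem ix|_] := boolP (x \in qball i).
      by rewrite mule1 => gi; exists i => //; rewrite /F asboolT.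
    by rewrite mule0 lte_fin ltNge (ltW lam0).
  move=> [i _]; rewrite /F; case: asboolP => // gi ix.
  exact: (lt_le_trans gi (avg_le_maximal _ ix)).
have mBS k : measurable (\big[setU/set0]_(i < k) F i) by exact: bigsetU_measurable.
have bound k : (lam%:E * mu (\big[setU/set0]_(i < k) F i)
    <= (3 ^+ n)%:E * \int[mu]_y `|f y|%:E)%E.
  pose s := [seq i <- iota 0 k | `[< good i >]].
  have [t [ts ut tt tcov]] := @vitali_seq R n qcenter qradius qradius_gt0 s.
  have sub : \big[setU/set0]_(i < k) F i `<=`
      \big[setU/set0]_(j <- t) ball (qcenter j) (3 * qradius j).
    rewrite -bigcup_mkord => x [i /= ik]; rewrite /F; case: asboolP => // gi ix.
    have : i \in s by rewrite mem_filter asboolT// mem_iota/= add0n.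
    by move=> /tcov[j jt /(_ _ ix) h]; rewrite -bigcup_seq; exists j.
  have m3 j : measurable (ball (qcenter j) (3 * qradius j) : set 'rV[R]_n).
    exact: measurable_ball_rV.
  have le1 : (mu (\big[setU/set0]_(i < k) F i)
      <= \sum_(j <- t) mu (ball (qcenter j) (3 * qradius j)))%E.
    apply: (@le_trans _ _ (mu (\big[setU/set0]_(j <- t) ball (qcenter j) (3 * qradius j)))).
      by apply: le_measure; rewrite ?inE//; exact: bigsetU_measurable.
    elim: (t) => [|j t' IHt]; first by rewrite !big_nil measure0.
    rewrite !big_cons; apply: (le_trans (measureU2 mu (m3 j) _)).
      exact: bigsetU_measurable.
    by rewrite leeD2l.
  apply: (@le_trans _ _ (lam%:E * \sum_(j <- t) mu (ball (qcenter j) (3 * qradius j)))%E).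
    by rewrite lee_pmul2l.
  have le2 j : good j -> (lam%:E * mu (ball (qcenter j) (3 * qradius j))
      <= (3 ^+ n)%:E * \int[mu]_(y in qball j) `|f y|%:E)%E.
    move=> gj; have q0 := qradius_gt0 j.
    rewrite lebesgue_rV_ball ?mulr_gt0// (_ : (2 * (3 * qradius j)) ^+ n
      = 3 ^+ n * (2 * qradius j) ^+ n); last by rewrite mulrCA exprMn.
    rewrite EFinM muleCA lee_pmul2l ?lte_fin ?exprn_gt0//.
    have := ltW gj; rewrite /avg lee_pdivlMl// ?exprn_gt0 ?mulr_gt0//.
    by rewrite muleC.
  rewrite ge0_sume_distrr; last by move=> j _; exact: measure_ge0.
  apply: (@le_trans _ _ (\sum_(j <- t) (3 ^+ n)%:E * \int[mu]_(y in qball j) `|f y|%:E)%E).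
    rewrite big_seq [leRHS]big_seq; apply: lee_sum => j /ts.
    by rewrite mem_filter => /andP[/asboolP gj _]; exact: le2.
  rewrite -ge0_sume_distrr; last by move=> j _; apply: integral_ge0 => y _; rewrite lee_fin.
  rewrite lee_pmul2l ?lte_fin ?exprn_gt0//.
  have mfa : measurable_fun setT (fun y => `|f y|%:E).
    by apply/measurable_EFinP; exact: measurableT_comp.
  rewrite -ge0_integral_bigsetU//; last 2 first.
  - by move=> j; exact: measurable_ball_rV.
  - exact: measurable_funTS.
  apply: ge0_subset_integral => //.
  by apply: bigsetU_measurable => j _; exact: measurable_ball_rV.
have cvg1 : mu (\big[setU/set0]_(i < k) F i) @[k --> \oo] --> mu (\bigcup_i F i).
  have -> : \bigcup_i F i = \bigcup_k \big[setU/set0]_(i < k) F i.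
    apply/seteqP; split => [x [i _ Fi]|x [k _]]; last exact: bigsetU_bigcup.
    by exists i.+1 => //; exact: (@bigsetU_sup _ i i.+1).
  apply: nondecreasing_cvg_mu => //.
    exact: bigcup_measurable.
  by move=> a b ab; apply/subsetPset; exact: subset_bigsetU.
apply: (cvge_le (F := \oo) (f := fun k => lam%:E * mu (\big[setU/set0]_(i < k) F i))%E).
  exact: nearW.
by apply: cvgeZl.
Qed.

Lemma measurable_ltr_ind d (T : measurableType d) (g h : T -> R) :
  measurable_fun setT g -> measurable_fun setT h ->
  measurable_fun setT (fun z : T => (g z < h z)%R%:R : R).
Proof.
move=> mg mh.
rewrite (_ : (fun z => _) = \1_([set z | g z < h z])); last first.
  apply/funext => z; rewrite indicE; case: (boolP (g z < h z)) => gh.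
    by rewrite mem_set.
  by rewrite memNset//=; exact/negP.
apply: measurable_indic; rewrite -[X in measurable X]setTI.
rewrite (_ : [set z | _] = (fun z => h z - g z) @^-1` `]0, +oo[%classic).
  exact: (measurable_funB mh mg measurableT (measurable_itv _)).
by apply/seteqP; split => z /=; rewrite in_itv/= andbT subr_gt0.
Qed.

(** The values of [f] of size at most [a] contribute at most [a] to any average. *)
Lemma maximal_half f x (a : R) : 0 <= a -> measurable_fun setT f ->
  (maximal f x <= maximal (fun y => f y * (a < `|f y|)%R%:R)%R x + a%:E)%E.
Proof.
move=> a0 mf; set f1 := fun y => _.
have mf1 : measurable_fun setT f1.
  apply: measurable_funM => //.
  by apply: measurable_ltr_ind => //; exact: measurableT_comp.
apply: maximal_le => [|i ix]; first by rewrite adde_ge0 ?maximal_ge0.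
apply: (@le_trans _ _ (avg f1 i + a%:E)%E); last by rewrite leeD2r// avg_le_maximal.
have q0 := qradius_gt0 i.
have p0 : 0 < (2 * qradius i) ^+ n by rewrite exprn_gt0// mulr_gt0.
rewrite /avg lee_pdivrMl// muleDr//; last by rewrite fin_num_adde_defl.
rewrite muleA -EFinM mulfV ?gt_eqF// mul1e.
have <- : (\int[mu]_(y in qball i) a%:E = ((2 * qradius i) ^+ n)%:E * a%:E)%E.
  rewrite integral_cst; last exact: measurable_ball_rV.
  by rewrite muleC; congr (_ * _)%E; exact: lebesgue_rV_ball.
have mb := measurable_ball_rV (qcenter i) (qradius i).
rewrite -ge0_integralD//; last first.
  by apply/measurable_EFinP; apply: measurableT_comp => //; exact: measurable_funTS.
apply: ge0_le_integral => //.
- by apply/measurable_EFinP; apply: measurableT_comp => //; exact: measurable_funTS.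
- apply: emeasurable_funD => //.
  by apply/measurable_EFinP; apply: measurableT_comp => //; exact: measurable_funTS.
move=> y _; rewrite -EFinD lee_fin /f1.
by case: ltP => h; rewrite ?mulr1 ?mulr0 ?normr0 ?add0r// lerDl.
Qed.

(** Marcinkiewicz's argument on dyadic levels: at each level the weak bound is applied to the part
    of [f] above half of that level, and the sum over levels is evaluated pointwise in |f x| by
    [dyad_sum] with exponent [s - 1]. *)
Lemma maximal_strong (s : R) : 1 < s -> exists2 C : R, 0 < C & forall f,
  measurable_fun setT f ->
  (\int[mu]_x poweR (maximal f x) s <= C%:E * \int[mu]_x (`|f x| `^ s)%:E)%E.
Proof.
move=> s1; have s10 : 0 < s - 1 by lra.
have s0 : 0 < s by lra.
have [D D0 DP] := dyad_sum s10.
pose c : R := 4 `^ s * (2 * 3 ^+ n).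
have c0 : 0 < c by rewrite /c !mulr_gt0 ?powR_gt0 ?exprn_gt0.
exists (c * 2 `^ (s - 1) * D); first by rewrite !mulr_gt0 ?powR_gt0.
move=> f mf.
have mp : measurable_fun setT (fun x => poweR (maximal f x) s).
  by apply: (measurableT_comp (measurable_poweR s)); exact: measurable_maximal.
pose E i : set 'rV[R]_n := [set x | ((dyad i)%:E < maximal f x)%E].
have mE i : measurable (E i).
  rewrite -[X in measurable X]setTI.
  apply: (emeasurable_fun_o_infty measurableT (measurable_maximal f)).
pose u i x : \bar R := (((4 * dyad i) `^ s)%:E * (\1_(E i) x)%:E)%E.
have u0 i x : (0 <= u i x)%E by rewrite mule_ge0 ?lee_fin ?powR_ge0.
have mu_ i : measurable_fun setT (u i).
  by apply: measurable_funeM; apply/measurable_EFinP; exact: measurable_indic.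
have uE i x : E i x -> u i x = ((4 * dyad i) `^ s)%:E.
  by move=> Ex; rewrite /u indicE mem_set// mule1.
have ge_term (x : 'rV[R]_n) i : (u i x <= \sum_(0 <= j <oo) u j x)%E.
  apply: (@le_trans _ _ (\sum_(0 <= j < i.+1) u j x)%E).
    by rewrite big_nat_recr//= leeDr// sume_ge0.
  by apply: nneseries_lim_ge => j _ _.
(* A finite positive value v lies strictly between [dyad i] and [4 * dyad i] for some [i], and that
   single term suffices; for an infinite value every level contributes and the series diverges. *)
have point x : (poweR (maximal f x) s <= \sum_(0 <= i <oo) u i x)%E.
  have := maximal_ge0 f x; case E1 : (maximal f x) => [v| |] //.
    rewrite lee_fin le_eqVlt => /predU1P[<-|v0].
      by rewrite poweR0r ?gt_eqF// nneseries_ge0.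
    have v20 : 0 < v / 2 by rewrite divr_gt0.
    have [i /andP[i1 i2]] := dyad_ex v20.
    have d0 := @dyad_gt0 R i.
    apply: le_trans (ge_term x i); rewrite uE; last by rewrite /E /= E1 lte_fin; lra.
    rewrite poweR_EFin lee_fin ge0_ler_powR ?nnegrE ?(ltW s0) ?(ltW v0)//.
      by rewrite mulr_ge0// ltW.
    lra.
  move=> _; suff -> : (\sum_(0 <= i <oo) u i x = +oo)%E by rewrite leey.
  apply/eqyP => A A0; have [k Ak] : exists k : nat, A <= k%:R.
    by exists (Num.truncn A).+1; rewrite ltW// truncnS_gt.
  apply: le_trans (ge_term x k.*2); rewrite uE; last by rewrite /E /= E1 ltry.
  rewrite lee_fin (le_trans Ak)// dyad_double.
  have k4 : (1 : R) <= 4 * 2 ^+ k.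
    have : (1 : R) <= 2 ^+ k by rewrite exprn_ege1// ler1n.
    by lra.
  apply: (@le_trans _ _ ((4 * 2 ^+ k) `^ 1)); last by rewrite ler_powR// ltW.
  rewrite powRr1; last by rewrite mulr_ge0// exprn_ge0.
  rewrite (@le_trans _ _ (2 ^+ k))//; last by rewrite ler_peMl ?exprn_ge0// ler1n.
  by rewrite -natrX ler_nat ltnW// ltn_expl.
apply: (@le_trans _ _ (\int[mu]_x \sum_(0 <= i <oo) u i x)%E).
  apply: ge0_le_integral => //.
  - by move=> x _; exact: poweR_ge0.
  - by apply: ge0_emeasurable_sum => // i x _ _.
rewrite integral_nneseries//.
(* The integrand of the weak bound at level [dyad i / 2]; [c] collects [4 ^ s], the factor 2 of the
   inverse half level, and [3 ^ n]. *)
pose v i x : \bar R := ((c * dyad i `^ (s - 1)) * (`|f x| * (dyad i / 2 < `|f x|)%R%:R))%:E.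
have v0 i x : (0 <= v i x)%E.
  by rewrite lee_fin !mulr_ge0// ?powR_ge0// ltW.
have mbb (a : R) : measurable_fun setT (fun y => (a < `|f y|)%R%:R : R).
  by apply: measurable_ltr_ind => //; exact: measurableT_comp.
have mv i : measurable_fun setT (v i).
  apply/measurable_EFinP; apply: measurable_funM => //; apply: measurable_funM => //.
  exact: measurableT_comp.
have uv i : (\int[mu]_x u i x <= \int[mu]_x v i x)%E.
  have d0 := @dyad_gt0 R i.
  have d20 : 0 < dyad i / 2 :> R by rewrite divr_gt0.
  rewrite /u ge0_integralZl//; try by [apply/measurable_EFinP; exact: measurable_indic
    |move=> x _; rewrite lee_fin|rewrite lee_fin powR_ge0].
  rewrite integral_indic// setIT.
  pose f1 y := f y * (dyad i / 2 < `|f y|)%R%:R.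
  have mf1 : measurable_fun setT f1 by exact: measurable_funM.
  have sub : E i `<=` [set x | ((dyad i / 2)%:E < maximal f1 x)%E].
    move=> x /= Ex; have := maximal_half x (ltW d20) mf.
    move=> /(lt_le_trans Ex); rewrite -lteBlDr//; apply: le_lt_trans.
    by rewrite -EFinB lee_fin; lra.
  have mE1 : measurable [set x | ((dyad i / 2)%:E < maximal f1 x)%E].
    rewrite -[X in measurable X]setTI.
    apply: (emeasurable_fun_o_infty measurableT (measurable_maximal f1)).
  have le1 : (mu (E i) <= mu [set x | ((dyad i / 2)%:E < maximal f1 x)%E])%E.
    by apply: le_measure; rewrite ?inE.
  have := maximal_weak d20 mf1; rewrite -lee_pdivlMl// => h.
  rewrite /v; under [leRHS]eq_integral do rewrite EFinM.
  rewrite ge0_integralZl//; try by [move=> x _; rewrite lee_fin mulr_ge0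
    |rewrite lee_fin mulr_ge0 ?powR_ge0// ltW
    |apply/measurable_EFinP; apply: measurable_funM => //; exact: measurableT_comp].
  apply: (@le_trans _ _ (((4 * dyad i) `^ s)%:E * ((dyad i / 2)^-1%:E *
     ((3 ^+ n)%:E * \int[mu]_y `|f1 y|%:E)))%E).
    by rewrite lee_pmul2l ?lte_fin ?powR_gt0 ?mulr_gt0// (le_trans le1).
  rewrite !muleA -!EFinM.
  rewrite (_ : (4 * dyad i) `^ s / (dyad i / 2) * 3 ^+ n = c * dyad i `^ (s - 1)).
    rewrite le_eqVlt; apply/orP; left; apply/eqP; congr (_ * _)%E.
    by apply: eq_integral => x _; rewrite /f1 normrM (ger0_norm (ler0n _ _)).
  rewrite powRM// ?ltW// powRB; last by rewrite (gt_eqF d0) implybT.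
  rewrite powRr1 ?ltW// /c; field; rewrite gt_eqF//.
apply: (@le_trans _ _ (\sum_(0 <= i <oo) \int[mu]_x v i x)%E).
  by apply: lee_nneseries => [i _ _|i _]; [exact: integral_ge0|exact: uv].
have mpow : measurable_fun setT (fun x => (`|f x| `^ s)%:E).
  apply/measurable_EFinP.
  by apply: (measurableT_comp (measurable_powR s)); exact: measurableT_comp.
rewrite -integral_nneseries// -ge0_integralZl//; try by [
  move=> x _; rewrite lee_fin powR_ge0|rewrite lee_fin !mulr_ge0 ?powR_ge0// ltW].
apply: ge0_le_integral => //.
- by move=> x _; exact: nneseries_ge0.
- by apply: ge0_emeasurable_sum => // i x _ _.
- exact: measurable_funeM.
move=> x _; rewrite /v.
have [f0|f0] := eqVneq (f x) 0.
  rewrite eseries0; last by move=> i _ _; rewrite f0 normr0 mul0r mulr0.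
  by rewrite mule_ge0 ?lee_fin ?powR_ge0// !mulr_ge0 ?powR_ge0// ltW.
have a0 : 0 < `|f x| by rewrite normr_gt0.
(* Only levels with [dyad i < 2 * |f x|] count; with this inverse as [rho] they are the increasing
   half of [dyad_sum]. *)
have r0 : 0 < (2 * `|f x|)^-1 by rewrite invr_gt0 mulr_gt0.
apply: (@le_trans _ _ (\sum_(0 <= i <oo) (c * (2 * `|f x|) `^ (s - 1) * `|f x|)%:E *
   (Num.min ((dyad i * (2 * `|f x|)^-1) `^ (s - 1)) (((dyad i * (2 * `|f x|)^-1) `^ (s - 1))^-1))%:E)%E).
  apply: lee_nneseries => [i _ _|i _]; first exact: v0.
  have d0 := @dyad_gt0 R i.
  rewrite -EFinM lee_fin; case: ltP => h; last first.
    rewrite !mulr0; apply: mulr_ge0; last by rewrite le_min powR_ge0 invr_ge0 powR_ge0.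
    by rewrite !mulr_ge0 ?powR_ge0// ltW.
  have d1 : dyad i * (2 * `|f x|)^-1 <= 1.
    by rewrite ler_pdivrMr ?mulr_gt0//; lra.
  have p0 : 0 < dyad i * (2 * `|f x|)^-1 by rewrite mulr_gt0.
  have q1 : (dyad i * (2 * `|f x|)^-1) `^ (s - 1) <= 1.
    rewrite -[leRHS](powRr0 (dyad i * (2 * `|f x|)^-1)).
    by rewrite ger_powR ?p0// ltW.
  rewrite min_l; last first.
    by rewrite (le_trans q1)// invf_ge1// powR_gt0.
  have e : dyad i `^ (s - 1) = (2 * `|f x|) `^ (s - 1) *
      (dyad i * (2 * `|f x|)^-1) `^ (s - 1).
    rewrite -powRM; [|by rewrite mulr_ge0|exact: ltW].
    by congr (_ `^ _); rewrite mulrCA mulfV ?mulr1// gt_eqF// mulr_gt0.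
  by rewrite mulr1 e le_eqVlt; apply/orP; left; apply/eqP; ring.
rewrite nneseriesZl//; last by move=> i _; rewrite lee_fin le_min powR_ge0 invr_ge0 powR_ge0.
apply: (@le_trans _ _ ((c * (2 * `|f x|) `^ (s - 1) * `|f x|)%:E * D%:E)%E).
  rewrite lee_pmul2l ?lte_fin ?mulr_gt0 ?powR_gt0 ?mulr_gt0//.
  exact: DP.
have e : `|f x| `^ (s - 1) * `|f x| = `|f x| `^ s.
  by rewrite powRB ?(gt_eqF a0) ?implybT// powRr1// mulfVK ?gt_eqF.
rewrite -!EFinM lee_fin powRM// -e.
by rewrite le_eqVlt; apply/orP; left; apply/eqP; ring.
Qed.

End maximal.

(** * The maximal function on variable Lebesgue spaces *)

Section enorm_theory.
Context {R : realType} {n : nat}.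
Implicit Types x y : 'rV[R]_n.

Lemma enorm_ge0 x : 0 <= enorm x. Proof. exact: sqrtr_ge0. Qed.

Lemma enorm_sqr x : enorm x ^+ 2 = dot x x.
Proof. by rewrite sqr_sqrtr// dot_ge0. Qed.

Lemma measurable_enorm d (T : measurableType d) (f : T -> 'rV[R]_n) :
  measurable_fun setT f -> measurable_fun setT (fun z => enorm (f z)).
Proof.
move=> mf; apply: (@measurableT_comp _ _ _ _ _ _ (fun x : R => Num.sqrt x) _
  (fun z => dot (f z) (f z))); last by meas.
by apply: continuous_measurable_fun; exact: sqrt_continuous.
Qed.

Lemma enormN x : enorm (- x) = enorm x.
Proof. by rewrite /enorm dotNl dotNr opprK. Qed.

Lemma enormZ a x : enorm (a *: x) = `|a| * enorm x.
Proof. by rewrite /enorm dotZl dotZr mulrA -expr2 sqrtrM ?sqr_ge0// sqrtr_sqr. Qed.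

Lemma enorm0 : enorm (0 : 'rV[R]_n) = 0.
Proof. by rewrite /enorm dot0r sqrtr0. Qed.

Lemma coord_le_enorm x i : `|x 0 i| <= enorm x.
Proof.
rewrite -sqrtr_sqr ler_sqrt ?dot_ge0// /dot (bigD1 i)//= -expr2 lerDl.
by apply: sumr_ge0 => j _; rewrite -expr2 sqr_ge0.
Qed.

Lemma dot_le_enorm x y : dot x y <= enorm x * enorm y.
Proof.
have sq : 0 <= dot (enorm y *: x - enorm x *: y) (enorm y *: x - enorm x *: y).
  exact: dot_ge0.
move: sq; rewrite !dotBl !dotBr !dotZl !dotZr -!enorm_sqr (dotC y x).
have [x0|x0] := eqVneq (enorm x) 0.
  move=> _; rewrite x0 mul0r.
  have xi i : x 0 i = 0.
    by apply/eqP; rewrite -normr_le0 -x0 coord_le_enorm.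
  by rewrite /dot big1// => i _; rewrite xi mul0r.
have [y0|y0] := eqVneq (enorm y) 0.
  move=> _; rewrite y0 mulr0.
  have yi i : y 0 i = 0.
    by apply/eqP; rewrite -normr_le0 -y0 coord_le_enorm.
  by rewrite /dot big1// => i _; rewrite yi mulr0.
move=> h; have xp : 0 < enorm x by rewrite lt_neqAle eq_sym x0 enorm_ge0.
have yp : 0 < enorm y by rewrite lt_neqAle eq_sym y0 enorm_ge0.
have : 0 <= (enorm x * enorm y) * (enorm x * enorm y - dot x y) by nra.
by rewrite pmulr_rge0 ?mulr_gt0// subr_ge0.
Qed.

Lemma enormD x y : enorm (x + y) <= enorm x + enorm y.
Proof.
rewrite -[leRHS]ger0_norm ?addr_ge0 ?enorm_ge0// -sqrtr_sqr ler_sqrt ?sqr_ge0//.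
rewrite sqrrD !enorm_sqr dotDl !dotDr (dotC y x).
have := dot_le_enorm x y; lra.
Qed.

Lemma enorm_le_sum x : enorm x <= \sum_(i < n) `|x 0 i|.
Proof.
have s0 : 0 <= \sum_(i < n) `|x 0 i| by apply: sumr_ge0.
rewrite -[leRHS]ger0_norm// -sqrtr_sqr ler_sqrt ?sqr_ge0// expr2 mulr_suml.
apply: ler_sum => i _; rewrite -expr2 -real_normK ?num_real// expr2.
by rewrite ler_wpM2l// (bigD1 i)//= lerDl sumr_ge0.
Qed.

Lemma enorm_ball_lt x y z (r : R) : ball z r x -> ball z r y ->
  enorm (x - y) <= n%:R * (2 * r).
Proof.
move=> [r0 zx] [_ zy]; rewrite (le_trans (enorm_le_sum _))//.
rewrite (@le_trans _ _ (\sum_(i < n) (2 * r)))//; last first.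
  by rewrite sumr_const card_ord -[leLHS]mulr_natl.
apply: ler_sum => i _; rewrite !mxE.
have := zx 0 i; have := zy 0 i; rewrite -!ball_normE/= => a b.
rewrite -(subrKA (z 0 i)) (le_trans (ler_normD _ _))// distrC.
by rewrite mulr_natl mulr2n lerD// ltW.
Qed.

End enorm_theory.

Section powR_more.
Context {R : realType}.

(** The convex function t ^ s lies above its tangent at [a]; this is the inequality averaged in
    [avg_jensen]. *)
Lemma powR_young (s a t : R) : 1 <= s -> 0 <= a -> 0 <= t ->
  s * a `^ (s - 1) * t <= t `^ s + (s - 1) * a `^ s.
Proof.
rewrite le_eqVlt => /predU1P[<-|s1] a0 t0.
  by rewrite subrr mul0r addr0 powRr0 mulr1 mul1r powRr1.
have s0 : 0 < s by lra.
have s10 : 0 < s - 1 by lra.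
have := @conjugate_powR R t (a `^ (s - 1)) s (s / (s - 1)) t0 (powR_ge0 _ _) s0
  (divr_gt0 s0 s10).
rewrite -powRrM mulrCA mulfV ?mulr1 ?gt_eqF// invf_div => h.
have := h _; rewrite -[X in X + _]mul1r -mulrDl addrC subrK divff ?gt_eqF// => /(_ erefl).
rewrite -(ler_pM2l s0) => h2.
rewrite [leLHS](_ : _ = s * (t * a `^ (s - 1))); last by ring.
apply: (le_trans h2); rewrite le_eqVlt; apply/orP; left; apply/eqP; field.
by rewrite !gt_eqF.
Qed.

Lemma powRD_le (a b r : R) : 0 <= a -> 0 <= b -> 0 <= r ->
  (a + b) `^ r <= 2 `^ r * (a `^ r + b `^ r).
Proof.
move=> a0 b0 r0; wlog ab : a b a0 b0 / a <= b.
  move=> wl; have [/wl//|/ltW ba] := leP a b; first exact.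
  by rewrite addrC [X in _ * X]addrC; exact: wl.
apply: (@le_trans _ _ ((2 * b) `^ r)).
  by rewrite ge0_ler_powR// ?nnegrE ?addr_ge0 ?mulr_ge0//; lra.
by rewrite powRM// ler_wpM2l ?powR_ge0// lerDr powR_ge0.
Qed.

(** The power is an indicator times exp (r ln f). Where [f x = 0] this product is 0, which is the
    value of the power for a nonzero exponent. *)
Lemma measurable_powR_fun d (T : measurableType d) (f r : T -> R) :
  (forall x, 0 <= f x) -> (forall x, r x != 0) ->
  measurable_fun setT f -> measurable_fun setT r ->
  measurable_fun setT (fun x => f x `^ r x).
Proof.
move=> f0 r0 mf mr.
rewrite (_ : (fun x => _) = (fun x => (0 < f x)%R%:R * expR (r x * ln (f x)))).
  apply: measurable_funM; first exact: measurable_ltr_ind.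
  by apply: measurable_expf; apply: measurable_funM => //; exact: measurableT_comp.
apply/funext => x; have := f0 x; rewrite le_eqVlt => /predU1P[<-|fx].
  by rewrite ltxx mul0r powR0.
by rewrite fx mul1r /powR gt_eqF.
Qed.

Lemma measurable_poweR_fun d (T : measurableType d) (f : T -> \bar R) (r : T -> R) :
  (forall x, 0 <= f x)%E -> (forall x, 0 < r x) ->
  measurable_fun setT f -> measurable_fun setT r ->
  measurable_fun setT (fun x => poweR (f x) (r x)).
Proof.
move=> f0 r0 mf mr.
rewrite (_ : (fun x => _) = (fun x => if f x == +oo%E then +oo%E
    else (fine (f x) `^ r x)%:E)).
  apply: measurable_fun_ifT => //.
    apply: (measurable_fun_bool true).
    rewrite (_ : _ @^-1` _ = f @^-1` [set +oo%E] :> set T).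
      have := mf measurableT _ (emeasurable_set1 +oo%E); exact.
    by apply/seteqP; split=> x /= /eqP.
  apply/measurable_EFinP; apply: measurable_powR_fun => //.
  - by move=> x; rewrite fine_ge0.
  - by move=> x; rewrite gt_eqF.
  - exact: measurableT_comp.
apply/funext => x; have := f0 x; case: (f x) => [a| |]//= _.
by rewrite gt_eqF.
Qed.

End powR_more.

Section avg_theory.
Context {R : realType} {n : nat}.
Let mu := @lebesgue_rV R n.
Implicit Types (f g : 'rV[R]_n -> R).
Local Notation qball := (@qball R n).
Local Notation m i := ((2 * @qradius R n i) ^+ n).

Lemma qvol_gt0 i : 0 < m i.
Proof. by rewrite exprn_gt0// mulr_gt0// qradius_gt0. Qed.

Lemma measurable_qball i : measurable (qball i). Proof. exact: measurable_ball_rV. Qed.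

Lemma qball_vol i : mu (qball i) = (m i)%:E.
Proof. by rewrite lebesgue_rV_ball// qradius_gt0. Qed.

Let mabs f (D : set 'rV[R]_n) : measurable_fun setT f -> measurable_fun D (fun y => `|f y|%:E).
Proof.
move=> mf; apply/measurable_EFinP; apply: measurableT_comp => //.
exact: measurable_funTS.
Qed.

Lemma le_avg f g i : measurable_fun setT f -> measurable_fun setT g ->
  (forall y, qball i y -> `|f y| <= `|g y|) -> (avg f i <= avg g i)%E.
Proof.
move=> mf mg fg; rewrite /avg lee_pmul2l ?lte_fin ?invr_gt0 ?qvol_gt0//.
by apply: ge0_le_integral => //; try by [exact: measurable_qball|exact: mabs].
Qed.

Lemma avgD f g i : measurable_fun setT f -> measurable_fun setT g ->
  (forall y, 0 <= f y) -> (forall y, 0 <= g y) ->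
  avg (fun y => f y + g y) i = (avg f i + avg g i)%E.
Proof.
move=> mf mg f0 g0; rewrite /avg -muleDr//; last first.
  by apply: ge0_adde_def; rewrite inE; apply: integral_ge0.
rewrite -ge0_integralD//; [|exact: measurable_qball|exact: mabs|exact: mabs].
by congr (_ * _)%E; apply: eq_integral => y _; rewrite !ger0_norm// addr_ge0.
Qed.

Lemma avgZ f i a : measurable_fun setT f -> 0 <= a ->
  avg (fun y => a * f y) i = (a%:E * avg f i)%E.
Proof.
move=> mf a0; rewrite /avg [RHS]muleCA; congr (_ * _)%E.
rewrite -ge0_integralZl//; try by [exact: measurable_qball|exact: mabs].
by apply: eq_integral => y _; rewrite normrM ger0_norm.
Qed.

Lemma avg_cst (a : R) i : 0 <= a -> avg (fun _ : 'rV[R]_n => a) i = a%:E.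
Proof.
move=> a0; rewrite /avg integral_cst; last exact: measurable_qball.
rewrite muleCA; transitivity (`|a|%:E * 1)%E; last by rewrite mule1 ger0_norm.
congr (_ * _)%E; transitivity ((m i)^-1%:E * (m i)%:E)%E.
  by congr (_ * _)%E; exact: qball_vol.
by rewrite -EFinM mulVf// gt_eqF// qvol_gt0.
Qed.

Lemma avg_jensen g i s : 1 <= s -> measurable_fun setT g -> (forall y, 0 <= g y) ->
  (poweR (avg g i) s <= avg (fun y => g y `^ s)%R i)%E.
Proof.
move=> s1 mg g0; have s0 : 0 < s by lra.
have mgs : measurable_fun setT (fun y => g y `^ s).
  exact: (measurableT_comp (measurable_powR s)).
have [goo|] := ltP (avg (fun y => g y `^ s)%R i) +oo%E; last first.
  by rewrite leye_eq => /eqP ->; rewrite leey.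
(* Finiteness of the average of [g], from g <= 1 + g ^ s, is needed before the tangent can be taken
   at that average. *)
have gle : (avg g i <= 1 + avg (fun y => g y `^ s)%R i)%E.
  rewrite -(avg_cst i ler01) -avgD//; last by move=> y; rewrite powR_ge0.
  apply: le_avg => //; first exact: measurable_funD.
  move=> y _; rewrite !ger0_norm ?addr_ge0 ?powR_ge0//.
  have [h|h] := leP (g y) 1; first by rewrite (le_trans h)// lerDl powR_ge0.
  by rewrite (le_trans (le1r_powR (ltW h) s1))// lerDr.
have gfin : (avg g i < +oo)%E by rewrite (le_lt_trans gle)// lte_add_pinfty ?ltry.
have [a aE] : exists a, avg g i = a%:E.
  exists (fine (avg g i)); rewrite fineK// ge0_fin_numE ?avg_ge0//.
have [b bE] : exists b, avg (fun y => g y `^ s)%R i = b%:E.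
  exists (fine (avg (fun y => g y `^ s)%R i)); rewrite fineK// ge0_fin_numE ?avg_ge0//.
have a0 : 0 <= a by have := avg_ge0 g i; rewrite aE.
(* The tangent inequality at [a], the average of [g] itself. *)
have : (avg (fun y => s * a `^ (s - 1) * g y)%R i <=
    avg (fun y => g y `^ s + (s - 1) * a `^ s)%R i)%E.
  apply: le_avg; [exact: measurable_funM|exact: measurable_funD|].
  move=> y _; rewrite !ger0_norm ?powR_young ?addr_ge0 ?mulr_ge0 ?powR_ge0//; lra.
rewrite avgZ//; last by rewrite mulr_ge0 ?powR_ge0// ltW.
rewrite avgD// ?avg_cst ?aE ?bE ?poweR_EFin.
- rewrite -EFinM -EFinD !lee_fin -mulrA [_ * a]mulrC mulr_powRB1//; lra.
- by rewrite mulr_ge0 ?powR_ge0//; lra.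
- by move=> y; rewrite powR_ge0.
- by move=> y; rewrite mulr_ge0 ?powR_ge0//; lra.
Qed.

End avg_theory.

Section variable_maximal.
Context {R : realType} {n : nat}.
Let mu := @lebesgue_rV R n.
Local Notation qball := (@qball R n).
Local Notation rad i := (@qradius R n i).

(** The power [2 * n] makes this integrable (it is below [weight]), and the base is the one inside
    the logarithm of the decay condition: a number t above [tailw y] has - ln t at most [2 * n]
    times that logarithm. *)
Definition tailw (y : 'rV[R]_n) : R := ((expR 1 + enorm y) ^+ (2 * n))^-1.

Lemma expR1_ge1 : 1 <= expR 1 :> R.
Proof. by have := expR_ge1Dx (1 : R); lra. Qed.

Lemma tail_base_ge1 (y : 'rV[R]_n) : 1 <= expR 1 + enorm y.
Proof. by have := expR1_ge1; have := enorm_ge0 y; lra. Qed.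

Lemma tailw_gt0 y : 0 < tailw y.
Proof.
by rewrite invr_gt0 exprn_gt0// (lt_le_trans ltr01)// tail_base_ge1.
Qed.

Lemma tailw_le1 y : tailw y <= 1.
Proof.
rewrite invf_le1 ?exprn_ege1 ?tail_base_ge1//.
by rewrite exprn_gt0// (lt_le_trans ltr01)// tail_base_ge1.
Qed.

Lemma tailw_le_weight y : tailw y <= weight y.
Proof.
rewrite /tailw /weight prodfV lef_pV2 ?posrE; last 2 first.
- by rewrite exprn_gt0// (lt_le_trans ltr01)// tail_base_ge1.
- by apply: prodr_gt0 => i _; rewrite /oneDsqr ltr_pwDl// sqr_ge0.
rewrite exprM -[X in _ ^+ X](card_ord n) -prodr_const.
apply: ler_prod => i _; rewrite /oneDsqr addr_ge0 ?sqr_ge0//=.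
rewrite -real_normK ?num_real//.
have := coord_le_enorm y i; have := @expR1_ge1; have := normr_ge0 (y 0 i).
by nra.
Qed.

Lemma measurable_tailw : measurable_fun setT tailw.
Proof.
rewrite (_ : tailw = (fun y => expR (- (ln (expR 1 + enorm y) *+ (2 * n))))).
  apply: measurable_expf; apply: measurableT_comp => //.
  rewrite (_ : (fun y => _) = fun y => (2 * n)%:R * ln (expR 1 + enorm y)).
    apply: measurable_funM => //; apply: measurableT_comp => //.
    by apply: measurable_funD => //; apply: measurable_enorm; exact: measurable_id.
  by apply/funext => y; rewrite mulr_natl.
apply/funext => y; rewrite expRN -lnXn ?lnK ?posrE ?exprn_gt0//;
  by rewrite (lt_le_trans ltr01)// tail_base_ge1.
Qed.

(* [r]: an exponent bounded by [Q]; the two last hypotheses are local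
   log-Hölder continuity and log-Hölder decay without the limit value *)
Variables (r : 'rV[R]_n -> R) (Q c1 c2 : R).
Hypothesis mr : measurable_fun setT r.
Hypothesis r1 : forall x, 1 <= r x.
Hypothesis rQ : forall x, r x <= Q.
Hypothesis c10 : 0 < c1.
Hypothesis c20 : 0 < c2.
Hypothesis rloc : forall x y, 0 < enorm (x - y) -> enorm (x - y) < 2^-1 ->
  `|r x - r y| <= c1 / ln (expR 1 + 1 / enorm (x - y)).
Hypothesis rinf : forall x y, `|r x - r y| <=
  c2 / ln (expR 1 + enorm x) + c2 / ln (expR 1 + enorm y).

Let r0 x : 0 < r x. Proof. exact: lt_le_trans (r1 x). Qed.

Let lnE (t : R) : 0 <= t -> 1 <= ln (expR 1 + t).
Proof.
move=> t0; rewrite -[leLHS](expRK (1 : R)) ler_ln ?posrE ?expR_gt0 ?lerDl//.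
by rewrite ltr_pwDl ?expR_gt0.
Qed.

(** On a small ball of diameter at most d the exponent oscillates by at most c1 / ln (e + 1 / d),
    which turns a power of the inverse volume into a constant. On a large ball the inverse volume is
    bounded and [rB = 1] will do. *)
Let lower_exponent : exists2 K : R, 1 <= K & forall i x, qball i x -> exists rB,
  [/\ 1 <= rB, rB <= r x, (forall y, qball i y -> rB <= r y) &
      (Num.max 1 ((2 * rad i) ^+ n)^-1) `^ (r x - rB) <= K].
Proof.
pose N : R := n.+1%:R.
have N1 : 1 <= N by rewrite ler1n.
have N0 : 0 < N by exact: lt_le_trans N1.
have Q1 : 1 <= Q by exact: le_trans (r1 0) (rQ 0).
pose KA : R := ((2 * N) ^+ n) `^ Q.
pose KB : R := (N ^+ n) `^ c1 * expR (n%:R * c1).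
have KA1 : 1 <= KA.
  rewrite -[leLHS](powRr0 ((2 * N) ^+ n)); apply: ler_powR; last lra.
  by rewrite exprn_ege1//; lra.
have KB1 : 1 <= KB.
  rewrite /KB -[leLHS]mulr1 ler_pM//.
    by rewrite -[leLHS](powRr0 (N ^+ n)) ler_powR ?(ltW c10)// exprn_ege1.
  by rewrite -[leLHS]expR0 ler_expR mulr_ge0// ltW.
exists (Num.max KA KB); first by rewrite le_max KA1.
move=> i x ix; have q0 := @qradius_gt0 R n i.
pose d : R := N * (2 * rad i).
have d0 : 0 < d by rewrite !mulr_gt0.
have dist x' y' : qball i x' -> qball i y' -> enorm (x' - y') <= d.
  move=> a b; rewrite (le_trans (enorm_ball_lt a b))// ler_wpM2r ?mulr_ge0 ?(ltW q0)//.
  by rewrite ler_nat.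
have vol : ((2 * rad i) ^+ n)^-1 = (N / d) ^+ n.
  by rewrite -exprVn; congr (_ ^+ _); rewrite /d; field; rewrite !gt_eqF.
have [dh|dh] := ltP d 2^-1; last first.
  exists 1; split => //; rewrite le_max; apply/orP; left.
  have b1 : Num.max 1 ((2 * rad i) ^+ n)^-1 <= (2 * N) ^+ n.
    rewrite ge_max exprn_ege1 ?vol/=; last lra.
    apply: lerXn2r; rewrite ?nnegrE ?divr_ge0 ?(ltW N0) ?(ltW d0) ?mulr_ge0 ?(ltW N0)//.
    by rewrite ler_pdivrMr//; nra.
  apply: (@le_trans _ _ (((2 * N) ^+ n) `^ (r x - 1))).
    apply: ge0_ler_powR => //; rewrite ?nnegrE ?le_max ?ler01//.
      by rewrite subr_ge0.
    by rewrite exprn_ge0//; lra.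
  apply: ler_powR; first by rewrite exprn_ege1//; lra.
  by have := rQ x; lra.
pose om : R := c1 / ln (expR 1 + 1 / d).
have l1 : 1 <= ln (expR 1 + 1 / d) by apply: lnE; rewrite divr_ge0// ltW.
have l0 : 0 < ln (expR 1 + 1 / d) by exact: lt_le_trans l1.
have om0 : 0 <= om by rewrite divr_ge0 ?(ltW c10)// ltW.
have omc : om <= c1 by rewrite ler_pdivrMr// ler_peMr// ltW.
have osc y : qball i y -> r x - om <= r y.
  move=> iy; have exy := dist _ _ ix iy.
  have [e0|e0] := eqVneq (enorm (x - y)) 0.
    have -> : y = x; last by lra.
    apply/rowP => j; apply/eqP; rewrite eq_sym -subr_eq0 -normr_le0.
    by have := coord_le_enorm (x - y) j; rewrite e0 !mxE.
  have ep : 0 < enorm (x - y) by rewrite lt_neqAle eq_sym e0 enorm_ge0.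
  have := rloc ep (le_lt_trans exy dh).
  have : c1 / ln (expR 1 + 1 / enorm (x - y)) <= om.
    rewrite ler_wpM2l ?(ltW c10)// lef_pV2 ?posrE//; last first.
      by apply: lt_le_trans (lnE _) => //; rewrite divr_ge0// ltW.
    rewrite ler_ln ?posrE; [|by rewrite ltr_pwDl ?expR_gt0 ?divr_ge0// ltW..].
    by rewrite lerD2l !div1r lef_pV2.
  by move=> h1 h2; have := le_trans h2 h1; rewrite ler_norml => /andP[_]; lra.
exists (Num.max 1 (r x - om)); split.
- by rewrite le_max lexx.
- by rewrite ge_max r1/=; lra.
- by move=> y iy; rewrite ge_max r1/= osc.
rewrite le_max; apply/orP; right.
have ex0 : 0 <= r x - Num.max 1 (r x - om) <= om.
  have := r1 x; case: (leP 1 (r x - om)) => ?; rewrite ?max_r ?max_l//; lra.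
case/andP: ex0 => ex0 exom.
have g1 : 1 <= N * (expR 1 + 1 / d).
  have := @expR1_ge1; have : 0 < 1 / d by rewrite divr_gt0.
  by nra.
apply: (@le_trans _ _ (((N * (expR 1 + 1 / d)) ^+ n) `^ om)).
  apply: (@le_trans _ _ (((N * (expR 1 + 1 / d)) ^+ n) `^ (r x - Num.max 1 (r x - om)))).
    apply: ge0_ler_powR => //; rewrite ?nnegrE ?le_max ?ler01//.
      by rewrite exprn_ge0//; lra.
    rewrite ge_max exprn_ege1//= vol.
    apply: lerXn2r; rewrite ?nnegrE ?divr_ge0 ?(ltW N0) ?(ltW d0)//; first lra.
    by rewrite ler_pM2l// div1r lerDr expR_ge0.
  by rewrite ler_powR// exprn_ege1.
have e0 : 0 < expR 1 + 1 / d by rewrite addr_gt0 ?expR_gt0// divr_gt0.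
rewrite exprMn powRM ?exprn_ge0 ?(ltW N0) ?(ltW e0)// /KB ler_pM ?powR_ge0//.
  by rewrite ler_powR// exprn_ege1.
rewrite -powR_mulrn ?(ltW e0)// -powRrM /powR gt_eqF// ler_expR -mulrA /om.
by rewrite mulfVK// gt_eqF.
Qed.

(** Only [r x < r y] needs an argument. Let b be the base of [tailw] at whichever of [x], [y] is
    nearer the origin. If [t] is below that tail, the tail itself bounds the left side. Otherwise -
    ln t is at most [2 * n] times ln b, while the exponents differ by at most [2 * c2 / ln b], so
    the ratio of the two powers is bounded. *)
Let small_exponent : exists2 K : R, 1 <= K & forall (t : R) x y, 0 <= t -> t < 1 ->
  t `^ (r x) <= K * t `^ (r y) + (tailw x + tailw y).
Proof.
exists (expR ((2 * n)%:R * (2 * c2))).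
  by rewrite -[leLHS]expR0 ler_expR !mulr_ge0// ltW.
move=> t x y; rewrite le_eqVlt => /predU1P[<-|t0] t1.
  have tx := tailw_gt0 x; have ty := tailw_gt0 y.
  by rewrite !powR0 ?gt_eqF// mulr0 add0r; lra.
have tx := tailw_gt0 x; have ty := tailw_gt0 y.
have [ryx|rxy] := leP (r y) (r x).
  apply: (@le_trans _ _ (t `^ r y)); first by rewrite ger_powR// t0 ltW.
  rewrite (@le_trans _ _ (expR ((2 * n)%:R * (2 * c2)) * t `^ r y))//; last lra.
  rewrite ler_peMl ?powR_ge0// -[leLHS]expR0 ler_expR !mulr_ge0// ltW//.
pose z := Num.min (enorm x) (enorm y).
have z0 : 0 <= z by rewrite le_min !enorm_ge0.
pose b : R := expR 1 + z.
have b1 : 1 <= b by have := @expR1_ge1; rewrite /b; lra.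
have b0 : 0 < b by exact: lt_le_trans b1.
have lb := lnE z0; have lb0 : 0 < ln b by exact: lt_le_trans lb.
have [tb|tb] := ltP t (b ^+ (2 * n))^-1.
  apply: (@le_trans _ _ (b ^+ (2 * n))^-1).
    by rewrite (le_trans _ (ltW tb))// ge1r_powR// t0 ltW.
  apply: (@le_trans _ _ (tailw x + tailw y)); last first.
    by rewrite lerDr mulr_ge0 ?powR_ge0// expR_ge0.
  rewrite /b /z; case: (leP (enorm x) (enorm y)) => h; rewrite -/(tailw _); lra.
have dif : r y - r x <= 2 * c2 / ln b.
  have := rinf y x; rewrite ler_norml => /andP[_ h]; apply: (le_trans h).
  have mono u : z <= u -> c2 / ln (expR 1 + u) <= c2 / ln b.
    move=> zu; have u0 : 0 <= u by exact: le_trans zu.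
    rewrite ler_wpM2l ?(ltW c20)// lef_pV2 ?posrE//; last exact: lt_le_trans (lnE u0).
    by rewrite ler_ln ?posrE ?lerD2l// ltr_pwDl ?expR_gt0.
  have := mono _ (_ : z <= enorm y); have := mono _ (_ : z <= enorm x).
  rewrite /z !ge_min !lexx orbT => /(_ isT) h1 /(_ isT) h2.
  have -> : 2 * c2 / ln b = c2 / ln b + c2 / ln b by ring.
  exact: lerD.
apply: (@le_trans _ _ (expR ((2 * n)%:R * (2 * c2)) * t `^ r y)); last lra.
have -> : t `^ r x = t `^ (- (r y - r x)) * t `^ r y.
  by rewrite -powRD ?(gt_eqF t0) ?implybT//; congr (_ `^ _); ring.
rewrite ler_wpM2r ?powR_ge0// powRN /powR gt_eqF// -expRN ler_expR.
have lnt : - ln t <= (2 * n)%:R * ln b.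
  rewrite -lnV ?posrE// mulr_natl -lnXn// ler_ln ?posrE ?invr_gt0 ?exprn_gt0//.
  by rewrite -[leRHS]invrK lef_pV2 ?posrE ?invr_gt0 ?exprn_gt0.
have lnt0 : 0 <= - ln t by rewrite oppr_ge0 ln_le0// ltW.
rewrite -mulrN; apply: (@le_trans _ _ ((2 * c2 / ln b) * ((2 * n)%:R * ln b))).
  by rewrite ler_pM// subr_ge0 ltW.
by rewrite le_eqVlt; apply/orP; left; apply/eqP; field; rewrite gt_eqF.
Qed.

Let maxr_powR (a rx rB K m' : R) : 0 <= a -> a <= m' -> rB <= rx ->
  (Num.max 1 m') `^ (rx - rB) <= K -> 1 <= rB -> a `^ rx <= K * a `^ rB.
Proof.
move=> a0 am h hK rB1; move: a0; rewrite le_eqVlt => /predU1P[<-|a0].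
  by rewrite !powR0 ?mulr0// gt_eqF//; lra.
have -> : a `^ rx = a `^ (rx - rB) * a `^ rB.
  by rewrite -powRD ?subrK// (gt_eqF a0) implybT.
rewrite ler_wpM2r ?powR_ge0// (le_trans _ hK)// ge0_ler_powR ?subr_ge0// ?nnegrE ?(ltW a0)//.
  by rewrite le_max ler01.
by rewrite le_max am orbT.
Qed.

Let Q1 : 1 <= Q. Proof. exact: le_trans (r1 0) (rQ 0). Qed.

(** Values of [h] at least 1 and below 1 are treated separately. The first have averages at most the
    inverse volume, since their modular is at most 1, so [lower_exponent] and Jensen with the
    exponent [rB] apply; the second go through Jensen with exponent [r x] and [small_exponent]. Only
    the factor [r] of the exponent is spent: [q0 > 1] is kept for the strong bound. *)
Lemma maximal_poweR_le (q0 : R) : 1 < q0 -> exists2 K : R, 0 < K &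
  forall h : 'rV[R]_n -> R, measurable_fun setT h -> (forall y, 0 <= h y) ->
  (\int[mu]_y (h y `^ (q0 * r y))%:E <= 1)%E -> forall x,
  (poweR (maximal h x) (r x) <=
    K%:E * (maximal (fun y => h y `^ r y + tailw y)%R x + (tailw x)%:E))%E.
Proof.
move=> q01; have [K1 K11 lowK] := lower_exponent.
have [K2 K21 smallK] := small_exponent.
have K1p : 0 < K1 by lra.
have K2p : 0 < K2 by lra.
have twoQ : 0 < (2 : R) `^ Q by rewrite powR_gt0.
exists (2 `^ Q * (K1 + K2)); first by rewrite mulr_gt0//; lra.
move=> h mh h0 hle x.
pose W := fun y => h y `^ r y + tailw y.
have mhr : measurable_fun setT (fun y => h y `^ r y).
  by apply: measurable_powR_fun => // y; rewrite gt_eqF.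
have mW : measurable_fun setT W by apply: measurable_funD => //; exact: measurable_tailw.
have hr0 y : 0 <= h y `^ r y by exact: powR_ge0.
have tw0 y := ltW (tailw_gt0 y).
have W0 y : 0 <= W y by rewrite addr_ge0.
pose f1 y := (1 <= h y)%R%:R * h y; pose f2 y := (h y < 1)%R%:R * h y.
have mf2 : measurable_fun setT f2 by apply: measurable_funM => //; exact: measurable_ltr_ind.
have hf y : h y = f1 y + f2 y.
  by rewrite /f1 /f2 -mulrDl; case: leP => _; rewrite ?addr0 ?add0r mul1r.
have mf1 : measurable_fun setT f1.
  rewrite (_ : f1 = (fun y => h y - f2 y)); first exact: measurable_funB.
  by apply/funext => y; rewrite hf addrK.
have f10 y : 0 <= f1 y by rewrite mulr_ge0.
have f20 y : 0 <= f2 y by rewrite mulr_ge0.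
have q00 : 0 < q0 by lra.
have f1le y : f1 y <= h y `^ (q0 * r y).
  rewrite /f1; case: (leP 1 (h y)) => h1; last by rewrite mul0r powR_ge0.
  rewrite mul1r; apply: le1r_powR => //; have := r1 y; nra.
have f2lt y : f2 y < 1 by rewrite /f2; case: (ltP (h y) 1) => h1; rewrite ?mul1r ?mul0r.
have mhq : measurable_fun setT (fun y => h y `^ (q0 * r y)).
  apply: measurable_powR_fun => //; last exact: measurable_funM.
  by move=> y; rewrite gt_eqF// mulr_gt0.
(* [maximal_le] bounds a supremum of averages, not of their powers, so the bound for one ball is
   pulled back through the exponent [(r x)^-1]. *)
suff key i : qball i x ->
    (poweR (avg h i) (r x) <= (2 `^ Q * (K1 + K2))%:E * (maximal W x + (tailw x)%:E))%E.
  set RHS := (X in (_ <= X)%E).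
  have RHS0 : (0 <= RHS)%E.
    by rewrite mule_ge0 ?adde_ge0 ?maximal_ge0 ?lee_fin// mulr_ge0 ?powR_ge0//; lra.
  have maxle : (maximal h x <= poweR RHS (r x)^-1)%E.
    apply: maximal_le => [|i ix]; first exact: poweR_ge0.
    have -> : avg h i = poweR (poweR (avg h i) (r x)) (r x)^-1.
      by rewrite -poweRrM divff ?gt_eqF// poweRe1// avg_ge0.
    apply: gt0_ler_poweR; rewrite ?invr_ge0 ?(ltW (r0 x))// ?in_itv/= ?poweR_ge0 ?RHS0 ?leey//.
    exact: key.
  apply: (@le_trans _ _ (poweR (poweR RHS (r x)^-1) (r x))).
    apply: gt0_ler_poweR; rewrite ?(ltW (r0 x))// ?in_itv/= ?poweR_ge0 ?maximal_ge0 ?leey//.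
  by rewrite -poweRrM mulVf ?gt_eqF// poweRe1.
move=> ix.
have [rB [rB1 rBx rBy hK]] := lowK i x ix.
have mi0 := @qvol_gt0 R n i.
have avgf1 : (avg f1 i <= ((2 * rad i) ^+ n)^-1%:E)%E.
  rewrite /avg -[leRHS]mule1; apply: lee_wpmul2l; first by rewrite lee_fin invr_ge0 ltW.
  apply: (le_trans _ hle); apply: (@le_trans _ _ (\int[mu]_(y in qball i) (h y `^ (q0 * r y))%:E)%E).
    apply: ge0_le_integral => //.
    - exact: measurable_qball.
    - apply/measurable_EFinP; apply: measurableT_comp => //; exact: measurable_funTS.
    - by apply/measurable_EFinP; exact: measurable_funTS.
    - by move=> y _; rewrite lee_fin ger0_norm.
  apply: ge0_subset_integral => //; first exact: measurable_qball.
    exact/measurable_EFinP.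
  by move=> y _; rewrite lee_fin powR_ge0.
have avgf2 : (avg f2 i <= 1)%E.
  rewrite -(avg_cst (n := n) i (@ler01 R)); apply: le_avg => // y _.
  by rewrite !ger0_norm// ltW.
have [a aE] : exists a, avg f1 i = a%:E.
  by exists (fine (avg f1 i)); rewrite fineK// ge0_fin_numE ?avg_ge0// (le_lt_trans avgf1) ?ltry.
have [b bE] : exists b, avg f2 i = b%:E.
  by exists (fine (avg f2 i)); rewrite fineK// ge0_fin_numE ?avg_ge0// (le_lt_trans avgf2) ?ltry.
have a0 : 0 <= a by have := avg_ge0 f1 i; rewrite aE.
have b0 : 0 <= b by have := avg_ge0 f2 i; rewrite bE.
have am : a <= ((2 * rad i) ^+ n)^-1 by move: avgf1; rewrite aE lee_fin.
have arx := maxr_powR a0 am rBx hK rB1.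
have mH s : measurable_fun setT (fun y => f1 y `^ s).
  exact: (measurableT_comp (measurable_powR s)).
have mH2 s : measurable_fun setT (fun y => f2 y `^ s).
  exact: (measurableT_comp (measurable_powR s)).
have hrW : (avg (fun y => h y `^ r y)%R i <= avg W i)%E.
  by apply: le_avg => // y _; rewrite !ger0_norm// lerDl.
have aW : ((a `^ r x)%:E <= K1%:E * avg W i)%E.
  apply: (@le_trans _ _ (K1%:E * (a `^ rB)%:E)%E); first by rewrite -EFinM lee_fin.
  apply: lee_wpmul2l; first by rewrite lee_fin ltW.
  apply: (le_trans _ hrW); rewrite -poweR_EFin -aE.
  apply: (le_trans (avg_jensen i rB1 mf1 f10)).
  apply: le_avg => // y iy; rewrite !ger0_norm ?powR_ge0//.
  rewrite /f1; case: (leP 1 (h y)) => h1; first by rewrite mul1r ler_powR// rBy.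
  by rewrite mul0r powR0 ?gt_eqF ?powR_ge0//; lra.
have bW : ((b `^ r x)%:E <= K2%:E * (avg W i + (tailw x)%:E))%E.
  rewrite -poweR_EFin -bE; apply: (le_trans (avg_jensen i (r1 x) mf2 f20)).
  rewrite -(avg_cst (n := n) i (tw0 x)) -avgD// -avgZ ?(ltW K2p)//; last exact: measurable_funD.
  apply: le_avg => //; first by apply: measurable_funM => //; exact: measurable_funD.
  move=> y _; rewrite !ger0_norm ?powR_ge0 ?mulr_ge0 ?addr_ge0 ?(ltW K2p)//.
  have := smallK (f2 y) x y (f20 y) (f2lt y).
  have : f2 y `^ r y <= h y `^ r y.
    by rewrite ge0_ler_powR ?(ltW (r0 y)) ?nnegrE// /f2; case: (ltP (h y) 1) => _; rewrite ?mul1r ?mul0r.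
  have := tailw_gt0 x; have := tailw_gt0 y; rewrite /W.
  have := hr0 y; nra.
have Wx := avg_le_maximal W ix.
have -> : avg h i = (a + b)%:E.
  by rewrite (_ : h = (fun y => f1 y + f2 y)) ?avgD ?aE ?bE//; apply/funext.
rewrite poweR_EFin.
have ab : (a + b) `^ r x <= 2 `^ Q * (a `^ r x + b `^ r x).
  rewrite (le_trans (powRD_le a0 b0 (ltW (r0 x))))// ler_wpM2r ?addr_ge0 ?powR_ge0//.
  by rewrite ler_powR// ler1n.
apply: (@le_trans _ _ (2 `^ Q * (a `^ r x + b `^ r x))%:E); first by rewrite lee_fin.
rewrite EFinM [in leRHS]EFinM -muleA; apply: lee_wpmul2l; first by rewrite lee_fin ltW.
rewrite EFinD [in leRHS]EFinD ge0_muleDl ?lee_fin ?(ltW K1p) ?(ltW K2p)//.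
apply: leeD; [apply: (le_trans aW)|apply: (le_trans bW)]; apply: lee_wpmul2l;
  rewrite ?lee_fin ?(ltW K1p) ?(ltW K2p)//.
- by rewrite (le_trans Wx)// leeDl// lee_fin.
- exact: leeD2r.
Qed.

(** The pointwise bound is raised to the constant power [q0]: the classical strong bound then
    applies to h ^ r plus [tailw], whose [q0]-th power has bounded integral. *)
Lemma variable_maximal (q0 : R) : 1 < q0 -> exists2 K : R, 0 < K &
  forall h : 'rV[R]_n -> R, measurable_fun setT h -> (forall y, 0 <= h y) ->
  (\int[mu]_y (h y `^ (q0 * r y))%:E <= 1)%E ->
  (\int[mu]_x poweR (maximal h x) (q0 * r x) <= K%:E)%E.
Proof.
move=> q01; have [K K0 keyK] := maximal_poweR_le q01.
have [C C0 strong] := maximal_strong (n := n) q01.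
have q00 : 0 < q0 by lra.
pose P : R := pi ^+ n.
have P0 : 0 <= P by rewrite exprn_ge0// pi_ge0.
have cp (a : R) : 0 <= a `^ q0 by exact: powR_ge0.
exists (K `^ q0 * (2 `^ q0 * (C * (2 `^ q0 * (1 + P)) + P)) + 1).
  by rewrite ltr_wpDl// !mulr_ge0// addr_ge0// !mulr_ge0 ?(ltW C0)// addr_ge0.
move=> h mh h0 hle.
have := keyK h mh h0 hle.
set W := (X in forall x, (_ <= _ * (maximal X x + _))%E) => key.
have mhr : measurable_fun setT (fun y => h y `^ r y).
  by apply: measurable_powR_fun => // y; rewrite gt_eqF.
have mW : measurable_fun setT W by apply: measurable_funD => //; exact: measurable_tailw.
have tw0 y := ltW (tailw_gt0 y).
have tailint : (\int[mu]_x (tailw x `^ q0)%:E <= P%:E)%E.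
  rewrite -integral_weight; apply: ge0_le_integral => //.
  - by move=> x _; rewrite lee_fin powR_ge0.
  - apply/measurable_EFinP; apply: (measurableT_comp (measurable_powR q0)).
    exact: measurable_tailw.
  - by apply/measurable_EFinP; exact: measurable_weight.
  - move=> x _; rewrite lee_fin (le_trans _ (tailw_le_weight x))// ge1r_powR ?(ltW q01)//.
    by rewrite tailw_gt0 tailw_le1.
have Wint : (\int[mu]_x (`|W x| `^ q0)%:E <= (2 `^ q0 * (1 + P))%:E)%E.
  apply: (@le_trans _ _ (\int[mu]_x ((2 `^ q0)%:E *
      ((h x `^ (q0 * r x))%:E + (tailw x `^ q0)%:E)))%E).
    apply: ge0_le_integral => //.
    - apply/measurable_EFinP; apply: (measurableT_comp (measurable_powR q0)).
      exact: measurableT_comp.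
    - apply: emeasurable_funM => //; apply: emeasurable_funD.
        apply/measurable_EFinP; apply: measurable_powR_fun => //; last exact: measurable_funM.
        by move=> y; rewrite gt_eqF// mulr_gt0.
      apply/measurable_EFinP; apply: (measurableT_comp (measurable_powR q0)).
      exact: measurable_tailw.
    - move=> x _; rewrite -EFinD -EFinM lee_fin [q0 * r x]mulrC powRrM ger0_norm ?addr_ge0 ?powR_ge0//.
      exact: powRD_le (powR_ge0 _ _) (tw0 x) (ltW q00).
  have mhq : measurable_fun setT (fun y => (h y `^ (q0 * r y))%:E).
    apply/measurable_EFinP; apply: measurable_powR_fun => //; last exact: measurable_funM.
    by move=> y; rewrite gt_eqF// mulr_gt0.
  have mtq : measurable_fun setT (fun y => (tailw y `^ q0)%:E).
    apply/measurable_EFinP; apply: (measurableT_comp (measurable_powR q0)).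
    exact: measurable_tailw.
  rewrite ge0_integralZl//; last 2 first.
    by apply: emeasurable_funD.
    by move=> x _; rewrite adde_ge0// lee_fin powR_ge0.
  rewrite ge0_integralD//; try by move=> x _; rewrite lee_fin powR_ge0.
  rewrite [leRHS]EFinM; apply: lee_wpmul2l; first by rewrite lee_fin.
  by rewrite EFinD leeD.
have maxint : (\int[mu]_x poweR (maximal W x) q0 <= (C * (2 `^ q0 * (1 + P)))%:E)%E.
  apply: (le_trans (strong W mW)); rewrite [leRHS]EFinM.
  by apply: lee_wpmul2l; [rewrite lee_fin ltW|exact: Wint].
have mM := @measurable_maximal R n W.
have mpM : measurable_fun setT (fun x => poweR (maximal W x) q0).
  exact: (measurableT_comp (measurable_poweR q0)).
have mtq : measurable_fun setT (fun y => (tailw y `^ q0)%:E).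
  apply/measurable_EFinP; apply: (measurableT_comp (measurable_powR q0)).
  exact: measurable_tailw.
apply: (@le_trans _ _ (\int[mu]_x ((K `^ q0)%:E * ((2 `^ q0)%:E *
    (poweR (maximal W x) q0 + (tailw x `^ q0)%:E))))%E).
  have m1 : measurable_fun setT (fun x => (poweR (maximal W x) q0 + (tailw x `^ q0)%:E)%E).
    exact: emeasurable_funD.
  apply: ge0_le_integral => //.
  - by move=> x _; exact: poweR_ge0.
  - by apply: measurable_poweR_fun => //; [exact: maximal_ge0|move=> x; rewrite mulr_gt0|exact: measurable_maximal|exact: measurable_funM].
  - by apply: emeasurable_funM => //; exact: emeasurable_funM.
  move=> x _; rewrite mulrC poweRrM.
  apply: (@le_trans _ _ (poweR (K%:E * (maximal W x + (tailw x)%:E)) q0)).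
    apply: gt0_ler_poweR; rewrite ?(ltW q00)// ?in_itv/= ?poweR_ge0 ?leey//.
    by rewrite mule_ge0 ?adde_ge0 ?maximal_ge0 ?lee_fin// ltW.
  rewrite poweRM ?adde_ge0 ?maximal_ge0 ?lee_fin ?(ltW K0)// poweR_EFin.
  apply: lee_wpmul2l; first by rewrite lee_fin.
  have := maximal_ge0 W x; case: (maximal W x) => [b| |] //; rewrite ?lee_fin => b0.
    by apply: powRD_le => //; exact: ltW.
  by rewrite addye// poweRyr ?gt_eqF// addye// gt0_muley ?leey// lte_fin powR_gt0.
rewrite ge0_integralZl//; try by [rewrite lee_fin
  |move=> x _; rewrite mule_ge0 ?lee_fin// adde_ge0 ?poweR_ge0// lee_fin
  |apply: emeasurable_funM => //; exact: emeasurable_funD].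
rewrite ge0_integralZl//; try by [rewrite lee_fin|exact: emeasurable_funD
  |move=> x _; rewrite adde_ge0 ?poweR_ge0// lee_fin].
rewrite ge0_integralD//; try by move=> x _; rewrite ?lee_fin ?poweR_ge0.
apply: (@le_trans _ _ (K `^ q0 * (2 `^ q0 * (C * (2 `^ q0 * (1 + P)) + P)))%:E); last first.
  by rewrite lee_fin lerDl.
rewrite !(EFinM (K `^ q0)); apply: lee_wpmul2l; first by rewrite lee_fin.
rewrite [leRHS]EFinM; apply: lee_wpmul2l; first by rewrite lee_fin.
by rewrite EFinD leeD.
Qed.

End variable_maximal.

(** * Frequency pieces of the averages *)

Section shells.
Context {R : realType}.

(** For v >= 1 and 2 ^ k <= v < 2 ^ k.+1: ln (2 ^ k.+1) <= 2 v, and 2 m v <= m^2 + v^2. *)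
Lemma expR_sqr_dyadic (m v : R) : 0 <= m -> 0 <= v -> exists k : nat,
  v < 2 ^+ k /\ expR (- v ^+ 2) <= expR (m ^+ 2) * (2 ^+ k) `^ (- m).
Proof.
move=> m0 v0; have [v1|v1] := ltP v 1.
  exists 0; rewrite expr0; split => //; rewrite powR1 mulr1 ler_expR.
  by rewrite (@le_trans _ _ 0)// ?oppr_le0 sqr_ge0.
have [k /andP[k1 k2]] := ge1_pow2 v1.
exists k.+1; split => //; have p0 : 0 < 2 ^+ k.+1 :> R by rewrite exprn_gt0.
rewrite /powR gt_eqF// -expRD ler_expR.
have lnle : ln (2 ^+ k.+1) <= 2 * v.
  have := ln_sublinear p0; move/ltW => h; rewrite (le_trans h)// exprS ler_pM2l//.
have := ler_wpM2l m0 lnle; have := sqr_ge0 (m - v); nra.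
Qed.

Lemma geometric_series2 : (\sum_(0 <= k <oo) ((2 ^+ k)^-1 : R)%:E <= 2%:E)%E.
Proof.
apply: lime_le; first by apply: is_cvg_nneseries => i _ _; rewrite lee_fin invr_ge0 exprn_ge0.
apply: nearW => k; rewrite sumEFin lee_fin.
have -> : \sum_(0 <= i < k) (2 ^+ i)^-1 = 2 - 2 * (2 ^+ k)^-1 :> R.
  elim: k => [|k IH]; first by rewrite big_geq// expr0 invr1 mulr1 subrr.
  by rewrite big_nat_recr//= IH exprS; field; rewrite gt_eqF// exprn_gt0.
by rewrite gerBl mulr_ge0// invr_ge0 exprn_ge0.
Qed.

Lemma nneseries_term_le (u : nat -> \bar R) k : (forall i, 0 <= u i)%E ->
  (u k <= \sum_(0 <= i <oo) u i)%E.
Proof.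
move=> u0; rewrite (nneseriesD1 (n := k))// leeDl// nneseries_ge0// => i _ _; exact: u0.
Qed.

(** The Gaussian is dominated by indicators of dyadic sublevel sets of [u], with coefficients of
    decay [b + 1], one more than the growth [b]. The measure is left general: [sigma] with its
    dimension bound gives the kernel estimate, and Lebesgue measure weighted by |f| gives the
    comparison with the maximal function. *)
Lemma shell (b : R) : 0 <= b -> exists2 C : R, 0 < C &
  forall d (T : measurableType d) (m : {measure set T -> \bar R}) (u g : T -> R)
    (K : \bar R) (s : R),
  measurable_fun setT u -> measurable_fun setT g -> (forall y, 0 <= u y) ->
  (forall y, 0 <= g y) -> (0 <= K)%E -> 0 < s ->
  (forall r : R, 0 < r -> (\int[m]_(y in [set y | (u y < r)%R]) (g y)%:E <= (r `^ b)%:E * K)%E) ->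
  (\int[m]_y (g y * expR (- (u y / s) ^+ 2))%:E <= (C * s `^ b)%:E * K)%E.
Proof.
move=> b0; pose A : R := expR ((b + 1) ^+ 2); have A0 : 0 < A by exact: expR_gt0.
exists (2 * A); first by rewrite mulr_gt0.
move=> d T m u g K s mu_ mg u0 g0 K0 s0 hK.
case: K K0 hK => [K| |]// K0 hK; last first.
  by rewrite gt0_muley ?leey// lte_fin !mulr_gt0// powR_gt0.
have mset (r : R) : measurable [set y | u y < r].
  rewrite (_ : mkset _ = u @^-1` `]-oo, r[%classic); last first.
    by apply/seteqP; split => y; rewrite /= in_itv.
  by rewrite -[X in measurable X]setTI; exact: mu_.
pose F k y : \bar R := ((A * (2 ^+ k) `^ (- (b + 1)))%:E *
  ((g y)%:E * (\1_[set y | (u y < 2 ^+ k * s)%R] y)%:E))%E.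
have cf0 k : 0 <= A * (2 ^+ k) `^ (- (b + 1)) by rewrite mulr_ge0 ?powR_ge0 ?ltW.
have F0 k y : (0 <= F k y)%E by rewrite !mule_ge0// lee_fin.
have mg1 k : measurable_fun setT
    (fun y => ((g y)%:E * (\1_[set y | (u y < 2 ^+ k * s)%R] y)%:E)%E).
  apply: emeasurable_funM; first exact/measurable_EFinP.
  by apply/measurable_EFinP; apply: measurable_indic.
have mF k : measurable_fun setT (F k) by exact: emeasurable_funM.
apply: (@le_trans _ _ (\int[m]_y (\sum_(0 <= k <oo) F k y))%E).
  apply: ge0_le_integral => //.
  - by move=> y _; rewrite lee_fin mulr_ge0 ?expR_ge0.
  - apply/measurable_EFinP; apply: measurable_funM => //; apply: measurable_expf.
    apply: measurableT_comp => //; apply: measurable_funX.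
    by apply: measurable_funM.
  - by apply: ge0_emeasurable_sum => // k y _; exact: F0.
  - move=> y _; have [k [vk ek]] := @expR_sqr_dyadic (b + 1) (u y / s) (addr_ge0 b0 ler01)
      (divr_ge0 (u0 y) (ltW s0)).
    apply: (@le_trans _ _ (F k y)).
      rewrite /F indicE mem_set/=; last by rewrite -ltr_pdivrMr.
      by rewrite mule1 -EFinM lee_fin [leRHS]mulrC ler_wpM2l.
    by apply: (nneseries_term_le (u := fun k => F k y)) => i; exact: F0.
rewrite integral_nneseries//.
apply: (@le_trans _ _ (\sum_(0 <= k <oo) ((A * s `^ b * K)%:E * ((2 ^+ k)^-1)%:E))%E).
  apply: lee_nneseries => [k _ _|k _]; first exact: integral_ge0.
  rewrite ge0_integralZl//; try by [rewrite lee_fin|move=> y _; rewrite mule_ge0 ?lee_fin].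
  apply: (@le_trans _ _ ((A * (2 ^+ k) `^ (- (b + 1)))%:E * (((2 ^+ k * s) `^ b)%:E * K%:E))%E).
    apply: lee_wpmul2l; first by rewrite lee_fin.
    apply: le_trans (hK _ _); last by rewrite mulr_gt0 ?exprn_gt0.
    by rewrite [leRHS]integral_mkcond/= epatch_indic.
  have p0 : 0 < 2 ^+ k :> R by rewrite exprn_gt0.
  rewrite -!EFinM lee_fin powRM ?(ltW p0) ?(ltW s0)// le_eqVlt; apply/orP; left; apply/eqP.
  have -> : (2 ^+ k)^-1 = (2 ^+ k) `^ (- (b + 1)) * (2 ^+ k) `^ b :> R.
    rewrite -powRD; last by rewrite (gt_eqF p0) implybT.
    by rewrite opprD addrAC addNr add0r powR_inv1 ?(ltW p0).
  by ring.
rewrite nneseriesZl; last by move=> k _; rewrite lee_fin invr_ge0 exprn_ge0.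
apply: (@le_trans _ _ ((A * s `^ b * K)%:E * 2%:E)%E).
  by apply: lee_wpmul2l; [rewrite lee_fin !mulr_ge0 ?powR_ge0 ?(ltW A0)|exact: geometric_series2].
by rewrite -!EFinM lee_fin le_eqVlt; apply/orP; left; apply/eqP; ring.
Qed.

End shells.

Section bounded_support.
Context {R : realType} {n : nat}.

Lemma le_coord_norm (x : 'rV[R]_n) i : `|x 0 i| <= `|x|.
Proof.
rewrite [leRHS]/Num.norm/= mx_normrE.
exact: (le_bigmax _ (fun ij : 'I_1 * 'I_n => `|x ij.1 ij.2|) (0, i)).
Qed.

Lemma open_measurable_rV (U : set 'rV[R]_n) : open U -> measurable U.
Proof. exact: sub_sigma_algebra. Qed.

Lemma measurable_enorm_gt (M : R) : measurable [set z : 'rV[R]_n | M < enorm z].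
Proof.
rewrite (_ : mkset _ = enorm @^-1` `]M, +oo[%classic); last first.
  by apply/seteqP; split => y; rewrite /= in_itv/= andbT.
by rewrite -[X in measurable X]setTI; apply: measurable_enorm => //; exact: measurable_id.
Qed.

Lemma measurable_eball (x : 'rV[R]_n) (r : R) : measurable (eball x r).
Proof.
rewrite (_ : eball x r = (fun y => enorm (y - x)) @^-1` `]-oo, r[%classic); last first.
  by apply/seteqP; split => y; rewrite /= in_itv.
rewrite -[X in measurable X]setTI; apply: measurable_enorm => //; meas.
Qed.

(** Each point off the support lies in a null ball of the countable family, so the far region is
    null. The factor [n.+1] passes from the sup norm, in which compactness bounds the support, to
    the Euclidean norm. *)
Lemma compact_support_bounded (sigma : {measure set 'rV[R]_n -> \bar R}) :
  compactly_supported sigma -> exists2 M : R, 0 < M &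
  sigma [set z | M < enorm z] = 0%E.
Proof.
move=> /compact_bounded[M0 [_ bM]].
pose M : R := `|M0| + 1; have M1 : 0 < M by rewrite ltr_wpDl.
have {}bM x : measure_support sigma x -> `|x| <= M.
  by apply: bM; rewrite /M (le_lt_trans (ler_norm M0))// ltrDl.
exists (n.+1%:R * M); first by rewrite mulr_gt0.
pose P i := sigma (@qball R n i) == 0%E.
apply/eqP; rewrite eq_le measure_ge0 andbT.
have mb i : measurable (if P i then @qball R n i else set0).
  by case: ifP => // _; exact: measurable_qball.
have m1 := measurable_enorm_gt (n.+1%:R * M).
apply: (@le_trans _ _ (\sum_(0 <= i <oo) sigma (if P i then @qball R n i else set0))%E).
  apply: measure_sigma_subadditive => // z /= zM.
  have : ~ measure_support sigma z.
    move=> /bM zb; move: zM; rewrite ltNge => /negP; apply.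
    rewrite (le_trans (enorm_le_sum z))//.
    apply: (@le_trans _ _ (\sum_(i < n) M)).
      by apply: ler_sum => i _; rewrite (le_trans _ zb)// le_coord_norm.
    by rewrite sumr_const card_ord -[leLHS]mulr_natl ler_pM2r// ler_nat.
  rewrite /measure_support /=; move/existsNP => [U /not_implyP[oU /not_implyP[Uz]]].
  move=> /negP; rewrite -leNgt => sU.
  have /nbhs_ballP[e /= e0 eU] : nbhs z U by exact: open_nbhs_nbhs.
  have e8 : 0 < e / 16 by rewrite divr_gt0.
  have [i [_ zi ri]] := qball_cover z e8.
  have iU : @qball R n i `<=` U.
    move=> y iy; apply: eU; have h : ball z (@qradius R n i + @qradius R n i) y.
      exact: (ball_triangle (ball_sym zi) iy).
    by apply: (le_ball _ h); lra.
  exists i => //; have -> : P i; last by [].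
  rewrite /P eq_le measure_ge0 andbT (le_trans _ sU)//.
  by apply: le_measure; rewrite ?inE//; [exact: measurable_qball|exact: open_measurable_rV].
rewrite eseries0// => i _ _; case: ifP => [/eqP//|_]; exact: measure0.
Qed.

End bounded_support.

(** * Mollified dilates of the measure *)

Section kernel.
Context {R : realType} {n : nat}.
Variable sigma : {finite_measure set 'rV[R]_n -> \bar R}.
Let mu := @lebesgue_rV R n.

(** The dilate of [sigma] by [t] convolved with the Gaussian of mass 1 whose Fourier transform is
    [gauss s]. *)
Definition kern (s t : R) (w : 'rV[R]_n) : R :=
  \int[sigma]_z (s ^- n * gauss s^-1 (w - t *: z)).

Lemma integrable_one : sigma.-integrable setT (EFin \o (fun=> 1 : R)).
Proof. exact: finite_measure_integrable_cst. Qed.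

Let kf s t (z : 'rV[R]_n * 'rV[R]_n) : R := s ^- n * gauss s^-1 (z.2 - t *: z.1).

Let mkf s t : measurable_fun setT (kf s t).
Proof.
by apply: measurable_funM => //; apply: measurable_gauss; meas.
Qed.

Let kf_le s t z : 0 < s -> `|kf s t z| <= s ^- n.
Proof.
move=> s0; rewrite ger0_norm ?mulr_ge0 ?gauss_ge0 ?invr_ge0 ?exprn_ge0 ?(ltW s0)//.
by rewrite ler_piMr ?gauss_le1// invr_ge0 exprn_ge0// ltW.
Qed.

Let kern_tensor s t w : kern s t w = \int[sigma]_z (1 * kf s t (z, w)).
Proof. by apply: eq_Rintegral => z _; rewrite mul1r. Qed.

Lemma measurable_kern s t : 0 < s -> measurable_fun setT (kern s t).
Proof.
move=> s0; rewrite (_ : kern s t = fun w => \int[sigma]_z (1 * kf s t (z, w))).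
  apply: (measurable_tensor_inner (c := s ^- n)) => //; first exact: integrable_one.
  by move=> z; exact: kf_le.
by apply/funext => w; exact: kern_tensor.
Qed.

Lemma kern_ge0 s t w : 0 < s -> 0 <= kern s t w.
Proof.
move=> s0; apply: Rintegral_ge0 => // z _.
by rewrite mulr_ge0 ?gauss_ge0 ?invr_ge0 ?exprn_ge0 ?(ltW s0).
Qed.

Lemma kern_bounded s t : 0 < s -> exists c : R, forall w, `|kern s t w| <= c.
Proof.
move=> s0; exists (s ^- n * \int[sigma]_z `|1 : R|) => w; rewrite kern_tensor.
by apply: (tensor_inner_le (c := s ^- n)) => //; [exact: integrable_one|move=> z; exact: kf_le].
Qed.

Lemma kernE s t w : 0 < s ->
  (kern s t w)%:E = (\int[sigma]_z (s ^- n * gauss s^-1 (w - t *: z))%:E)%E.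
Proof.
move=> s0; rewrite /kern /Rintegral fineK//; apply: integrable_fin_num => //.
have mK := measurableT_comp (mkf s t) (measurable_pair2 w).
have := integrable_bounded_mul (c := s ^- n) integrable_one mK (fun z => kf_le _ _ s0).
by apply: eq_integrable => // z _; rewrite /= mul1r.
Qed.

(* The Gaussian at scale [a * d] is split in two halves: one is summed over
   dyadic shells against the dimension bound, the other one gives the decay in
   [w], since [z] stays in a ball of radius [M]. *)
Lemma kern_le_gauss (beta M d0 : R) : 0 <= beta -> 0 < d0 ->
  locally_uniformly_dimensional beta sigma -> sigma [set z | M < enorm z] = 0%E ->
  exists2 D : R, 0 < D & forall (a t d : R) (w : 'rV[R]_n), 0 < a -> a <= t <= 2 * a ->
  0 < d -> d <= d0 ->
  kern (a * d) t w <=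
    D * a ^- n * d `^ (beta - n%:R) * expR (- (enorm w / (3 * d0 * a)) ^+ 2).
Proof.
move=> beta0 d00 [C1 hC1] sM; have [Cb Cb0 shellb] := shell beta0 (R := R).
have [S SE] : exists S : R, sigma setT = S%:E.
  by exists (fine (sigma setT)); rewrite fineK// fin_num_measure.
have S0 : 0 <= S by rewrite -lee_fin -SE measure_ge0.
pose Ks := `|C1| + S + 1; have Ks0 : 0 < Ks by rewrite ltr_wpDl// addr_ge0.
have ballb (x : 'rV[R]_n) (r : R) : 0 < r ->
    (sigma [set z | (enorm (x - z) < r)%R] <= (r `^ beta * Ks)%:E)%E.
  move=> r0; have rb : 0 <= r `^ beta by exact: powR_ge0.
  have -> : [set z | enorm (x - z) < r] = eball x r.
    by apply/seteqP; split => z /=; rewrite /eball/= -enormN opprB.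
  (* The dimension hypothesis covers radii up to 1; beyond, the total mass is enough because r ^
     beta >= 1. *)
  have [r1|r1] := leP r 1.
    apply: (le_trans (hC1 x r r0 r1)); rewrite lee_fin mulrC ler_wpM2l//.
    by have := ler_norm C1; rewrite /Ks; lra.
  apply: (@le_trans _ _ (sigma setT)).
    by apply: le_measure; rewrite ?inE//; exact: measurable_eball.
  rewrite SE lee_fin; have : 1 <= r `^ beta.
    by rewrite -(powRr0 r); apply: ler_powR => //; exact: ltW.
  by have := normr_ge0 C1; rewrite /Ks; nra.
exists (Cb * expR ((M / d0) ^+ 2) * Ks); first by rewrite !mulr_gt0 ?expR_gt0.
move=> a t d w a0 /andP[at_ t2a] dp dd0.
have t0 : 0 < t by exact: lt_le_trans at_.
pose u z := enorm (t^-1 *: w - z).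
pose c0 : R := (a * d) ^- n * (expR ((M / d0) ^+ 2) * expR (- (enorm w / (3 * d0 * a)) ^+ 2)).
have adn : 0 < (a * d) ^- n by rewrite invr_gt0 exprn_gt0// mulr_gt0.
have c00 : 0 <= c0 by rewrite !mulr_ge0 ?expR_ge0// ltW.
have mu_ : measurable_fun setT u by apply: measurable_enorm; rewrite /u; meas.
have u0 z : 0 <= u z by exact: enorm_ge0.
have ad0 : 0 < a * d by rewrite mulr_gt0.
have mset (r : R) : measurable [set y | u y < r].
  rewrite (_ : mkset _ = u @^-1` `]-oo, r[%classic); last first.
    by apply/seteqP; split => y; rewrite /= in_itv.
  by rewrite -[X in measurable X]setTI; exact: mu_.
rewrite -lee_fin kernE//.
apply: (@le_trans _ _ (\int[sigma]_z (c0 * expR (- (u z / d) ^+ 2))%:E)%E); last first.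
  apply: (le_trans (shellb _ _ sigma u (fun=> c0) (c0 * Ks)%:E d mu_ _ u0 _ _ dp _)) => //.
  - by rewrite lee_fin mulr_ge0// ltW.
  - move=> r r0; rewrite integral_cst//.
    apply: (@le_trans _ _ (c0%:E * (r `^ beta * Ks)%:E)%E).
      by apply: lee_wpmul2l; [rewrite lee_fin|exact: ballb].
    by rewrite -!EFinM lee_fin le_eqVlt; apply/orP; left; apply/eqP; ring.
  - rewrite -EFinM lee_fin le_eqVlt; apply/orP; left; apply/eqP.
    rewrite /c0 exprMn invfM powRB; last by rewrite (gt_eqF dp) implybT.
    by rewrite powR_mulrn ?(ltW dp)//; ring.
apply: ae_ge0_le_integral => //.
- by move=> z _; rewrite lee_fin mulr_ge0 ?gauss_ge0// ltW.
- apply/measurable_EFinP; exact: (measurableT_comp (mkf _ t) (measurable_pair2 w)).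
- by move=> z _; rewrite lee_fin mulr_ge0 ?expR_ge0.
- apply/measurable_EFinP; apply: measurable_funM => //; apply: measurable_expf.
  by apply: measurableT_comp => //; apply: measurable_funX; exact: measurable_funM.
exists [set z | M < enorm z]; split => //.
  exact: measurable_enorm_gt.
move=> z /= hz; rewrite ltNge; apply/negP => zM; apply: hz => _.
rewrite lee_fin /c0 -!mulrA ler_pM2l// /gauss -!expRD ler_expR.
have E : dot (w - t *: z) (w - t *: z) = t ^+ 2 * u z ^+ 2.
  have -> : w - t *: z = t *: (t^-1 *: w - z).
    by rewrite scalerBr scalerA divff ?gt_eqF// scale1r.
  by rewrite dotZl dotZr mulrA -expr2 -enorm_sqr.
rewrite E.
(* Since pi >= 2, the exponent contains two copies of the quadratic form, one for each half. *)
have pi2 : 2 <= pi :> R by exact: pi_ge2.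
have uw : enorm w <= t * (u z + M).
  have -> : w = t *: (t^-1 *: w - z) + t *: z.
    by rewrite scalerBr scalerA divff ?gt_eqF// scale1r subrK.
  rewrite (le_trans (enormD _ _))// !enormZ gtr0_norm// mulrDr lerD2l.
  by rewrite ler_wpM2l// ltW.
have uz := u0 z.
have p1 : (t / (a * d)) ^+ 2 * u z ^+ 2 >= (u z / d) ^+ 2.
  rewrite -exprMn lerXn2r ?nnegrE ?mulr_ge0 ?invr_ge0 ?(ltW ad0) ?(ltW dp) ?(ltW t0)//.
  rewrite [leRHS]mulrC ler_wpM2l// -[leLHS]mul1r invfM mulrA ler_wpM2r ?invr_ge0 ?(ltW dp)//.
  by rewrite ler_pdivlMr// mul1r.
have p2 : (u z / d0) ^+ 2 <= (u z / d) ^+ 2.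
  rewrite lerXn2r ?nnegrE ?mulr_ge0 ?invr_ge0 ?(ltW d00) ?(ltW dp)//.
  by rewrite ler_wpM2l// lef_pV2 ?posrE.
have M0 : 0 <= M by exact: le_trans (enorm_ge0 z) zM.
(* As |w| <= 2 a (u z + M), dividing by [3 * d0 * a] leaves a factor 2/3, and twice its square is
   below 1. *)
have p3 : (enorm w / (3 * d0 * a)) ^+ 2 <= (u z / d0) ^+ 2 + (M / d0) ^+ 2.
  have h : enorm w / (3 * d0 * a) <= (2 / 3) * (u z / d0 + M / d0).
    rewrite ler_pdivrMr ?mulr_gt0//; apply: (le_trans uw).
    have -> : 2 / 3 * (u z / d0 + M / d0) * (3 * d0 * a) = 2 * a * (u z + M).
      by field; rewrite gt_eqF.
    by rewrite ler_wpM2r// addr_ge0.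
  have h0 : 0 <= enorm w / (3 * d0 * a) by rewrite divr_ge0 ?enorm_ge0 ?mulr_ge0 ?(ltW d00) ?(ltW a0).
  have := sqr_ge0 (u z / d0 - M / d0); nra.
have -> : pi * (a * d)^-1 ^+ 2 * (t ^+ 2 * u z ^+ 2) = pi * ((t / (a * d)) ^+ 2 * u z ^+ 2).
  by ring.
have X0 : 0 <= (t / (a * d)) ^+ 2 * u z ^+ 2 by rewrite mulr_ge0 ?sqr_ge0.
have := ler_wpM2r X0 pi2; lra.
Qed.

End kernel.

Lemma Rintegral_sum d (T : measurableType d) (R : realType) (m : {measure set T -> \bar R})
    (I : Type) (r : seq I) (F : I -> T -> R) :
  (forall i, m.-integrable setT (EFin \o F i)) ->
  \int[m]_x (\sum_(i <- r) F i x) = \sum_(i <- r) \int[m]_x F i x.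
Proof.
move=> iF; elim: r => [|i r IH].
  rewrite big_nil -[RHS](mulr0 (fine (m setT))) -[RHS]mulrC -Rintegral_cst//.
  by apply: eq_Rintegral => x _; rewrite big_nil.
rewrite big_cons -IH -RintegralD//.
  by apply: eq_Rintegral => x _; rewrite big_cons.
apply: (eq_integrable _ (fun x => (\sum_(i <- r) (F i x)%:E)%E)) => //.
  by move=> x _; rewrite /= sumEFin.
by apply: integrable_sum => // j _; exact: iF.
Qed.

Section convolution.
Context {R : realType} {n : nat}.
Let mu := @lebesgue_rV R n.

Lemma enorm_lt_ball (x y : 'rV[R]_n) (r : R) : enorm (x - y) < r -> ball x r y.
Proof.
move=> xy; have r0 : 0 < r by rewrite (le_lt_trans _ xy)// enorm_ge0.
split => // i j; rewrite !ord1 -ball_normE/= (le_lt_trans _ xy)//.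
by have := coord_le_enorm (x - y) j; rewrite !mxE.
Qed.

(** [shell] with [b = n], the growth hypothesis being the bound of the integral of |f| over balls by
    the maximal function. *)
Lemma conv_maximal : exists2 C : R, 0 < C & forall (f k : 'rV[R]_n -> R) (D rho : R) x,
  measurable_fun setT f -> measurable_fun setT k -> 0 <= D -> 0 < rho ->
  (forall w, `|k w| <= D * expR (- (enorm w / rho) ^+ 2)) ->
  (`|\int[mu]_y (f y * k (x - y))|%:E <= (C * D * rho ^+ n)%:E * maximal f x)%E.
Proof.
have [C C0 sh] := shell (ler0n R n).
have e8 : 0 < 8 ^+ n :> R by rewrite exprn_gt0.
exists (C * 8 ^+ n); first by rewrite mulr_gt0.
move=> f k D rho x mf mk D0 rho0 hk.
pose u y := enorm (x - y).
have mu_ : measurable_fun setT u by apply: measurable_enorm; meas.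
have mset (r : R) : measurable [set y | u y < r].
  rewrite (_ : mkset _ = u @^-1` `]-oo, r[%classic); last first.
    by apply/seteqP; split => y; rewrite /= in_itv.
  by rewrite -[X in measurable X]setTI; exact: mu_.
have mxy : measurable_fun setT (fun y : 'rV[R]_n => k (x - y)).
  by apply: (measurableT_comp mk); meas.
have mE : measurable_fun setT (fun y => expR (- (u y / rho) ^+ 2)).
  apply: measurable_expf; apply: measurableT_comp => //; apply: measurable_funX.
  exact: measurable_funM.
have mf1 : measurable_fun setT (fun y => `|f y|) by exact: measurableT_comp.
apply: (@le_trans _ _ (\int[mu]_y (D%:E * (`|f y| * expR (- (u y / rho) ^+ 2))%:E))%E).
  apply: le_EFin_Rintegral.
  - exact: measurable_funM.
  - by apply: emeasurable_funM => //; apply/measurable_EFinP; exact: measurable_funM.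
  - by move=> y; rewrite -EFinM lee_fin normrM mulrCA ler_wpM2l.
rewrite ge0_integralZl//; try by [move=> y _; rewrite lee_fin mulr_ge0 ?expR_ge0|
  apply/measurable_EFinP; exact: measurable_funM].
apply: (@le_trans _ _ (D%:E * ((C * rho `^ n%:R)%:E * ((8 ^+ n)%:E * maximal f x)))%E).
  apply: lee_wpmul2l; first by rewrite lee_fin.
  apply: sh => //.
  - by move=> y; exact: enorm_ge0.
  - by rewrite mule_ge0 ?maximal_ge0// lee_fin ltW.
  - move=> r r0; rewrite powR_mulrn ?(ltW r0)// muleA -EFinM mulrC -exprMn.
    apply: (le_trans _ (integral_ball_le x r0 mf)).
    apply: ge0_subset_integral => //; first exact: measurable_ball_rV.
      by apply/measurable_EFinP; exact: measurable_funTS.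
    by move=> y /= h; exact: enorm_lt_ball.
rewrite powR_mulrn ?(ltW rho0)// !muleA -!EFinM le_eqVlt; apply/orP; left; apply/eqP.
by congr (_%:E * _)%E; ring.
Qed.

Variable sigma : {finite_measure set 'rV[R]_n -> \bar R}.

Definition scos (xi : 'rV[R]_n) : R := fcos sigma (fun=> 1) xi.
Definition ssin (xi : 'rV[R]_n) : R := fsin sigma (fun=> 1) xi.

Lemma measurable_scos : measurable_fun setT scos.
Proof. exact: measurable_fcos (integrable_one sigma). Qed.

Lemma measurable_ssin : measurable_fun setT ssin.
Proof. exact: measurable_fsin (integrable_one sigma). Qed.

Lemma scos_le xi : `|scos xi| <= \int[sigma]_y `|1 : R|.
Proof. exact: fcos_le (integrable_one sigma). Qed.

Lemma ssin_le xi : `|ssin xi| <= \int[sigma]_y `|1 : R|.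
Proof. exact: fsin_le (integrable_one sigma). Qed.

(* for real [f], the real part of [f^(xi) m(t xi) exp (2 pi i x.xi)] *)
Definition wave (f : 'rV[R]_n -> R) (t : R) (x xi : 'rV[R]_n) : R :=
  cos (2 * pi * dot x xi) *
    (fcos mu f xi * scos (t *: xi) - fsin mu f xi * ssin (t *: xi)) +
  sin (2 * pi * dot x xi) *
    (fsin mu f xi * scos (t *: xi) + fcos mu f xi * ssin (t *: xi)).

(* [phi = 0] gives [wave]; [phi = - pi / 2] gives the matching imaginary part,
   whose integral vanishes *)
Definition wave_shift (phi : R) (f : 'rV[R]_n -> R) (t : R) (x xi : 'rV[R]_n) : R :=
  cos (2 * pi * dot x xi + phi) *
    (fcos mu f xi * scos (t *: xi) - fsin mu f xi * ssin (t *: xi)) +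
  sin (2 * pi * dot x xi + phi) *
    (fsin mu f xi * scos (t *: xi) + fcos mu f xi * ssin (t *: xi)).

(** The real part of exp (i (2 pi xi.(x - y) + phi)) m (t xi), where m = scos - i ssin; [wave_shift]
    is its integral against [f]. *)
Let phase (phi t : R) (x xi y : 'rV[R]_n) : R :=
  cos (2 * pi * dot xi (x - y) + phi) * scos (t *: xi) +
  sin (2 * pi * dot xi (x - y) + phi) * ssin (t *: xi).

Let phaseE phi t x xi y : phase phi t x xi y =
  \int[sigma]_z (1 * cos (2 * pi * dot xi (x - y - t *: z) + phi)).
Proof.
have i1 := integrable_one sigma.
have ic : sigma.-integrable setT (fun z => (1 * cos (2 * pi * dot z (t *: xi)))%:E).
  by apply: integrable_cos => //; meas.
have is' : sigma.-integrable setT (fun z => (1 * sin (2 * pi * dot z (t *: xi)))%:E).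
  by apply: integrable_sin => //; meas.
rewrite /phase /scos /ssin /fcos /fsin -!RintegralZl//.
rewrite -RintegralD//; try exact: integrable_mulrl.
apply: eq_Rintegral => z _; rewrite !mul1r (dotBr (x - y)) mulrBr addrAC cosB.
by rewrite !dotZr (dotC xi z).
Qed.

Let wave_phase phi f t x xi : mu.-integrable setT (EFin \o f) ->
  wave_shift phi f t x xi = \int[mu]_y (f y * phase phi t x xi y).
Proof.
move=> iF; have ic : mu.-integrable setT (fun y => (f y * cos (2 * pi * dot y xi))%:E).
  by apply: integrable_cos => //; meas.
have is' : mu.-integrable setT (fun y => (f y * sin (2 * pi * dot y xi))%:E).
  by apply: integrable_sin => //; meas.
set cx := cos (2 * pi * dot x xi + phi); set sx := sin (2 * pi * dot x xi + phi).
set C := scos (t *: xi); set S := ssin (t *: xi).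
transitivity ((cx * C + sx * S) * fcos mu f xi + (sx * C - cx * S) * fsin mu f xi).
  by rewrite /wave_shift -/cx -/sx -/C -/S; ring.
rewrite (_ : (_ + _) * _ = \int[mu]_y ((cx * C + sx * S) * (f y * cos (2 * pi * dot y xi)))).
  rewrite (_ : (_ - _) * _ = \int[mu]_y ((sx * C - cx * S) * (f y * sin (2 * pi * dot y xi)))).
    rewrite -RintegralD//; [|exact: integrable_mulrl..].
    apply: eq_Rintegral => y _; rewrite /phase dotBr mulrBr addrAC cosB sinB !(dotC xi) -/cx -/sx -/C -/S.
    by ring.
  by rewrite RintegralZl.
by rewrite RintegralZl.
Qed.

Let phase_bounded phi t x : exists c : R, forall xi y, `|phase phi t x xi y| <= c.
Proof.
exists (\int[sigma]_y `|1 : R| + \int[sigma]_y `|1 : R|) => xi y.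
rewrite (le_trans (ler_normD _ _))// !normrM lerD//.
  by rewrite -[leRHS]mul1r ler_pM// ?cos_le1_norm ?scos_le.
by rewrite -[leRHS]mul1r ler_pM// ?sin_le1_norm ?ssin_le.
Qed.

(** The Gaussian in [xi] makes every exchange legitimate and is transformed exactly. Being even, it
    lets the phase out as the factor [cos phi]: 1 for the operator, 0 for the imaginary part. *)
Lemma conv_kern_shift phi f (s t : R) x : 0 < s -> mu.-integrable setT (EFin \o f) ->
  \int[mu]_xi (gauss s xi * wave_shift phi f t x xi) =
  cos phi * \int[mu]_y (f y * kern sigma s t (x - y)).
Proof.
move=> s0 iF; have [c pc] := phase_bounded phi t x.
have mphase : measurable_fun setT (fun z : 'rV[R]_n * 'rV[R]_n => phase phi t x z.1 z.2).
  rewrite /phase; apply: measurable_funD; apply: measurable_funM.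
  - by apply: measurable_cosf; meas.
  - by apply: (measurableT_comp measurable_scos); meas.
  - by apply: measurable_sinf; meas.
  - by apply: (measurableT_comp measurable_ssin); meas.
transitivity (\int[mu]_xi (gauss s xi * \int[mu]_y (f y * phase phi t x xi y))).
  by apply: eq_Rintegral => xi _; rewrite wave_phase.
rewrite (Rfubini_tensor (K := fun z => phase phi t x z.1 z.2) (c := c))//; try by [exact: integrable_gauss|exact: mphase].
have [b hb] := kern_bounded sigma t s0.
have ik : mu.-integrable setT (fun y => (f y * kern sigma s t (x - y))%:E).
  have mK : measurable_fun setT (fun y : 'rV[R]_n => kern sigma s t (x - y)).
    by apply: (measurableT_comp (measurable_kern sigma t s0)); meas.
  exact: (integrable_bounded_mul iF mK (fun y => hb (x - y))).
rewrite -RintegralZl//; apply: eq_Rintegral => y _; rewrite [RHS]mulrCA; congr (_ * _).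
transitivity (\int[mu]_xi (gauss s xi *
    \int[sigma]_z (1 * cos (2 * pi * dot xi (x - y - t *: z) + phi)))).
  by apply: eq_Rintegral => xi _; rewrite phaseE.
rewrite (Rfubini_tensor (K := fun p : 'rV[R]_n * 'rV[R]_n => cos (2 * pi * dot p.1 (x - y - t *: p.2) + phi)) (c := 1))//.
- have mK : measurable_fun setT (fun z : 'rV[R]_n => s ^- n * gauss s^-1 (x - y - t *: z)).
    by apply: measurable_funM => //; apply: measurable_gauss; meas.
  have ikz : sigma.-integrable setT (fun z => (s ^- n * gauss s^-1 (x - y - t *: z))%:E).
    have sn : 0 <= s ^- n by rewrite invr_ge0 exprn_ge0// ltW.
    have kn z : `|s ^- n * gauss s^-1 (x - y - t *: z)| <= s ^- n.
      by rewrite ger0_norm ?mulr_ge0 ?gauss_ge0// ler_piMr// gauss_le1.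
    have := integrable_bounded_mul (integrable_one sigma) mK kn.
    by apply: eq_integrable => // z _; rewrite /= mul1r.
  rewrite /kern -(RintegralZl _ measurableT ikz).
  by apply: eq_Rintegral => z _; rewrite /= gauss_fourier// mul1r.
- exact: integrable_gauss.
- exact: integrable_one.
- by apply: measurable_cosf; meas.
- by move=> z; exact: cos_le1_norm.
Qed.

Lemma conv_kern f (s t : R) x : 0 < s -> mu.-integrable setT (EFin \o f) ->
  \int[mu]_y (f y * kern sigma s t (x - y)) = \int[mu]_xi (gauss s xi * wave f t x xi).
Proof.
move=> s0 iF; rewrite -[LHS]mul1r -cos0 -(conv_kern_shift 0 t x s0 iF).
by apply: eq_Rintegral => xi _; rewrite /wave_shift addr0.
Qed.

End convolution.

Section truncated.
Context {R : realType} {n : nat}.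
Variable sigma : {finite_measure set 'rV[R]_n -> \bar R}.
Variable N : nat.
Let mu := @lebesgue_rV R n.

(** The coefficient of y ^ i.+1 in the polynomial 1 - (1 - y) ^ N. *)
Definition hcoef (i : nat) : R := (-1) ^+ i * 'C(N, i.+1)%:R.

(** A low-pass profile: decaying like exp (- v) at infinity as a single Gaussian does, but equal to
    1 up to order [N] at 0. The order is chosen so that differences of consecutive scales vanish at
    low frequency beyond what [alpha] requires. *)
Definition hmul (v : R) : R := 1 - (1 - expR (- v)) ^+ N.

Lemma hmulE v : \sum_(i < N) hcoef i * expR (- (i.+1%:R * v)) = hmul v.
Proof.
rewrite /hmul exprDn big_ord_recl subn0 expr0 bin0 mulr1n expr1n mulr1 opprD addrA subrr add0r.
rewrite -sumrN; apply: eq_bigr => i _.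
rewrite /= /bump leq0n add1n expr1n mul1r.
rewrite exprNn -mulrN expRM_natl -mulr_natr (exprS (-1)) /hcoef; ring.
Qed.

(** The square root turns the scale into the power: the symbol of the [i]-th term is the [i.+1]-st
    power of [gauss s]. *)
Definition skern (s t : R) (w : 'rV[R]_n) : R :=
  \sum_(i < N) hcoef i * kern sigma (s * Num.sqrt i.+1%:R) t w.

(* the Fourier symbol of [skern]: it is [1 + O(s ^ (2 N))] as [s] tends to 0 *)
Definition smul (s : R) (xi : 'rV[R]_n) : R := hmul (pi * s ^+ 2 * dot xi xi).

Let sq0 (s : R) (i : nat) : 0 < s -> 0 < s * Num.sqrt i.+1%:R.
Proof. by move=> s0; rewrite mulr_gt0// sqrtr_gt0. Qed.

Lemma smulE s xi : smul s xi = \sum_(i < N) hcoef i * gauss (s * Num.sqrt i.+1%:R) xi.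
Proof.
rewrite /smul -hmulE; apply: eq_bigr => i _; rewrite /gauss exprMn sqr_sqrtr//.
by congr (_ * expR (- _)); ring.
Qed.

Lemma measurable_skern s t : 0 < s -> measurable_fun setT (skern s t).
Proof.
move=> s0; apply: measurable_sum => i; apply: measurable_funM => //.
exact: measurable_kern (sq0 _ s0).
Qed.

Lemma skern_bounded s t : 0 < s -> exists c : R, forall w, `|skern s t w| <= c.
Proof.
move=> s0; have /choice[c hc] : forall i, exists c : R, forall w,
    `|kern sigma (s * Num.sqrt i.+1%:R) t w| <= c.
  by move=> i; exact: kern_bounded (sq0 _ s0).
exists (\sum_(i < N) `|hcoef i| * c i) => w.
rewrite (le_trans (ler_norm_sum _ _ _))//; apply: ler_sum => i _.
by rewrite normrM ler_wpM2l.
Qed.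

Lemma integrable_smul s : 0 < s -> mu.-integrable setT (EFin \o smul s).
Proof.
move=> s0; apply: (eq_integrable _ (fun x => (\sum_(i < N)
    (hcoef i * gauss (s * Num.sqrt i.+1%:R) x)%:E)%E)) => //.
  by move=> x _; rewrite /= smulE sumEFin.
apply: integrable_sum => // i _; apply: integrable_mulrl => //.
exact: integrable_gauss (sq0 _ s0).
Qed.

Lemma wave_bounded f t x : mu.-integrable setT (EFin \o f) ->
  exists c : R, forall xi, `|wave sigma f t x xi| <= c.
Proof.
move=> iF; pose a := \int[mu]_y `|f y|; pose b := \int[sigma]_y `|1 : R|.
have a0 : 0 <= a by exact: Rintegral_ge0.
have b0 : 0 <= b by exact: Rintegral_ge0.
exists ((a * b + a * b) + (a * b + a * b)) => xi.
rewrite (le_trans (ler_normD _ _))// lerD//.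
  rewrite normrM -[leRHS]mul1r ler_pM// ?cos_le1_norm// (le_trans (ler_normB _ _))//.
  by rewrite !normrM; apply: lerD; apply: ler_pM => //;
    [exact: fcos_le|exact: scos_le|exact: fsin_le|exact: ssin_le].
rewrite normrM -[leRHS]mul1r ler_pM// ?sin_le1_norm// (le_trans (ler_normD _ _))//.
by rewrite !normrM; apply: lerD; apply: ler_pM => //;
  [exact: fsin_le|exact: scos_le|exact: fcos_le|exact: ssin_le].
Qed.

Lemma measurable_wave f t x : mu.-integrable setT (EFin \o f) ->
  measurable_fun setT (wave sigma f t x).
Proof.
move=> iF; have mC := measurable_fcos iF; have mS := measurable_fsin iF.
have m1 : measurable_fun setT (fun xi : 'rV[R]_n => scos sigma (t *: xi)).
  by apply: (measurableT_comp (measurable_scos sigma)); meas.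
have m2 : measurable_fun setT (fun xi : 'rV[R]_n => ssin sigma (t *: xi)).
  by apply: (measurableT_comp (measurable_ssin sigma)); meas.
apply: measurable_funD; apply: measurable_funM.
- by apply: measurable_cosf; meas.
- by apply: measurable_funB; apply: measurable_funM.
- by apply: measurable_sinf; meas.
- by apply: measurable_funD; apply: measurable_funM.
Qed.

Lemma conv_skern f (s t : R) x : 0 < s -> mu.-integrable setT (EFin \o f) ->
  \int[mu]_y (f y * skern s t (x - y)) = \int[mu]_xi (smul s xi * wave sigma f t x xi).
Proof.
move=> s0 iF.
have [c hc] := wave_bounded t x iF; have mw := measurable_wave t x iF.
transitivity (\sum_(i < N) hcoef i * \int[mu]_y (f y * kern sigma (s * Num.sqrt i.+1%:R) t (x - y))).
  have ik i : mu.-integrable setT (fun y => (f y * kern sigma (s * Num.sqrt i.+1%:R) t (x - y))%:E).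
    have [b hb] := kern_bounded sigma t (sq0 i s0).
    have mK : measurable_fun setT (fun y : 'rV[R]_n => kern sigma (s * Num.sqrt i.+1%:R) t (x - y)).
      by apply: (measurableT_comp (measurable_kern sigma t (sq0 i s0))); meas.
    exact: (integrable_bounded_mul iF mK (fun y => hb (x - y))).
  rewrite (eq_bigr (fun i : 'I_N => \int[mu]_y (hcoef i * (f y * kern sigma (s * Num.sqrt i.+1%:R) t (x - y))))); last first.
    by move=> i _; rewrite (RintegralZl _ measurableT (ik i)).
  rewrite -Rintegral_sum; last by move=> i; exact: (integrable_mulrl _ measurableT (ik i)).
  apply: eq_Rintegral => y _; rewrite /skern mulr_sumr; apply: eq_bigr => i _; ring.
have ig i : mu.-integrable setT (fun xi => (gauss (s * Num.sqrt i.+1%:R) xi * wave sigma f t x xi)%:E).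
  exact: (integrable_bounded_mul (@integrable_gauss R n _ (sq0 i s0)) mw hc).
rewrite (eq_bigr (fun i : 'I_N => \int[mu]_xi (hcoef i * (gauss (s * Num.sqrt i.+1%:R) xi * wave sigma f t x xi)))); last first.
  by move=> i _; rewrite conv_kern ?sq0// (RintegralZl _ measurableT (ig i)).
rewrite -Rintegral_sum; last by move=> i; exact: (integrable_mulrl _ measurableT (ig i)).
apply: eq_Rintegral => xi _; rewrite smulE mulr_suml; apply: eq_bigr => i _; ring.
Qed.

(* The [j]-th piece of the kernel at scale [a]; its symbol is localised at
   frequencies of size about [2 ^ j / a]. *)
Definition tkern (a : R) (j : nat) (t : R) (w : 'rV[R]_n) : R :=
  if j is k.+1 then skern (a / 2 ^+ k.+1) t w - skern (a / 2 ^+ k) t w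
  else skern a t w.

Definition tmul (a : R) (j : nat) (xi : 'rV[R]_n) : R :=
  if j is k.+1 then smul (a / 2 ^+ k.+1) xi - smul (a / 2 ^+ k) xi else smul a xi.

Let ap (a : R) k : 0 < a -> 0 < a / 2 ^+ k.
Proof. by move=> a0; rewrite divr_gt0// exprn_gt0. Qed.

Lemma measurable_tkern a j t : 0 < a -> measurable_fun setT (tkern a j t).
Proof.
move=> a0; case: j => [|k]; first exact: measurable_skern.
by apply: measurable_funB; apply: measurable_skern; exact: ap.
Qed.

Lemma tkern_bounded a j t : 0 < a -> exists c : R, forall w, `|tkern a j t w| <= c.
Proof.
move=> a0; case: j => [|k]; first exact: skern_bounded.
have [c hc] := skern_bounded t (ap k.+1 a0); have [b hb] := skern_bounded t (ap k a0).
by exists (c + b) => w; rewrite (le_trans (ler_normB _ _))// lerD.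
Qed.

Lemma integrable_tmul a j : 0 < a -> mu.-integrable setT (EFin \o tmul a j).
Proof.
move=> a0; case: j => [|k]; first exact: integrable_smul.
have := integrableB measurableT (integrable_smul (ap k.+1 a0)) (integrable_smul (ap k a0)).
exact.
Qed.

Lemma conv_tkern f (a t : R) j x : 0 < a -> mu.-integrable setT (EFin \o f) ->
  \int[mu]_y (f y * tkern a j t (x - y)) = \int[mu]_xi (tmul a j xi * wave sigma f t x xi).
Proof.
move=> a0 iF; case: j => [|k]; first exact: conv_skern.
have [c hc] := wave_bounded t x iF; have mw := measurable_wave t x iF.
have iw l : mu.-integrable setT (fun xi => (smul (a / 2 ^+ l) xi * wave sigma f t x xi)%:E).
  exact: (integrable_bounded_mul (integrable_smul (ap l a0)) mw hc).
have ik l : mu.-integrable setT (fun y => (f y * skern (a / 2 ^+ l) t (x - y))%:E).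
  have [b hb] := skern_bounded t (ap l a0).
  have mK : measurable_fun setT (fun y : 'rV[R]_n => skern (a / 2 ^+ l) t (x - y)).
    by apply: (measurableT_comp (measurable_skern t (ap l a0))); meas.
  exact: (integrable_bounded_mul iF mK (fun y => hb (x - y))).
transitivity (\int[mu]_y (f y * skern (a / 2 ^+ k.+1) t (x - y)) -
    \int[mu]_y (f y * skern (a / 2 ^+ k) t (x - y))).
  by rewrite -(RintegralB measurableT (ik k.+1) (ik k)); apply: eq_Rintegral => y _; rewrite mulrBr.
rewrite !conv_skern//; try exact: ap.
by rewrite -(RintegralB measurableT (iw k.+1) (iw k)); apply: eq_Rintegral => y _; rewrite /= [RHS]mulrBl.
Qed.

Lemma tkern_le_gauss (beta M : R) : 0 <= beta -> beta <= n%:R -> (0 < N)%N ->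
  locally_uniformly_dimensional beta sigma -> sigma [set z | M < enorm z] = 0%E ->
  exists2 D : R, 0 < D & forall (a t : R) (j : nat) (w : 'rV[R]_n), 0 < a -> a <= t <= 2 * a ->
  `|tkern a j t w| <=
    D * a ^- n * (2 ^+ j) `^ (n%:R - beta) * expR (- (enorm w / (3 * N%:R * a)) ^+ 2).
Proof.
move=> beta0 betan N0 lu sM; have Np : 0 < N%:R :> R by rewrite ltr0n.
(* All Gaussians in the pieces have scale [a * d] with [d] at most [N], which is why [N] is taken as
   the bound [d0]. *)
have [D D0 hD] := kern_le_gauss beta0 Np lu sM.
pose H := \sum_(i < N) `|hcoef i|; have H0 : 0 <= H by apply: sumr_ge0.
pose E (a : R) (w : 'rV[R]_n) : R := expR (- (enorm w / (3 * N%:R * a)) ^+ 2).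
have sk a t k w : 0 < a -> a <= t <= 2 * a ->
    `|skern (a / 2 ^+ k) t w| <= H * (D * a ^- n * (2 ^+ k) `^ (n%:R - beta) * E a w).
  move=> a0 ht; rewrite (le_trans (ler_norm_sum _ _ _))// mulr_suml; apply: ler_sum => i _.
  have p0 : 0 < 2 ^+ k :> R by rewrite exprn_gt0.
  rewrite normrM ler_wpM2l// ger0_norm ?kern_ge0 ?sq0 ?ap//.
  have s1 : 1 <= Num.sqrt i.+1%:R :> R by rewrite -[leLHS]sqrtr1 ler_sqrt// ler1n.
  have s0 : 0 < Num.sqrt i.+1%:R :> R by exact: lt_le_trans s1.
  pose d : R := (2 ^+ k)^-1 * Num.sqrt i.+1%:R.
  have d0 : 0 < d by rewrite mulr_gt0// invr_gt0.
  have dN : d <= N%:R.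
    rewrite -[leRHS]mul1r ler_pM// ?invr_ge0 ?(ltW p0) ?(ltW s0)//.
      by rewrite invf_le1// exprn_ege1// ler1n.
    rewrite -[leRHS]sqr_sqrtr ?ler0n// expr2 -[leLHS]mul1r ler_pM// ?(ltW s0)//.
      by rewrite -[leLHS]sqrtr1 ler_sqrt// ler1n.
    by rewrite ler_sqrt ?ler0n// ler_nat.
  have -> : a / 2 ^+ k * Num.sqrt i.+1%:R = a * d by rewrite /d mulrA.
  apply: (le_trans (hD a t d w a0 ht d0 dN)).
  rewrite ler_wpM2r ?expR_ge0// ler_wpM2l//.
    by rewrite mulr_ge0 ?(ltW D0)// invr_ge0 exprn_ge0// ltW.
  rewrite -opprB powRN -[leRHS]invrK lef_pV2 ?posrE ?invr_gt0 ?powR_gt0//.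
  have -> : ((2 ^+ k) `^ (n%:R - beta))^-1 = (2 ^+ k)^-1 `^ (n%:R - beta) :> R.
    by rewrite -(powR_inv1 (ltW p0)) -powRrM mulN1r powRN.
  rewrite ge0_ler_powR ?subr_ge0// ?nnegrE ?invr_ge0 ?(ltW p0) ?(ltW d0)//.
  by rewrite ler_peMr// invr_ge0 ltW.
exists (H * D * 2 + 1); first by rewrite ltr_wpDl// !mulr_ge0// ltW.
move=> a t j w a0 ht.
have X0 k : 0 <= a ^- n * (2 ^+ k) `^ (n%:R - beta) * E a w.
  by rewrite !mulr_ge0 ?expR_ge0 ?powR_ge0// invr_ge0 exprn_ge0// ltW.
have -> : (H * D * 2 + 1) * a ^- n * (2 ^+ j) `^ (n%:R - beta) * expR (- (enorm w / (3 * N%:R * a)) ^+ 2)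
    = (H * D * 2 + 1) * (a ^- n * (2 ^+ j) `^ (n%:R - beta) * E a w) by rewrite /E; ring.
have HD : 0 <= H * D by rewrite mulr_ge0// ltW.
case: j => [|k] /=.
  have := sk a t 0 w a0 ht; rewrite expr0 divr1.
  have := X0 0; rewrite expr0; set X := (Z in 0 <= Z).
  have -> : H * (D * a ^- n * 1 `^ (n%:R - beta) * E a w) = H * D * X by rewrite /X; ring.
  move=> Xp h; rewrite -/X; have := mulr_ge0 HD Xp; nra.
rewrite (le_trans (ler_normB _ _))//.
have h1 := sk a t k.+1 w a0 ht; have h2 := sk a t k w a0 ht.
have mono : a ^- n * (2 ^+ k) `^ (n%:R - beta) * E a w <= a ^- n * (2 ^+ k.+1) `^ (n%:R - beta) * E a w.
  rewrite ler_wpM2r ?expR_ge0// ler_wpM2l ?invr_ge0 ?exprn_ge0 ?(ltW a0)//.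
  rewrite ge0_ler_powR ?subr_ge0// ?nnegrE ?exprn_ge0//.
  by rewrite exprS ler_peMl ?exprn_ge0// ler1n.
move: h1 h2 mono (X0 k) (X0 k.+1); rewrite -!(mulrA D) !(mulrA H D) -!(mulrA (a ^- n)).
set X := a ^- n * _; set Y := a ^- n * _ => b1 b2 XY X0k X0k1.
apply: (le_trans (lerD b1 (le_trans b2 (ler_wpM2l HD XY)))).
by rewrite [H * D * 2]mulrC mulr_natl mulr2n 2!mulrDl mul1r lerDl; exact: X0k1.
Qed.

Lemma conv_tkern_maximal (beta M : R) : 0 <= beta -> beta <= n%:R -> (0 < N)%N ->
  locally_uniformly_dimensional beta sigma -> sigma [set z | M < enorm z] = 0%E ->
  exists2 C : R, 0 < C & forall (f : 'rV[R]_n -> R) (a t : R) (j : nat) x, measurable_fun setT f ->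
  0 < a -> a <= t <= 2 * a ->
  (`|\int[mu]_y (f y * tkern a j t (x - y))|%:E
    <= (C * (2 ^+ j) `^ (n%:R - beta))%:E * maximal f x)%E.
Proof.
move=> beta0 betan N0 lu sM; have Np : 0 < N%:R :> R by rewrite ltr0n.
have [D D0 hD] := tkern_le_gauss beta0 betan N0 lu sM.
have [C C0 hC] := @conv_maximal R n.
exists (C * D * (3 * N%:R) ^+ n); first by rewrite !mulr_gt0// exprn_gt0// mulr_gt0.
move=> f a t j x mf a0 ht.
have h := hC f (tkern a j t) (D * a ^- n * (2 ^+ j) `^ (n%:R - beta)) (3 * N%:R * a) x mf
  (measurable_tkern j t a0) _ _ (fun w => hD a t j w a0 ht).
apply: (le_trans (h _ _)).
- by rewrite !mulr_ge0 ?powR_ge0 ?(ltW D0)// invr_ge0 exprn_ge0// ltW.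
- by rewrite !mulr_gt0.
rewrite le_eqVlt; apply/orP; left; apply/eqP; congr (_%:E * _)%E.
rewrite exprMn; field; rewrite expf_neq0// gt_eqF//.
Qed.

End truncated.

(** * The square function estimate *)

Lemma measurable_Rintegral_param d1 d2 (T1 : measurableType d1) (T2 : measurableType d2)
    (R : realType) (m1 : {sigma_finite_measure set T1 -> \bar R}) (f : T1 * T2 -> R) :
  measurable_fun setT f -> measurable_fun setT (fun y => \int[m1]_x f (x, y)).
Proof.
move=> mf; have mEf : measurable_fun setT (EFin \o f) by exact/measurable_EFinP.
rewrite (_ : (fun y => _) = (fun y => fine
  (\int[m1]_x ((EFin \o f)^\+ (x, y)) - \int[m1]_x ((EFin \o f)^\- (x, y)))%E)); last first.
  apply/funext => y; congr fine; rewrite integralE; congr (_ - _)%E;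
    by apply: eq_integral => x _; rewrite ?funeposE ?funenegE.
apply: (measurableT_comp (fine_measurable measurableT)); apply: emeasurable_funB.
  apply: (measurable_fun_fubini_tonelli_G (m1 := m1)) => //.
  exact: measurable_funepos.
apply: (measurable_fun_fubini_tonelli_G (m1 := m1)) => //.
exact: measurable_funeneg.
Qed.

Section sup_by_derivative.
Context {R : realType}.
Local Notation mu := (@lebesgue_measure R).

(** The increment of F^2 is an integral of 2 F F', and 2 |F F'| <= F^2 / l + l F'^2. Averaging
    F(t)^2 <= F(u)^2 + J over [u] in the interval, of length [a], gives the bound. The parameter [l]
    balances the two terms. *)
Lemma sqr_le_integral_derive (F H H2 : R -> R) (a l : R) : 0 < a -> 0 < l ->
  (forall t : R, is_derive t 1 F (H t)) -> (forall t : R, is_derive t 1 H (H2 t)) ->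
  forall t, a <= t <= 2 * a ->
  ((F t ^+ 2)%:E <= (a^-1 + l^-1)%:E * (\int[mu]_(u in `[a, (2 * a)%R]) (F u ^+ 2)%:E)
    + l%:E * (\int[mu]_(u in `[a, (2 * a)%R]) (H u ^+ 2)%:E))%E.
Proof.
move=> a0 l0 dF dH.
have cF : continuous F by move=> t; apply: derivable_cts; exact: ex_derive.
have cH : continuous H by move=> t; apply: derivable_cts; exact: ex_derive.
have cF2 : continuous (fun t => F t ^+ 2) by move=> t; apply: cvgM; exact: cF.
have cH2 : continuous (fun t => H t ^+ 2) by move=> t; apply: cvgM; exact: cH.
pose g t := 2 * (F t * H t).
have cg : continuous g by move=> t; apply: cvgMl_tmp; apply: cvgM; [exact: cF|exact: cH].
pose G t := l^-1 * F t ^+ 2 + l * H t ^+ 2.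
have cG : continuous G.
  by move=> t; apply: cvgD; apply: cvgMl_tmp; [exact: cF2|exact: cH2].
have gG t : `|g t| <= G t.
  have h : 2 * (`|F t| * `|H t|) <= l^-1 * `|F t| ^+ 2 + l * `|H t| ^+ 2.
    rewrite -subr_ge0 (_ : _ - _ = l^-1 * (`|F t| - l * `|H t|) ^+ 2).
      by rewrite mulr_ge0 ?sqr_ge0// invr_ge0 ltW.
    by field; rewrite gt_eqF.
  by rewrite /g /G normrM normrM ger0_norm// -[F t ^+ 2]real_normK ?num_real//
    -[H t ^+ 2]real_normK ?num_real.
have ci (f : R -> R) b c : continuous f -> mu.-integrable `[b, c] (EFin \o f).
  move=> cf; apply: continuous_compact_integrable; first exact: segment_compact.
  by apply: continuous_subspaceT.
pose J := \int[mu]_(u in `[a, 2 * a]) G u.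
have G0 t : 0 <= G t by exact: le_trans (gG t).
have key s r : a <= s -> s <= r -> r <= 2 * a -> `|F r ^+ 2 - F s ^+ 2| <= J.
  move=> as_ sr ra.
  have dF2 (t : R) : is_derive t 1 (fun t => F t ^+ 2) (g t).
    have dt := dF t; apply: is_derive_eq; rewrite !scaleRE /g; ring.
  rewrite -(Rintegral_derive sr dF2 cg).
  apply: (le_trans (le_normr_Rintegral _ (ci g s r cg))); first exact: measurable_itv.
  apply: (@le_trans _ _ (\int[mu]_(u in `[s, r]) G u)).
    apply: le_Rintegral => //; last exact: ci.
    exact: (integrable_norm (ci _ _ _ cg)).
  apply: fine_le; try by apply: integrable_fin_num => //; exact: ci.
  apply: ge0_subset_integral => //.
  - by apply/measurable_EFinP; apply: measurable_funTS; exact: continuous_measurable_fun.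
  - by move=> u _; rewrite lee_fin.
  - by apply: subset_itv; rewrite bnd_simp.
move=> t /andP[at_ ta].
have fk (f : R -> R) : continuous f -> (\int[mu]_(u in `[a, (2 * a)%R]) (f u)%:E =
    (\int[mu]_(u in `[a, 2 * a]) f u)%:E)%E.
  by move=> cf; rewrite /Rintegral fineK//; apply: integrable_fin_num => //; exact: ci.
rewrite (fk _ cF2) (fk _ cH2) -!EFinM -EFinD lee_fin.
set IF := \int[mu]_(u in _) _ ^+ 2; set IH := \int[mu]_(u in _) _.
have JE : J = l^-1 * IF + l * IH.
  rewrite /J RintegralD//; try by apply: integrable_mulrl => //; exact: ci.
  by rewrite !RintegralZl//; exact: ci.
have vol : fine (mu (`[a, 2 * a]%classic : set R)) = a.
  rewrite lebesgue_measure_itv/= lte_fin ifT /=; last by lra.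
  by lra.
have : \int[mu]_(u in `[a, 2 * a]) (F t ^+ 2) <= \int[mu]_(u in `[a, 2 * a]) (F u ^+ 2 + J).
  apply: le_Rintegral => //.
  - by apply: ci => ?; exact: cvg_cst.
  - by apply: ci => u; apply: cvgD; [exact: cF2|exact: cvg_cst].
  - move=> u; rewrite /= in_itv/= => /andP[au ua].
    have [ut|tu] := leP u t.
      by have := key u t au ut ta; rewrite ler_norml => /andP[_]; lra.
    by have := key t u at_ (ltW tu) ua; rewrite ler_norml => /andP[]; lra.
rewrite RintegralD//; [|exact: ci|by apply: ci => ?; exact: cvg_cst].
rewrite !Rintegral_cst// vol -/IF JE => h.
rewrite -(ler_pM2r a0) (le_trans h)// le_eqVlt; apply/orP; left; apply/eqP.
by field; rewrite !gt_eqF.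
Qed.

End sup_by_derivative.

Section bessel_blend.
Context {R : realType} {n : nat}.
Let mu := @lebesgue_rV R n.

(** The integrand [wave] with a general symbol c - i s, so that derivatives in [t] of the multiplier
    are covered too. *)
Definition blend (f c s : 'rV[R]_n -> R) (x xi : 'rV[R]_n) : R :=
  cos (2 * pi * dot x xi) * (fcos mu f xi * c xi - fsin mu f xi * s xi) +
  sin (2 * pi * dot x xi) * (fsin mu f xi * c xi + fcos mu f xi * s xi).

(** In [x] the integral is a cosine transform of [p] plus a sine transform of [q], so Bessel's
    inequality applies to each; p^2 + q^2 is the product of the squared moduli of Psi, of the
    transform of [f] and of the symbol. *)
Lemma bessel_blend (f c s Psi : 'rV[R]_n -> R) : mu.-integrable setT (EFin \o f) ->
  mu.-integrable setT (fun xi => (Psi xi * c xi)%:E) ->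
  mu.-integrable setT (fun xi => (Psi xi * s xi)%:E) ->
  (\int[mu]_x ((\int[mu]_xi (Psi xi * blend f c s x xi)) ^+ 2)%:E <=
   2%:E * \int[mu]_xi (Psi xi ^+ 2 * (fcos mu f xi ^+ 2 + fsin mu f xi ^+ 2) *
     (c xi ^+ 2 + s xi ^+ 2))%:E)%E.
Proof.
move=> iF ic is'.
have mC := measurable_fcos iF; have mS := measurable_fsin iF.
pose b := \int[mu]_y `|f y|.
have bC xi : `|fcos mu f xi| <= b by exact: fcos_le.
have bS xi : `|fsin mu f xi| <= b by exact: fsin_le.
pose p xi := Psi xi * c xi * fcos mu f xi - Psi xi * s xi * fsin mu f xi.
pose q xi := Psi xi * c xi * fsin mu f xi + Psi xi * s xi * fcos mu f xi.
have ip : mu.-integrable setT (EFin \o p).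
  have := integrableB measurableT (integrable_bounded_mul ic mC bC) (integrable_bounded_mul is' mS bS).
  exact.
have iq : mu.-integrable setT (EFin \o q).
  have := integrableD measurableT (integrable_bounded_mul ic mS bS) (integrable_bounded_mul is' mC bC).
  exact.
have mp := measurable_fcos ip; have mps := measurable_fsin ip.
have mq := measurable_fcos iq; have mqs := measurable_fsin iq.
have mpp : measurable_fun setT p by apply/measurable_EFinP; exact: measurable_int ip.
have mqq : measurable_fun setT q by apply/measurable_EFinP; exact: measurable_int iq.
have E x : \int[mu]_xi (Psi xi * blend f c s x xi) = fcos mu p x + fsin mu q x.
  rewrite /fcos /fsin -RintegralD//; first last.
  - by apply: integrable_sin => //; meas.
  - by apply: integrable_cos => //; meas.
  by apply: eq_Rintegral => xi _; rewrite /blend /p /q (dotC xi x); ring.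
have m2 (h : 'rV[R]_n -> R) : measurable_fun setT h -> measurable_fun setT (fun x => (h x ^+ 2)%:E).
  by move=> mh; apply/measurable_EFinP; exact: measurable_funX.
have m3 (h k : 'rV[R]_n -> R) : measurable_fun setT h -> measurable_fun setT k ->
    measurable_fun setT (fun x => (h x ^+ 2 + k x ^+ 2)%:E).
  by move=> mh mk; apply/measurable_EFinP; apply: measurable_funD; exact: measurable_funX.
apply: (@le_trans _ _ (\int[mu]_x (2%:E * ((fcos mu p x ^+ 2 + fsin mu p x ^+ 2)%:E +
    (fcos mu q x ^+ 2 + fsin mu q x ^+ 2)%:E)))%E).
  apply: ge0_le_integral => //.
  - by move=> x _; rewrite lee_fin sqr_ge0.
  - under eq_fun do rewrite E; apply: m2; exact: measurable_funD.
  - by apply: emeasurable_funM => //; apply: emeasurable_funD; exact: m3.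
  - move=> x _; rewrite E -EFinD -EFinM lee_fin.
    have := sqr_ge0 (fcos mu p x - fsin mu q x).
    by have := sqr_ge0 (fsin mu p x); have := sqr_ge0 (fcos mu q x); nra.
rewrite ge0_integralZl//; try by [apply: emeasurable_funD; exact: m3|
  move=> x _; rewrite adde_ge0// lee_fin addr_ge0// sqr_ge0].
apply: lee_wpmul2l => //.
rewrite ge0_integralD//; try by [exact: m3|move=> x _; rewrite lee_fin addr_ge0// sqr_ge0].
apply: (le_trans (leeD (bessel ip) (bessel iq))).
rewrite -ge0_integralD//; try by [exact: m2|move=> x _; rewrite lee_fin sqr_ge0].
rewrite le_eqVlt; apply/orP; left; apply/eqP; apply: eq_integral => xi _.
by rewrite -EFinD; congr EFin; rewrite /p /q; ring.
Qed.

End bessel_blend.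

Section weighted_multiplier.
Context {R : realType} {n : nat}.
Let mu := @lebesgue_rV R n.

(** Up to two derivatives of the symbol in [t] cost at most a multiple of this factor, see
    [osc_le_w2]. *)
Definition w2 (xi : 'rV[R]_n) : R := 1 + dot xi xi.

Lemma w2_ge1 xi : 1 <= w2 xi. Proof. by rewrite lerDl dot_ge0. Qed.

Lemma measurable_w2 : measurable_fun setT w2.
Proof. by rewrite /w2; meas. Qed.

(** Three quarters of the exponent absorb the polynomial: 1 + v <= (1 + 1/k) (1 + k v) <= (1 + 1/k)
    exp (k v). *)
Lemma integrable_gauss_w2 (s : R) : 0 < s ->
  mu.-integrable setT (fun xi => (gauss s xi * w2 xi)%:E).
Proof.
move=> s0; pose k : R := pi * s ^+ 2 * (3 / 4).
have k0 : 0 < k by rewrite !mulr_gt0 ?pi_gt0 ?exprn_gt0.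
have s2 : 0 < s / 2 by rewrite divr_gt0.
apply: (le_integrable measurableT _ _ (integrable_mulrl (1 + k^-1) measurableT (@integrable_gauss R n _ s2))).
  apply/measurable_EFinP; apply: measurable_funM; last exact: measurable_w2.
  by apply: measurable_gauss; meas.
move=> xi _ /=; rewrite lee_fin.
have w0 : 0 <= w2 xi by exact: le_trans (w2_ge1 xi).
have k1 : 0 <= 1 + k^-1 by rewrite addr_ge0// invr_ge0 ltW.
rewrite !ger0_norm ?mulr_ge0 ?gauss_ge0//.
have v0 := dot_ge0 xi; set v := dot xi xi in v0 *.
have -> : gauss (s / 2) xi = gauss s xi * expR (k * v).
  by rewrite /gauss -expRD; congr expR; rewrite -/v /k; field.
rewrite mulrCA ler_wpM2l ?gauss_ge0//.
apply: (@le_trans _ _ ((1 + k^-1) * (1 + k * v))).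
  rewrite /w2 -/v -subr_ge0 (_ : _ - _ = k * v + k^-1); last by field; rewrite gt_eqF.
  by apply: addr_ge0; [exact: mulr_ge0 (ltW k0) v0|rewrite invr_ge0 ltW].
by rewrite ler_wpM2l// expR_ge1Dx.
Qed.

Variable N : nat.

Lemma integrable_smul_w2 s : 0 < s -> mu.-integrable setT (fun xi => (smul N s xi * w2 xi)%:E).
Proof.
move=> s0; apply: (eq_integrable _ (fun x => (\sum_(i < N)
    (hcoef N i * (gauss (s * Num.sqrt i.+1%:R) x * w2 x))%:E)%E)) => //.
  move=> x _; rewrite sumEFin; congr EFin; rewrite smulE mulr_suml.
  by apply: eq_bigr => i _; rewrite mulrA.
apply: integrable_sum => // i _; apply: integrable_mulrl => //.
by apply: integrable_gauss_w2; rewrite mulr_gt0// sqrtr_gt0.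
Qed.

Lemma integrable_tmul_w2 a j : 0 < a -> mu.-integrable setT (fun xi => (tmul N a j xi * w2 xi)%:E).
Proof.
move=> a0; have ap k : 0 < a / 2 ^+ k by rewrite divr_gt0// exprn_gt0.
case: j => [|k]; first exact: integrable_smul_w2.
apply: (eq_integrable _ ((fun xi => (smul N (a / 2 ^+ k.+1) xi * w2 xi)%:E) \-
  (fun xi => (smul N (a / 2 ^+ k) xi * w2 xi)%:E))%E) => //.
  move=> xi _; transitivity (((smul N (a / 2 ^+ k.+1) xi - smul N (a / 2 ^+ k) xi) * w2 xi)%:E) => //.
  by rewrite -EFinB; congr EFin; ring.
by apply: integrableB => //; apply: integrable_smul_w2.
Qed.

End weighted_multiplier.

(** * Derivatives of the Fourier transform of the measure *)

Section modulated.
Context {R : realType} {n : nat}.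
Variables (sigma : {finite_measure set 'rV[R]_n -> \bar R}) (M : R).
Hypothesis M0 : 0 <= M.
Hypothesis sM : sigma [set z | M < enorm z] = 0%E.
Let mu := @lebesgue_rV R n.

(** [sigma] lives on the ball of radius [M] only almost everywhere, while differentiation under the
    integral asks for bounds at every point; so the restriction is written into the integrand. *)
Definition insupp (z : 'rV[R]_n) : R := 1 - (M < enorm z)%R%:R.

(* the [k]-th derivative in [t] of the Fourier transform of [sigma] at [t xi],
   up to a phase *)
Definition osc (k : nat) (c t : R) (xi : 'rV[R]_n) : R :=
  \int[sigma]_z (insupp z * (2 * pi * dot z xi) ^+ k * cos (2 * pi * dot z xi * t + c)).

Lemma measurable_insupp : measurable_fun setT insupp.
Proof.
apply: measurable_funB => //; apply: measurable_ltr_ind => //.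
by apply: measurable_enorm; exact: measurable_id.
Qed.

Let S := \int[sigma]_z `|1 : R|.
Let S0 : 0 <= S. Proof. exact: Rintegral_ge0. Qed.

Let insupp_dot_le k z xi : `|insupp z * (2 * pi * dot z xi) ^+ k| <= (2 * pi * M * enorm xi) ^+ k.
Proof.
have p0 : 0 <= 2 * pi * M * enorm xi by rewrite !mulr_ge0 ?enorm_ge0 ?pi_ge0.
rewrite /insupp; case: (ltP M (enorm z)) => zM; first by rewrite subrr mul0r normr0 exprn_ge0.
rewrite subr0 mul1r normrX; apply: lerXn2r; rewrite ?nnegrE//.
rewrite normrM ger0_norm ?mulr_ge0 ?pi_ge0// -(mulrA (2 * pi)) ler_wpM2l ?mulr_ge0 ?pi_ge0//.
apply: (@le_trans _ _ (enorm z * enorm xi)); last by rewrite ler_wpM2r ?enorm_ge0.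
rewrite ler_norml dot_le_enorm andbT lerNl -dotNl.
by rewrite (le_trans (dot_le_enorm _ _))// enormN.
Qed.

Let osc_integrand k c t xi (z : 'rV[R]_n) : R :=
  insupp z * (2 * pi * dot z xi) ^+ k * cos (2 * pi * dot z xi * t + c).

Let osc_integrand_le k c t xi z : `|osc_integrand k c t xi z| <= (2 * pi * M * enorm xi) ^+ k.
Proof.
rewrite normrM -[leRHS]mulr1 ler_pM ?insupp_dot_le//; exact: cos_le1_norm.
Qed.

Let measurable_osc_integrand k c d (T : measurableType d) (t : T -> R) (xi z : T -> 'rV[R]_n) :
  measurable_fun setT t -> measurable_fun setT xi -> measurable_fun setT z ->
  measurable_fun setT (fun p => osc_integrand k c (t p) (xi p) (z p)).
Proof.
move=> mt mxi mz; apply: measurable_funM; last by apply: measurable_cosf; meas.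
apply: measurable_funM; first exact: (measurableT_comp measurable_insupp mz).
by apply: measurable_funX; meas.
Qed.

Let integrable_osc_integrand k c t xi :
  sigma.-integrable setT (EFin \o osc_integrand k c t xi).
Proof.
have ic : sigma.-integrable setT (EFin \o (fun=> (2 * pi * M * enorm xi) ^+ k)).
  exact: finite_measure_integrable_cst.
apply: (le_integrable measurableT _ _ ic).
  by apply/measurable_EFinP; apply: measurable_osc_integrand; meas.
by move=> z _ /=; rewrite lee_fin (le_trans (osc_integrand_le _ _ _ _ _))// ler_norm.
Qed.

Lemma measurable_osc k c d (T : measurableType d) (t : T -> R) (xi : T -> 'rV[R]_n) :
  measurable_fun setT t -> measurable_fun setT xi ->
  measurable_fun setT (fun p => osc k c (t p) (xi p)).
Proof.
move=> mt mxi.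
apply: (@measurable_Rintegral_param _ _ _ _ _ sigma
  (fun q : 'rV[R]_n * T => osc_integrand k c (t q.2) (xi q.2) q.1)).
by apply: measurable_osc_integrand; [exact: measurableT_comp|exact: measurableT_comp|meas].
Qed.

Lemma osc_le k c t xi : `|osc k c t xi| <= (2 * pi * M * enorm xi) ^+ k * S.
Proof.
rewrite (le_trans (le_normr_Rintegral measurableT (integrable_osc_integrand k c t xi)))//.
have i1 := integrable_one sigma.
rewrite /S -RintegralZl//; last exact: (integrable_norm i1).
apply: le_Rintegral => //.
- exact: (integrable_norm (integrable_osc_integrand k c t xi)).
- by apply: integrable_mulrl => //; exact: (integrable_norm i1).
- by move=> z _; rewrite normr1 mulr1; exact: osc_integrand_le.
Qed.

Lemma osc_le_w2 : exists2 C : R, 0 <= C & forall k c t xi, (k <= 2)%N ->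
  `|osc k c t xi| <= C * w2 xi.
Proof.
exists (2 * (1 + (2 * pi * M) ^+ 2) * S); first by rewrite !mulr_ge0// addr_ge0// sqr_ge0.
move=> k c t xi k2; rewrite (le_trans (osc_le _ _ _ _))//.
rewrite [leRHS]mulrAC ler_wpM2r//; set y := 2 * pi * M.
have e0 := enorm_ge0 xi; have y0 : 0 <= y by rewrite !mulr_ge0 ?pi_ge0.
have x0 : 0 <= y * enorm xi by rewrite mulr_ge0.
have -> : w2 xi = 1 + enorm xi ^+ 2 by rewrite enorm_sqr.
apply: (@le_trans _ _ ((1 + y * enorm xi) ^+ 2)).
  apply: (@le_trans _ _ ((1 + y * enorm xi) ^+ k)).
    by apply: lerXn2r; rewrite ?nnegrE ?addr_ge0// lerDr.
  by apply: ler_weXn2l => //; rewrite lerDl.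
have := sqr_ge0 (y * enorm xi - 1); have := sqr_ge0 y; have := sqr_ge0 (enorm xi); nra.
Qed.

Lemma is_derive_osc k c xi (t : R) :
  is_derive t 1 (fun t => osc k c t xi) (osc k.+1 (c + pi / 2) t xi).
Proof.
apply: (is_derive_under (B := setT) (f := fun t z => osc_integrand k c t xi z)
  (df := fun t z => osc_integrand k.+1 (c + pi / 2) t xi z)
  (G := fun=> (2 * pi * M * enorm xi) ^+ k.+1)) => //.
- move=> w z _; rewrite /osc_integrand; apply: is_derive_eq.
  rewrite !scaleRE addrA cosDpihalf exprS; ring.
- exact: finite_measure_integrable_cst.
Qed.

Lemma insupp_ae (f g : 'rV[R]_n -> R) : measurable_fun setT f -> measurable_fun setT g ->
  (forall z, insupp z = 1 -> f z = g z) -> \int[sigma]_z f z = \int[sigma]_z g z.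
Proof.
move=> mf mg fg; congr fine; apply: ae_eq_integral => //; try exact/measurable_EFinP.
exists [set z | M < enorm z]; split => //; first exact: measurable_enorm_gt.
move=> z /= hz; rewrite ltNge; apply/negP => zM; apply: hz => _.
by rewrite fg// /insupp ltNge zM subr0.
Qed.

Lemma scos_osc t xi : scos sigma (t *: xi) = osc 0 0 t xi.
Proof.
apply: insupp_ae.
- by apply: measurable_funM => //; apply: measurable_cosf; meas.
- by apply: measurable_osc_integrand; meas.
- move=> z z1; rewrite /osc_integrand z1 expr0 mulr1 addr0 dotZr.
  by congr (_ * cos _); ring.
Qed.

Lemma ssin_osc t xi : ssin sigma (t *: xi) = osc 0 (- (pi / 2)) t xi.
Proof.
apply: insupp_ae.
- by apply: measurable_funM => //; apply: measurable_sinf; meas.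
- by apply: measurable_osc_integrand; meas.
- move=> z z1; rewrite /osc_integrand z1 expr0 mulr1 cosB cos_pihalf sin_pihalf mulr0 add0r mulr1.
  by rewrite dotZr; congr (_ * sin _); ring.
Qed.

End modulated.

Lemma derive_line (R : realType) (V : normedModType R) (f : V -> R) (v a : V) (l : R) :
  is_derive (0 : R) 1 (fun h : R => f (h *: v + a)) l -> 'D_v f a = l.
Proof.
move=> d; have := @derive_val _ _ _ _ _ _ _ d; rewrite /derive => <-.
have fE (h : R) : f (h *: v + a) = f ((h *: (1 : R) + 0) *: v + a).
  by rewrite addr0 scaleRE mulr1.
have f0 : f a = f ((0 : R) *: v + a) by rewrite scale0r add0r.
suff -> : (fun h : R => h^-1 *: ((f \o shift a) (h *: v) - f a)) =
    (fun h : R => h^-1 *: (((fun h : R => f (h *: v + a)) \o shift 0) (h *: 1) - f (0 *: v + a))) by [].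
by apply/funext => h; rewrite /= -f0 -fE.
Qed.

Section gradient_bound.
Context {R : realType} {n : nat}.
Variables (sigma : {finite_measure set 'rV[R]_n -> \bar R}) (M : R).
Hypothesis M0 : 0 <= M.
Hypothesis sM : sigma [set z | M < enorm z] = 0%E.
Local Notation osc := (osc sigma M).

Let insupp_bounded (z : 'rV[R]_n) : `|insupp M z| <= 1.
Proof. by rewrite /insupp; case: (M < enorm z); rewrite /= ?subrr ?subr0 ?normr0 ?normr1. Qed.

Let dirint (v : 'rV[R]_n) (c : R) (eta : 'rV[R]_n) (z : 'rV[R]_n) : R :=
  insupp M z * (2 * pi * dot z v) * cos (2 * pi * dot z eta + c).

Let dirint_le v c eta z : `|dirint v c eta z| <= 2 * pi * M * enorm v.
Proof.
rewrite normrM -[leRHS]mulr1 ler_pM ?cos_le1_norm//.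
rewrite /insupp; case: (ltP M (enorm z)) => zM.
  by rewrite subrr mul0r normr0 !mulr_ge0 ?enorm_ge0 ?pi_ge0.
rewrite subr0 mul1r normrM ger0_norm ?mulr_ge0 ?pi_ge0// -(mulrA (2 * pi)) ler_wpM2l ?mulr_ge0 ?pi_ge0//.
apply: (@le_trans _ _ (enorm z * enorm v)); last by rewrite ler_wpM2r ?enorm_ge0.
rewrite ler_norml dot_le_enorm andbT lerNl -dotNl.
by rewrite (le_trans (dot_le_enorm _ _))// enormN.
Qed.

Let mdirint v c eta : measurable_fun setT (dirint v c eta).
Proof.
apply: measurable_funM; last by apply: measurable_cosf; meas.
by apply: measurable_funM; [exact: measurable_insupp|meas].
Qed.

Let idirint v c eta : sigma.-integrable setT (EFin \o dirint v c eta).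
Proof.
have ic : sigma.-integrable setT (EFin \o (fun=> 2 * pi * M * enorm v)).
  exact: finite_measure_integrable_cst.
apply: (le_integrable measurableT _ _ ic); first exact/measurable_EFinP.
by move=> z _ /=; rewrite lee_fin (le_trans (dirint_le _ _ _ _))// ler_norm.
Qed.

Let dirosc v c eta := \int[sigma]_z dirint v c eta z.

Let cosint c (eta z : 'rV[R]_n) : R := insupp M z * cos (2 * pi * dot z eta + c).

Let icosint c eta : sigma.-integrable setT (EFin \o cosint c eta).
Proof.
have i1 : sigma.-integrable setT (EFin \o (fun=> 1 : R)) := integrable_one sigma.
apply: (le_integrable measurableT _ _ i1).
  apply/measurable_EFinP; apply: measurable_funM; first exact: measurable_insupp.
  by apply: measurable_cosf; meas.
by move=> z _ /=; rewrite lee_fin normr1 normrM -[leRHS]mulr1 ler_pM// ?insupp_bounded ?cos_le1_norm.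
Qed.

Let derive_cosint v c eta :
  'D_v (fun y => \int[sigma]_z cosint c y z) eta = dirosc v (c + pi / 2) eta.
Proof.
have d : is_derive (0 : R) 1 (fun h : R => \int[sigma]_z cosint c (h *: v + eta) z)
    (\int[sigma]_z dirint v (c + pi / 2) (0 *: v + eta) z).
  apply: (is_derive_under (B := setT) (f := fun h z => cosint c (h *: v + eta) z)
    (df := fun h z => dirint v (c + pi / 2) (h *: v + eta) z) (G := fun=> 2 * pi * M * enorm v)).
  - exact: measurableT.
  - by move=> w; exact: icosint.
  - move=> w z _; suff : is_derive w (1 : R) (fun h : R => cosint c (h *: v + eta) z)
      (dirint v (c + pi / 2) (w *: v + eta) z) by [].
    rewrite (_ : (fun h => _) = fun h : R => insupp M z * cos (2 * pi * (h * dot z v + dot z eta) + c)).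
      apply: is_derive_eq; rewrite !scaleRE /dirint addrA cosDpihalf dotDr dotZr; ring.
    by apply/funext => h; rewrite /cosint/= dotDr dotZr.
  - exact: finite_measure_integrable_cst.
  - by move=> w z _; exact: dirint_le.
rewrite (derive_line d).
by rewrite scale0r add0r.
Qed.

Let mcosint c eta : measurable_fun setT (cosint c eta).
Proof.
apply: measurable_funM; first exact: measurable_insupp.
by apply: measurable_cosf; meas.
Qed.

Let Re_fourier : (fun y => complex.Re (fourier_measure sigma y)) =
  fun y => \int[sigma]_z cosint 0 y z.
Proof.
apply/funext => y /=; apply: (insupp_ae sM) => //.
  by apply: measurable_cosf; meas.
by move=> z z1; rewrite /cosint z1 mul1r addr0 cosN.
Qed.

Let Im_fourier : (fun y => complex.Im (fourier_measure sigma y)) =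
  fun y => \int[sigma]_z cosint (pi / 2) y z.
Proof.
apply/funext => y /=; apply: (insupp_ae sM) => //.
  by apply: measurable_sinf; meas.
by move=> z z1; rewrite /cosint z1 mul1r sinN cosDpihalf.
Qed.

Lemma normc_fourier_sqr xi :
  Normc.normc (fourier_measure sigma xi) ^+ 2 = scos sigma xi ^+ 2 + ssin sigma xi ^+ 2.
Proof.
rewrite /fourier_measure /cintegral /= sqr_sqrtr ?addr_ge0 ?sqr_ge0//.
congr (_ ^+ 2 + _).
  by apply: eq_Rintegral => z _; rewrite mul1r cosN.
rewrite -[RHS]sqrrN; congr (_ ^+ 2).
have is' : sigma.-integrable setT (EFin \o (fun z : 'rV[R]_n => 1 * sin (2 * pi * dot z xi))).
  by apply: integrable_sin; [exact: integrable_one|meas].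
rewrite /ssin /fsin -mulN1r -RintegralZl//.
by apply: eq_Rintegral => z _; rewrite mul1r mulN1r sinN.
Qed.

Let diroscE v c eta : dirosc v c eta = \sum_(j < n) v 0 j * dirosc (delta_mx 0 j) c eta.
Proof.
rewrite (eq_bigr (fun j => \int[sigma]_z (v 0 j * dirint (delta_mx 0 j) c eta z))); last first.
  by move=> j _; rewrite RintegralZl.
rewrite -Rintegral_sum; last first.
  by move=> j; exact: (integrable_mulrl _ measurableT (idirint _ c eta)).
apply: eq_Rintegral => z _; rewrite /dirint [X in _ * (_ * X) * _](_ : _ = \sum_(j < n) v 0 j * dot z (delta_mx 0 j)).
  by rewrite !mulr_sumr mulr_suml; apply: eq_bigr => j _; ring.
apply: eq_bigr => j _; rewrite mulrC; congr (_ * _).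
rewrite /dot (bigD1 j)//= big1; last by move=> i ij; rewrite mxE eqxx (negbTE ij) mulr0.
by rewrite mxE !eqxx mulr1 addr0.
Qed.

(** The derivative of m (t xi) in [t] is the scalar product of [xi] with the gradient at [t xi];
    Cauchy-Schwarz is applied to its real and imaginary parts. *)
Lemma osc1_sqr_le t xi : osc 1 (pi / 2) t xi ^+ 2 + osc 1 0 t xi ^+ 2 <=
  enorm xi ^+ 2 * cvnorm (gradient (fourier_measure sigma) (t *: xi)) ^+ 2.
Proof.
have E c : osc 1 c t xi = dirosc xi c (t *: xi).
  apply: eq_Rintegral => z _; rewrite /dirint expr1 dotZr.
  by congr (_ * cos (_ + _)); ring.
(* The phase [pi] is the one produced by differentiating the imaginary part, whose own phase is
   [pi / 2]. *)
have EN : dirosc xi pi (t *: xi) = - dirosc xi 0 (t *: xi).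
  rewrite /dirosc -mulN1r -RintegralZl//.
  by apply: eq_Rintegral => z _; rewrite /dirint cosDpi addr0; ring.
rewrite !E -[dirosc _ 0 _ ^+ 2]sqrrN -EN.
pose a : 'rV[R]_n := \row_j dirosc (delta_mx 0 j) (pi / 2) (t *: xi).
pose b : 'rV[R]_n := \row_j dirosc (delta_mx 0 j) pi (t *: xi).
have -> : dirosc xi (pi / 2) (t *: xi) = dot xi a.
  by rewrite diroscE; apply: eq_bigr => j _; rewrite mxE.
have -> : dirosc xi pi (t *: xi) = dot xi b.
  by rewrite diroscE; apply: eq_bigr => j _; rewrite mxE.
have cs (u v : 'rV[R]_n) : dot u v ^+ 2 <= enorm u ^+ 2 * enorm v ^+ 2.
  rewrite -exprMn -real_normK ?num_real//; apply: lerXn2r; rewrite ?nnegrE ?mulr_ge0 ?enorm_ge0//.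
  rewrite ler_norml dot_le_enorm andbT lerNl -dotNl.
  by rewrite (le_trans (dot_le_enorm _ _))// enormN.
apply: (le_trans (lerD (cs _ _) (cs _ _))); rewrite -mulrDr ler_wpM2l ?sqr_ge0//.
rewrite le_eqVlt; apply/orP; left; apply/eqP.
rewrite (enorm_sqr a) (enorm_sqr b) /cvnorm sqr_sqrtr; last by apply: sumr_ge0 => j _; rewrite sqr_ge0.
rewrite /dot -big_split/=; apply: eq_bigr => j _; rewrite !mxE.
rewrite /cpartial /partial /= sqr_sqrtr ?addr_ge0 ?sqr_ge0// -!expr2.
rewrite Re_fourier Im_fourier !derive_cosint add0r.
by rewrite -splitr.
Qed.

Lemma measurable_cvnorm_gradient :
  measurable_fun setT (fun xi => cvnorm (gradient (fourier_measure sigma) xi) ^+ 2).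
Proof.
have mdir v c : measurable_fun setT (dirosc v c).
  apply: (@measurable_Rintegral_param _ _ _ _ _ sigma (fun q => dirint v c q.2 q.1)).
  apply: measurable_funM; last by apply: measurable_cosf; meas.
  by apply: measurable_funM; [exact: (measurableT_comp (measurable_insupp M) measurable_fst)|meas].
rewrite (_ : (fun xi => _) = fun xi => \sum_(j < n) (dirosc (delta_mx 0 j) (0 + pi / 2) xi ^+ 2 +
    dirosc (delta_mx 0 j) (pi / 2 + pi / 2) xi ^+ 2)).
  by apply: measurable_sum => j; apply: measurable_funD; apply: measurable_funX.
apply/funext => xi; rewrite /cvnorm sqr_sqrtr; last by apply: sumr_ge0 => j _; rewrite sqr_ge0.
apply: eq_bigr => j _; rewrite !mxE.
rewrite /cpartial /partial /= sqr_sqrtr ?addr_ge0 ?sqr_ge0//.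
by rewrite Re_fourier Im_fourier !derive_cosint.
Qed.

End gradient_bound.

Section blend_derivative.
Context {R : realType} {n : nat}.
Variables (sigma : {finite_measure set 'rV[R]_n -> \bar R}) (M : R).
Hypothesis M0 : 0 <= M.
Hypothesis sM : sigma [set z | M < enorm z] = 0%E.
Let mu := @lebesgue_rV R n.
Local Notation osc := (osc sigma M).
Variables (f Psi : 'rV[R]_n -> R).
Hypothesis mPsi : measurable_fun setT Psi.
Hypothesis iF : mu.-integrable setT (EFin \o f).
Hypothesis iPsi : mu.-integrable setT (fun xi => (Psi xi * w2 xi)%:E).

Lemma blend_le : exists2 b : R, 0 <= b & forall (c s : 'rV[R]_n -> R) x xi,
  `|blend f c s x xi| <= b * (`|c xi| + `|s xi|).
Proof.
pose b := \int[mu]_y `|f y|; have b0 : 0 <= b by exact: Rintegral_ge0.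
exists (2 * b); first by rewrite mulr_ge0.
move=> c s x xi; have hC := fcos_le xi iF; have hS := fsin_le xi iF.
have -> : 2 * b * (`|c xi| + `|s xi|) =
  1 * (b * `|c xi| + b * `|s xi|) + 1 * (b * `|c xi| + b * `|s xi|) by ring.
rewrite (le_trans (ler_normD _ _))// !normrM; apply: lerD; apply: ler_pM => //.
- exact: cos_le1_norm.
- rewrite (le_trans (ler_normB _ _))// !normrM; apply: lerD; exact: ler_wpM2r.
- exact: sin_le1_norm.
- rewrite (le_trans (ler_normD _ _))// !normrM; apply: lerD; exact: ler_wpM2r.
Qed.

Lemma measurable_blend d (T : measurableType d) (c s : T -> 'rV[R]_n -> R)
    (x xi : T -> 'rV[R]_n) :
  measurable_fun setT x -> measurable_fun setT xi ->
  measurable_fun setT (fun p => c p (xi p)) -> measurable_fun setT (fun p => s p (xi p)) ->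
  measurable_fun setT (fun p => blend f (c p) (s p) (x p) (xi p)).
Proof.
move=> mx mxi mc ms.
have mC : measurable_fun setT (fun p => fcos mu f (xi p)).
  exact: (measurableT_comp (measurable_fcos iF)).
have mS : measurable_fun setT (fun p => fsin mu f (xi p)).
  exact: (measurableT_comp (measurable_fsin iF)).
apply: measurable_funD; apply: measurable_funM.
- by apply: measurable_cosf; meas.
- by apply: measurable_funB; apply: measurable_funM.
- by apply: measurable_sinf; meas.
- by apply: measurable_funD; apply: measurable_funM.
Qed.

Let mw := @measurable_w2 R n.
Let w0 (xi : 'rV[R]_n) : 0 < w2 xi. Proof. exact: lt_le_trans (w2_ge1 xi). Qed.

Let mosc k c t : measurable_fun setT (osc k c t).
Proof. exact: (measurable_osc sigma M k c (t := fun=> t) (xi := id)). Qed.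

Lemma integrable_psi_osc k c t : (k <= 2)%N ->
  mu.-integrable setT (fun xi => (Psi xi * osc k c t xi)%:E).
Proof.
move=> k2; have [C C0 hC] := osc_le_w2 sigma M0.
apply: (le_integrable measurableT _ _ (integrable_mulrr C measurableT iPsi)).
  by apply/measurable_EFinP; apply: measurable_funM => //; exact: mosc.
move=> xi _ /=; rewrite lee_fin !normrM -mulrA ler_wpM2l//.
by rewrite (le_trans (hC _ _ _ _ k2))// mulrC !ger0_norm// ltW.
Qed.

(* the [k]-th derivative in [t] of the multiplier of the cut-off operator,
   applied to [f] *)
Definition blend_int (k : nat) (c c' : R) (x : 'rV[R]_n) (t : R) : R :=
  \int[mu]_xi (Psi xi * blend f (osc k c t) (osc k c' t) x xi).

Let bound : exists2 D : R, 0 <= D & forall k c c' t x xi, (k <= 2)%N ->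
  `|Psi xi * blend f (osc k c t) (osc k c' t) x xi| <= `|Psi xi * w2 xi| * D.
Proof.
have [C C0 hC] := osc_le_w2 sigma M0; have [b b0 hb] := blend_le.
exists (b * (C + C)); first by rewrite mulr_ge0// addr_ge0.
move=> k c c' t x xi k2; rewrite !normrM -mulrA ler_wpM2l// (le_trans (hb _ _ _ _))//.
rewrite mulrCA ler_wpM2l// (ger0_norm (ltW (w0 xi))) mulrC mulrDl.
by apply: lerD; exact: hC.
Qed.

Let mint k c c' t x : measurable_fun setT
  (fun xi => Psi xi * blend f (osc k c t) (osc k c' t) x xi).
Proof.
apply: measurable_funM => //.
exact: (measurable_blend (c := fun=> osc k c t) (s := fun=> osc k c' t) (x := fun=> x) (xi := id)).
Qed.

Let idom D : mu.-integrable setT (fun xi => (`|Psi xi * w2 xi| * D)%:E).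
Proof. by apply: integrable_mulrr => //; exact: (integrable_norm iPsi). Qed.

Let iint k c c' t x : (k <= 2)%N ->
  mu.-integrable setT (fun xi => (Psi xi * blend f (osc k c t) (osc k c' t) x xi)%:E).
Proof.
move=> k2; have [D D0 hD] := bound.
apply: (le_integrable measurableT _ _ (idom D)); first exact/measurable_EFinP.
move=> xi _; rewrite lee_fin (le_trans (hD _ _ _ _ _ _ k2))//.
exact: ler_norm.
Qed.

Lemma is_derive_blend_int k c c' x (t : R) : (k <= 1)%N ->
  is_derive t 1 (blend_int k c c' x) (blend_int k.+1 (c + pi / 2) (c' + pi / 2) x t).
Proof.
move=> k1; have [D D0 hD] := bound.
apply: (is_derive_under (B := setT)
  (f := fun t xi => Psi xi * blend f (osc k c t) (osc k c' t) x xi)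
  (df := fun t xi => Psi xi * blend f (osc k.+1 (c + pi / 2) t) (osc k.+1 (c' + pi / 2) t) x xi)
  (G := fun xi => `|Psi xi * w2 xi| * D)).
- exact: measurableT.
- by move=> w; apply: iint; rewrite (leq_trans k1).
- move=> w xi _.
  have d1 := is_derive_osc sigma M0 k c xi w; have d2 := is_derive_osc sigma M0 k c' xi w.
  by rewrite /blend; apply: is_derive_eq; rewrite !scaleRE; ring.
- exact: idom.
- by move=> w xi _; exact: hD.
Qed.

Lemma measurable_blend_int k c c' d (T : measurableType d) (x : T -> 'rV[R]_n) (t : T -> R) :
  measurable_fun setT x -> measurable_fun setT t ->
  measurable_fun setT (fun p => blend_int k c c' (x p) (t p)).
Proof.
move=> mx mt.
apply: (@measurable_Rintegral_param _ _ _ _ _ mu (fun q : 'rV[R]_n * T =>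
  Psi q.1 * blend f (osc k c (t q.2)) (osc k c' (t q.2)) (x q.2) q.1)).
apply: measurable_funM; first exact: measurableT_comp.
apply: (measurable_blend (c := fun q : 'rV[R]_n * T => osc k c (t q.2))
  (s := fun q : 'rV[R]_n * T => osc k c' (t q.2)) (x := fun q => x q.2) (xi := fst)) => //.
- exact: measurableT_comp.
- by apply: measurable_osc => //; exact: measurableT_comp.
- by apply: measurable_osc => //; exact: measurableT_comp.
Qed.

Local Notation leb := (@lebesgue_measure R).

Lemma measurable_osc_sqr k c c' :
  measurable_fun setT (fun p : 'rV[R]_n * measurableTypeR R =>
    (osc k c p.2 p.1 ^+ 2 + osc k c' p.2 p.1 ^+ 2)).
Proof.
by apply: measurable_funD; apply: measurable_funX; apply: measurable_osc.
Qed.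

(** Bessel's inequality in [x] is used for each fixed [t]; by Tonelli the integral in [t] then falls
    on the symbol alone, which is what the decay hypotheses control. *)
Lemma blend_int_l2 k c c' (A : set (measurableTypeR R)) : measurable A -> (k <= 2)%N ->
  (\int[mu]_x \int[leb]_(t in A) (blend_int k c c' x t ^+ 2)%:E <=
   2%:E * \int[mu]_xi ((Psi xi ^+ 2 * (fcos mu f xi ^+ 2 + fsin mu f xi ^+ 2))%:E *
     \int[leb]_(t in A) (osc k c t xi ^+ 2 + osc k c' t xi ^+ 2)%:E))%E.
Proof.
move=> mA k2.
pose h (p : 'rV[R]_n * measurableTypeR R) : \bar R :=
  ((blend_int k c c' p.1 p.2 ^+ 2)%:E * (\1_A p.2)%:E)%E.
pose g (p : 'rV[R]_n * measurableTypeR R) : \bar R :=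
  ((Psi p.1 ^+ 2 * (fcos mu f p.1 ^+ 2 + fsin mu f p.1 ^+ 2))%:E *
   ((osc k c p.2 p.1 ^+ 2 + osc k c' p.2 p.1 ^+ 2)%:E * (\1_A p.2)%:E))%E.
have P0 xi : 0 <= Psi xi ^+ 2 * (fcos mu f xi ^+ 2 + fsin mu f xi ^+ 2).
  by rewrite mulr_ge0 ?addr_ge0 ?sqr_ge0.
have mind : measurable_fun setT (fun p : 'rV[R]_n * measurableTypeR R => (\1_A p.2)%:E : \bar R).
  by apply/measurable_EFinP; apply: measurableT_comp => //; exact: measurable_indic.
have mh : measurable_fun setT h.
  apply: emeasurable_funM => //; apply/measurable_EFinP; apply: measurable_funX.
  exact: measurable_blend_int.
have mP : measurable_fun setT (fun xi => Psi xi ^+ 2 * (fcos mu f xi ^+ 2 + fsin mu f xi ^+ 2)).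
  apply: measurable_funM; first exact: measurable_funX.
  by apply: measurable_funD; apply: measurable_funX; [exact: measurable_fcos|exact: measurable_fsin].
have mos := measurable_osc_sqr k c c'.
have mg : measurable_fun setT g.
  apply: emeasurable_funM; last by apply: emeasurable_funM => //; exact/measurable_EFinP.
  by apply/measurable_EFinP; exact: (measurableT_comp mP measurable_fst).
have h0 p : (0 <= h p)%E by rewrite mule_ge0// lee_fin sqr_ge0.
have g0 p : (0 <= g p)%E.
  apply: mule_ge0; first by rewrite lee_fin P0.
  by apply: mule_ge0; rewrite lee_fin// addr_ge0 ?sqr_ge0.
apply: (@le_trans _ _ (\int[mu]_x \int[leb]_t h (x, t))%E).
  rewrite le_eqVlt; apply/orP; left; apply/eqP; apply: eq_integral => x _.
  by rewrite integral_mkcond epatch_indic.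
rewrite (@fubini_tonelli _ _ _ _ _ mu leb h)//.
apply: (@le_trans _ _ (\int[leb]_t (2%:E * \int[mu]_xi g (xi, t)))%E).
  apply: ge0_le_integral => //.
  - by move=> t _; apply: integral_ge0 => x _; exact: h0.
  - exact: (measurable_fun_fubini_tonelli_G (m1 := mu)).
  - by apply: emeasurable_funM => //; exact: (measurable_fun_fubini_tonelli_G (m1 := mu)).
  - move=> t _; rewrite /h /g /=.
    rewrite indicE; case: (t \in A) => /=; last first.
      under eq_integral do rewrite mule0; rewrite integral0.
      by rewrite mule_ge0//; apply: integral_ge0 => xi _; rewrite !mule0.
    under eq_integral do rewrite mule1.
    apply: (le_trans (bessel_blend iF (integrable_psi_osc c t k2) (integrable_psi_osc c' t k2))).
    apply: lee_wpmul2l => //; rewrite le_eqVlt; apply/orP; left; apply/eqP.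
    by apply: eq_integral => xi _; rewrite mule1 -EFinM.
rewrite ge0_integralZl//; last 2 first.
  exact: (measurable_fun_fubini_tonelli_G (m1 := mu)).
  by move=> t _; apply: integral_ge0 => xi _; exact: g0.
apply: lee_wpmul2l => //.
rewrite -(@fubini_tonelli _ _ _ _ _ mu leb g)//.
rewrite le_eqVlt; apply/orP; left; apply/eqP; apply: eq_integral => xi _.
rewrite /g/= ge0_integralZl//.
- by rewrite [in RHS]integral_mkcond epatch_indic.
- apply: emeasurable_funM.
    apply/measurable_EFinP; apply: measurable_funD; apply: measurable_funX;
      exact: (measurable_osc sigma M k _ (T := measurableTypeR R) (t := id) (xi := fun=> xi)).
  by apply/measurable_EFinP; exact: measurable_indic.
- by move=> t _; rewrite mule_ge0// lee_fin addr_ge0// sqr_ge0.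
- by rewrite lee_fin P0.
Qed.

End blend_derivative.

(** * Size of the symbols of the pieces *)

Section symbol.
Context {R : realType} {n : nat}.
Variables (N : nat) (alpha : R).
Hypothesis N0 : (0 < N)%N.
Hypothesis N4 : 2 * alpha + 1 <= 4 * N%:R.
Hypothesis alpha12 : 2^-1 < alpha.

Lemma bernoulli_ge (y : R) k : 0 <= y <= 1 -> 1 - k%:R * y <= (1 - y) ^+ k.
Proof.
move=> /andP[y0 y1]; elim: k => [|k IH]; first by rewrite mul0r subr0 expr0.
rewrite exprS -natr1; have k0 : 0 <= k%:R :> R by [].
have := ler_wpM2l (_ : 0 <= 1 - y) IH; rewrite subr_ge0 => /(_ y1).
have := mulr_ge0 k0 (sqr_ge0 y); nra.
Qed.

(** The factor 4 is the square of the ratio of consecutive scales. The first upper bound is the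
    vanishing at low frequency, the second, by Bernoulli's inequality, the decay at high
    frequency. *)
Lemma hmul_diff (v : R) : 0 <= v ->
  [/\ 0 <= hmul N v - hmul N (4 * v), hmul N v - hmul N (4 * v) <= (4 * v) ^+ N &
      hmul N v - hmul N (4 * v) <= N%:R * expR (- v)].
Proof.
move=> v0; have e1 : expR (- v) <= 1 by rewrite expR_le1 oppr_le0.
have e4 : expR (- (4 * v)) <= 1 by rewrite expR_le1 oppr_le0 mulr_ge0.
have mono : expR (- (4 * v)) <= expR (- v) by rewrite ler_expR; lra.
have -> : hmul N v - hmul N (4 * v) = (1 - expR (- (4 * v))) ^+ N - (1 - expR (- v)) ^+ N.
  by rewrite /hmul; ring.
have p1 : 0 <= (1 - expR (- v)) ^+ N by rewrite exprn_ge0// subr_ge0.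
have p2 : (1 - expR (- (4 * v))) ^+ N <= 1.
  by rewrite exprn_ile1// ?subr_ge0// lerBlDr lerDl expR_ge0.
split.
- by rewrite subr_ge0; apply: lerXn2r; rewrite ?nnegrE ?subr_ge0//; lra.
- apply: (@le_trans _ _ ((1 - expR (- (4 * v))) ^+ N)); first by rewrite lerBlDr lerDl.
  apply: lerXn2r; rewrite ?nnegrE ?subr_ge0 ?mulr_ge0//.
  by have := expR_ge1Dx (- (4 * v)); lra.
- have := @bernoulli_ge (expR (- v)) N; rewrite expR_ge0 e1 => /(_ isT); lra.
Qed.

(** The power of [tau] will be cancelled by the decay of the measure, the minimum will be summed
    over [a] by [dyad_sum], and [1 + tau ^+ 2] pays for the derivative in [t]. For [tau <= 1] the
    order of vanishing [4 * N >= 2 * alpha + 1] is used; for [tau > 1] the right side is at least a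
    constant, because [2 * alpha > 1]. *)
Lemma tmul_sqr_le : exists2 C : R, 0 < C & forall (a tau : R) (j : nat) (xi : 'rV[R]_n), 0 < a ->
  tau = a / 2 ^+ j.+1 * enorm xi ->
  tmul N a j.+1 xi ^+ 2 * (1 + tau ^+ 2) <= C * (tau `^ (2 * alpha) * Num.min tau tau^-1).
Proof.
exists (2 * (4 * pi) ^+ (2 * N) + N%:R ^+ 2).
  by rewrite ltr_pwDr ?exprn_gt0 ?ltr0n// mulr_ge0// exprn_ge0// mulr_ge0// pi_ge0.
move=> a tau j xi a0 tauE; have p0 : 0 < 2 ^+ j :> R by rewrite exprn_gt0.
have tau0 : 0 <= tau by rewrite tauE mulr_ge0 ?enorm_ge0// divr_ge0 ?exprn_ge0// ltW.
pose v := pi * tau ^+ 2.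
have v0 : 0 <= v by rewrite mulr_ge0 ?pi_ge0 ?sqr_ge0.
have -> : tmul N a j.+1 xi = hmul N v - hmul N (4 * v).
  rewrite /= /smul -enorm_sqr; congr (hmul N _ - hmul N _); rewrite /v tauE.
    by ring.
  by rewrite (exprS 2 j); field; rewrite gt_eqF.
have [d0 d1 d2] := hmul_diff v0; set D := hmul N v - _ in d0 d1 d2 *.
have C1 : 0 <= 2 * (4 * pi) ^+ (2 * N) :> R by rewrite mulr_ge0// exprn_ge0// mulr_ge0// pi_ge0.
have C2 : 0 <= N%:R ^+ 2 :> R by rewrite sqr_ge0.
have [t1|t1] := ltP 1 tau.
  have tp : 0 < tau by lra.
  have R1 : 1 <= tau `^ (2 * alpha) * Num.min tau tau^-1.
    rewrite min_r; last by rewrite (le_trans _ (ltW t1))// invf_le1// ltW.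
    rewrite -powR_inv1// -powRD; last by rewrite (gt_eqF tp) implybT.
    apply: (@le_trans _ _ (tau `^ 0)); first by rewrite powRr0.
    apply: ler_powR; first exact: ltW.
    by rewrite subr_ge0 -ler_pdivrMl// mulr1 ltW.
  apply: (@le_trans _ _ (N%:R ^+ 2)); last first.
    apply: (@le_trans _ _ ((2 * (4 * pi) ^+ (2 * N) + N%:R ^+ 2) * 1)); first by rewrite mulr1 lerDr.
    by rewrite ler_wpM2l// addr_ge0.
  apply: (@le_trans _ _ ((N%:R * expR (- v)) ^+ 2 * (1 + tau ^+ 2))).
    rewrite ler_wpM2r ?addr_ge0 ?sqr_ge0//; apply: lerXn2r; rewrite ?nnegrE ?mulr_ge0 ?expR_ge0//.
  rewrite exprMn -mulrA ler_piMr// -expRM_natl mulrN expRN mulrC ler_pdivrMr ?expR_gt0// mul1r.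
  apply: (le_trans _ (expR_ge1Dx _)); rewrite lerD2l /v.
  by have := @pi_ge2 R; have := sqr_ge0 tau; nra.
have [t0|tp] := eqVneq tau 0.
  have D0 : D = 0.
    by apply/eqP; rewrite eq_le d0 andbT (le_trans d1)// /v t0 expr0n/= !mulr0 expr0n gtn_eqF.
  by rewrite D0 expr0n/= mul0r !mulr_ge0 ?powR_ge0 ?addr_ge0// le_min invr_ge0 tau0.
have {}tp : 0 < tau by rewrite lt_neqAle eq_sym tp.
rewrite min_l; last by rewrite (le_trans t1)// -[leLHS]invr1 lef_pV2 ?posrE.
have -> : tau `^ (2 * alpha) * tau = tau `^ (2 * alpha + 1).
  by rewrite powRD ?powRr1// (gt_eqF tp) implybT.
have hp : (tau ^+ 2) ^+ (2 * N) <= tau `^ (2 * alpha + 1).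
  rewrite -exprM -powR_mulrn// ger_powR ?tp//.
  by rewrite mulnA natrM.
apply: (@le_trans _ _ (((4 * v) ^+ N) ^+ 2 * 2)).
  apply: ler_pM; rewrite ?sqr_ge0 ?addr_ge0 ?sqr_ge0//.
    have v4 : 0 <= (4 * v) ^+ N by rewrite exprn_ge0// mulr_ge0.
    by apply: (lerXn2r 2); rewrite ?nnegrE.
  have : tau ^+ 2 <= 1 by rewrite exprn_ile1.
  lra.
have -> : ((4 * v) ^+ N) ^+ 2 * 2 = 2 * (4 * pi) ^+ (2 * N) * (tau ^+ 2) ^+ (2 * N).
  by rewrite -exprM mulnC /v mulrA exprMn; ring.
have := ler_wpM2l C1 hp; have := mulr_ge0 C2 (powR_ge0 tau (2 * alpha + 1)).
by rewrite mulrDl; lra.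
Qed.

End symbol.

Section dyadic_l2.
Context {R : realType} {n : nat}.
Variables (sigma : {finite_measure set 'rV[R]_n -> \bar R}) (M : R) (N : nat) (alpha : R).
Hypothesis M0 : 0 <= M.
Hypothesis sM : sigma [set z | M < enorm z] = 0%E.
Hypothesis N0 : (0 < N)%N.
Hypothesis N4 : 2 * alpha + 1 <= 4 * N%:R.
Hypothesis alpha12 : 2^-1 < alpha.
Let mu := @lebesgue_rV R n.
Local Notation leb := (@lebesgue_measure R).
Local Notation osc := (osc sigma M).

Definition mean_decay (g : 'rV[R]_n -> R) : Prop := exists2 C : R, 0 <= C & forall xi,
  (\int[leb]_(t in `[1%R, 2%R]) (g (t *: xi))%:E <= (C * (1 + enorm xi) `^ (- (2 * alpha)))%:E)%E.

Hypothesis decay : mean_decay (fun xi => Normc.normc (fourier_measure sigma xi) ^+ 2).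
Hypothesis gdecay : mean_decay (fun xi => cvnorm (gradient (fourier_measure sigma) xi) ^+ 2).

Lemma ge0_integral_dilate (g : R -> \bar R) (a : R) : 0 < a ->
  measurable_fun setT (g : measurableTypeR R -> \bar R) -> (forall t, 0 <= g t)%E ->
  (\int[leb]_(t in `[a, (2 * a)%R]) g t = a%:E * \int[leb]_(t in `[1%R, 2%R]) g (a * t)%R)%E.
Proof.
move=> a0 mg g0.
pose h (t : R) : \bar R := (g t * (\1_(`[a, (2 * a)%R]%classic : set R) t)%:E)%E.
have mh : measurable_fun setT (h : measurableTypeR R -> \bar R).
  by apply: emeasurable_funM => //; apply/measurable_EFinP; exact: measurable_indic.
have h0 t : (0 <= h t)%E by rewrite mule_ge0// lee_fin.
transitivity (\int[leb]_x h x)%E; first by rewrite integral_mkcond epatch_indic.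
transitivity (a%:E * \int[leb]_x h (a * x + 0)%R)%E.
  by rewrite (ge0_integral_affine 0 a0 mh h0) muleA -EFinM mulfV ?mul1e// gt_eqF.
congr (_ * _)%E; rewrite [in RHS]integral_mkcond epatch_indic; apply: eq_integral => t _.
rewrite /h /= addr0 !indicE; congr (_ * ((nat_of_bool _)%:R)%:E)%E.
by apply/idP/idP; rewrite !inE/= !in_itv/= => /andP[? ?]; apply/andP; split; nra.
Qed.

Let measurable_min_inv (a b : R) : 0 <= a -> 0 <= b -> measurable_fun setT
  (fun xi : 'rV[R]_n => Num.min (a * (enorm xi / b)) (a * (enorm xi / b))^-1).
Proof.
move=> a0 b0; have mt : measurable_fun setT (fun xi : 'rV[R]_n => a * (enorm xi / b)).
  apply: measurable_funM => //; apply: measurable_funM => //.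
  by apply: measurable_enorm; exact: measurable_id.
apply: measurable_minr => //.
rewrite (_ : (fun xi => _) = fun xi : 'rV[R]_n => (a * (enorm xi / b)) `^ (-1)).
  exact: (measurableT_comp (measurable_powR _)).
by apply/funext => xi; rewrite powR_inv1// mulr_ge0// divr_ge0 ?enorm_ge0.
Qed.

Lemma dilate_decay (g : 'rV[R]_n -> R) : measurable_fun setT g -> (forall xi, 0 <= g xi) ->
  mean_decay g -> exists2 C : R, 0 <= C & forall (a : R) xi, 0 < a ->
  (\int[leb]_(t in `[a, (2 * a)%R]) (g (t *: xi))%:E <=
    (a * C * (1 + a * enorm xi) `^ (- (2 * alpha)))%:E)%E.
Proof.
move=> mg g0 [C C0 hC]; exists C => // a xi a0.
rewrite (@ge0_integral_dilate (fun t => (g (t *: xi))%:E))//; last 2 first.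
- apply/measurable_EFinP; apply: (measurableT_comp mg).
  by apply: measurable_rVZ.
- by move=> t; rewrite lee_fin.
rewrite -mulrA EFinM; apply: lee_wpmul2l; first by rewrite lee_fin ltW.
have := hC (a *: xi); rewrite enormZ gtr0_norm//; apply: le_trans.
rewrite le_eqVlt; apply/orP; left; apply/eqP; apply: eq_integral => t _.
by rewrite scalerA mulrC.
Qed.

(* [tau ^ (2 alpha)] from the symbol cancels the decay of the measure *)
Let block_arith (a C2 C3 C0 P psi : R) (j : nat) (xi : 'rV[R]_n) (tau l B : R) :
  0 < a -> 0 <= C2 -> 0 <= C3 -> 0 <= C0 -> 0 <= P ->
  tau = a / 2 ^+ j.+1 * enorm xi ->
  psi ^+ 2 * (1 + tau ^+ 2) <= C0 * (tau `^ (2 * alpha) * Num.min tau tau^-1) ->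
  l = a / 2 ^+ j.+1 -> B = (1 + a * enorm xi) `^ (- (2 * alpha)) ->
  (a^-1 + l^-1) * (2 * (psi ^+ 2 * P * (a * C2 * B))) +
  l * (2 * (psi ^+ 2 * P * (enorm xi ^+ 2 * (a * C3 * B)))) <=
  4 * (C2 + C3) * C0 * (2 ^+ j.+1) `^ (1 - 2 * alpha) * (P * Num.min tau tau^-1).
Proof.
move=> a0 C20 C30 C00 P0 tauE hpsi lE BE.
pose p : R := 2 ^+ j.+1; have p0 : 0 < p by rewrite exprn_gt0.
have p1 : 1 <= p by rewrite exprn_ege1// ler1n.
have e0 := enorm_ge0 xi.
have tau0 : 0 <= tau by rewrite tauE mulr_ge0// divr_ge0// ltW.
have B0 : 0 <= B by rewrite BE powR_ge0.
have q0 : 0 <= psi ^+ 2 by exact: sqr_ge0.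
have al2 : 0 < 2 * alpha.
  by rewrite mulr_gt0// (lt_trans _ alpha12)// invr_gt0.
have m0 : 0 <= Num.min tau tau^-1 by rewrite le_min invr_ge0 tau0.
have ptau : p * tau = a * enorm xi by rewrite tauE /p; field; rewrite gt_eqF.
have BT : B * tau `^ (2 * alpha) <= p `^ (- (2 * alpha)).
  have [t0|tn] := eqVneq tau 0.
    by rewrite t0 powR0 ?mulr0 ?powR_ge0// gt_eqF.
  have tp : 0 < tau by rewrite lt_neqAle eq_sym tn.
  have pt0 : 0 < p * tau by rewrite mulr_gt0.
  apply: (@le_trans _ _ ((p * tau) `^ (- (2 * alpha)) * tau `^ (2 * alpha))).
    rewrite ler_wpM2r ?powR_ge0// BE -ptau !powRN lef_pV2 ?posrE ?powR_gt0//; last by rewrite ltr_pwDl// ltW.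
    by rewrite ge0_ler_powR ?nnegrE ?addr_ge0 ?(ltW pt0) ?mulr_ge0 ?(ltW al2)//; lra.
  rewrite powRM ?(ltW p0)// -mulrA -powRD; last by rewrite (gt_eqF tp) implybT.
  by rewrite addNr powRr0 mulr1.
have -> : (a^-1 + l^-1) * (2 * (psi ^+ 2 * P * (a * C2 * B))) +
  l * (2 * (psi ^+ 2 * P * (enorm xi ^+ 2 * (a * C3 * B)))) =
  2 * B * P * psi ^+ 2 * (C2 * (1 + p) + C3 * (p * tau ^+ 2)).
  have -> : p * tau ^+ 2 = l * a * enorm xi ^+ 2.
    by rewrite tauE lE /p; field; rewrite gt_eqF.
  by rewrite lE /p; field; rewrite !gt_eqF.
apply: (@le_trans _ _ (2 * B * P * psi ^+ 2 * (2 * p * (C2 + C3) * (1 + tau ^+ 2)))).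
  apply: ler_wpM2l; first by apply: mulr_ge0 => //; rewrite !mulr_ge0.
  have t2 := sqr_ge0 tau.
  have h1 : C2 * (1 + p) <= C2 * (2 * p) by rewrite ler_wpM2l//; lra.
  have h2 : 0 <= C2 * (p * tau ^+ 2) by rewrite !mulr_ge0// ltW.
  have h3 : 0 <= C3 * p by rewrite !mulr_ge0// ltW.
  have h4 : 0 <= C3 * (p * tau ^+ 2) by rewrite !mulr_ge0// ltW.
  nra.
have -> : 2 * B * P * psi ^+ 2 * (2 * p * (C2 + C3) * (1 + tau ^+ 2)) =
  4 * (C2 + C3) * p * P * B * (psi ^+ 2 * (1 + tau ^+ 2)) by ring.
apply: (@le_trans _ _ (4 * (C2 + C3) * p * P * B * (C0 * (tau `^ (2 * alpha) * Num.min tau tau^-1)))).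
  by apply: ler_wpM2l => //; rewrite !mulr_ge0 ?addr_ge0 ?(ltW p0).
have -> : 4 * (C2 + C3) * p * P * B * (C0 * (tau `^ (2 * alpha) * Num.min tau tau^-1)) =
  (4 * (C2 + C3) * C0 * p * (P * Num.min tau tau^-1)) * (B * tau `^ (2 * alpha)) by ring.
have -> : 4 * (C2 + C3) * C0 * (2 ^+ j.+1) `^ (1 - 2 * alpha) * (P * Num.min tau tau^-1) =
  (4 * (C2 + C3) * C0 * p * (P * Num.min tau tau^-1)) * p `^ (- (2 * alpha)).
  rewrite -/p powRD; last by rewrite (gt_eqF p0) implybT.
  by rewrite powRr1 ?(ltW p0)//; ring.
by apply: ler_wpM2l => //; rewrite !mulr_ge0 ?addr_ge0 ?(ltW p0).
Qed.

Let fP (f : 'rV[R]_n -> R) xi : R := fcos mu f xi ^+ 2 + fsin mu f xi ^+ 2.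

Let fP0 f xi : 0 <= fP f xi. Proof. by rewrite addr_ge0 ?sqr_ge0. Qed.

Let measurable_fP f : mu.-integrable setT (EFin \o f) -> measurable_fun setT (fP f).
Proof.
by move=> iF; apply: measurable_funD; apply: measurable_funX;
  [exact: measurable_fcos|exact: measurable_fsin].
Qed.

Let measurable_normc : measurable_fun setT (fun xi => Normc.normc (fourier_measure sigma xi) ^+ 2).
Proof.
rewrite (_ : (fun xi => _) = fun xi => scos sigma xi ^+ 2 + ssin sigma xi ^+ 2).
  by apply: measurable_funD; apply: measurable_funX; [exact: measurable_scos|exact: measurable_ssin].
by apply/funext => xi; exact: normc_fourier_sqr.
Qed.

(** [IF] and [IH] are the integrals over the block of the squares of the operator and of its
    derivative in [t]. They stand in for the supremum over [t] because they are measurable in [x]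
    and have computable integrals. *)
Let block_integrals : exists2 C : R, 0 <= C & forall (a l : R) (j : nat) (f : 'rV[R]_n -> R),
  0 < a -> 0 < l -> mu.-integrable setT (EFin \o f) -> exists IF IH : 'rV[R]_n -> \bar R,
  [/\ measurable_fun setT IF, measurable_fun setT IH, (forall x, 0 <= IF x)%E,
      (forall x, 0 <= IH x)%E &
   [/\ forall (t : R) x, a <= t <= 2 * a ->
        (((\int[mu]_y (f y * tkern sigma N a j.+1 t (x - y))) ^+ 2)%:E <=
           (a^-1 + l^-1)%:E * IF x + l%:E * IH x)%E,
      (\int[mu]_x IF x <= \int[mu]_xi (2 * (tmul N a j.+1 xi ^+ 2 * fP f xi *
         (a * C * (1 + a * enorm xi) `^ (- (2 * alpha)))))%:E)%E &
      (\int[mu]_x IH x <= \int[mu]_xi (2 * (tmul N a j.+1 xi ^+ 2 * fP f xi *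
         (enorm xi ^+ 2 * (a * C * (1 + a * enorm xi) `^ (- (2 * alpha))))))%:E)%E]].
Proof.
have [C2 C20 h2] := dilate_decay measurable_normc (fun xi => sqr_ge0 _) decay.
have mgr := measurable_cvnorm_gradient M0 sM.
have [C3 C30 h3] := dilate_decay mgr (fun xi => sqr_ge0 _) gdecay.
exists (C2 + C3); first exact: addr_ge0.
move=> a l j f a0 l0 iF.
have iPsi := integrable_tmul_w2 N j.+1 a0 (n := n).
have mPsi : measurable_fun setT (tmul N a j.+1 : 'rV[R]_n -> R).
  by apply/measurable_EFinP; exact: (measurable_int mu (integrable_tmul N j.+1 a0)).
have mint k c c' : measurable_fun setT
    (fun x => \int[leb]_(t in `[a, (2 * a)%R]) (blend_int sigma M f (tmul N a j.+1) k c c' x t ^+ 2)%:E)%E.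
  pose h (p : 'rV[R]_n * measurableTypeR R) : \bar R :=
    ((blend_int sigma M f (tmul N a j.+1) k c c' p.1 p.2 ^+ 2)%:E *
      (\1_(`[a, (2 * a)%R]%classic : set R) p.2)%:E)%E.
  rewrite (_ : (fun x => _) = fun x => (\int[leb]_t h (x, t))%E); last first.
    by apply/funext => x; rewrite integral_mkcond epatch_indic.
  apply: measurable_fun_fubini_tonelli_F; last first.
    by move=> p; apply: mule_ge0; rewrite lee_fin// sqr_ge0.
  apply: emeasurable_funM; apply/measurable_EFinP; last first.
    by apply: measurableT_comp => //; exact: measurable_indic.
  by apply: measurable_funX; exact: measurable_blend_int.
have B0 xi : 0 <= (1 + a * enorm xi) `^ (- (2 * alpha)) by exact: powR_ge0.
have PP0 xi : 0 <= tmul N a j.+1 xi ^+ 2 * fP f xi by rewrite mulr_ge0 ?sqr_ge0 ?fP0.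
have men : measurable_fun setT (fun xi : 'rV[R]_n => enorm xi).
  by apply: measurable_enorm; exact: measurable_id.
have mB : measurable_fun setT (fun xi : 'rV[R]_n => (1 + a * enorm xi) `^ (- (2 * alpha))).
  apply: (measurableT_comp (measurable_powR _)); apply: measurable_funD => //.
  exact: measurable_funM.
have mPP : measurable_fun setT (fun xi => tmul N a j.+1 xi ^+ 2 * fP f xi).
  by apply: measurable_funM; [exact: measurable_funX|exact: measurable_fP].
have mosc2 (k : nat) (c c' : R) : measurable_fun setT
    (fun xi => \int[leb]_(t in `[a, (2 * a)%R]) (osc k c t xi ^+ 2 + osc k c' t xi ^+ 2)%:E)%E.
  pose h (p : 'rV[R]_n * measurableTypeR R) : \bar R :=
    ((osc k c p.2 p.1 ^+ 2 + osc k c' p.2 p.1 ^+ 2)%:E *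
      (\1_(`[a, (2 * a)%R]%classic : set R) p.2)%:E)%E.
  rewrite (_ : (fun x => _) = fun x => (\int[leb]_t h (x, t))%E); last first.
    by apply/funext => x; rewrite integral_mkcond epatch_indic.
  apply: measurable_fun_fubini_tonelli_F; last first.
    by move=> p; apply: mule_ge0; rewrite lee_fin// addr_ge0 ?sqr_ge0.
  apply: emeasurable_funM; apply/measurable_EFinP; last first.
    by apply: measurableT_comp => //; exact: measurable_indic.
  exact: measurable_osc_sqr.
have fin_step (g : 'rV[R]_n -> R) k c c' : measurable_fun setT g -> (forall xi, 0 <= g xi) ->
    (forall xi, \int[leb]_(t in `[a, (2 * a)%R]) (osc k c t xi ^+ 2 + osc k c' t xi ^+ 2)%:E <= (g xi)%:E)%E ->
    (2%:E * \int[mu]_xi ((tmul N a j.+1 xi ^+ 2 * fP f xi)%:E *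
      \int[leb]_(t in `[a, (2 * a)%R]) (osc k c t xi ^+ 2 + osc k c' t xi ^+ 2)%:E) <=
     \int[mu]_xi (2 * (tmul N a j.+1 xi ^+ 2 * fP f xi * g xi))%:E)%E.
  move=> mg g0 hg.
  have mPg : measurable_fun setT (fun xi => (tmul N a j.+1 xi ^+ 2 * fP f xi * g xi)%:E).
    by apply/measurable_EFinP; exact: measurable_funM.
  have Pg0 xi : 0 <= tmul N a j.+1 xi ^+ 2 * fP f xi * g xi by exact: mulr_ge0.
  under [leRHS]eq_integral do rewrite EFinM.
  rewrite ge0_integralZl//; last by move=> xi _; rewrite lee_fin.
  apply: lee_wpmul2l => //; apply: ge0_le_integral => //.
  - move=> xi _; apply: mule_ge0; first by rewrite lee_fin.
    by apply: integral_ge0 => t _; rewrite lee_fin addr_ge0 ?sqr_ge0.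
  - by apply: emeasurable_funM; [exact/measurable_EFinP|exact: mosc2].
  - by move=> xi _; rewrite [leRHS]EFinM; apply: lee_wpmul2l; [rewrite lee_fin|exact: hg].
have bmono (c x y : R) : 0 <= c -> x <= y -> x * c <= y * c by move=> c0 xy; exact: ler_wpM2r.
have mI : measurable (`[a, (2 * a)%R]%classic : set (measurableTypeR R)) by exact: measurable_itv.
exists (fun x => \int[leb]_(t in `[a, (2 * a)%R])
  (blend_int sigma M f (tmul N a j.+1) 0 0 (- (pi / 2)) x t ^+ 2)%:E)%E.
exists (fun x => \int[leb]_(t in `[a, (2 * a)%R])
  (blend_int sigma M f (tmul N a j.+1) 1 (0 + pi / 2) (- (pi / 2) + pi / 2) x t ^+ 2)%:E)%E.
split; [exact: mint|exact: mint| | |].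
- by move=> x; apply: integral_ge0 => t _; rewrite lee_fin sqr_ge0.
- by move=> x; apply: integral_ge0 => t _; rewrite lee_fin sqr_ge0.
split.
- move=> t x ht; rewrite conv_tkern//.
  have -> : \int[mu]_xi (tmul N a j.+1 xi * wave sigma f t x xi) =
      blend_int sigma M f (tmul N a j.+1) 0 0 (- (pi / 2)) x t.
    by apply: eq_Rintegral => xi _; rewrite /wave /blend (scos_osc sM) (ssin_osc sM).
  have dF := is_derive_blend_int sigma M0 mPsi iF iPsi (k := 0) 0 (- (pi / 2)) x.
  have dH := is_derive_blend_int sigma M0 mPsi iF iPsi (k := 1) (0 + pi / 2) (- (pi / 2) + pi / 2) x.
  exact: (sqr_le_integral_derive a0 l0 (fun t => dF t (leq0n 1)) (fun t => dH t (leqnn 1)) ht).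
- apply: (le_trans (blend_int_l2 sigma M0 mPsi iF iPsi 0 (- (pi / 2)) mI (leq0n 2))).
  apply: fin_step.
  + by apply: measurable_funM.
  + by move=> xi; rewrite !mulr_ge0 ?addr_ge0// ltW.
  move=> xi; apply: (@le_trans _ _ (a * C2 * (1 + a * enorm xi) `^ (- (2 * alpha)))%:E).
    apply: le_trans (h2 a xi a0); rewrite le_eqVlt; apply/orP; left; apply/eqP.
    by apply: eq_integral => t _; rewrite normc_fourier_sqr (scos_osc sM) (ssin_osc sM).
  by rewrite lee_fin; apply: bmono => //; rewrite ler_pM2l// lerDl.
- apply: (le_trans (blend_int_l2 sigma M0 mPsi iF iPsi _ _ mI (leqnSn 1))).
  apply: fin_step.
  + by apply: measurable_funM; [exact: measurable_funX|exact: measurable_funM].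
  + by move=> xi; rewrite !mulr_ge0 ?addr_ge0 ?enorm_ge0// ltW.
  move=> xi; apply: (@le_trans _ _ ((enorm xi ^+ 2)%:E * (a * C3 * (1 + a * enorm xi) `^ (- (2 * alpha)))%:E)%E).
    apply: (@le_trans _ _ ((enorm xi ^+ 2)%:E * \int[leb]_(t in `[a, (2 * a)%R])
        (cvnorm (gradient (fourier_measure sigma) (t *: xi)) ^+ 2)%:E)%E); last first.
      by apply: lee_wpmul2l; [rewrite lee_fin sqr_ge0|exact: h3].
    have mt : measurable_fun setT (fun t : measurableTypeR R => t *: xi) by exact: measurable_rVZ.
    have mc : measurable_fun `[a, (2 * a)%R] (fun t : measurableTypeR R =>
        (cvnorm (gradient (fourier_measure sigma) (t *: xi)) ^+ 2)%:E).
      by apply: measurable_funTS; apply/measurable_EFinP; exact: (measurableT_comp mgr mt).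
    rewrite -ge0_integralZl//; try by [rewrite lee_fin sqr_ge0|move=> t _; rewrite lee_fin sqr_ge0].
    apply: ge0_le_integral => //.
    - by move=> t _; rewrite lee_fin addr_ge0 ?sqr_ge0.
    - apply: measurable_funTS; apply/measurable_EFinP; apply: measurable_funD; apply: measurable_funX;
        exact: (measurable_osc sigma M _ _ (T := measurableTypeR R) (t := id) (xi := fun=> xi)).
    - exact: emeasurable_funM.
    - by move=> t _; rewrite -EFinM lee_fin add0r addNr; exact: osc1_sqr_le.
  rewrite -EFinM lee_fin; apply: ler_wpM2l; first exact: sqr_ge0.
  by apply: bmono => //; rewrite ler_pM2l// lerDr.
Qed.

Let block_l2 : exists2 C : R, 0 <= C & forall (a : R) (j : nat) (f : 'rV[R]_n -> R),
  0 < a -> mu.-integrable setT (EFin \o f) -> exists S : 'rV[R]_n -> \bar R,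
  [/\ measurable_fun setT S, (forall x, 0 <= S x)%E,
      forall (t : R) x, a <= t <= 2 * a ->
        (((\int[mu]_y (f y * tkern sigma N a j.+1 t (x - y))) ^+ 2)%:E <= S x)%E &
      (\int[mu]_x S x <= \int[mu]_xi (C * (2 ^+ j.+1) `^ (1 - 2 * alpha) *
         (fP f xi * Num.min (a * (enorm xi / 2 ^+ j.+1)) (a * (enorm xi / 2 ^+ j.+1))^-1))%:E)%E].
Proof.
have [C C_ge0 hC] := block_integrals.
have [C0 C00 h0] := tmul_sqr_le (n := n) N0 N4 alpha12.
exists (4 * (C + C) * C0); first by rewrite !mulr_ge0 ?addr_ge0// ltW.
(* The inverse of the typical frequency of the piece: a derivative in [t] costs about [l^-1], so
   this choice balances the two integrals. *)
move=> a j f a0 iF; pose l := a / 2 ^+ j.+1.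
have l0 : 0 < l by rewrite divr_gt0// exprn_gt0.
have [IF [IH [mIF mIH IF0 IH0 [hsup hF hH]]]] := hC a l j f a0 l0 iF.
have c0 : 0 <= a^-1 + l^-1 by rewrite addr_ge0 ?invr_ge0 ?ltW.
exists (fun x => (a^-1 + l^-1)%:E * IF x + l%:E * IH x)%E; split => //.
- by apply: emeasurable_funD; exact: emeasurable_funM.
- by move=> x; apply: adde_ge0; apply: mule_ge0 => //; rewrite lee_fin// ltW.
rewrite ge0_integralD//; try by [move=> x _; apply: mule_ge0 => //; rewrite lee_fin// ltW|
  exact: emeasurable_funM].
rewrite !ge0_integralZl ?lee_fin ?(ltW l0)//.
apply: (le_trans (leeD (lee_wpmul2l (_ : (0 <= (a^-1 + l^-1)%:E)%E) hF)
  (lee_wpmul2l (_ : (0 <= l%:E)%E) hH))); rewrite ?lee_fin ?(ltW l0)//.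
set G0 := (X in (_ * \int[_]_x (X x)%:E + _)%E).
set G1 := (X in (_ + _ * \int[_]_x (X x)%:E)%E).
have mPsi : measurable_fun setT (tmul N a j.+1 : 'rV[R]_n -> R).
  by apply/measurable_EFinP; exact: (measurable_int mu (integrable_tmul N j.+1 a0)).
have men : measurable_fun setT (fun xi : 'rV[R]_n => enorm xi).
  by apply: measurable_enorm; exact: measurable_id.
have mB : measurable_fun setT (fun xi : 'rV[R]_n => (1 + a * enorm xi) `^ (- (2 * alpha))).
  apply: (measurableT_comp (measurable_powR _)); apply: measurable_funD => //.
  exact: measurable_funM.
have mPP : measurable_fun setT (fun xi => tmul N a j.+1 xi ^+ 2 * fP f xi).
  by apply: measurable_funM; [exact: measurable_funX|exact: measurable_fP].
have PP0 xi : 0 <= tmul N a j.+1 xi ^+ 2 * fP f xi by rewrite mulr_ge0 ?sqr_ge0 ?fP0.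
have aC0 : 0 <= a * C by rewrite mulr_ge0// ltW.
have G00 xi : 0 <= G0 xi.
  by rewrite /G0 mulr_ge0// mulr_ge0// mulr_ge0 ?powR_ge0.
have G10 xi : 0 <= G1 xi.
  by rewrite /G1 mulr_ge0// mulr_ge0// mulr_ge0 ?sqr_ge0// mulr_ge0 ?powR_ge0.
have m0 : measurable_fun setT (fun xi => (G0 xi)%:E).
  by apply/measurable_EFinP; apply: measurable_funM => //; apply: measurable_funM => //; exact: measurable_funM.
have m1 : measurable_fun setT (fun xi => (G1 xi)%:E).
  apply/measurable_EFinP; apply: measurable_funM => //; apply: measurable_funM => //; apply: measurable_funM.
    exact: measurable_funX.
  exact: measurable_funM.
rewrite -!ge0_integralZl ?lee_fin ?(ltW l0)//; try by move=> xi _; rewrite lee_fin.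
rewrite -ge0_integralD//; try by [exact: emeasurable_funM|
  move=> xi _; apply: mule_ge0; rewrite lee_fin// ltW].
apply: ge0_le_integral => //.
- by move=> xi _; apply: adde_ge0; apply: mule_ge0; rewrite lee_fin// ltW.
- by apply: emeasurable_funD; exact: emeasurable_funM.
- apply/measurable_EFinP; apply: measurable_funM => //; apply: measurable_funM.
    exact: measurable_fP.
  by apply: measurable_min_inv; rewrite ?exprn_ge0// ltW.
move=> xi _; rewrite -!EFinM -EFinD lee_fin.
have tauE : a * (enorm xi / 2 ^+ j.+1) = a / 2 ^+ j.+1 * enorm xi by ring.
exact: (block_arith a0 C_ge0 C_ge0 (ltW C00) (fP0 f xi) tauE (h0 _ _ j xi a0 tauE) erefl erefl).
Qed.

(** The supremum over blocks is replaced by the sum over blocks, at no loss: each frequency matters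
    only to the few blocks where the minimum is not small. This rests on the vanishing of the
    symbols at low frequency, hence [j.+1]. *)
Lemma dyadic_l2 : exists2 C : R, 0 < C & forall (j : nat) (f : 'rV[R]_n -> R),
  mu.-integrable setT (EFin \o f) -> exists S : 'rV[R]_n -> \bar R,
  [/\ measurable_fun setT S, (forall x, 0 <= S x)%E,
      forall (i : nat) (t : R) x, dyad i <= t <= 2 * dyad i ->
        (((\int[mu]_y (f y * tkern sigma N (dyad i) j.+1 t (x - y))) ^+ 2)%:E <= S x)%E &
      (\int[mu]_x S x <=
        (C * (2 ^+ j.+1) `^ (1 - 2 * alpha))%:E * \int[mu]_x (f x ^+ 2)%:E)%E].
Proof.
have [C C_ge0 hC] := block_l2.
have [C1 C10 h1] := dyad_sum (ltr01 : 0 < 1 :> R).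
exists (C * C1 + 1); first by rewrite ltr_wpDl// mulr_ge0// ltW.
move=> j f iF.
have d0 i : 0 < dyad i :> R by exact: dyad_gt0.
have /choice[S hS] := fun i => hC (dyad i) j f (d0 i) iF.
have S0 i x : (0 <= S i x)%E by have [_ + _ _] := hS i; exact.
have mS i : measurable_fun setT (S i) by have [] := hS i.
pose K : R := C * (2 ^+ j.+1) `^ (1 - 2 * alpha).
have K0 : 0 <= K by rewrite mulr_ge0 ?powR_ge0.
pose T i (xi : 'rV[R]_n) : R :=
  Num.min (dyad i * (enorm xi / 2 ^+ j.+1)) (dyad i * (enorm xi / 2 ^+ j.+1))^-1.
have T0 i xi : 0 <= T i xi.
  by rewrite le_min invr_ge0 andbb mulr_ge0 ?(ltW (d0 i))// divr_ge0 ?enorm_ge0.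
have mT i : measurable_fun setT (T i) by apply: measurable_min_inv; rewrite ?exprn_ge0// ltW.
have mP := measurable_fP iF.
exists (fun x => \sum_(0 <= i <oo) S i x)%E; split.
- by apply: ge0_emeasurable_sum => // k x _; exact: S0.
- by move=> x; apply: nneseries_ge0 => i _ _; exact: S0.
- move=> i t x ht; apply: (@le_trans _ _ (S i x)); last first.
    exact: (nneseries_term_le (u := fun i => S i x)).
  by have [_ _ + _] := hS i; exact.
rewrite integral_nneseries//.
apply: (@le_trans _ _ (\sum_(0 <= i <oo) \int[mu]_xi (K * (fP f xi * T i xi))%:E)%E).
  apply: lee_nneseries => [i _ _|i _]; first exact: integral_ge0.
  by have [] := hS i.
have KPT0 i xi : 0 <= K * (fP f xi * T i xi) by rewrite !mulr_ge0.
rewrite -integral_nneseries//; try by [move=> i xi _; rewrite lee_fin|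
  move=> i; apply/measurable_EFinP; apply: measurable_funM => //; exact: measurable_funM].
have KC0 : 0 <= K * C1 by rewrite mulr_ge0// ltW.
apply: (@le_trans _ _ (\int[mu]_xi ((K * C1)%:E * (fP f xi)%:E))%E).
  apply: ge0_le_integral => //.
  - by move=> xi _; apply: nneseries_ge0 => i _ _; rewrite lee_fin.
  - apply: ge0_emeasurable_sum => i; first by move=> xi _ _; rewrite lee_fin.
    by move=> _; apply/measurable_EFinP; apply: measurable_funM => //; exact: measurable_funM.
  - by apply: emeasurable_funM => //; exact/measurable_EFinP.
  - move=> xi _; under eq_eseriesr do rewrite mulrA EFinM.
    rewrite nneseriesZl; last by move=> i _; rewrite lee_fin.
    rewrite -EFinM (mulrAC K C1) [leRHS]EFinM; apply: lee_wpmul2l.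
      by rewrite lee_fin mulr_ge0.
    (* At [xi = 0] all terms vanish, since [0^-1 = 0]; [dyad_sum] wants a positive [rho]. *)
    have [x0|x0] := eqVneq (enorm xi) 0.
      rewrite eseries0 ?lee_fin ?(ltW C10)// => i _ _.
      by rewrite /T x0 mul0r mulr0 invr0 minxx.
    have xp : 0 < enorm xi / 2 ^+ j.+1 by rewrite divr_gt0 ?exprn_gt0// lt_neqAle eq_sym x0 enorm_ge0.
    apply: (le_trans _ (h1 _ xp)); apply: lee_nneseries => [i _ _|i _]; rewrite lee_fin//.
    by rewrite powRr1// mulr_ge0 ?(ltW xp) ?(ltW (d0 i)).
rewrite ge0_integralZl//; try by [move=> xi _; rewrite lee_fin|exact/measurable_EFinP].
apply: (@le_trans _ _ ((K * C1)%:E * \int[mu]_x (f x ^+ 2)%:E)%E).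
  by apply: lee_wpmul2l; [rewrite lee_fin|exact: bessel].
apply: lee_wpmul2r; first by apply: integral_ge0 => x _; rewrite lee_fin sqr_ge0.
by rewrite lee_fin mulrAC ler_wpM2r ?powR_ge0// lerDl.
Qed.

End dyadic_l2.

(** * Interpolation of maximal bounds *)

Section scalar_interpolation.
Context {R : realType}.

Lemma geometric_sum_le (r : R) k : 0 <= r -> r < 1 ->
  \sum_(0 <= i < k) r ^+ i <= (1 - r)^-1.
Proof.
move=> r0 r1; have r10 : 0 < 1 - r by rewrite subr_gt0.
rewrite -[leRHS]mul1r ler_pdivlMr//.
have -> : (\sum_(0 <= i < k) r ^+ i) * (1 - r) = 1 - r ^+ k.
  elim: k => [|k IH]; first by rewrite big_geq// mul0r expr0 subrr.
  by rewrite big_nat_recr//= mulrDl IH exprS; ring.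
by rewrite lerBlDr lerDl exprn_ge0.
Qed.

Lemma geometric_nneseries_le (r : R) : 0 <= r -> r < 1 ->
  (\sum_(0 <= j <oo) (r ^+ j)%:E <= ((1 - r)^-1)%:E)%E.
Proof.
move=> r0 r1; apply: lime_le.
  by apply: is_cvg_nneseries => i _ _; rewrite lee_fin exprn_ge0.
by apply: nearW => k; rewrite sumEFin lee_fin geometric_sum_le.
Qed.

(** The two bounds cross at the level a / b, where both equal a ^ (1 - theta) b ^ theta. Measured
    from there they decay geometrically on either side, with exponents [theta] and [1 - theta], both
    at least [w]. *)
Lemma min_powR_sum (theta : R) : 0 < theta < 1 -> exists2 C : R, 0 < C &
  forall (a b : R) (u : nat -> R), 0 <= a -> 0 <= b -> (forall k, 0 <= u k) ->
  (forall k, u k <= a * (dyad k) `^ (- theta)) ->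
  (forall k, u k <= b * (dyad k) `^ (1 - theta)) ->
  (\sum_(0 <= k <oo) (u k)%:E <= (C * (a `^ (1 - theta) * b `^ theta))%:E)%E.
Proof.
move=> /andP[t0 t1]; pose w := Num.min theta (1 - theta).
have w0 : 0 < w by rewrite lt_min t0 subr_gt0.
have wt : w <= theta by rewrite ge_min lexx.
have wt1 : w <= 1 - theta by rewrite ge_min lexx orbT.
have [C C0 hC] := dyad_sum w0; exists C => // a b u a0 b0 u0 ua ub.
have RHS0 : 0 <= C * (a `^ (1 - theta) * b `^ theta) by rewrite !mulr_ge0 ?powR_ge0// ltW.
have [az|an] := eqVneq a 0.
  rewrite eseries0 ?lee_fin// => k _ _; congr EFin; apply/eqP.
  by rewrite eq_le u0 andbT (le_trans (ua k))// az mul0r.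
have [bz|bn] := eqVneq b 0.
  rewrite eseries0 ?lee_fin// => k _ _; congr EFin; apply/eqP.
  by rewrite eq_le u0 andbT (le_trans (ub k))// bz mul0r.
have ap : 0 < a by rewrite lt_neqAle eq_sym an.
have bp : 0 < b by rewrite lt_neqAle eq_sym bn.
pose rho := b / a; have rho0 : 0 < rho by rewrite divr_gt0.
pose v := a `^ (1 - theta) * b `^ theta.
have v0 : 0 <= v by rewrite mulr_ge0 ?powR_ge0.
have dp k : 0 < dyad k :> R by exact: dyad_gt0.
have vE : v = expR ((1 - theta) * ln a + theta * ln b).
  by rewrite expRD /v /powR !gt_eqF.
have yE k e : (dyad k * rho) `^ e = expR (e * (ln (dyad k) + (ln b - ln a))).
  have y0 : 0 < dyad k * rho by rewrite mulr_gt0.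
  rewrite /powR (gt_eqF y0); congr (expR (e * _)).
  by rewrite lnM ?posrE// /rho lnM ?posrE ?invr_gt0// lnV.
have dE k e : (dyad k : R) `^ e = expR (e * ln (dyad k)) by rewrite /powR gt_eqF.
have E1 k : a * (dyad k) `^ (- theta) = v * (dyad k * rho) `^ (- theta).
  rewrite -[a in LHS]lnK ?posrE// vE yE dE -!expRD; congr expR; ring.
have E2 k : b * (dyad k) `^ (1 - theta) = v * (dyad k * rho) `^ (1 - theta).
  rewrite -[b in LHS]lnK ?posrE// vE yE dE -!expRD; congr expR; ring.
apply: (@le_trans _ _ (\sum_(0 <= k <oo) (v%:E * (Num.min ((dyad k * rho) `^ w) ((dyad k * rho) `^ w)^-1)%:E))%E).
  apply: lee_nneseries => [k _ _|k _]; first by rewrite lee_fin.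
  rewrite -EFinM lee_fin.
  have y0 : 0 < dyad k * rho by rewrite mulr_gt0.
  have := ua k; have := ub k; rewrite E1 E2; set y := dyad k * rho => h2 h1.
  have [y1|y1] := leP 1 y.
    apply: (le_trans h1); rewrite ler_wpM2l// le_min -powRN !ler_powR//; lra.
  apply: (le_trans h2); rewrite ler_wpM2l// le_min -powRN.
  by rewrite !ger_powR ?y0 ?(ltW y1)//; lra.
rewrite nneseriesZl; last by move=> k _; rewrite lee_fin le_min invr_ge0 powR_ge0.
rewrite mulrC [leRHS]EFinM; apply: lee_wpmul2l; first by rewrite lee_fin.
exact: hC.
Qed.

Lemma powR_mean_le (v w lam : R) : 0 <= v -> 0 <= w -> 0 < lam < 1 ->
  v `^ lam * w `^ (1 - lam) <= v + w.
Proof.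
move=> v0 w0 /andP[l0 l1].
pose m := Num.max v w; have m0 : 0 <= m by rewrite le_max v0.
have ml : 0 <= 1 - lam by lra.
apply: (@le_trans _ _ (m `^ lam * m `^ (1 - lam))).
  apply: ler_pM; rewrite ?powR_ge0// ge0_ler_powR ?nnegrE ?(ltW l0)// le_max lexx ?orbT//.
have [m1|m1] := eqVneq m 0; first by rewrite m1 powR0 ?mul0r ?addr_ge0// gt_eqF.
rewrite -powRD; last by rewrite m1 implybT.
rewrite addrC subrK powRr1// /m; case: (leP v w) => _; rewrite ?lerDr ?lerDl//.
Qed.

End scalar_interpolation.

Section interpolation.
Context {R : realType} {n : nat}.
Let mu := @lebesgue_rV R n.
(** The index in [Om] plays the part of [t]: a bound uniform in it is a bound for the maximal
    operator, and the majorant [S] in [T_l2] supplies the measurability that the supremum lacks. *)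
Variables (Om : Type) (T : nat -> Om -> ('rV[R]_n -> R) -> 'rV[R]_n -> R).
Hypothesis T_sum : forall j om (f : 'rV[R]_n -> R) (f_ : nat -> 'rV[R]_n -> R) x,
  mu.-integrable setT (EFin \o f) -> (forall k, measurable_fun setT (f_ k)) ->
  (forall K y, `|\sum_(0 <= k < K) f_ k y| <= `|f y|) ->
  (forall y, \sum_(0 <= k < K) f_ k y @[K --> \oo] --> f y) ->
  (`|T j om f x|%:E <= \sum_(0 <= k <oo) `|T j om (f_ k) x|%:E)%E.
Variables (B kap C s : R).
Hypothesis B0 : 0 < B.
Hypothesis T_max : forall j om f x, measurable_fun setT f ->
  (`|T j om f x|%:E <= (B * (2 ^+ j) `^ kap)%:E * maximal f x)%E.
Hypothesis C0 : 0 < C.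
Hypothesis T_l2 : forall j f, mu.-integrable setT (EFin \o f) ->
  exists S : 'rV[R]_n -> \bar R,
  [/\ measurable_fun setT S, (forall x, 0 <= S x)%E,
      forall om x, ((T j om f x ^+ 2)%:E <= S x)%E &
      (\int[mu]_x S x <= (C * (2 ^+ j) `^ (- s))%:E * \int[mu]_x (f x ^+ 2)%:E)%E].

(** The L^2 decay [s] is shared: [s - s'] makes the square functions of the different pieces
    summable into one, and [s'] is what interpolation uses, [gain] being the condition for the
    interpolated bounds to decrease in j. *)
Variables (theta s' : R) (p q : 'rV[R]_n -> R) (P1 : R).
Hypothesis theta01 : 0 < theta < 1.
Hypothesis ss' : s' < s.
Hypothesis gain : theta * kap < (1 - theta) * s' / 2.
Hypothesis mp : measurable_fun setT p.
Hypothesis mq : measurable_fun setT q.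
Hypothesis p0 : forall x, 0 < p x.
Hypothesis pP1 : forall x, p x <= P1.
Hypothesis q0 : forall x, 0 < q x.
Hypothesis pq : forall x, (1 - theta) * p x / 2 + theta * p x / q x = 1.
Variable Kq : R.
Hypothesis Kq0 : 0 < Kq.
Hypothesis hl : forall h : 'rV[R]_n -> R, measurable_fun setT h -> (forall y, 0 <= h y) ->
  (\int[mu]_y (h y `^ q y)%:E <= 1)%E ->
  (\int[mu]_x poweR (maximal h x) (q x) <= Kq%:E)%E.

Let theta0 : 0 < theta. Proof. by case/andP: theta01. Qed.
Let theta1 : 0 < 1 - theta. Proof. by case/andP: theta01; rewrite subr_gt0. Qed.

Section cut.
Variable f : 'rV[R]_n -> R.
Hypothesis mf : measurable_fun setT f.
Hypothesis iF : mu.-integrable setT (EFin \o f).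
Hypothesis f1 : (\int[mu]_y (`|f y| `^ p y)%:E <= 1)%E.

(** Both f0 ^ 2 and h ^ q equal |f| ^ p, and |f| = f0 ^ (1 - theta) h ^ theta where [f] does not
    vanish. On the level set where [u] is about [dyad k], |f| is thus comparable to a multiple of
    [f0] and to a multiple of [h]. *)
Let f0 y : R := `|f y| `^ (p y / 2).
Let h y : R := `|f y| `^ (p y / q y).
Let u y : R := f0 y / h y.
Let inE k y : R := (1 - (u y < dyad k)%R%:R) * (u y < 2 * dyad k)%R%:R.
(** Discarding the earlier indices makes the slices disjoint by construction, so that their partial
    sums telescope in [e_sum]. *)
Let e k y : R := inE k y * \prod_(0 <= l < k) (1 - inE l y).
Let f_ k y : R := f y * e k y.

Let inE01 k y : inE k y = 0 \/ inE k y = 1.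
Proof.
by rewrite /inE; case: ltP => _; case: ltP => _; rewrite ?subrr ?subr0 ?mul0r ?mulr0 ?mulr1; auto.
Qed.

Let prod01 k y : \prod_(0 <= l < k) (1 - inE l y) = 0 \/ \prod_(0 <= l < k) (1 - inE l y) = 1.
Proof.
elim: k => [|k IH]; first by right; rewrite big_geq.
rewrite big_nat_recr//=; case: IH => ->; rewrite ?mul0r; first by left.
by case: (inE01 k y) => ->; rewrite ?subrr ?subr0 ?mulr0 ?mulr1; auto.
Qed.

Let e01 k y : e k y = 0 \/ e k y = 1 /\ inE k y = 1.
Proof.
rewrite /e; case: (prod01 k y) => ->; rewrite ?mulr0 ?mulr1; first by left.
by case: (inE01 k y) => ->; auto.
Qed.

Let e_sum K y : \sum_(0 <= k < K) e k y = 1 - \prod_(0 <= l < K) (1 - inE l y).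
Proof.
elim: K => [|K IH]; first by rewrite !big_geq// subrr.
by rewrite !big_nat_recr//= IH /e; ring.
Qed.

Let mf0 : measurable_fun setT f0.
Proof.
apply: measurable_powR_fun => //; first by move=> y; rewrite gt_eqF// divr_gt0.
  exact: measurableT_comp.
exact: measurable_funM.
Qed.

Let measurable_quot (a b : 'rV[R]_n -> R) : measurable_fun setT a -> measurable_fun setT b ->
  (forall y, 0 <= b y) -> measurable_fun setT (fun y => a y / b y).
Proof.
move=> ma mb b0; apply: measurable_funM => //.
rewrite (_ : (fun y => _) = fun y => b y `^ (-1)).
  exact: (measurableT_comp (measurable_powR _)).
by apply/funext => y; rewrite powR_inv1.
Qed.

Let mh : measurable_fun setT h.
Proof.
apply: measurable_powR_fun => //; first by move=> y; rewrite gt_eqF// divr_gt0.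
  exact: measurableT_comp.
by apply: measurable_quot => // y; exact: ltW.
Qed.

Let me_ k : measurable_fun setT (e k).
Proof.
have mu_ : measurable_fun setT u by apply: measurable_quot => // y; rewrite powR_ge0.
have mi l : measurable_fun setT (inE l).
  apply: measurable_funM; first apply: measurable_funB => //; apply: measurable_ltr_ind => //.
apply: measurable_funM => //.
by apply: measurable_prod => l *; exact: measurable_funB.
Qed.

Let mf_ k : measurable_fun setT (f_ k).
Proof. exact: measurable_funM. Qed.

Let mfe k : measurable_fun setT (fun y => (`|f y| `^ p y * e k y)%:E).
Proof.
apply/measurable_EFinP; apply: measurable_funM => //.
apply: measurable_powR_fun => //; first by move=> y; rewrite gt_eqF.
exact: measurableT_comp.
Qed.

Let h0 y : 0 <= h y. Proof. exact: powR_ge0. Qed.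
Let f00 y : 0 <= f0 y. Proof. exact: powR_ge0. Qed.
Let dp k : 0 < dyad k :> R. Proof. exact: dyad_gt0. Qed.

Let inE1 k y : inE k y = 1 -> dyad k <= u y < 2 * dyad k.
Proof.
by rewrite /inE; case: ltP => a; case: ltP => b; rewrite ?subrr ?subr0 ?mul0r ?mulr0 ?mulr1// => /eqP;
  rewrite eq_sym oner_eq0.
Qed.

Let abs_split y : f y != 0 ->
  [/\ 0 < f0 y, 0 < h y & `|f y| = f0 y `^ (1 - theta) * h y `^ theta].
Proof.
move=> fy; have a0 : 0 < `|f y| by rewrite normr_gt0.
split; rewrite ?powR_gt0// /f0 /h -!powRrM -powRD; last by rewrite (gt_eqF a0) implybT.
rewrite -[LHS]powRr1//; congr (_ `^ _); rewrite -[LHS](pq y); ring.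
Qed.

Let f_le1 k y : `|f_ k y| <= f0 y * (dyad k) `^ (- theta).
Proof.
have R0 : 0 <= f0 y * (dyad k) `^ (- theta) by rewrite mulr_ge0 ?powR_ge0.
rewrite /f_ normrM; case: (e01 k y) => [->|[-> /inE1/andP[du _]]]; first by rewrite normr0 mulr0.
rewrite normr1 mulr1; have [->|fy] := eqVneq (f y) 0; first by rewrite normr0.
have [a0 b0 ->] := abs_split fy.
apply: (@le_trans _ _ (f0 y * u y `^ (- theta))).
  have u0 : 0 < u y by rewrite divr_gt0.
  rewrite le_eqVlt; apply/orP; left; apply/eqP.
  have -> : h y = f0 y / u y by rewrite /u; field; rewrite !gt_eqF.
  rewrite powRM ?invr_ge0 ?(ltW u0)// mulrA -powRD; last by rewrite (gt_eqF a0) implybT.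
  rewrite subrK powRr1 ?(ltW a0)//; congr (_ * _).
  by rewrite -(powR_inv1 (ltW u0)) -powRrM mulN1r.
by rewrite ler_wpM2l// !powRN lef_pV2 ?posrE ?powR_gt0//;
  [rewrite ge0_ler_powR ?nnegrE ?(ltW theta0) ?(le_trans _ du)// ltW|rewrite (lt_le_trans _ du)].
Qed.

Let f_le2 k y : `|f_ k y| <= (2 * dyad k) `^ (1 - theta) * h y.
Proof.
have R0 : 0 <= (2 * dyad k) `^ (1 - theta) * h y by rewrite mulr_ge0 ?powR_ge0.
rewrite /f_ normrM; case: (e01 k y) => [->|[-> /inE1/andP[_ du]]]; first by rewrite normr0 mulr0.
rewrite normr1 mulr1; have [->|fy] := eqVneq (f y) 0; first by rewrite normr0.
have [a0 b0 ->] := abs_split fy.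
have u0 : 0 < u y by rewrite divr_gt0.
apply: (@le_trans _ _ (u y `^ (1 - theta) * h y)).
  rewrite le_eqVlt; apply/orP; left; apply/eqP.
  have -> : f0 y = u y * h y by rewrite /u; field; rewrite !gt_eqF.
  rewrite powRM ?(ltW u0)// -mulrA -powRD; last by rewrite (gt_eqF b0) implybT.
  by rewrite subrK powRr1 ?(ltW b0).
apply: ler_wpM2r => //; apply: ge0_ler_powR; rewrite ?nnegrE ?(ltW theta1) ?(ltW du) ?(ltW u0)//.
by rewrite mulr_ge0// ltW.
Qed.

Let f_part K y : `|\sum_(0 <= k < K) f_ k y| <= `|f y|.
Proof.
rewrite -mulr_sumr e_sum normrM ler_piMr//.
by case: (prod01 K y) => ->; rewrite ?subr0 ?subrr ?normr0 ?normr1.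
Qed.

Let f_cvg y : \sum_(0 <= k < K) f_ k y @[K --> \oo] --> f y.
Proof.
have [fy|fy] := eqVneq (f y) 0.
  rewrite (_ : (fun K => _) = fun=> f y); first exact: cvg_cst.
  by apply/funext => K; rewrite -mulr_sumr fy mul0r.
have [a0 b0 _] := abs_split fy.
have u0 : 0 < u y by rewrite divr_gt0.
have [k /andP[k1 k2]] := dyad_ex u0.
apply/cvg_ballP => eps eps0; near=> K.
have -> : \sum_(0 <= k < K) f_ k y = f y; last exact: ballxx.
have kK : (k < K)%N by near: K; exists k.+1.
rewrite -mulr_sumr e_sum (big_cat_nat _ (n := k.+1))//= big_nat_recr//=.
have -> : inE k y = 1 by rewrite /inE ltNge k1 k2 subr0 mulr1.
by rewrite subrr mulr0 mul0r subr0 mulr1.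
Unshelve. all: by end_near.
Qed.

Let if_ k : mu.-integrable setT (EFin \o f_ k).
Proof.
apply: (le_integrable measurableT _ _ iF); first exact/measurable_EFinP.
move=> y _ /=; rewrite lee_fin /f_ normrM ler_piMr//.
by case: (e01 k y) => [->|[-> _]]; rewrite ?normr0 ?normr1.
Qed.

Let int_h : (\int[mu]_y (h y `^ q y)%:E <= 1)%E.
Proof.
apply: le_trans f1; rewrite le_eqVlt; apply/orP; left; apply/eqP; apply: eq_integral => y _.
by rewrite /h -powRrM divfK// gt_eqF.
Qed.

Let int_f_sqr k : (\int[mu]_y (f_ k y ^+ 2)%:E <=
  ((dyad k) `^ (- (2 * theta)))%:E * \int[mu]_y (`|f y| `^ p y * e k y)%:E)%E.
Proof.
have pe0 y : 0 <= `|f y| `^ p y * e k y.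
  by rewrite mulr_ge0 ?powR_ge0//; case: (e01 k y) => [->|[-> _]].
rewrite -ge0_integralZl//; try by [move=> y _; rewrite lee_fin|rewrite lee_fin powR_ge0].
apply: ge0_le_integral => //.
- by move=> y _; rewrite lee_fin sqr_ge0.
- by apply/measurable_EFinP; exact: measurable_funX.
- by apply: emeasurable_funM.
move=> y _; rewrite -EFinM lee_fin.
case: (e01 k y) => [ek|[ek _]].
  by rewrite /f_ ek !mulr0 expr0n.
rewrite ek mulr1 -real_normK ?num_real//.
apply: (@le_trans _ _ ((f0 y * (dyad k) `^ (- theta)) ^+ 2)).
  by apply: lerXn2r; rewrite ?nnegrE ?mulr_ge0 ?powR_ge0.
rewrite exprMn mulrC le_eqVlt; apply/orP; left; apply/eqP; congr (_ * _).
  by rewrite -powR_mulrn ?powR_ge0// -powRrM; congr (_ `^ _); ring.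
by rewrite -powR_mulrn ?powR_ge0// /f0 -powRrM divfK.
Qed.

Let sum_e_le1 K y : \sum_(0 <= k < K) e k y <= 1.
Proof. by rewrite e_sum; case: (prod01 K y) => ->; rewrite ?subr0 ?subrr. Qed.

Let sum_int_f : (\sum_(0 <= k <oo) \int[mu]_y (`|f y| `^ p y * e k y)%:E <= 1)%E.
Proof.
have pe0 k y : 0 <= `|f y| `^ p y * e k y.
  by rewrite mulr_ge0 ?powR_ge0//; case: (e01 k y) => [->|[-> _]].
have mfp : measurable_fun setT (fun y => (`|f y| `^ p y)%:E).
  apply/measurable_EFinP; apply: measurable_powR_fun => //; first by move=> y; rewrite gt_eqF.
  exact: measurableT_comp.
rewrite -integral_nneseries//; try by move=> k y _; rewrite lee_fin.
apply: le_trans f1; apply: ge0_le_integral => //.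
- by move=> y _; apply: nneseries_ge0 => k _ _; rewrite lee_fin.
- by apply: ge0_emeasurable_sum => [k y _ _|k _] //; rewrite lee_fin.
- move=> y _; apply: lime_le; first by apply: is_cvg_nneseries => k _ _; rewrite lee_fin.
  apply: nearW => K; rewrite sumEFin lee_fin -mulr_sumr ler_piMr ?powR_ge0//.
Qed.

Let pow2E (j : nat) (c : R) : (2 ^+ j) `^ c = (2 `^ c) ^+ j :> R.
Proof. by rewrite -(powR_mulrn j (ler0n R 2)) -(powR_mulrn j (powR_ge0 2 c)) -!powRrM mulrC. Qed.

Let powlt1 (c : R) : c < 0 -> 0 <= (2 : R) `^ c < 1.
Proof.
move=> c0; rewrite powR_ge0/= /powR gt_eqF// expR_lt1 pmulr_llt0//.
by rewrite ln_gt0// ltr1n.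
Qed.

(** At a fixed point each slice has a bound through the square function [V] and one through the
    maximal function of [h]. [min_powR_sum] adds the slices, a geometric series adds the pieces j,
    and the relation between [p] and [q] splits the power [p x] of the result. [C1] enters as an
    argument because the final constant has to be fixed before [f]. *)
Lemma cut_bound (C1 : R) : 0 < C1 ->
  (forall (a b : R) (u : nat -> R), 0 <= a -> 0 <= b -> (forall k, 0 <= u k) ->
    (forall k, u k <= a * (dyad k) `^ (- theta)) ->
    (forall k, u k <= b * (dyad k) `^ (1 - theta)) ->
    (\sum_(0 <= k <oo) (u k)%:E <= (C1 * (a `^ (1 - theta) * b `^ theta))%:E)%E) ->
  let D := (Num.max 1 (C1 * (B * 2 `^ (1 - theta)) `^ theta *
    (1 - 2 `^ (theta * kap - (1 - theta) * s' / 2))^-1)) `^ P1 in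
  exists W : 'rV[R]_n -> \bar R,
  [/\ measurable_fun setT W, (forall x, 0 <= W x)%E,
    (forall J om x, ((`|\sum_(0 <= j < J) T j om f x| `^ p x)%:E <= W x)%E) &
    (\int[mu]_x W x <= (D * (C * (1 - 2 `^ (s' - s))^-1 + Kq))%:E)%E].
Proof.
move=> C10 hC1; cbv zeta.
have r1 : 0 <= (2 : R) `^ (s' - s) < 1 by apply: powlt1; rewrite subr_lt0.
set r2 := 2 `^ (theta * kap - (1 - theta) * s' / 2).
have hr2 : 0 <= r2 < 1 by apply: powlt1; rewrite subr_lt0.
set D0 := C1 * _ * _; set D := (Num.max 1 D0) `^ P1.
have D00 : 0 <= D0.
  rewrite /D0 !mulr_ge0 ?powR_ge0 ?(ltW C10)// invr_ge0 subr_ge0.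
  by case/andP: hr2 => _ /ltW.
have Dp : 0 < D by rewrite powR_gt0// lt_max ltr01.
have /choice[S hS] : forall jk : nat * nat, exists S : 'rV[R]_n -> \bar R,
  [/\ measurable_fun setT S, (forall x, 0 <= S x)%E,
      forall om x, ((T jk.1 om (f_ jk.2) x ^+ 2)%:E <= S x)%E &
      (\int[mu]_x S x <= (C * (2 ^+ jk.1) `^ (- s))%:E * \int[mu]_x (f_ jk.2 x ^+ 2)%:E)%E].
  by move=> [j k]; exact: T_l2.
have mS j k : measurable_fun setT (S (j, k)) by have [] := hS (j, k).
have S0 j k x : (0 <= S (j, k) x)%E by have [_ + _ _] := hS (j, k); exact.
(* The power of [dyad k] undoes the one in [int_f_sqr], so that the slices add up to the modular of
   [f]; the power of 2 ^ j leaves a geometric series of ratio 2 ^ (s' - s). *)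
pose cf j k : R := (2 ^+ j) `^ s' * (dyad k) `^ (2 * theta).
have cf0 j k : 0 < cf j k by rewrite mulr_gt0// powR_gt0// exprn_gt0.
pose Vj j x := (\sum_(0 <= k <oo) (cf j k)%:E * S (j, k) x)%E.
have t0 j k x : (0 <= (cf j k)%:E * S (j, k) x)%E by rewrite mule_ge0// lee_fin ltW.
have mt j k : measurable_fun setT (fun x => (cf j k)%:E * S (j, k) x)%E by exact: emeasurable_funM.
have Vj0 j x : (0 <= Vj j x)%E by apply: nneseries_ge0 => k _ _; exact: t0.
have mVj j : measurable_fun setT (Vj j) by apply: ge0_emeasurable_sum => [k x _ _|k _] //.
pose V x := (\sum_(0 <= j <oo) Vj j x)%E.
have V0 x : (0 <= V x)%E by apply: nneseries_ge0 => j _ _; exact: Vj0.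
have mV : measurable_fun setT V by apply: ge0_emeasurable_sum => [j x _ _|j _] //.
have SV j k x : ((cf j k)%:E * S (j, k) x <= V x)%E.
  apply: (le_trans _ (nneseries_term_le (u := fun j => Vj j x) j _)) => //.
  exact: (nneseries_term_le (u := fun k => (cf j k)%:E * S (j, k) x)%E).
have mH : measurable_fun setT (fun x => poweR (maximal h x) (q x)).
  by apply: measurable_poweR_fun => //; [exact: maximal_ge0|exact: measurable_maximal].
exists (fun x => D%:E * (V x + poweR (maximal h x) (q x)))%E; split.
- by apply: emeasurable_funM => //; exact: emeasurable_funD.
- by move=> x; rewrite mule_ge0 ?adde_ge0 ?poweR_ge0// lee_fin ltW.
- move=> J om x.
  (* Where [V] or the maximal function is infinite, so is the majorant. *)
  have := V0 x; have := SV; move=> /(_ _ _ x); case: (V x) => [v| |]// hv; last first.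
    by move=> _; rewrite addye ?gt0_muley ?leey ?lte_fin// gt_eqF// (lt_le_trans _ (poweR_ge0 _ _)) ?ltNyr.
  rewrite lee_fin => v0.
  have := maximal_ge0 h x; case E : (maximal h x) => [eta| |]//; last first.
    by move=> _; rewrite poweRyr ?gt_eqF// addey ?gt0_muley ?leey ?lte_fin.
  rewrite lee_fin => eta0.
  have Tf j k : `|T j om (f_ k) x| <= (2 ^+ j) `^ (- (s' / 2)) * Num.sqrt v * (dyad k) `^ (- theta).
    have p0' : 0 <= (2 ^+ j) `^ (- (s' / 2)) * Num.sqrt v * (dyad k : R) `^ (- theta).
      by rewrite !mulr_ge0 ?powR_ge0 ?sqrtr_ge0.
    rewrite -(ler_pXn2r (ltn0Sn 1)) ?nnegrE// !exprMn sqr_sqrtr// real_normK ?num_real//.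
    have sqE (y c : R) : (y `^ c) ^+ 2 = y `^ (c * 2).
      by rewrite -powR_mulrn ?powR_ge0// -powRrM.
    rewrite !sqE.
    have -> : - (s' / 2) * 2 = - s' by field.
    have -> : - theta * 2 = - (2 * theta) by ring.
    have -> : (2 ^+ j) `^ (- s') * v * dyad k `^ (- (2 * theta)) = (cf j k)^-1 * v.
      by rewrite !powRN /cf invfM; ring.
    rewrite ler_pdivlMl// -lee_fin EFinM; apply: le_trans (hv j k).
    apply: lee_wpmul2l; first by rewrite lee_fin ltW.
    by have [_ _ + _] := hS (j, k); exact.
  have Tg j k : `|T j om (f_ k) x| <= B * 2 `^ (1 - theta) * (2 ^+ j) `^ kap * eta * (dyad k) `^ (1 - theta).
    have c0 : 0 <= (2 * dyad k : R) `^ (1 - theta) by exact: powR_ge0.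
    rewrite -lee_fin; apply: (le_trans (T_max j om x (mf_ k))).
    apply: (@le_trans _ _ ((B * (2 ^+ j) `^ kap)%:E * (((2 * dyad k) `^ (1 - theta))%:E * maximal h x))%E).
      apply: lee_wpmul2l; first by rewrite lee_fin mulr_ge0 ?powR_ge0// ltW.
      rewrite -maximalZ//; apply: le_maximal => //; first exact: measurable_funM.
      by move=> y; rewrite [leRHS]ger0_norm ?f_le2// mulr_ge0.
    rewrite E -!EFinM lee_fin powRM ?(ltW (dp k))// le_eqVlt; apply/orP; left; apply/eqP.
    by ring.
  have pj j : 0 < 2 ^+ j :> R by rewrite exprn_gt0.
  pose X := Num.sqrt v `^ (1 - theta) * eta `^ theta.
  have X0 : 0 <= X by rewrite mulr_ge0 ?powR_ge0.
  have B2 : 0 <= B * 2 `^ (1 - theta) by rewrite mulr_ge0 ?powR_ge0// ltW.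
  have c0 : 0 <= C1 * (B * 2 `^ (1 - theta)) `^ theta by rewrite mulr_ge0 ?powR_ge0// ltW.
  have Tj j : `|T j om f x| <= C1 * (B * 2 `^ (1 - theta)) `^ theta * X * r2 ^+ j.
    rewrite -lee_fin; apply: (le_trans (T_sum j om x iF mf_ f_part f_cvg)).
    apply: (le_trans (hC1 ((2 ^+ j) `^ (- (s' / 2)) * Num.sqrt v)
      (B * 2 `^ (1 - theta) * (2 ^+ j) `^ kap * eta) _ _ _ _ (Tf j) (Tg j)));
      try by rewrite ?mulr_ge0 ?powR_ge0 ?sqrtr_ge0 ?(ltW B0).
    rewrite lee_fin le_eqVlt; apply/orP; left; apply/eqP.
    rewrite !powRM ?powR_ge0 ?sqrtr_ge0 ?(ltW B0) ?mulr_ge0 ?powR_ge0 ?(ltW B0)//.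
    have -> : r2 ^+ j = (2 ^+ j) `^ (- (s' / 2)) `^ (1 - theta) * (2 ^+ j) `^ kap `^ theta.
      rewrite -!powRrM -powRD; last by rewrite (gt_eqF (pj j)) implybT.
      by rewrite /r2 -pow2E; congr (_ `^ _); field.
    rewrite /X; move: (B `^ theta) (2 `^ (1 - theta) `^ theta) ((2 ^+ j) `^ kap `^ theta)
      ((2 ^+ j) `^ (- (s' / 2)) `^ (1 - theta)) (Num.sqrt v `^ (1 - theta)) (eta `^ theta).
    by clear; move=> ? ? ? ? ? ?; ring.
  have TJ : `|\sum_(0 <= j < J) T j om f x| <= D0 * X.
    rewrite (le_trans (ler_norm_sum _ _ _))//.
    apply: (@le_trans _ _ (\sum_(0 <= j < J) C1 * (B * 2 `^ (1 - theta)) `^ theta * X * r2 ^+ j)).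
      by apply: ler_sum => j _; exact: Tj.
    rewrite -mulr_sumr /D0 -/r2 [leRHS]mulrAC; apply: ler_wpM2l; first by rewrite mulr_ge0.
    by case/andP: hr2 => ? ?; exact: geometric_sum_le.
  rewrite poweR_EFin -EFinD -EFinM lee_fin.
  have px0 := ltW (p0 x).
  apply: (@le_trans _ _ ((D0 * X) `^ p x)).
    by apply: ge0_ler_powR; rewrite ?nnegrE ?(mulr_ge0 D00 X0).
  rewrite powRM//; apply: ler_pM; rewrite ?powR_ge0//.
    apply: (@le_trans _ _ ((Num.max 1 D0) `^ p x)).
      by apply: ge0_ler_powR; rewrite ?nnegrE ?le_max ?ler01 ?lexx ?orbT.
    by apply: ler_powR; rewrite ?le_max ?lexx.
  (* By [pq] the complement of [lam] is [theta * p x / q x], so the power [p x] of the product is v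
     ^ lam times the power 1 - lam of eta ^ (q x). *)
  pose lam := (1 - theta) * p x / 2.
  have l1E : 1 - lam = theta * p x / q x by rewrite -(pq x) /lam; ring.
  have lam01 : 0 < lam < 1.
    rewrite divr_gt0 ?mulr_gt0//= -subr_gt0 l1E divr_gt0// mulr_gt0//.
  apply: le_trans (powR_mean_le v0 (powR_ge0 eta (q x)) lam01).
  rewrite /X (powRM _ (powR_ge0 _ _) (powR_ge0 _ _)) l1E -(powR12_sqrt v0) -!powRrM.
  rewrite le_eqVlt; apply/orP; left; apply/eqP.
  by congr (_ `^ _ * _ `^ _); [rewrite /lam; field|field; rewrite gt_eqF].
rewrite ge0_integralZl//; try by [exact: emeasurable_funD|rewrite lee_fin ltW|
  move=> x _; rewrite adde_ge0 ?poweR_ge0].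
rewrite [leRHS]EFinM; apply: lee_wpmul2l; first by rewrite lee_fin ltW.
rewrite ge0_integralD//; try by move=> x _; rewrite poweR_ge0.
rewrite EFinD; apply: leeD; last exact: hl.
rewrite integral_nneseries//.
apply: (@le_trans _ _ (\sum_(0 <= j <oo) (C%:E * ((2 `^ (s' - s)) ^+ j)%:E))%E).
  apply: lee_nneseries => [j _ _|j _]; first exact: integral_ge0.
  rewrite integral_nneseries//.
  have ie0 k : (0 <= \int[mu]_y (`|f y| `^ p y * e k y)%:E)%E.
    apply: integral_ge0 => y _; rewrite lee_fin mulr_ge0 ?powR_ge0//.
    by case: (e01 k y) => [->|[-> _]].
  have r1j : 0 <= C * (2 `^ (s' - s)) ^+ j by rewrite mulr_ge0 ?exprn_ge0 ?powR_ge0// ltW.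
  apply: (@le_trans _ _ (\sum_(0 <= k <oo) ((C * (2 `^ (s' - s)) ^+ j)%:E *
      \int[mu]_y (`|f y| `^ p y * e k y)%:E))%E).
    apply: lee_nneseries => [k _ _|k _]; first exact: integral_ge0.
    rewrite ge0_integralZl//; try by rewrite lee_fin ltW.
    have [_ _ _ hint] := hS (j, k).
    apply: (le_trans (lee_wpmul2l (_ : (0 <= (cf j k)%:E)%E) hint)); first by rewrite lee_fin ltW.
    have c1 : 0 <= C * (2 ^+ j) `^ (- s) by rewrite mulr_ge0 ?powR_ge0// ltW.
    apply: (le_trans (lee_wpmul2l (_ : (0 <= (cf j k)%:E)%E)
      (lee_wpmul2l (_ : (0 <= (C * (2 ^+ j) `^ (- s))%:E)%E) (int_f_sqr k))));
      rewrite ?lee_fin ?(ltW (cf0 j k))//.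
    rewrite !muleA -!EFinM le_eqVlt; apply/orP; left; apply/eqP; congr (_%:E * _)%E.
    have pj : 0 < 2 ^+ j :> R by rewrite exprn_gt0.
    rewrite -pow2E powRD; last by rewrite (gt_eqF pj) implybT.
    have dd : (dyad k : R) `^ (2 * theta) * dyad k `^ (- (2 * theta)) = 1.
      by rewrite powRN mulfV// gt_eqF// powR_gt0.
    rewrite /cf; transitivity (C * ((2 ^+ j) `^ s' * (2 ^+ j) `^ (- s)) *
      ((dyad k : R) `^ (2 * theta) * dyad k `^ (- (2 * theta)))); first by ring.
    by rewrite dd mulr1.
  rewrite nneseriesZl; last by move=> k _; exact: ie0.
  rewrite -EFinM -[leRHS]mule1; apply: lee_wpmul2l; first by rewrite lee_fin.
  exact: sum_int_f.
have rr0 : 0 <= (2 : R) `^ (s' - s) by exact: powR_ge0.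
rewrite nneseriesZl; last by move=> k _; rewrite lee_fin exprn_ge0.
rewrite EFinM; apply: lee_wpmul2l; first by rewrite lee_fin ltW.
by case/andP: r1 => ? ?; exact: geometric_nneseries_le.
Qed.

End cut.

Lemma interpolation_bound : exists2 K : R, 0 < K & forall f : 'rV[R]_n -> R,
  measurable_fun setT f -> mu.-integrable setT (EFin \o f) ->
  (\int[mu]_y (`|f y| `^ p y)%:E <= 1)%E ->
  exists W : 'rV[R]_n -> \bar R,
  [/\ measurable_fun setT W, (forall x, 0 <= W x)%E,
    (forall J om x, ((`|\sum_(0 <= j < J) T j om f x| `^ p x)%:E <= W x)%E) &
    (\int[mu]_x W x <= K%:E)%E].
Proof.
have [C1 C10 hC1] := min_powR_sum theta01.
eexists; last by move=> f mf iF f1; exact: cut_bound C10 hC1.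
have r1 : 2 `^ (s' - s) < 1.
  by rewrite /powR gt_eqF// expR_lt1 pmulr_llt0 ?subr_lt0// ln_gt0// ltr1n.
apply: mulr_gt0; first by rewrite powR_gt0// lt_max ltr01.
by rewrite addr_gt0// mulr_gt0// invr_gt0 subr_gt0.
Qed.

End interpolation.

(** * Fourier inversion for Schwartz functions *)

Section schwartz_decay.
Context {R : realType} {n : nat}.
Let mu := @lebesgue_rV R n.
Implicit Types (f g : 'rV[R]_n -> R).

Lemma partials_partial s j f : partials s (partial j f) = partials (rcons s j) f.
Proof. by rewrite /partials foldr_rcons. Qed.

Lemma real_schwartz_partial j f : real_schwartz f -> real_schwartz (partial j f).
Proof. by move=> sf s; rewrite partials_partial; exact: sf. Qed.

Lemma partials_comb s (c : R) f g : real_schwartz f -> real_schwartz g ->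
  partials s (fun x => f x + c * g x) = fun x => partials s f x + c * partials s g x.
Proof.
move=> sf sg; elim: s => [//|j s IH].
rewrite /= -/(partials s _) IH; apply/funext => x.
have df : derivable (partials s f) x (delta_mx 0 j) by apply: diff_derivable; have [] := sf s.
have dg : derivable (partials s g) x (delta_mx 0 j) by apply: diff_derivable; have [] := sg s.
rewrite /partial (_ : (fun x => _) = partials s f + c \*: partials s g) //.
by rewrite deriveD ?deriveZ//; exact: derivableZ.
Qed.

Lemma real_schwartz_comb (c : R) f g : real_schwartz f -> real_schwartz g ->
  real_schwartz (fun x => f x + c * g x).
Proof.
move=> sf sg s; rewrite partials_comb//; have [df bf] := sf s; have [dg bg] := sg s.
split.
  move=> x; rewrite (_ : (fun x => _) = partials s f + c \*: partials s g)//.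
  by apply: differentiableD => //; exact: differentiableZ.
move=> N; have [A hA] := bf N; have [B hB] := bg N.
exists (A + `|c| * B) => x.
have e0 : 0 <= (1 + enorm x) ^+ N by rewrite exprn_ge0// addr_ge0// enorm_ge0.
apply: (@le_trans _ _ ((1 + enorm x) ^+ N * (`|partials s f x| + `|c| * `|partials s g x|))).
  by rewrite ler_wpM2l// (le_trans (ler_normD _ _))// normrM.
by rewrite mulrDr lerD// mulrCA ler_wpM2l.
Qed.

(** Uniformity over translations of length at most 1 provides the dominating functions in
    [schwartz_ibp]; it follows from 1 + |y| <= 2 (1 + |v + y|). *)
Lemma real_schwartz_weight f : real_schwartz f -> exists2 C : R, 0 <= C &
  forall y v, enorm v <= 1 -> `|f (v + y)| <= C * weight y.
Proof.
move=> sf; have [_ /(_ (2 * n)%N)[C hC]] := sf [::].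
have C0 : 0 <= C.
  by apply: (le_trans _ (hC 0)); rewrite mulr_ge0// exprn_ge0// addr_ge0// enorm_ge0.
exists (2 ^+ (2 * n) * C); first by rewrite mulr_ge0// exprn_ge0.
move=> y v v1; rewrite /weight prodfV ler_pdivlMr; last first.
  by apply: prodr_gt0 => i _; rewrite /oneDsqr ltr_pwDl// sqr_ge0.
have e0 := enorm_ge0 y; have z0 := enorm_ge0 (v + y).
have yz : 1 + enorm y <= 2 * (1 + enorm (v + y)).
  have : enorm y <= enorm (v + y) + enorm v.
    by rewrite -{1}[y](addKr v) [X in enorm X]addrC (le_trans (enormD _ _))// enormN.
  lra.
apply: (@le_trans _ _ (`|f (v + y)| * (1 + enorm y) ^+ (2 * n))).
  rewrite ler_wpM2l// exprM -[X in _ ^+ X](card_ord n) -prodr_const.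
  apply: ler_prod => i _; rewrite /oneDsqr addr_ge0 ?sqr_ge0//=.
  rewrite -real_normK ?num_real//; have := coord_le_enorm y i.
  have := normr_ge0 (y 0 i); nra.
apply: (@le_trans _ _ (`|f (v + y)| * (2 * (1 + enorm (v + y))) ^+ (2 * n))).
  by rewrite ler_wpM2l//; apply: lerXn2r; rewrite ?nnegrE ?mulr_ge0 ?addr_ge0.
rewrite exprMn mulrCA ler_wpM2l ?exprn_ge0// mulrC; exact: hC.
Qed.

Lemma real_schwartz_measurable f : real_schwartz f -> measurable_fun setT f.
Proof.
move=> sf; apply: continuous_measurable_rV => x; apply: differentiable_continuous.
by have [+ _] := sf [::]; exact.
Qed.

Lemma real_schwartz_integrable f : real_schwartz f -> mu.-integrable setT (EFin \o f).
Proof.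
move=> sf; have [C C0 hC] := real_schwartz_weight sf.
have iw := integrable_mulrl C measurableT (integrable_weight n (R := R)).
apply: (le_integrable measurableT _ _ iw).
  by apply/measurable_EFinP; exact: real_schwartz_measurable.
move=> y _ /=; rewrite lee_fin (le_trans _ (ler_norm _))//.
by have := hC y 0; rewrite enorm0 add0r; apply.
Qed.

Lemma is_derive_line f (v y : 'rV[R]_n) (h0 : R) : derivable f (h0 *: v + y) v ->
  is_derive h0 1 (fun h : R => f (h *: v + y)) ('D_v f (h0 *: v + y)).
Proof.
move=> df.
have E : (fun h : R => h^-1 *: (((fun h : R => f (h *: v + y)) \o shift h0) (h *: (1 : R)) - f (h0 *: v + y))) =
    (fun h : R => h^-1 *: ((f \o shift (h0 *: v + y)) (h *: v) - f (h0 *: v + y))).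
  apply/funext => h; congr (_ *: (_ - _)) => /=.
  by rewrite scaleRE mulr1 scalerDl addrA.
by constructor; [rewrite /derivable E|rewrite /derive E].
Qed.

Let e j : 'rV[R]_n := delta_mx 0 j.

Let dot_e y j : dot (e j) y = y 0 j.
Proof.
rewrite /dot (bigD1 j)//= big1 ?addr0 ?mxE ?eqxx ?mul1r//.
by move=> i ij; rewrite mxE eqxx (negbTE ij) mul0r.
Qed.

Let enorm_e a j : enorm (a *: e j) = `|a|.
Proof. by rewrite enormZ /enorm dot_e mxE !eqxx sqrtr1 mulr1. Qed.

(* The integral of [g cos] over the translates along [sin w * e_j] is constant
   in [w]; a bounded reparametrisation keeps the derivatives dominated. *)
Lemma schwartz_ibp g j (xi : 'rV[R]_n) (c : R) : real_schwartz g ->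
  \int[mu]_y (partial j g y * cos (2 * pi * dot y xi + c)) =
  2 * pi * xi 0 j * \int[mu]_y (g y * sin (2 * pi * dot y xi + c)).
Proof.
move=> sg; have sd := real_schwartz_partial j sg.
have [A A0 hA] := real_schwartz_weight sg; have [B B0 hB] := real_schwartz_weight sd.
have mg := real_schwartz_measurable sg; have md := real_schwartz_measurable sd.
pose G (y : 'rV[R]_n) := g y * cos (2 * pi * dot y xi + c).
have mG : measurable_fun setT G by apply: measurable_funM => //; apply: measurable_cosf; meas.
pose dG (y : 'rV[R]_n) := partial j g y * cos (2 * pi * dot y xi + c) -
  2 * pi * xi 0 j * (g y * sin (2 * pi * dot y xi + c)).
have sin1 w : enorm (sin w *: e j) <= 1 by rewrite enorm_e sin_le1_norm.
pose D := B + 2 * pi * `|xi 0 j| * A.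
have iw := integrable_weight n (R := R).
have d : is_derive (0 : R) 1 (fun w => \int[mu]_y G (sin w *: e j + y))
    (\int[mu]_y (dG (sin 0 *: e j + y) * cos 0)).
  apply: (is_derive_under (B := setT) (f := fun w y => G (sin w *: e j + y))
    (df := fun w y => dG (sin w *: e j + y) * cos w) (G := fun y => D * weight y)).
  - exact: measurableT.
  - move=> w; apply: (le_integrable measurableT _ _ (integrable_mulrl A measurableT iw)).
      by apply/measurable_EFinP; apply: (measurableT_comp mG); meas.
    move=> y _ /=; rewrite lee_fin (le_trans _ (ler_norm _))// /G normrM -[leRHS]mulr1.
    by apply: ler_pM => //; [exact: hA|exact: cos_le1_norm].
  - move=> w y _.
    have dk (h : R) : is_derive h 1 (fun h => G (h *: e j + y)) (dG (h *: e j + y)).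
      have dg : is_derive h 1 (fun h => g (h *: e j + y)) (partial j g (h *: e j + y)).
        by apply: is_derive_line; apply: diff_derivable; have [+ _] := sg [::]; exact.
      rewrite (_ : (fun h => _) = fun h : R => g (h *: e j + y) * cos (2 * pi * (h * xi 0 j + dot y xi) + c)).
        apply: is_derive_eq; rewrite !scaleRE /dG dotDl dotZl dot_e; ring.
      by apply/funext => h'; rewrite /G dotDl dotZl dot_e.
    have dsin := is_derive_sin w.
    exact: (is_derive1_comp (f := fun h => G (h *: e j + y)) (g := sin)).
  - exact: integrable_mulrl.
  - move=> w y _; rewrite normrM -[leRHS]mulr1; apply: ler_pM => //; last exact: cos_le1_norm.
    apply: (le_trans (ler_normB _ _)); rewrite /D [leRHS]mulrDl; apply: lerD.
      rewrite normrM -[leRHS]mulr1; apply: ler_pM => //; last exact: cos_le1_norm.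
      exact: hB.
    rewrite !normrM (ger0_norm (pi_ge0 R)) ger0_norm// -[leRHS]mulrA ler_wpM2l ?mulr_ge0 ?pi_ge0//.
    by rewrite -[leRHS]mulr1; apply: ler_pM => //; [exact: hA|exact: sin_le1_norm].
have cst : (fun w => \int[mu]_y G (sin w *: e j + y)) = fun=> \int[mu]_y G y.
  apply/funext => w; rewrite -(Rintegral_rV_shift (sin w *: e j) mG).
  by apply: eq_Rintegral => y _; rewrite addrC.
have := @derive_val _ _ _ _ _ _ _ d; rewrite cst derive_cst sin0 scale0r cos0 => /esym.
under eq_Rintegral do rewrite add0r mulr1.
have i1 : mu.-integrable setT (fun y => (partial j g y * cos (2 * pi * dot y xi + c))%:E).
  by apply: integrable_cos; [exact: real_schwartz_integrable|meas].
have i2 : mu.-integrable setT (fun y => (g y * sin (2 * pi * dot y xi + c))%:E).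
  by apply: integrable_sin; [exact: real_schwartz_integrable|meas].
rewrite RintegralB//; last exact: integrable_mulrl.
by rewrite RintegralZl// => /eqP; rewrite subr_eq0 => /eqP.
Qed.

(** On the Fourier side this operator is multiplication by 1 + xi_j ^ 2, the inverse of one factor
    of [weight]. *)
Definition oneBlap j g : 'rV[R]_n -> R :=
  fun y => g y + - (4 * pi ^+ 2)^-1 * partial j (partial j g) y.

Lemma oneBlap_cos g j (xi : 'rV[R]_n) (c : R) : real_schwartz g ->
  \int[mu]_y (oneBlap j g y * cos (2 * pi * dot y xi + c)) =
  (1 + xi 0 j ^+ 2) * \int[mu]_y (g y * cos (2 * pi * dot y xi + c)).
Proof.
move=> sg; have sd := real_schwartz_partial j sg; have sdd := real_schwartz_partial j sd.
have i1 h : real_schwartz h -> mu.-integrable setT (fun y => (h y * cos (2 * pi * dot y xi + c))%:E).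
  by move=> sh; apply: integrable_cos; [exact: real_schwartz_integrable|meas].
have sinE (h : 'rV[R]_n -> R) c' : \int[mu]_y (h y * sin (2 * pi * dot y xi + c')) =
    \int[mu]_y (h y * cos (2 * pi * dot y xi + (c' - pi / 2))).
  apply: eq_Rintegral => y _; rewrite addrA [in RHS]cosB cos_pihalf sin_pihalf.
  by rewrite mulr0 add0r mulr1.
have msin : \int[mu]_y (g y * sin (2 * pi * dot y xi + (c - pi / 2))) =
    - \int[mu]_y (g y * cos (2 * pi * dot y xi + c)).
  rewrite -[RHS]mulN1r -RintegralZl//; last exact: i1.
  apply: eq_Rintegral => y _; rewrite addrA sinB cos_pihalf sin_pihalf; ring.
have E : \int[mu]_y (partial j (partial j g) y * cos (2 * pi * dot y xi + c)) =
    - (4 * pi ^+ 2 * xi 0 j ^+ 2) * \int[mu]_y (g y * cos (2 * pi * dot y xi + c)).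
  by rewrite schwartz_ibp// sinE schwartz_ibp// msin; ring.
transitivity (\int[mu]_y (g y * cos (2 * pi * dot y xi + c) +
    - (4 * pi ^+ 2)^-1 * (partial j (partial j g) y * cos (2 * pi * dot y xi + c)))).
  by apply: eq_Rintegral => y _; rewrite /oneBlap; ring.
rewrite RintegralD//; [|exact: i1|by apply: integrable_mulrl => //; exact: i1].
rewrite RintegralZl//; last exact: i1.
have pi0 : 4 * pi ^+ 2 != 0 :> R by rewrite mulf_neq0// expf_neq0// gt_eqF// pi_gt0.
by rewrite E mulrA mulrNN mulrA mulVf// (mulrDl 1 (xi 0 j ^+ 2)) !mul1r.
Qed.

(** One application of [oneBlap] per coordinate multiplies the transform by the inverse of
    [weight xi] and keeps the function Schwartz, hence its transform bounded. *)
Lemma schwartz_cos_decay g : real_schwartz g -> exists2 C : R, 0 <= C & forall xi c,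
  `|\int[mu]_y (g y * cos (2 * pi * dot y xi + c))| <= C * weight xi.
Proof.
move=> sg; pose Lg := foldr oneBlap g (enum 'I_n).
have sL s : real_schwartz (foldr oneBlap g s).
  elim: s => [//|j s IH] /=; apply: real_schwartz_comb => //.
  by do 2 apply: real_schwartz_partial.
have LE s xi c : \int[mu]_y (foldr oneBlap g s y * cos (2 * pi * dot y xi + c)) =
    (\prod_(j <- s) (1 + xi 0 j ^+ 2)) * \int[mu]_y (g y * cos (2 * pi * dot y xi + c)).
  elim: s => [|j s IH]; first by rewrite big_nil mul1r.
  by rewrite big_cons /= oneBlap_cos// IH mulrA.
exists (\int[mu]_y `|Lg y|); first exact: Rintegral_ge0.
move=> xi c; have p0 : 0 < \prod_(i < n) oneDsqr (xi 0 i).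
  by apply: prodr_gt0 => i _; rewrite /oneDsqr ltr_pwDl// sqr_ge0.
rewrite /weight prodfV ler_pdivlMr//.
have iL := real_schwartz_integrable (sL (enum 'I_n)).
have ic : mu.-integrable setT (fun y => (Lg y * cos (2 * pi * dot y xi + c))%:E).
  by apply: integrable_cos => //; meas.
have -> : `|\int[mu]_y (g y * cos (2 * pi * dot y xi + c))| * \prod_(i < n) oneDsqr (xi 0 i) =
    `|\int[mu]_y (Lg y * cos (2 * pi * dot y xi + c))|.
  rewrite LE normrM mulrC big_enum/= [in RHS]ger0_norm//; exact: ltW.
rewrite (le_trans (le_normr_Rintegral measurableT ic))//.
apply: le_Rintegral => //; [exact: (integrable_norm ic)|exact: (integrable_norm iL)|].
by move=> y _; rewrite normrM ler_piMr// cos_le1_norm.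
Qed.

Lemma schwartz_fcos_integrable g : real_schwartz g -> mu.-integrable setT (EFin \o fcos mu g).
Proof.
move=> sg; have [C C0 hC] := schwartz_cos_decay sg.
apply: (le_integrable measurableT _ _ (integrable_mulrl C measurableT (integrable_weight n (R := R)))).
  by apply/measurable_EFinP; apply: measurable_fcos; exact: real_schwartz_integrable.
move=> xi _ /=; rewrite lee_fin (le_trans _ (ler_norm _))//.
have := hC xi 0; rewrite /fcos.
by under eq_Rintegral do rewrite addr0.
Qed.

Lemma schwartz_fsin_integrable g : real_schwartz g -> mu.-integrable setT (EFin \o fsin mu g).
Proof.
move=> sg; have [C C0 hC] := schwartz_cos_decay sg.
apply: (le_integrable measurableT _ _ (integrable_mulrl C measurableT (integrable_weight n (R := R)))).
  by apply/measurable_EFinP; apply: measurable_fsin; exact: real_schwartz_integrable.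
move=> xi _ /=; rewrite lee_fin (le_trans _ (ler_norm _))//.
have := hC xi (- (pi / 2)); rewrite /fsin.
by under eq_Rintegral do rewrite cosB cos_pihalf sin_pihalf mulr0 add0r mulr1.
Qed.

End schwartz_decay.

Section inversion.
Local Open Scope complex_scope.
Context {R : realType} {n : nat}.
Variable sigma : {finite_measure set 'rV[R]_n -> \bar R}.
Let mu := @lebesgue_rV R n.

Lemma wave_shift_integrable phi u t x : real_schwartz u ->
  mu.-integrable setT (EFin \o wave_shift sigma phi u t x).
Proof.
move=> su; have iC := schwartz_fcos_integrable su; have iS := schwartz_fsin_integrable su.
have m1 : measurable_fun setT (fun xi : 'rV[R]_n => scos sigma (t *: xi)).
  by apply: (measurableT_comp (measurable_scos sigma)); meas.
have m2 : measurable_fun setT (fun xi : 'rV[R]_n => ssin sigma (t *: xi)).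
  by apply: (measurableT_comp (measurable_ssin sigma)); meas.
have i1 g h : mu.-integrable setT (EFin \o g) -> mu.-integrable setT (EFin \o h) ->
    mu.-integrable setT (fun xi => (g xi * scos sigma (t *: xi) + h xi * ssin sigma (t *: xi))%:E).
  move=> ig ih; rewrite (_ : (fun xi => _) = (fun xi => (g xi * scos sigma (t *: xi))%:E +
    (h xi * ssin sigma (t *: xi))%:E)%E)//.
  apply: integrableD => //.
    exact: (integrable_bounded_mul ig m1 (fun xi => scos_le sigma (t *: xi))).
  exact: (integrable_bounded_mul ih m2 (fun xi => ssin_le sigma (t *: xi))).
have iN : mu.-integrable setT (EFin \o (fun xi => - fsin mu u xi)).
  have := integrable_mulrl (-1) measurableT iS.
  by under eq_fun do rewrite mulN1r.
have A := i1 _ _ iC iN; have B := i1 _ _ iS iC.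
have ia : measurable_fun setT (fun xi => 2 * pi * dot x xi + phi) by meas.
apply: (eq_integrable _ _ (fun xi => _)) (integrableD measurableT (integrable_cos A ia) (integrable_sin B ia)) => //.
by move=> xi _ /=; rewrite -EFinD /wave_shift; congr EFin; ring.
Qed.

(** With a Gaussian factor the integral is 0 by [conv_kern_shift], as [cos (- (pi / 2)) = 0];
    dominated convergence removes the Gaussian. This says that the operator takes real functions to
    real functions. *)
Lemma wave_shift_odd u t x : real_schwartz u ->
  \int[mu]_xi wave_shift sigma (- (pi / 2)) u t x xi = 0.
Proof.
move=> su; have iW := wave_shift_integrable (- (pi / 2)) t x su.
have cv : (\int[mu]_xi (gauss k.+1%:R^-1 xi * wave_shift sigma (- (pi / 2)) u t x xi))
    @[k --> \oo] --> \int[mu]_xi wave_shift sigma (- (pi / 2)) u t x xi.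
  apply: (Rdominated_cvg (g := fun xi => `|wave_shift sigma (- (pi / 2)) u t x xi|)).
  - move=> k; apply: measurable_funM; first exact: measurable_gauss.
    by apply/measurable_EFinP; exact: measurable_int iW.
  - move=> xi; rewrite -[X in _ --> X]mul1r; apply: cvgMr_tmp.
    have c0 : (- (pi * k.+1%:R^-1 ^+ 2 * dot xi xi)) @[k --> \oo] --> (0 : R).
      rewrite -[X in _ --> X](_ : - (pi * 0 ^+ 2 * dot xi xi) = 0); last by ring.
      apply: cvgN; apply: cvgMr_tmp; apply: cvgMl_tmp; rewrite expr2; under eq_cvg do rewrite expr2.
      by apply: cvgM; exact: cvg_harmonic.
    by rewrite -[X in _ --> X]expR0; exact: (cvg_comp _ _ c0 (@continuous_expR R 0)).
  - by move=> k xi; rewrite normrM ler_piMl// ger0_norm ?gauss_le1// ltW// gauss_gt0.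
  - exact: (integrable_norm iW).
have z k : \int[mu]_xi (gauss k.+1%:R^-1 xi * wave_shift sigma (- (pi / 2)) u t x xi) = 0.
  rewrite conv_kern_shift ?invr_gt0//; last exact: real_schwartz_integrable.
  by rewrite cosN cos_pihalf mul0r.
move: cv; under eq_cvg do rewrite z.
by move=> /cvg_lim <-//; rewrite lim_cst.
Qed.

(** The pieces telescope to the symbol of scale [a / 2 ^+ k], which stays in [0, 1] and tends to 1;
    the Schwartz hypothesis makes [wave] integrable, so dominated convergence applies. *)
Lemma tkern_sum_cvg N u a t x : (0 < N)%N -> 0 < a -> real_schwartz u ->
  (\sum_(j < k.+1) \int[mu]_y (u y * tkern sigma N a j t (x - y)))
    @[k --> \oo] --> \int[mu]_xi wave sigma u t x xi.
Proof.
move=> N0 a0 su; have iu := real_schwartz_integrable su.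
have iW : mu.-integrable setT (EFin \o wave sigma u t x).
  rewrite (_ : wave _ _ _ _ = wave_shift sigma 0 u t x); first exact: wave_shift_integrable.
  by apply/funext => xi; rewrite /wave_shift addr0.
have ap k : 0 < a / 2 ^+ k by rewrite divr_gt0// exprn_gt0.
have ik l : mu.-integrable setT (fun y => (u y * skern sigma N (a / 2 ^+ l) t (x - y))%:E).
  have [b hb] := skern_bounded sigma N t (ap l).
  have mK : measurable_fun setT (fun y : 'rV[R]_n => skern sigma N (a / 2 ^+ l) t (x - y)).
    by apply: (measurableT_comp (measurable_skern sigma N t (ap l))); meas.
  exact: (integrable_bounded_mul iu mK (fun y => hb (x - y))).
have tel k : \sum_(j < k.+1) \int[mu]_y (u y * tkern sigma N a j t (x - y)) =
    \int[mu]_xi (smul N (a / 2 ^+ k) xi * wave sigma u t x xi).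
  rewrite -(conv_skern _ _ _ _ (ap k) iu).
  elim: k => [|k IH]; first by rewrite big_ord_recl big_ord0 addr0 expr0 divr1.
  rewrite big_ord_recr IH /=.
  transitivity (\int[mu]_y (u y * skern sigma N (a / 2 ^+ k) t (x - y)) +
      \int[mu]_y (u y * skern sigma N (a / 2 ^+ k.+1) t (x - y) -
        u y * skern sigma N (a / 2 ^+ k) t (x - y))).
    by congr (_ + _); apply: eq_Rintegral => y _; rewrite -mulrBr.
  have := RintegralB measurableT (ik k.+1) (ik k) => ->; exact: subrKC.
under eq_cvg do rewrite tel.
have hm (v : R) : 0 <= v -> 0 <= hmul N v <= 1.
  move=> v0; have e1 : expR (- v) <= 1 by rewrite -[leRHS]expR0 ler_expR oppr_le0.
  have := expR_ge0 (- v) => e0.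
  by rewrite /hmul subr_ge0 gerBl exprn_ile1 ?exprn_ge0 ?subr_ge0// gerBl.
have sv (s : R) (xi : 'rV[R]_n) : 0 <= pi * s ^+ 2 * dot xi xi.
  by rewrite mulr_ge0 ?dot_ge0// mulr_ge0 ?sqr_ge0// pi_ge0.
apply: (Rdominated_cvg (g := fun xi => `|wave sigma u t x xi|)).
- by move=> k; apply: measurable_funM;
    [apply/measurable_EFinP; exact: measurable_int (integrable_smul N (ap k))|
     exact: measurable_wave].
- move=> xi; rewrite -[X in _ --> X]mul1r; apply: cvgMr_tmp.
  have c0 : (pi * (a / 2 ^+ k) ^+ 2 * dot xi xi) @[k --> \oo] --> (0 : R).
    rewrite -[X in _ --> X](_ : pi * (a * 0) ^+ 2 * dot xi xi = 0); last by ring.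
    apply: cvgMr_tmp; apply: cvgMl_tmp.
    have ce : a / 2 ^+ k @[k --> \oo] --> a * 0.
      apply: cvgMl_tmp; under eq_cvg do rewrite -exprVn.
      by apply: cvg_expr; rewrite ger0_norm// invf_lt1// ltr1n.
    by rewrite expr2; under eq_cvg do rewrite expr2; apply: cvgM.
  have ch : hmul N v @[v --> (0 : R)] --> hmul N 0.
    rewrite /hmul; apply: cvgB; first exact: cvg_cst.
    apply: (@cvg_comp _ _ _ (fun v => 1 - expR (- v)) (fun w : R => w ^+ N) _ _ _ _ (@exprn_continuous _ N _)).
    apply: cvgB; first exact: cvg_cst.
    have cN : continuous (fun v : R => expR (- v)).
      move=> v; apply: continuous_comp; last exact: continuous_expR.
      exact: oppr_continuous.
    exact: cN.
  have h1 : hmul N (0 : R) = 1 by rewrite /hmul oppr0 expR0 subrr expr0n gtn_eqF// subr0.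
  by rewrite h1 in ch; exact: (@cvg_comp _ _ _ (fun k => pi * (a / 2 ^+ k) ^+ 2 * dot xi xi) (hmul N) _ _ _ c0 ch).
- move=> k xi; rewrite normrM ler_piMl//; have /andP[h0 h1] := hm _ (sv (a / 2 ^+ k) xi).
  by rewrite ger0_norm.
- exact: (integrable_norm iW).
Qed.

Lemma fourier_measureE xi : fourier_measure sigma xi = scos sigma xi +i* - ssin sigma xi.
Proof.
rewrite /fourier_measure /cintegral; congr (_ +i* _).
  by apply: eq_Rintegral => z _; rewrite mul1r /= cosN.
have is' : sigma.-integrable setT (fun z => (1 * sin (2 * pi * dot z xi))%:E).
  by apply: integrable_sin; [exact: integrable_one|meas].
rewrite /ssin /fsin -mulN1r -RintegralZl//.
by apply: eq_Rintegral => z _; rewrite mul1r mulN1r /= sinN.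
Qed.

Lemma ReM (z w : R[i]) : complex.Re (z * w) =
  complex.Re z * complex.Re w - complex.Im z * complex.Im w.
Proof. by case: z w => [a b] [c d]. Qed.

Lemma ImM (z w : R[i]) : complex.Im (z * w) =
  complex.Re z * complex.Im w + complex.Im z * complex.Re w.
Proof. by case: z w => [a b] [c d]. Qed.

Lemma fourierE (f : 'rV[R]_n -> R[i]) u v xi :
  u = (fun y => complex.Re (f y)) -> v = (fun y => complex.Im (f y)) ->
  mu.-integrable setT (EFin \o u) -> mu.-integrable setT (EFin \o v) ->
  fourier f xi = (fcos mu u xi + fsin mu v xi) +i* (fcos mu v xi - fsin mu u xi).
Proof.
move=> uE vE iu iv; have mx : measurable_fun setT (fun y => 2 * pi * dot y xi) by meas.
rewrite /fourier /cintegral; congr (_ +i* _).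
  rewrite -(RintegralD measurableT (integrable_cos iu mx) (integrable_sin iv mx)).
  by apply: eq_Rintegral => y _; rewrite ReM /= cosN sinN uE vE mulrN opprK.
rewrite -(RintegralB measurableT (integrable_cos iv mx) (integrable_sin iu mx)).
by apply: eq_Rintegral => y _; rewrite ImM /= cosN sinN uE vE mulrN addrC.
Qed.

(** Real and imaginary parts of [f] do not mix, the cross terms being the vanishing integrals of
    [wave_shift_odd]. *)
Lemma multiplier_opE (f : 'rV[R]_n -> R[i]) u v t x :
  u = (fun y => complex.Re (f y)) -> v = (fun y => complex.Im (f y)) -> schwartz f ->
  multiplier_op (fourier_measure sigma) t f x =
  (\int[mu]_xi wave sigma u t x xi) +i* (\int[mu]_xi wave sigma v t x xi).
Proof.
move=> uE vE [su sv]; rewrite -uE in su; rewrite -vE in sv.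
have iu := real_schwartz_integrable su; have iv := real_schwartz_integrable sv.
have w0 g : wave sigma g t x = wave_shift sigma 0 g t x.
  by apply/funext => xi; rewrite /wave_shift addr0.
have cs (a : R) : cos (a - pi / 2) = sin a by rewrite cosB cos_pihalf sin_pihalf; ring.
have ss (a : R) : sin (a - pi / 2) = - cos a by rewrite sinB cos_pihalf sin_pihalf; ring.
rewrite /multiplier_op /inverse_fourier /cintegral; congr (_ +i* _).
  rewrite -[RHS]subr0 -(wave_shift_odd t x sv) !w0.
  rewrite -(RintegralB measurableT (wave_shift_integrable 0 t x su)
    (wave_shift_integrable (- (pi / 2)) t x sv)).
  apply: eq_Rintegral => xi _; rewrite (fourierE xi uE vE iu iv) fourier_measureE !(ReM, ImM) /=.
  by rewrite /wave_shift cs ss addr0; ring.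
rewrite -[RHS]addr0 -(wave_shift_odd t x su) !w0.
rewrite -(RintegralD measurableT (wave_shift_integrable 0 t x sv)
  (wave_shift_integrable (- (pi / 2)) t x su)).
apply: eq_Rintegral => xi _; rewrite (fourierE xi uE vE iu iv) fourier_measureE !(ReM, ImM) /=.
by rewrite /wave_shift cs ss addr0; ring.
Qed.

End inversion.

(** * Admissible exponents *)

Section exponents.
Context {R : realType} {n : nat}.
Implicit Types (p r : 'rV[R]_n -> R).

(** At distance below exp (- c1 / e) the logarithm exceeds c1 / e; the division by [n.+1] passes
    from the sup norm to the Euclidean one. *)
Lemma log_lipschitz_ball r c1 : 0 < c1 ->
  (forall x y, 0 < enorm (x - y) -> enorm (x - y) < 2^-1 ->
    `|r x - r y| <= c1 / ln (expR 1 + 1 / enorm (x - y))) ->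
  forall (e : R) x, 0 < e -> exists2 d : R, 0 < d & forall y, ball x d y -> `|r x - r y| < e.
Proof.
move=> c10 hr e x e0; pose d := Num.min 2^-1 (expR (c1 / e))^-1.
have d0 : 0 < d by rewrite lt_min !invr_gt0 expR_gt0 ltr0n.
exists (d / n.+1%:R); first by rewrite divr_gt0.
move=> y xy; have exy : enorm (x - y) < d.
  apply: (@le_lt_trans _ _ (\sum_(i < n) d / n.+1%:R)).
    apply: (le_trans (enorm_le_sum _)); apply: ler_sum => i _.
    have [_ /(_ 0 i)] := xy; rewrite /ball/= !mxE => /ltW; exact.
  rewrite sumr_const card_ord -[ltLHS]mulr_natr mulrAC ltr_pdivrMr// ltr_pM2l//.
  by rewrite ltr_nat.
have [xy0|xy0] := leP (enorm (x - y)) 0.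
  suff -> : x = y by rewrite subrr normr0.
  apply/rowP => i; apply/eqP; rewrite -subr_eq0 -normr_le0 (le_trans _ xy0)//.
  by have := coord_le_enorm (x - y) i; rewrite !mxE.
have x2 : enorm (x - y) < 2^-1 by rewrite (lt_le_trans exy)// ge_min lexx.
apply: (le_lt_trans (hr _ _ xy0 x2)).
have xe : enorm (x - y) < (expR (c1 / e))^-1 by rewrite (lt_le_trans exy)// ge_min lexx orbT.
have big : c1 / e < ln (expR 1 + 1 / enorm (x - y)).
  rewrite -[ltLHS]expRK ltr_ln ?posrE ?expR_gt0 ?addr_gt0 ?expR_gt0 ?divr_gt0//.
  rewrite ltr_pwDl ?expR_gt0// div1r -[leLHS]invrK lef_pV2 ?posrE ?invr_gt0 ?expR_gt0//.
  exact: ltW.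
have l0 : 0 < ln (expR 1 + 1 / enorm (x - y)) by apply: lt_trans big; rewrite divr_gt0.
by rewrite ltr_pdivrMr// mulrC -ltr_pdivrMr.
Qed.

Lemma ball_continuous r : (forall (e : R) x, 0 < e ->
    exists2 d : R, 0 < d & forall y, ball x d y -> `|r x - r y| < e) -> continuous r.
Proof.
move=> hr x; apply/(@cvgrPdist_lt _ _ _ (nbhs x) (nbhs_filter x)) => e e0; have [d d0 hd] := hr e x e0.
by near do apply: hd; exact: nbhsx_ballx.
Unshelve. all: by end_near. Qed.

Lemma ae_ball (P : 'rV[R]_n -> Prop) x (d : R) : 0 < d ->
  {ae lebesgue_rV n, forall y, P y} -> exists2 y, ball x d y & P y.
Proof.
move=> d0 [N [mN N0 PN]]; apply: contrapT => h.
have sub : ball x d `<=` N.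
  by move=> y xy; apply: PN => Py; apply: h; exists y.
have : (lebesgue_rV n (ball x d) <= lebesgue_rV n N)%E.
  by apply: le_measure => //; rewrite inE//; exact: measurable_ball_rV.
by rewrite N0 lebesgue_rV_ball// lee_fin leNgt exprn_gt0// mulr_gt0.
Qed.

(** [p] is continuous and balls have positive measure, so its essential bounds hold at every
    point. *)
Lemma exponent_bounds p (a : R) (b : \bar R) : log_holder p ->
  (a%:E < p_minus p)%E -> (p_minus p <= p_plus p)%E -> (p_plus p < b)%E ->
  exists P0 P1 : R, [/\ a < P0, (P1%:E < b)%E & forall x, P0 <= p x <= P1].
Proof.
move=> [_ [c1 [c2 [pinf [c10 _ _ hloc _]]]]] ap pp pb.
have hb := log_lipschitz_ball c10 hloc.
have f1 : p_minus p \is a fin_num.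
  rewrite fin_real// (le_lt_trans _ ap) ?ltNyr//=; last exact: leNye.
  by rewrite (le_lt_trans pp)// (lt_le_trans pb)// leey.
have f2 : p_plus p \is a fin_num.
  rewrite fin_real//; apply/andP; split; last by rewrite (lt_le_trans pb)// leey.
  by rewrite (lt_le_trans _ pp)// (lt_trans _ ap) ?ltNyr.
exists (fine (p_minus p)), (fine (p_plus p)); split.
- by rewrite -lte_fin fineK.
- by rewrite fineK.
- move=> x; apply/andP; split; rewrite leNgt; apply/negP => h.
    rewrite -subr_gt0 in h; have [d d0 hd] := hb _ x h.
    have [y xy] := ae_ball x d0 (ess_inf_le (lebesgue_rV n) (EFin \o p)).
    rewrite -/(p_minus p) -(fineK f1) /= lee_fin => hy.
    by have := hd y xy; rewrite ltr_distlC => /andP[]; lra.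
  rewrite -subr_gt0 in h; have [d d0 hd] := hb _ x h.
  have [y xy] := ae_ball x d0 (ess_sup_ge (lebesgue_rV n) (EFin \o p)).
  rewrite -/(p_plus p) -(fineK f2) /= lee_fin => hy.
  by have := hd y xy; rewrite ltr_distlC => /andP[]; lra.
Qed.

(* At [th = s / (2 * kap + s)] the bounds on [P0] and [P1] hold and the last
   inequality is an equality; take [th] slightly smaller. *)
Lemma interpolation_exponent (kap s P0 P1 : R) : 0 <= kap -> 0 < s -> P0 <= P1 ->
  (2 * kap + s) / (kap + s) < P0 -> (0 < kap -> P1 < (2 * kap + s) / kap) ->
  exists th : R, [/\ 0 < th < 1, 2 < P0 * (1 + th), P1 * (1 - th) < 2 &
    th * (2 * kap + s) < s].
Proof.
move=> k0 s0 PP h0 h1; pose D := 2 * kap + s; have D0 : 0 < D by rewrite /D; lra.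
have P00 : 0 < P0 by apply: lt_trans h0; rewrite divr_gt0//; lra.
have P10 : 0 < P1 by exact: lt_le_trans PP.
pose t := s / D; have tD : t * D = s by rewrite /t divfK// gt_eqF.
have t0 : 0 < t by rewrite divr_gt0.
have A0 : 0 < P0 * (1 + t) - 2.
  move: h0; rewrite ltr_pdivrMr; last lra.
  move=> h0; rewrite -(pmulr_lgt0 _ D0).
  have -> : (P0 * (1 + t) - 2) * D = P0 * (D + t * D) - 2 * D by ring.
  by rewrite tD /D; nra.
have A1 : 0 < 2 - P1 * (1 - t).
  rewrite -(pmulr_lgt0 _ D0).
  have -> : (2 - P1 * (1 - t)) * D = 2 * D - P1 * (D - t * D) by ring.
  rewrite tD /D.
  have [k1|k1] := ltP 0 kap; first by have := h1 k1; rewrite ltr_pdivlMr//; nra.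
  have -> : kap = 0 by apply/eqP; rewrite eq_le k1.
  by rewrite mulr0 add0r subrr mulr0 subr0 mulr_gt0.
pose eta := Num.min (t / 2) (Num.min ((P0 * (1 + t) - 2) / (2 * P0)) ((2 - P1 * (1 - t)) / (2 * P1))).
have e0 : 0 < eta by rewrite !lt_min !divr_gt0// mulr_gt0.
have e1 : eta <= t / 2 by rewrite ge_min lexx.
have e2 : eta * (2 * P0) <= P0 * (1 + t) - 2.
  by rewrite -ler_pdivlMr ?mulr_gt0// ge_min ge_min lexx orbT.
have e3 : eta * (2 * P1) <= 2 - P1 * (1 - t).
  by rewrite -ler_pdivlMr ?mulr_gt0// ge_min ge_min lexx !orbT.
have t1 : t <= 1 by rewrite /t ler_pdivrMr// mul1r /D; lra.
exists (t - eta); split; first by apply/andP; split; lra.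
- nra.
- nra.
- by rewrite mulrBl tD; nra.
Qed.

(** Solved for q, the relation gives [th * p / D] with [D] affine in [p] and bounded below, so q is
    a Lipschitz function of [p] and inherits both logarithmic conditions. *)
Lemma interpolated_exponent p (P0 P1 th : R) : log_holder p ->
  (forall x, P0 <= p x <= P1) -> 0 < th < 1 -> 2 < P0 * (1 + th) -> P1 * (1 - th) < 2 ->
  exists2 q : 'rV[R]_n -> R,
    [/\ measurable_fun setT p, measurable_fun setT q, forall x, 0 < q x &
      forall x, (1 - th) * p x / 2 + th * p x / q x = 1] &
    exists2 K : R, 0 < K & forall h : 'rV[R]_n -> R, measurable_fun setT h ->
      (forall y, 0 <= h y) -> (\int[lebesgue_rV n]_y (h y `^ q y)%:E <= 1)%E ->
      (\int[lebesgue_rV n]_x poweR (maximal h x) (q x) <= K%:E)%E.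
Proof.
move=> [pp [c1 [c2 [pinf [c10 c20 _ hloc hinf]]]]] hP /andP[th0 th1] hP0 hP1.
have P00 : 0 < P0.
  by rewrite -(pmulr_lgt0 (x := 1 + th)); lra.
(* [q0 > 1] will bound [q] from below and [d0 > 0] its denominator; these are exactly the two
   inequalities assumed on [P0] and [P1]. The exponent is then factored as [q0 * r] with
   [r >= 1]. *)
pose c := (1 - th) / 2; pose q0 := P0 * (1 + th) / 2; pose d0 := 1 - c * P1.
have q01 : 1 < q0 by rewrite /q0; lra.
have q00 : 0 < q0 by lra.
have d00 : 0 < d0 by rewrite /d0 /c; lra.
have c0 : 0 < c by rewrite /c; lra.
pose D x := 1 - c * p x; pose q x := th * p x / D x; pose r x := q x / q0.
have Dd x : d0 <= D x.
  by rewrite /D /d0 lerD2l lerN2 ler_wpM2l// ?(ltW c0)//; case/andP: (hP x).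
have D0 x : 0 < D x by exact: lt_le_trans (Dd x).
have D1 x : D x <= 1 by rewrite /D gerBl mulr_ge0// ltW.
have q_ge x : q0 <= q x.
  rewrite /q ler_pdivlMr// -subr_ge0.
  have -> : th * p x - q0 * D x = (p x - P0) * (1 + th) / 2 + (q0 - 1) * (1 - D x).
    by rewrite /q0 /D /c; field.
  have /andP[h _] := hP x.
  apply: addr_ge0; last by rewrite mulr_ge0// subr_ge0// ltW.
  by rewrite divr_ge0// mulr_ge0 ?subr_ge0//; lra.
have qr x : q0 * r x = q x by rewrite /r mulrC divfK// gt_eqF.
pose L := th / d0 ^+ 2 / q0.
have L0 : 0 < L by rewrite /L divr_gt0// divr_gt0// exprn_gt0.
have rL x y : `|r x - r y| <= L * `|p x - p y|.
  have -> : r x - r y = th / (D x * D y) / q0 * (p x - p y).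
    rewrite /r /q /D; field.
    by rewrite -/(D x) -/(D y) !gt_eqF.
  rewrite normrM ler_wpM2r// ger0_norm; last first.
    by rewrite ltW// divr_gt0// divr_gt0// mulr_gt0.
  rewrite /L ler_wpM2r ?invr_ge0 ?(ltW q00)// ler_wpM2l ?(ltW th0)//.
  rewrite lef_pV2 ?posrE ?exprn_gt0 ?mulr_gt0// expr2.
  by apply: ler_pM => //; exact: ltW.
clearbody L.
have rloc x y : 0 < enorm (x - y) -> enorm (x - y) < 2^-1 ->
    `|r x - r y| <= (L * c1) / ln (expR 1 + 1 / enorm (x - y)).
  move=> h1 h2; apply: (le_trans (rL x y)); rewrite -mulrA ler_wpM2l ?(ltW L0)//.
  exact: hloc.
have rinf x y : `|r x - r y| <= (L * c2) / ln (expR 1 + enorm x) +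
    (L * c2) / ln (expR 1 + enorm y).
  apply: (le_trans (rL x y)); rewrite -!mulrA -mulrDr ler_wpM2l ?(ltW L0)//.
  rewrite -[p x - p y](subrKA pinf); apply: (le_trans (ler_normD _ _)).
  by rewrite lerD// distrC.
have Lc1 : 0 < L * c1 by rewrite mulr_gt0.
have Lc2 : 0 < L * c2 by rewrite mulr_gt0.
have mp : measurable_fun setT p.
  by apply: continuous_measurable_rV; apply: ball_continuous; exact: log_lipschitz_ball hloc.
have mr : measurable_fun setT r.
  by apply: continuous_measurable_rV; apply: ball_continuous; exact: log_lipschitz_ball rloc.
have r1 x : 1 <= r x by rewrite /r ler_pdivlMr// mul1r.
have rQ x : r x <= th * P1 / d0 / q0.
  rewrite /r ler_wpM2r ?invr_ge0 ?(ltW q00)// /q; have /andP[h1 h2] := hP x.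
  apply: ler_pM; rewrite ?invr_ge0 ?mulr_ge0 ?(ltW (pp x)) ?(ltW th0) ?(ltW (D0 x))//.
    by rewrite ler_wpM2l// ltW.
  by rewrite lef_pV2 ?posrE ?Dd ?D0.
have [K K0 hK] := variable_maximal mr r1 rQ Lc1 Lc2 rloc rinf q01.
exists q; last first.
  exists K => // h mh h0 h1.
  under eq_integral do rewrite -qr.
  by apply: hK => //; under eq_integral do rewrite qr.
split => //.
- by rewrite (_ : q = fun x => q0 * r x)//; [exact: measurable_funM|apply/funext].
- by move=> x; exact: lt_le_trans (q_ge x).
- move=> x; have p0 := pp x; rewrite /q invf_div mulrCA divff ?mulr1; last first.
    by rewrite mulf_neq0// gt_eqF.
  by rewrite /D /c; field.
Qed.

End exponents.

(** * The maximal multiplier *)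

Lemma norm_lim_le {R : realType} (u : nat -> R) (l B : R) :
  u k @[k --> \oo] --> l -> (forall k, `|u k| <= B) -> `|l| <= B.
Proof.
move=> ul uB; have nl : `|u k| @[k --> \oo] --> `|l| by apply: cvg_norm.
rewrite -(cvg_lim _ nl)//; apply: limr_le; first by apply/cvg_ex; exists `|l|.
by apply: nearW => k; exact: uB.
Qed.

Section blocks.
Context {R : realType} {n : nat}.
Let mu := @lebesgue_rV R n.
Variables (sigma : {finite_measure set 'rV[R]_n -> \bar R}) (N : nat).

(* [om] is a pair [(i, t)] such that [t] lies in the dyadic block starting at
   [dyad i]; other pairs are junk and give [0] *)
Definition blockop j (om : nat * R) (f : 'rV[R]_n -> R) (x : 'rV[R]_n) : R :=
  if dyad om.1 <= om.2 <= 2 * dyad om.1 then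
    \int[mu]_y (f y * tkern sigma N (dyad om.1) j om.2 (x - y)) else 0.

(** The kernel is bounded and the partial sums are dominated by |f|, so the operator passes to the
    limit; each term, a difference of two partial sums, is dominated by 2 |f|. *)
Lemma blockop_sum j om f (f_ : nat -> 'rV[R]_n -> R) x :
  mu.-integrable setT (EFin \o f) -> (forall k, measurable_fun setT (f_ k)) ->
  (forall K y, `|\sum_(0 <= k < K) f_ k y| <= `|f y|) ->
  (forall y, \sum_(0 <= k < K) f_ k y @[K --> \oo] --> f y) ->
  (`|blockop j om f x|%:E <= \sum_(0 <= k <oo) `|blockop j om (f_ k) x|%:E)%E.
Proof.
move=> iF mf_ bf cf; rewrite /blockop; case: ifP => _; last first.
  by rewrite normr0; apply: nneseries_ge0 => k _ _; rewrite lee_fin.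
have d0 := dyad_gt0 (R := R) om.1.
have [b hb] := tkern_bounded sigma N j om.2 d0.
pose k0 (y : 'rV[R]_n) := tkern sigma N (dyad om.1) j om.2 (x - y).
have mK : measurable_fun setT k0.
  by apply: (measurableT_comp (measurable_tkern sigma N j om.2 d0)); meas.
have if_ k : mu.-integrable setT (EFin \o f_ k).
  apply: (le_integrable measurableT _ _ (integrable_mulrl 2 measurableT (integrable_norm iF))).
    exact/measurable_EFinP.
  move=> y _ /=; rewrite lee_fin [leRHS]ger0_norm ?mulr_ge0//.
  have -> : f_ k y = \sum_(0 <= l < k.+1) f_ l y - \sum_(0 <= l < k) f_ l y.
    by rewrite big_nat_recr//=; ring.
  have := bf k.+1 y; have := bf k y.
  have := ler_normB (\sum_(0 <= l < k.+1) f_ l y) (\sum_(0 <= l < k) f_ l y); lra.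
have ik k : mu.-integrable setT (fun y => (f_ k y * k0 y)%:E).
  exact: (integrable_bounded_mul (if_ k) mK (fun y => hb (x - y))).
have iK : mu.-integrable setT (fun y => (f y * k0 y)%:E).
  exact: (integrable_bounded_mul iF mK (fun y => hb (x - y))).
have cv : (\sum_(0 <= k < K) \int[mu]_y (f_ k y * k0 y)) @[K --> \oo] -->
    \int[mu]_y (f y * k0 y).
  have sE K : \sum_(0 <= k < K) \int[mu]_y (f_ k y * k0 y) =
      \int[mu]_y ((\sum_(0 <= k < K) f_ k y) * k0 y).
    rewrite -Rintegral_sum//.
    by apply: eq_Rintegral => y _; rewrite mulr_suml.
  under eq_cvg do rewrite sE.
  apply: (Rdominated_cvg (g := fun y => `|f y * k0 y|)).
  - by move=> K; apply: measurable_funM => //; exact: measurable_sum.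
  - by move=> y; apply: cvgMr_tmp.
  - by move=> K y; rewrite !normrM ler_wpM2r.
  - exact: (integrable_norm iK).
set L := (X in (_ <= X)%E).
have pL K : (`|\sum_(0 <= k < K) \int[mu]_y (f_ k y * k0 y)|%:E <= L)%E.
  apply: (@le_trans _ _ (\sum_(0 <= k < K) `|\int[mu]_y (f_ k y * k0 y)|%:E)%E).
    by rewrite sumEFin lee_fin ler_norm_sum.
  by apply: nneseries_lim_ge => k _; rewrite lee_fin.
have [l Ll] : exists l, L = l.
  by exists L.
rewrite Ll in pL *; move: l pL {Ll} => [l| |] pL; last 2 first.
- exact: leey.
- by have := pL 0%N; rewrite leeNy_eq.
by rewrite lee_fin; apply: (norm_lim_le cv) => K; rewrite -lee_fin.
Qed.

Lemma blockop_max (beta M : R) : 0 <= beta -> beta <= n%:R -> (0 < N)%N ->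
  locally_uniformly_dimensional beta sigma -> sigma [set z | M < enorm z] = 0%E ->
  exists2 B : R, 0 < B & forall j om f x, measurable_fun setT f ->
  (`|blockop j om f x|%:E <= (B * (2 ^+ j) `^ (n%:R - beta))%:E * maximal f x)%E.
Proof.
move=> b0 bn N0 lu sM; have [B B0 hB] := conv_tkern_maximal b0 bn N0 lu sM.
exists B => // j om f x mf; rewrite /blockop; case: ifP => h.
  exact: (hB _ _ _ j x mf (dyad_gt0 om.1) h).
by rewrite normr0 mule_ge0 ?maximal_ge0// lee_fin mulr_ge0 ?powR_ge0// ltW.
Qed.

Lemma blockop_l2 (alpha beta M : R) : 0 <= M -> sigma [set z | M < enorm z] = 0%E ->
  0 <= beta -> beta <= n%:R -> locally_uniformly_dimensional beta sigma ->
  (0 < N)%N -> 2 * alpha + 1 <= 4 * N%:R -> 2^-1 < alpha ->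
  mean_decay alpha (fun xi => Normc.normc (fourier_measure sigma xi) ^+ 2) ->
  mean_decay alpha (fun xi => cvnorm (gradient (fourier_measure sigma) xi) ^+ 2) ->
  exists2 C : R, 0 < C & forall j f, mu.-integrable setT (EFin \o f) ->
  exists S : 'rV[R]_n -> \bar R,
  [/\ measurable_fun setT S, (forall x, 0 <= S x)%E,
      forall om x, ((blockop j om f x ^+ 2)%:E <= S x)%E &
      (\int[mu]_x S x <= (C * (2 ^+ j) `^ (- (2 * alpha - 1)))%:E *
        \int[mu]_x (f x ^+ 2)%:E)%E].
Proof.
move=> M0 sM b0 bn lu N0 N4 a2 dec gdec.
have [C1 C10 hC1] := dyadic_l2 M0 sM N0 N4 a2 dec gdec.
have [B B0 hB] := blockop_max b0 bn N0 lu sM.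
have s2 : 1 < 2 :> R by rewrite ltr1n.
have [C2 C20 hC2] := maximal_strong (n := n) s2.
exists (C1 + B ^+ 2 * C2); first by rewrite addr_gt0// mulr_gt0// exprn_gt0.
have F0 f : (0 <= \int[mu]_x (f x ^+ 2)%:E)%E.
  by apply: integral_ge0 => x _; rewrite lee_fin sqr_ge0.
have B2C : 0 <= B ^+ 2 * C2 by rewrite mulr_ge0 ?exprn_ge0// ltW.
(* The symbol of piece 0 does not vanish at the origin, so its blocks cannot be summed in L^2; the
   maximal function bounds all of them at once instead. *)
case=> [|j] f iF.
  have mf : measurable_fun setT f by apply/measurable_EFinP; exact: measurable_int iF.
  have mS : measurable_fun setT (fun x => poweR (maximal f x) 2).
    by apply: (measurableT_comp (measurable_poweR 2)); exact: measurable_maximal.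
  exists (fun x => (B ^+ 2)%:E * poweR (maximal f x) 2)%E; split.
  - exact: measurable_funeM.
  - by move=> x; rewrite mule_ge0 ?poweR_ge0// lee_fin exprn_ge0// ltW.
  - move=> om x; have := hB 0%N om f x mf.
    rewrite expr0 powR1 mulr1; case: (maximal f x) (maximal_ge0 f x) => [m| |] m0; last by move: m0; rewrite leeNy_eq.
      rewrite -EFinM !lee_fin in m0 * => h.
      rewrite (powR_mulrn 2 m0) -exprMn -real_normK ?num_real//.
      by rewrite lerXn2r// nnegrE// mulr_ge0// ltW.
    rewrite poweRyr ?pnatr_eq0// => _.
    by rewrite gt0_muley ?leey// lte_fin exprn_gt0.
  - rewrite ge0_integralZl//; last 2 first.
    + by move=> x _; exact: poweR_ge0.
    + by rewrite lee_fin exprn_ge0// ltW.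
    have h : (\int[mu]_x poweR (maximal f x) 2 <= C2%:E * \int[mu]_x (f x ^+ 2)%:E)%E.
      rewrite (_ : \int[mu]_x (f x ^+ 2)%:E = \int[mu]_x (`|f x| `^ 2)%:E)%E; first exact: hC2.
      by apply: eq_integral => x _; rewrite (powR_mulrn 2 (normr_ge0 _)) real_normK ?num_real.
    apply: (le_trans (lee_wpmul2l _ h)); first by rewrite lee_fin exprn_ge0// ltW.
    rewrite muleA -EFinM; apply: lee_wpmul2r => //.
    by rewrite expr0 powR1 mulr1 lee_fin lerDr ltW.
have [S [mS S0 hS iS]] := hC1 j f iF; exists S; split => //.
  move=> om x; rewrite /blockop; case: ifP => h; last by rewrite expr0n/=.
  exact: hS.
apply: (le_trans iS); apply: lee_wpmul2r => //.
by rewrite lee_fin opprB ler_wpM2r ?powR_ge0// lerDl.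
Qed.

End blocks.

Section final.
Local Open Scope complex_scope.
Context {R : realType}.

Lemma powR_le_root (a w p : R) : 0 <= a -> 0 <= w -> 0 < p ->
  (a `^ p <= w) = (a <= w `^ p^-1).
Proof.
move=> a0 w0 p0; apply/idP/idP => h.
  have := ge0_ler_powR (ltW (_ : 0 < p^-1)) _ _ h.
  rewrite !nnegrE powR_ge0 w0 -powRrM divff ?gt_eqF// powRr1//; apply => //.
  by rewrite invr_gt0.
have := ge0_ler_powR (ltW p0) _ _ h.
by rewrite !nnegrE powR_ge0 a0 -powRrM mulVf ?gt_eqF// powRr1//; apply.
Qed.

(** The integral of a nonnegative function is a supremum over simple functions below it, so
    monotonicity needs no measurability; the maximal multiplier is a supremum over uncountably many
    [t]. *)
Lemma ge0_le_nnintegral d (T : measurableType d) (mu : {measure set T -> \bar R})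
    (f g : T -> \bar R) : (forall x, 0 <= f x)%E -> (forall x, f x <= g x)%E ->
  (\int[mu]_x f x <= \int[mu]_x g x)%E.
Proof.
move=> f0 fg; rewrite !ge0_integralTE//; last by move=> x; exact: le_trans (fg x).
by apply: ereal_sup_le => _ /= [h hf <-]; exists h => // x; exact: le_trans (fg x).
Qed.

Lemma normc_le (z : R[i]) : Normc.normc z <= `|complex.Re z| + `|complex.Im z|.
Proof.
case: z => a b /=; rewrite -[leRHS]ger0_norm ?addr_ge0// -sqrtr_sqr ler_sqrt ?sqr_ge0//.
rewrite -(real_normK (num_real a)) -(real_normK (num_real b)).
by rewrite sqrrD -addrA lerD2l lerDr mulrn_wge0// mulr_ge0.
Qed.

Lemma Re_le_normc (z : R[i]) : `|complex.Re z| <= Normc.normc z.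
Proof.
case: z => a b /=; rewrite -sqrtr_sqr ler_sqrt ?addr_ge0 ?sqr_ge0//.
by rewrite lerDl sqr_ge0.
Qed.

Lemma Im_le_normc (z : R[i]) : `|complex.Im z| <= Normc.normc z.
Proof.
case: z => a b /=; rewrite -sqrtr_sqr ler_sqrt ?addr_ge0 ?sqr_ge0//.
by rewrite lerDr sqr_ge0.
Qed.

Context {n : nat}.
Let mu := @lebesgue_rV R n.
Variable sigma : {finite_measure set 'rV[R]_n -> \bar R}.

Lemma sqrt_mean_decay (alpha : R) (g : 'rV[R]_n -> R) : (forall x, 0 <= g x) ->
  (exists C : R, forall xi,
    (poweR (\int[lebesgue_measure]_(t in `[1%R, 2%R]%classic) (g (t *: xi))%:E) 2^-1
      <= (C * (1 + enorm xi)%R `^ (- alpha))%:E)%E) ->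
  mean_decay alpha g.
Proof.
move=> g0 [C hC]; exists (C ^+ 2); first exact: sqr_ge0.
move=> xi; have := hC xi; set I := (X in poweR X); set w := 1 + enorm xi.
have w0 : 0 < w by rewrite /w ltr_pwDl// enorm_ge0.
have I0 : (0 <= I)%E by apply: integral_ge0 => t _; rewrite lee_fin.
rewrite -/I; case: I I0 => [r| |] I0.
- rewrite poweR_EFin !lee_fin in I0 * => h.
  rewrite (_ : C ^+ 2 * w `^ (- (2 * alpha)) = (C * w `^ (- alpha)) `^ 2).
    by rewrite -[r]powRr1// -[1 in leLHS](mulVf (_ : 2 != 0)) ?pnatr_eq0// powRrM;
       apply: ge0_ler_powR; rewrite ?nnegrE ?powR_ge0// (le_trans (powR_ge0 _ _) h).
  rewrite (powR_mulrn 2 (le_trans (powR_ge0 _ _) h)) exprMn.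
  by rewrite -(powR_mulrn 2 (powR_ge0 w (- alpha))) -powRrM mulNr [alpha * _]mulrC.
- by rewrite poweRyr ?invr_eq0 ?pnatr_eq0// leye_eq.
- by move: I0; rewrite leeNy_eq.
Qed.

Lemma waveZ (c : R) (g : 'rV[R]_n -> R) t x xi : mu.-integrable setT (EFin \o g) ->
  wave sigma (fun y => c * g y) t x xi = c * wave sigma g t x xi.
Proof.
move=> ig; have mx : measurable_fun setT (fun y : 'rV[R]_n => 2 * pi * dot y xi) by meas.
have c1 : fcos mu (fun y => c * g y) xi = c * fcos mu g xi.
  rewrite /fcos -RintegralZl//; last exact: integrable_cos.
  by apply: eq_Rintegral => y _; rewrite mulrA.
have s1 : fsin mu (fun y => c * g y) xi = c * fsin mu g xi.
  rewrite /fsin -RintegralZl//; last exact: integrable_sin.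
  by apply: eq_Rintegral => y _; rewrite mulrA.
by rewrite /wave c1 s1; ring.
Qed.

Variables (beta alpha P0 P1 : R) (p : 'rV[R]_n -> R).
Hypothesis hsupp : compactly_supported sigma.
Hypothesis beta0 : 0 <= beta.
Hypothesis betan : beta <= n%:R.
Hypothesis alpha12 : 2^-1 < alpha.
Hypothesis lu : locally_uniformly_dimensional beta sigma.
Hypothesis decay : mean_decay alpha (fun xi => Normc.normc (fourier_measure sigma xi) ^+ 2).
Hypothesis gdecay :
  mean_decay alpha (fun xi => cvnorm (gradient (fourier_measure sigma) xi) ^+ 2).
Hypothesis hp : log_holder p.
Hypothesis hP : forall x, P0 <= p x <= P1.
Hypothesis hP0 : (2 * n%:R + 2 * alpha - 2 * beta - 1) / (n%:R + 2 * alpha - beta - 1) < P0.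
Hypothesis hP1 : beta < n%:R -> P1 < (2 * n%:R + 2 * alpha - 2 * beta - 1) / (n%:R - beta).

Lemma wave_maximal_bound : exists2 K : R, 0 < K & forall u, real_schwartz u ->
  (\int[mu]_y (`|u y| `^ p y)%:E <= 1)%E ->
  exists W : 'rV[R]_n -> \bar R,
  [/\ measurable_fun setT W, (forall x, 0 <= W x)%E,
    (forall t x, 0 < t -> ((`|\int[mu]_xi wave sigma u t x xi| `^ p x)%:E <= W x)%E) &
    (\int[mu]_x W x <= K%:E)%E].
Proof.
have [M M0 sM] := compact_support_bounded hsupp.
(* The order of flatness of the smoothing, fixed so that [2 * alpha + 1 <= 4 * N] and [N] is
   positive. *)
pose N := (Num.bound (2 * alpha + 1)).+1.
have a1 : 1 < 2 * alpha by rewrite mulrC -ltr_pdivrMr// div1r.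
have N4 : 2 * alpha + 1 <= 4 * N%:R.
  have a0 : 0 <= 2 * alpha + 1 by lra.
  have := archi_boundP a0; rewrite /N -natr1.
  have := ler0n R (Num.bound (2 * alpha + 1)); lra.
pose kap := n%:R - beta; pose s := 2 * alpha - 1.
have k0 : 0 <= kap by rewrite subr_ge0.
have s0 : 0 < s by rewrite /s; lra.
have kE : 2 * kap + s = 2 * n%:R + 2 * alpha - 2 * beta - 1 by rewrite /kap /s; ring.
have ksE : kap + s = n%:R + 2 * alpha - beta - 1 by rewrite /kap /s; ring.
have [th [th01 t0 t1 ts]] : exists th : R, [/\ 0 < th < 1, 2 < P0 * (1 + th),
    P1 * (1 - th) < 2 & th * (2 * kap + s) < s].
  apply: (interpolation_exponent k0 s0).
  - by have /andP[] := hP 0; exact: le_trans.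
  - rewrite kE ksE; exact: hP0.
  - rewrite kE subr_gt0; exact: hP1.
have [th0 th1] := andP th01.
have [q [mp mq q0 pq] [Kq Kq0 hl]] := interpolated_exponent hp hP th01 t0 t1.
have [B B0 hB] := blockop_max (N := N) beta0 betan isT lu sM.
have [C C0 hC] := blockop_l2 (N := N) (ltW M0) sM beta0 betan lu isT N4 alpha12 decay gdecay.
(* The midpoint between [s] and the least value allowed by [gain]; the choice of [th] leaves room
   between the two. *)
pose s' := (s + 2 * th * kap / (1 - th)) / 2.
have th1' : 0 < 1 - th by lra.
have tk : 2 * th * kap / (1 - th) < s by rewrite ltr_pdivrMr//; lra.
have ss' : s' < s by rewrite /s'; lra.
have gain : th * kap < (1 - th) * s' / 2.
  have : (1 - th) * (2 * th * kap / (1 - th)) < (1 - th) * s by rewrite ltr_pM2l.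
  rewrite /s'; have : (1 - th) * (2 * th * kap / (1 - th)) = 2 * th * kap.
    by field; rewrite gt_eqF.
  by move=> e1 e2; nra.
have p0 : forall x, 0 < p x by case: hp.
have pP1 x : p x <= P1 by case/andP: (hP x).
have [K K0 hK] := interpolation_bound (@blockop_sum _ _ sigma N) B0 hB C0 hC th01 ss' gain
  mp mq p0 pP1 q0 pq Kq0 hl.
exists K => // u su u1.
have [W [mW W0 hW iW]] := hK u (real_schwartz_measurable su) (real_schwartz_integrable su) u1.
exists W; split => // t x tp; have [i /andP[it ti]] := dyad_ex tp.
have om : dyad i <= t <= 2 * dyad i by rewrite it/= ltW.
have cv := @tkern_sum_cvg _ _ sigma N u (dyad i) t x isT (dyad_gt0 i) su.
have hS k : ((`|\sum_(j < k.+1) \int[mu]_y (u y * tkern sigma N (dyad i) j t (x - y))| `^ p x)%:E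
    <= W x)%E.
  have := hW k.+1 (i, t) x; rewrite big_mkord /blockop/=.
  by under eq_bigr do rewrite om.
have [w wE] : exists w, W x = w by exists (W x).
have w0 := W0 x; rewrite wE in hS w0 *; clear wE.
case: w w0 hS => [w| |] w0 hS; [|by rewrite leey|by move: w0; rewrite leeNy_eq].
(* The passage to the limit concerns the absolute values, so the bound on their power is first
   rewritten with a root. *)
rewrite !lee_fin in w0 *; rewrite powR_le_root//.
apply: (norm_lim_le cv) => k; rewrite -powR_le_root//.
by rewrite -lee_fin; exact: hS.
Qed.

Let p_ge1 x : 1 <= p x.
Proof.
have /andP[h _] := hP x; apply: le_trans h; apply: le_trans (ltW hP0).
have a1 : 1 < 2 * alpha by rewrite mulrC -ltr_pdivrMr// div1r.
have k0 : 0 <= n%:R - beta by rewrite subr_ge0.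
by rewrite ler_pdivlMr; lra.
Qed.

(** As [p >= 1], dividing a function by [K2 >= 1] divides its modular at least by [K2]; so a bound
    on the modular by a constant becomes the bound by 1 that the norm requires. *)
Lemma maximal_multiplier_modular : exists2 K : R, 0 < K & forall f (l : R), schwartz f -> 0 < l ->
  (modular p (fun x => `|(Normc.normc (f x))%:E| * (l^-1)%:E) <= 1)%E ->
  (modular p (fun x => `|maximal_multiplier (fourier_measure sigma) f x| *
    ((K * l)^-1)%:E) <= 1)%E.
Proof.
have [K K0 hK] := wave_maximal_bound.
have p0 x : 0 < p x by exact: lt_le_trans (p_ge1 x).
have mp : measurable_fun setT p.
  have [_ [c1 [_ [_ [c10 _ _ hloc _]]]]] := hp.
  by apply: continuous_measurable_rV; apply: ball_continuous; exact: log_lipschitz_ball hloc.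
pose A : R := 2 `^ P1; have A0 : 0 < A by exact: powR_gt0.
(* [A] comes from the power of the sum of real and imaginary parts, [2 * K] from adding their two
   majorants, and 1 ensures [K2 >= 1]. *)
pose K2 := A * (2 * K) + 1.
have AK0 : 0 < A * (2 * K) by rewrite mulr_gt0// mulr_gt0.
have K21 : 1 <= K2 by rewrite lerDr ltW.
have K20 : 0 < K2 by exact: lt_le_trans K21.
exists K2 => // f l sf l0 fl.
pose u y := complex.Re (f y); pose v y := complex.Im (f y).
have [su sv] : real_schwartz u /\ real_schwartz v := sf.
have scale (g : 'rV[R]_n -> R) : real_schwartz g -> real_schwartz (fun y => l^-1 * g y).
  move=> sg; rewrite (_ : (fun y => _) = fun y => g y + (l^-1 - 1) * g y).
    exact: real_schwartz_comb.
  by apply/funext => y; ring.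
have le1 g : real_schwartz g -> (forall y, `|g y| <= Normc.normc (f y)) ->
    (\int[mu]_y (`|l^-1 * g y| `^ p y)%:E <= 1)%E.
  move=> sg gf; apply: le_trans fl; apply: ge0_le_nnintegral.
    by move=> y; rewrite lee_fin powR_ge0.
  move=> y /=; have ly : 0 <= `|Normc.normc (f y)| * l^-1 by rewrite mulr_ge0// invr_ge0 ltW.
  rewrite (ger0_norm ly) lee_fin; apply: ge0_ler_powR; rewrite ?nnegrE// ?(ltW (p0 y))//.
  rewrite normrM [`|l^-1|]ger0_norm ?invr_ge0 ?(ltW l0)// mulrC ler_wpM2r ?invr_ge0 ?(ltW l0)//.
  exact: le_trans (gf y) (ler_norm _).
have [U [mU U0 hU iU]] := hK _ (scale u su) (le1 u su (fun y => Re_le_normc (f y))).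
have [W [mW W0 hW iW]] := hK _ (scale v sv) (le1 v sv (fun y => Im_le_normc (f y))).
pose V x := ((K2^-1 * A)%:E * (U x + W x))%E.
have KA0 : 0 <= K2^-1 * A by rewrite mulr_ge0 ?invr_ge0// ltW.
have V0 x : (0 <= V x)%E by rewrite mule_ge0 ?adde_ge0.
have iV : (\int[mu]_x V x <= 1)%E.
  rewrite ge0_integralZl//; last 2 first.
  - exact: emeasurable_funD.
  - by move=> x _; rewrite adde_ge0.
  rewrite ge0_integralD//.
  apply: (@le_trans _ _ ((K2^-1 * A)%:E * (K%:E + K%:E))%E).
    by apply: lee_wpmul2l; [rewrite lee_fin|exact: leeD].
  rewrite -EFinD -EFinM lee_fin -mulrA mulrC ler_pdivrMr// mul1r /K2.
  by rewrite (_ : K + K = 2 * K) ?lerDl//; ring.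
have normE t x : 0 < t ->
    (((Normc.normc (multiplier_op (fourier_measure sigma) t f x) / (K2 * l)) `^ p x)%:E <= V x)%E.
  move=> t0; rewrite (multiplier_opE sigma t x (erefl u) (erefl v) sf).
  have wE g : real_schwartz g -> \int[mu]_xi wave sigma (fun y => l^-1 * g y) t x xi =
      l^-1 * \int[mu]_xi wave sigma g t x xi.
    move=> sg; have ig := real_schwartz_integrable sg.
    rewrite -RintegralZl//; first by apply: eq_Rintegral => xi _; rewrite waveZ.
    rewrite (_ : wave _ _ _ _ = wave_shift sigma 0 g t x); first exact: wave_shift_integrable.
    by apply/funext => xi; rewrite /wave_shift addr0.
  set a := \int[mu]_xi wave sigma u t x xi; set b := \int[mu]_xi wave sigma v t x xi.
  have ha : ((`|l^-1 * a| `^ p x)%:E <= U x)%E by rewrite -wE//; exact: hU.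
  have hb : ((`|l^-1 * b| `^ p x)%:E <= W x)%E by rewrite -wE//; exact: hW.
  apply: (@le_trans _ _ ((K2^-1 * A)%:E * ((`|l^-1 * a| `^ p x)%:E + (`|l^-1 * b| `^ p x)%:E))%E).
    rewrite -EFinD -EFinM lee_fin.
    apply: (@le_trans _ _ ((K2^-1 * (`|l^-1 * a| + `|l^-1 * b|)) `^ p x)).
      apply: ge0_ler_powR; rewrite ?(ltW (p0 x))// ?nnegrE.
      - by rewrite divr_ge0 ?sqrtr_ge0// mulr_ge0// ltW.
      - by rewrite mulr_ge0 ?invr_ge0 ?(ltW K20)// addr_ge0.
      - rewrite !normrM -mulrDr ger0_norm ?invr_ge0 ?(ltW l0)// mulrA -invfM mulrC.
        rewrite ler_wpM2l ?invr_ge0 ?mulr_ge0 ?(ltW l0) ?(ltW K20)//.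
        exact: (normc_le (a +i* b)).
    rewrite powRM ?invr_ge0 ?(ltW K20)// ?addr_ge0// -mulrA.
    apply: ler_pM; rewrite ?powR_ge0//.
      by apply: ge1r_powR => //; rewrite invr_gt0 K20 invf_le1.
    apply: (le_trans (powRD_le (normr_ge0 _) (normr_ge0 _) (ltW (p0 x)))).
    apply: ler_wpM2r; first by rewrite addr_ge0 ?powR_ge0.
    by apply: ler_powR; [rewrite ler1n|case/andP: (hP x)].
  by apply: lee_wpmul2l; [rewrite lee_fin|exact: leeD].
apply: le_trans iV; apply: ge0_le_nnintegral; first by move=> x; exact: poweR_ge0.
move=> x; have [w wE] : exists w, V x = w by exists (V x).
have := V0 x; have := normE ^~ x; rewrite wE {wE}; case: w => [w| |] hw w0.
- have M0 : (0 <= maximal_multiplier (fourier_measure sigma) f x)%E.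
    apply: (@le_trans _ _ (Normc.normc (multiplier_op (fourier_measure sigma) 1 f x))%:E).
      by rewrite lee_fin sqrtr_ge0.
    by apply: ereal_sup_ubound; exists 1 => //=.
  have Mw : (maximal_multiplier (fourier_measure sigma) f x <= (K2 * l * w `^ (p x)^-1)%:E)%E.
    apply: ge_ereal_sup => _ [t /= t0 <-]; have := hw t t0.
    rewrite !lee_fin in w0 *; rewrite powR_le_root//; last first.
      by rewrite divr_ge0 ?sqrtr_ge0// mulr_ge0// ltW.
    by rewrite ler_pdivrMr ?mulr_gt0// mulrC.
  case: (maximal_multiplier _ f x) M0 Mw => [m| |] m0 mw; last 2 first.
  + by move: mw; rewrite leye_eq.
  + by move: m0; rewrite leeNy_eq.
  rewrite !lee_fin in m0 mw w0.
  have mc : 0 <= m * (K2 * l)^-1 by rewrite divr_ge0// mulr_ge0// ltW.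
  rewrite /= (ger0_norm m0) (ger0_norm mc) lee_fin.
  by rewrite powR_le_root// ler_pdivrMr ?mulr_gt0// mulrC.
- exact: leey.
- by move: w0; rewrite leeNy_eq.
Qed.

End final.

Theorem theorem2p2 (R : realType) (n : nat) (hn : (0 < n)%N)
  (sigma : {finite_measure set 'rV[R]_n -> \bar R})
  (hsupp : compactly_supported sigma)
  (beta alpha : R) (hbeta0 : 0 <= beta) (hbetan : beta <= n%:R)
  (halpha : 2^-1 < alpha)
  (h1 : locally_uniformly_dimensional beta sigma)
  (h2 : exists C : R, forall xi : 'rV[R]_n,
     (poweR (\int[lebesgue_measure]_(t in `[1%R, 2%R]%classic)
               (Normc.normc (fourier_measure sigma (t *: xi)) ^+ 2)%:E) 2^-1
      <= (C * (1 + enorm xi)%R `^ (- alpha))%:E)%E)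
  (h3 : exists C : R, forall xi : 'rV[R]_n,
     (poweR (\int[lebesgue_measure]_(t in `[1%R, 2%R]%classic)
               (cvnorm (gradient (fourier_measure sigma) (t *: xi)) ^+ 2)%:E) 2^-1
      <= (C * (1 + enorm xi)%R `^ (- alpha))%:E)%E)
  (p : 'rV[R]_n -> R) (hp : log_holder p)
  (hpminus : (((2 * n%:R + 2 * alpha - 2 * beta - 1)
                / (n%:R + 2 * alpha - beta - 1))%:E < p_minus p)%E)
  (hple : (p_minus p <= p_plus p)%E)
  (hpplus : (p_plus p < if beta == n%:R then +oo
              else ((2 * n%:R + 2 * alpha - 2 * beta - 1)
                    / (n%:R - beta))%:E)%E) :
  exists C : R, forall f : 'rV[R]_n -> R[i], schwartz f ->
    (vl_norm p (maximal_multiplier (fourier_measure sigma) f)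
     <= C%:E * vl_norm p (fun x => (Normc.normc (f x))%:E))%E.
Proof.
have [P0 [P1 [hP0 hP1 hP]]] := exponent_bounds hp hpminus hple hpplus.
have dec := sqrt_mean_decay (g := fun xi => Normc.normc (fourier_measure sigma xi) ^+ 2)
  (fun xi => sqr_ge0 _) h2.
have gdec := sqrt_mean_decay (g := fun xi => cvnorm (gradient (fourier_measure sigma) xi) ^+ 2)
  (fun xi => sqr_ge0 _) h3.
have hP1' : beta < n%:R ->
    P1 < (2 * n%:R + 2 * alpha - 2 * beta - 1) / (n%:R - beta).
  by move=> bn; move: hP1; rewrite lt_eqF// lte_fin.
have [K K0 hK] := maximal_multiplier_modular hsupp hbeta0 hbetan halpha h1 dec gdec hp hP hP0 hP1'.
exists K => f sf.
(* The inequality is checked on each [l] admissible for [f]; when there is none, the right-hand norm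
   is infinite. *)
rewrite -lee_pdivrMl//; apply: le_ereal_inf_tmp => _ [l /= [l0 hl] <-].
rewrite lee_pdivrMl// -EFinM; apply: ereal_inf_lbound; exists (K * l) => //.
by split; [rewrite mulr_gt0|exact: hK].
Qed.
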